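(* Let $\phi=(\phi_1,\phi_2)$ be an $L$-periodic solution of $\mathcal{M}\phi+c\phi-\nabla R(\phi)+A=0$ (with $c\in\mathbb{R}$ and $A=(A_1,A_2)\in\mathbb{R}^2$), and let $\mathcal{L}=\mathcal{M}+c\,\mathrm{Id}_2-\mathrm{Hess}\,R(\phi)$. Assume the following. $(H_1)$ $\phi\in C^\infty_{per}([0,L])\times C^\infty_{per}([0,L])$ has minimal period $L>0$; the self-adjoint operator $\mathcal{L}$ has only one negative eigenvalue, which is simple, and zero is a simple eigenvalue of $\mathcal{L}$ with associated eigenfunction $\phi'=(\phi_1',\phi_2')$. $(H_2)$ There exists $\Phi\in X=H^{s/2}_{per}([0,L])\times H^{s/2}_{per}([0,L])$ such that $\langle\mathcal{L}\Phi,\Phi\rangle<0$ and $\langle\mathcal{L}\Phi,\phi'\rangle=0$; moreover, there exists a conserved functional $Q=Q(u)$ such that $Q'(\phi)=\mathcal{L}\Phi$. Then $\phi$ is orbitally stable in $X$ by the periodic flow of $\partial_t u+\partial_x(\nabla R(u)-\mathcal{M}u)=0$.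
   Context: Consider the system $\partial_t u+\partial_x(\nabla R(u)-\mathcal{M}u)=0$ for $u=(u_1,u_2)$, where $u_1,u_2$ are real functions of $(x,t)\in\mathbb{R}\times\mathbb{R}$, $L$-periodic in $x$, and $R:\mathbb{R}^2\to\mathbb{R}$ is sufficiently smooth. $\mathcal{M}=(\mathcal{M}_{ij})_{i,j=1,2}$ is given by Fourier multipliers $\widehat{\mathcal{M}_{ij}g}(\kappa)=m_{ij}(\kappa)\widehat g(\kappa)$, $\kappa\in\mathbb{Z}$. The matrix $m(\kappa)=(m_{ij}(\kappa))$ is symmetric for each $\kappa$, the $m_{ij}$ are even and continuous, and there are $s>0$ and constants $c_1,c_2>0$ with $c_1|\kappa|^s\le\langle m(\kappa)w,w\rangle_{\mathbb{R}^2}\le c_2|\kappa|^s$ for all $\kappa\in\mathbb{Z}$ and all $w$ in the unit sphere of $\mathbb{R}^2$. Solutions of $\mathcal{M}\phi+c\phi-\nabla R(\phi)+A=0$ are the profiles of traveling waves $u(x,t)=\phi(x-ct)$. Standing assumptions: the system conserves the energy $E(u)=\int_0^L\{\frac12\langle\mathcal{M}u,u\rangle_{\mathbb{R}^2}-R(u)\}dx$, the momentum $F(u)=\frac12\int_0^L\langle u,u\rangle_{\mathbb{R}^2}dx$, and the mass $M(u)=\int_0^L\langle u,(1,1)\rangle_{\mathbb{R}^2}dx$; and the periodic Cauchy problem for the system is globally well-posed in the energy space $X=H^{s/2}_{per}([0,L])\times H^{s/2}_{per}([0,L])$. A functional is conserved if it is constant along the solutions $t\mapsto u(t)$. $\langle\cdot,\cdot\rangle$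 and $\|\cdot\|$ denote the inner product and norm of $L^2_{per}([0,L])\times L^2_{per}([0,L])$. $\mathcal{L}$ is self-adjoint in this space with domain $H^s_{per}([0,L])\times H^s_{per}([0,L])$; for elements of $X$, $\langle\mathcal{L}u,v\rangle$ is understood through the associated bilinear form. $Q'$ is the Fréchet derivative, and $Q'(\phi)=\mathcal{L}\Phi$ means $Q'(\phi)v=\langle\mathcal{L}\Phi,v\rangle$. Orbital stability: let $\rho(u,v)=\inf_{y\in\mathbb{R}}\|u-v(\cdot+y)\|_X$. $\phi$ is orbitally stable in $X$ by the periodic flow if for every $\varepsilon>0$ there is $\delta>0$ such that whenever $u_0\in X$ and $\|u_0-\phi\|_X<\delta$, the solution $u(t)$ with initial data $u_0$ exists globally and satisfies $\rho(u(t),\phi)<\varepsilon$ for all $t\ge0$. *)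

(* Defs.v *)
(* MathComp-Analysis, over an arbitrary [R : realType].

   Elements of the L-periodic function spaces are represented by measurable,
   everywhere defined, L-periodic functions [R -> 'cV[R]_2]; equality in these
   spaces is equality almost everywhere. *)
From HB Require Import structures.
From mathcomp Require Import all_boot all_order all_algebra.
From mathcomp Require Import complex.
From mathcomp Require Import all_classical all_reals all_analysis.

Set Implicit Arguments.
Unset Strict Implicit.
Unset Printing Implicit Defensive.

Import Order.TTheory GRing.Theory Num.Theory.
Import numFieldNormedType.Exports.

Local Open Scope classical_set_scope.
Local Open Scope ring_scope.

Section Functions.
Context {R : realType}.
Implicit Types (L s r : R) (f : R -> R) (u v : R -> 'cV[R]_2).

Definition dot (a b : 'cV[R]_2) : R := \sum_(i < 2) a i 0 * b i 0.

Definition component u (i : 'I_2) : R -> R := fun x => u x i 0.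

Definition translate (y : R) u : R -> 'cV[R]_2 := fun x => u (x + y).

Definition x_deriv u : R -> 'cV[R]_2 := fun x => \col_i derive1 (component u i) x.

Definition ae_equal u v := {ae lebesgue_measure, forall x, u x = v x}.

Definition smooth_periodic L u :=
  periodic u L /\
  forall (i : 'I_2) (n : nat) (x : R), derivable (derive1n n (component u i)) x 1.

Definition L2per L u :=
  periodic u L /\
  forall i : 'I_2,
    measurable_fun [set: R] (component u i) /\
    lebesgue_measure.-integrable `[0, L] (fun x => ((component u i x) ^+ 2)%:E).

Definition L2dot L u v : R :=
  \int[lebesgue_measure]_(x in `[0, L]) dot (u x) (v x).

(* (1/L) int_0^L f(x) exp(-2 pi i k x / L) dx *)
Definition fourier L f (k : int) : R[i] :=
  let w := fun x : R => 2 * pi * k%:~R * x / L in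
  ((L^-1 * \int[lebesgue_measure]_(x in `[0, L]) (f x * cos (w x)))
   -i* (L^-1 * \int[lebesgue_measure]_(x in `[0, L]) (f x * sin (w x))))%C.

Definition sqmod (z : R[i]) : R := complex.Re z ^+ 2 + complex.Im z ^+ 2.

(* L * sum_k (1 + |k|^2)^r |u^(k)|^2; the factor L makes the case r = 0 the
   square of the L^2 norm. *)
Definition sobolev_sq L r u : \bar R :=
  (L%:E * \esum_(k in [set: int])
     ((1 + `|k%:~R| ^+ 2) `^ r
      * \sum_(i < 2) sqmod (fourier L (component u i) k))%:E)%E.

Definition Hper L r u := L2per L u /\ (sobolev_sq L r u < +oo)%E.

Definition Hnorm L r u : R := Num.sqrt (fine (sobolev_sq L r u)).

Definition Xspace L s u := Hper L (s / 2) u.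

Definition Xnorm L s u : R := Hnorm L (s / 2) u.

Definition rho L s u v : R :=
  inf [set Xnorm L s (u - translate y v) | y in [set: R]].

Definition frechet_derivative L s (Q : (R -> 'cV[R]_2) -> R) u
    (l : (R -> 'cV[R]_2) -> R) :=
  [/\ (forall (a : R) h k, Xspace L s h -> Xspace L s k ->
         l (a *: h + k) = a * l h + l k),
      (exists C : R, forall h, Xspace L s h -> `|l h| <= C * Xnorm L s h) &
      forall e : R, 0 < e -> exists2 d : R, 0 < d &
        forall h, Xspace L s h -> Xnorm L s h < d ->
          `|Q (u + h) - Q u - l h| <= e * Xnorm L s h].

End Functions.

(* The nonlinearity is the gradient of G : R^2 -> R. *)
Section Potential.
Context {R : realType}.
Implicit Types (G : 'cV[R]_2 -> R).

Definition partial (i : 'I_2) G : 'cV[R]_2 -> R :=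
  fun a => 'D_(delta_mx i 0) G a.

Definition grad G (a : 'cV[R]_2) : 'cV[R]_2 := \col_i partial i G a.

Definition Hess G (a : 'cV[R]_2) : 'M[R]_2 :=
  \matrix_(i, j) partial i (partial j G) a.

Definition class_C2 G :=
  [/\ continuous G,
      (forall (i : 'I_2) a, derivable G a (delta_mx i 0)),
      (forall i : 'I_2, continuous (partial i G)),
      (forall (i j : 'I_2) a, derivable (partial j G) a (delta_mx i 0)) &
      forall i j : 'I_2, continuous (partial i (partial j G))].

End Potential.

Section System.
Context {R : realType}.
Implicit Types (L s c : R) (m : R -> 'M[R]_2) (G : 'cV[R]_2 -> R).
Implicit Types (u v w : R -> 'cV[R]_2) (U V : R -> R -> 'cV[R]_2).

Definition admissible_symbol s (c1 c2 : R) m :=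
  [/\ (forall (k : int), (m k%:~R)^T = m k%:~R),
      (forall (i j : 'I_2) (x : R), m (- x) i j = m x i j),
      (forall i j : 'I_2, continuous (fun x : R => m x i j)) &
      forall (k : int) (w : 'cV[R]_2), dot w w = 1 ->
        c1 * `|k%:~R| `^ s <= dot (m k%:~R *m w) w <= c2 * `|k%:~R| `^ s].

(* [is_multiplier L m u v] : v = M u in L^2_per x L^2_per. *)
Definition is_multiplier L m u v :=
  [/\ L2per L u, L2per L v &
      forall (k : int) (i : 'I_2),
        fourier L (component v i) k =
        \sum_(j < 2) ((m k%:~R i j)%:C)%C * fourier L (component u j) k].

(* int_0^L <M u, v> dx, extended to X x X by Parseval's identity; the series
   over the integers, summed symmetrically, converges absolutely there. *)
Definition Mform L m u v : R :=
  L * limn (fun n : nat => \sum_(l < n.*2.+1)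
    let k : int := l%:Z - n%:Z in
    complex.Re (\sum_(i < 2) \sum_(j < 2)
      ((m k%:~R i j)%:C)%C * fourier L (component u j) k
      * (fourier L (component v i) k)^*)%C).

(* The form <Lu, v> on X x X of the linearized operator M + c - Hess G(phi). *)
Definition Lform L c m G (phi : R -> 'cV[R]_2) u v : R :=
  Mform L m u v + c * L2dot L u v
  - \int[lebesgue_measure]_(x in `[0, L]) dot (Hess G (phi x) *m u x) (v x).

(* [is_Lop L s c m G phi u v] : u is in the domain H^s_per x H^s_per of the
   linearized operator and v is its image in L^2_per x L^2_per. *)
Definition is_Lop L s c m G (phi : R -> 'cV[R]_2) u v :=
  Hper L s u /\ L2per L v /\
  exists2 w, is_multiplier L m u w &
    ae_equal v (fun x => w x + c *: u x - Hess G (phi x) *m u x).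

Definition eigenfunction L s c m G (phi : R -> 'cV[R]_2) (lambda : R) u :=
  ~ ae_equal u (fun=> 0) /\
  is_Lop L s c m G phi u (fun x => lambda *: u x).

Definition simple_eigenvalue L s c m G (phi : R -> 'cV[R]_2) (lambda : R) u :=
  eigenfunction L s c m G phi lambda u /\
  forall v, eigenfunction L s c m G phi lambda v ->
    exists a : R, ae_equal v (fun x => a *: u x).

Definition profile_equation L c (A : 'cV[R]_2) m G (phi : R -> 'cV[R]_2) :=
  exists2 w, is_multiplier L m phi w &
    {ae lebesgue_measure, forall x,
       w x + c *: phi x - grad G (phi x) + A = 0}.

(* Solutions in C(R; X) of u_t + (grad G(u) - M u)_x = 0, the equation being
   understood in the sense of periodic distributions in x for every t. *)
Definition solution L s m G U :=
  [/\ (forall t, Xspace L s (U t)),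
      (forall t, (fun t' => Xnorm L s (U t' - U t)) @ t --> (0 : R)),
      (forall t (i : 'I_2), lebesgue_measure.-integrable `[0, L]
         (fun x => (grad G (U t x) i 0)%:E)) &
      forall psi : R -> 'cV[R]_2, smooth_periodic L psi -> forall t : R,
        is_derive t 1 (fun t' => L2dot L (U t') psi)
          (\int[lebesgue_measure]_(x in `[0, L])
              dot (grad G (U t x)) (x_deriv psi x)
           - Mform L m (U t) (x_deriv psi))].

Definition globally_well_posed L s m G :=
  [/\ (forall u0, Xspace L s u0 ->
         exists2 U, solution L s m G U & ae_equal (U 0) u0),
      (forall U V, solution L s m G U -> solution L s m G V ->
         ae_equal (U 0) (V 0) -> forall t, ae_equal (U t) (V t)) &
      forall U, solution L s m G U ->
      forall T e : R, 0 < T -> 0 < e -> exists2 d : R, 0 < d &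
        forall V, solution L s m G V -> Xnorm L s (V 0 - U 0) < d ->
          forall t, `|t| <= T -> Xnorm L s (V t - U t) < e].

Definition conserved L s m G (Q : (R -> 'cV[R]_2) -> R) :=
  forall U, solution L s m G U -> forall t, Q (U t) = Q (U 0).

Definition energy L m G u : R :=
  2^-1 * Mform L m u u - \int[lebesgue_measure]_(x in `[0, L]) G (u x).

Definition momentum L u : R := 2^-1 * L2dot L u u.

Definition mass L u : R := L2dot L u (fun=> const_mx 1).

(* The energy is a genuine functional on X: the integral of G(u) is not the
   default value of a non-integrable function. *)
Definition energy_defined L s G :=
  forall u, Xspace L s u ->
    lebesgue_measure.-integrable `[0, L] (fun x => (G (u x))%:E).

Definition hypothesis_H1 L s c m G (phi : R -> 'cV[R]_2) :=
  [/\ smooth_periodic L phi,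
      (forall p : R, 0 < p < L -> ~ periodic phi p),
      (exists lambda chi, [/\ lambda < 0,
         simple_eigenvalue L s c m G phi lambda chi &
         forall mu v, mu < 0 -> eigenfunction L s c m G phi mu v ->
           mu = lambda]) &
      simple_eigenvalue L s c m G phi 0 (x_deriv phi)].

Definition hypothesis_H2 L s c m G (phi : R -> 'cV[R]_2) :=
  exists Phi : R -> 'cV[R]_2,
    [/\ Xspace L s Phi,
        Lform L c m G phi Phi Phi < 0,
        Lform L c m G phi Phi (x_deriv phi) = 0 &
        exists2 Q : (R -> 'cV[R]_2) -> R,
          conserved L s m G Q &
          frechet_derivative L s Q phi (Lform L c m G phi Phi)].

Definition orbitally_stable L s m G (phi : R -> 'cV[R]_2) :=
  forall e : R, 0 < e -> exists2 d : R, 0 < d &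
    forall u0, Xspace L s u0 -> Xnorm L s (u0 - phi) < d ->
      (exists2 U, solution L s m G U & ae_equal (U 0) u0) /\
      forall U, solution L s m G U -> ae_equal (U 0) u0 ->
        forall t, 0 <= t -> rho L s (U t) phi < e.

End System.

(* Main.v *)
Require Import Defs.
From HB Require Import structures.
From mathcomp Require Import all_boot all_order all_algebra.
From mathcomp Require Import complex.
From mathcomp Require Import all_classical all_reals all_analysis.
From mathcomp Require Import measurable_realfun.
From mathcomp Require Import zify ring lra.

Set Implicit Arguments.
Unset Strict Implicit.
Unset Printing Implicit Defensive.

Import Order.TTheory GRing.Theory Num.Theory.
Import numFieldNormedType.Exports.

Local Open Scope classical_set_scope.
Local Open Scope ring_scope.

(** Let [action] be the sum of the energy, of c times the momentum and of the
pairing with A. It is conserved and invariant under translations, the wave is a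
critical point of it, and its second variation at the wave is the form
[l u v = <Lu, v>] of the linearized operator. By (H1) only two directions keep
[l] from being coercive on the energy space X: one negative direction and the
kernel, spanned by phi'. A vector Phi with [l Phi Phi < 0] disposes of the first
one: [l v v + D (l Phi v)^2] controls the square of the norm of v as soon as v
is L2-orthogonal to phi' ([coercive_direction]). The second one is the tangent
of the orbit; it is removed by comparing the solution with the nearest translate
of the wave ([modulation]). So the distance to the orbit stays small as long as
[l Phi v] does ([stability_of_controlled]), where v is a translate of the
solution minus the wave.

The functional Q with derivative [l Phi] at the wave is not supposed to be
invariant under translations, and v involves a translation that depends on time;
conservation of Q bounds [l Phi v] only after a further argument.

If c is not zero, the wave itself runs through all its translates in a bounded
time. By continuous dependence a solution that starts near the wave does the
same, and since translates of solutions are solutions, the value of Q at every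
translate of the initial datum is close to its value at the wave
([controlled_moving]).

If c = 0 the wave stands still, and [l Phi] is determined instead. For a
trigonometric polynomial g with [<g, phi'> = 0] let [l w] be the pairing with g,
and follow the solution that starts at [phi + e w]. To first order in e and t it
drifts by [e t g'] ([standing_response]), and Q is constant along it, so
[l Phi g' = 0] ([standing_annihilates]). Hence [l Phi] is a combination of the
pairings with phi and with constants, that is, the derivative at the wave of a
combination of the momentum and of the masses of the two components; these are
conserved and invariant under translations ([controlled_standing]).

G is of class C^2 without any growth condition, so the expansion of the action
to second order in X ([action_expansion]) rests on a growth bound extracted from
the mere integrability of G(u) for all u in X. If G grew too fast, a sum of
bumps of geometrically decreasing width would be an element u of X for which
G(u) is not integrable ([superposition_growth]); the bound obtained is exactly
strong enough to make the contribution of the points where v is large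
negligible with respect to the square of the norm of v ([superposition_tail]).

Fourier analysis is done in the real orthogonal system [cos + sin], in which
the L2 product, the norm of X and the form of the dispersive operator are all
diagonal. *)

(** * Bilinear forms on a subspace *)

Section Forms.
Context {R : realType} {V : lmodType R}.
Implicit Types (P K : V -> Prop) (b q l s : V -> V -> R) (u v w : V).

Definition subspace P := P 0 /\ forall a u v, P u -> P v -> P (a *: u + v).

Definition bilin P b :=
  (forall u v, P u -> P v -> b u v = b v u) /\
  (forall a u v w, P u -> P v -> P w -> b (a *: u + v) w = a * b u w + b v w).

Definition linf P (f : V -> R) :=
  forall a u v, P u -> P v -> f (a *: u + v) = a * f u + f v.

Definition psd P b := forall u, P u -> 0 <= b u u.

Definition form_lim b (v_ : nat -> V) u :=
  forall e : R, 0 < e -> exists N, forall n, (N <= n)%N -> b (v_ n - u) (v_ n - u) < e.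

Definition form_cauchy b (v_ : nat -> V) :=
  forall e : R, 0 < e -> exists N, forall n m, (N <= n)%N -> (N <= m)%N ->
    b (v_ n - v_ m) (v_ n - v_ m) < e.

Definition form_complete P b := forall v_ : nat -> V, (forall n, P (v_ n)) ->
  form_cauchy b v_ -> exists2 u, P u & form_lim b v_ u.

Definition form_closed P K b := forall (v_ : nat -> V) u, (forall n, K (v_ n)) -> P u ->
  form_lim b v_ u -> K u.

Lemma subspaceZ P a u : subspace P -> P u -> P (a *: u).
Proof. by move=> [P0 PL] Pu; rewrite -[_ *: _]addr0; apply: PL. Qed.

Lemma subspaceD P u v : subspace P -> P u -> P v -> P (u + v).
Proof. by move=> [P0 PL] Pu Pv; rewrite -[u]scale1r; apply: PL. Qed.

Lemma subspaceN P u : subspace P -> P u -> P (- u).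
Proof. by move=> sP Pu; rewrite -scaleN1r; apply: subspaceZ. Qed.

Lemma subspaceB P u v : subspace P -> P u -> P v -> P (u - v).
Proof. by move=> sP Pu Pv; apply: subspaceD => //; apply: subspaceN. Qed.

Lemma subspace_sum P (J : Type) (r : seq J) (F : J -> V) : subspace P ->
  (forall j, P (F j)) -> P (\sum_(j <- r) F j).
Proof.
move=> sP PF; elim: r => [|j r IH]; first by rewrite big_nil; exact: sP.1.
by rewrite big_cons; apply: subspaceD.
Qed.

Section Lin.
Context {P : V -> Prop} (sP : subspace P) {f : V -> R} (fP : linf P f).

Lemma linf0 : f 0 = 0.
Proof.
have := fP 1 sP.1 sP.1; rewrite scaler0 addr0 mul1r => /eqP.
by rewrite -subr_eq0 opprD addNKr oppr_eq0 => /eqP.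
Qed.

Lemma linfZ a u : P u -> f (a *: u) = a * f u.
Proof. by move=> Pu; rewrite -[_ *: _]addr0 fP ?linf0 ?addr0//; exact: sP.1. Qed.

Lemma linfD u v : P u -> P v -> f (u + v) = f u + f v.
Proof. by move=> Pu Pv; rewrite -[u]scale1r fP// mul1r scale1r. Qed.

Lemma linfB u v : P u -> P v -> f (u - v) = f u - f v.
Proof. by move=> Pu Pv; rewrite addrC -scaleN1r fP// mulN1r addrC. Qed.

Lemma linf_sum (J : Type) (r : seq J) (F : J -> V) : (forall j, P (F j)) ->
  f (\sum_(j <- r) F j) = \sum_(j <- r) f (F j).
Proof.
move=> PF; elim: r => [|j r IH]; first by rewrite !big_nil linf0.
by rewrite !big_cons linfD ?IH//; apply: subspace_sum.
Qed.
End Lin.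

Lemma linfS P K f : (forall u, K u -> P u) -> linf P f -> linf K f.
Proof. by move=> KP fP a u v Ku Kv; apply: fP; apply: KP. Qed.

Lemma bilinS P K b : (forall u, K u -> P u) -> bilin P b -> bilin K b.
Proof.
move=> KP [bC bL]; split=> [u v /KP ? /KP ?|a u v w /KP ? /KP ? /KP ?].
  exact: bC.
exact: bL.
Qed.

Lemma discriminant_le (a b c : R) : 0 <= a ->
  (forall t, 0 <= a * t ^+ 2 + 2 * b * t + c) -> b ^+ 2 <= a * c.
Proof.
rewrite le_eqVlt => /predU1P[<-|a0] H; last first.
  have := H (- b / a).
  have -> : a * (- b / a) ^+ 2 + 2 * b * (- b / a) + c = c - b ^+ 2 / a.
    by field; rewrite gt_eqF.
  by rewrite subr_ge0 ler_pdivrMr// mulrC.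
have [->|bn] := eqVneq b 0; first by rewrite expr0n/= mul0r.
have := H (- (c + 1) / (2 * b)).
rewrite mul0r add0r.
have -> : 2 * b * (- (c + 1) / (2 * b)) + c = -1 by field.
by rewrite ler0N1.
Qed.

Section Bilin.
Context {P : V -> Prop} (sP : subspace P) {b : V -> V -> R} (bP : bilin P b).

Lemma bilinC u v : P u -> P v -> b u v = b v u.
Proof. exact: bP.1. Qed.

Lemma bilin_linl w : P w -> linf P (b^~ w).
Proof. by move=> Pw a u v Pu Pv; exact: bP.2. Qed.

Lemma bilin_linr u : P u -> linf P (b u).
Proof.
move=> Pu a v w Pv Pw; rewrite bilinC//; last by apply: sP.2.
by rewrite bP.2// !(bilinC Pu).
Qed.

Lemma bilinDl u v w : P u -> P v -> P w -> b (u + v) w = b u w + b v w.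
Proof. by move=> Pu Pv Pw; rewrite (linfD (bilin_linl Pw)). Qed.
Lemma bilinDr u v w : P u -> P v -> P w -> b w (u + v) = b w u + b w v.
Proof. by move=> Pu Pv Pw; rewrite (linfD (bilin_linr Pw)). Qed.
Lemma bilinBl u v w : P u -> P v -> P w -> b (u - v) w = b u w - b v w.
Proof. by move=> Pu Pv Pw; rewrite (linfB (bilin_linl Pw)). Qed.
Lemma bilinBr u v w : P u -> P v -> P w -> b w (u - v) = b w u - b w v.
Proof. by move=> Pu Pv Pw; rewrite (linfB (bilin_linr Pw)). Qed.
Lemma bilinZl a u w : P u -> P w -> b (a *: u) w = a * b u w.
Proof. by move=> Pu Pw; rewrite (linfZ sP (bilin_linl Pw)). Qed.
Lemma bilinZr a u w : P u -> P w -> b w (a *: u) = a * b w u.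
Proof. by move=> Pu Pw; rewrite (linfZ sP (bilin_linr Pw)). Qed.
Lemma bilin0l w : P w -> b 0 w = 0.
Proof. by move=> Pw; rewrite (linf0 sP (bilin_linl Pw)). Qed.

Lemma bilin_sqD u v : P u -> P v ->
  b (u + v) (u + v) = b u u + 2 * b u v + b v v.
Proof.
move=> Pu Pv; have PD := subspaceD sP Pu Pv.
by rewrite bilinDl// !bilinDr// (bilinC Pv Pu); ring.
Qed.

Lemma bilin_sqB u v : P u -> P v ->
  b (u - v) (u - v) = b u u - 2 * b u v + b v v.
Proof.
move=> Pu Pv; have PD := subspaceB sP Pu Pv.
by rewrite bilinBl// !bilinBr// (bilinC Pv Pu); ring.
Qed.

Lemma bilin_sqZ a u : P u -> b (a *: u) (a *: u) = a ^+ 2 * b u u.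
Proof. by move=> Pu; have PZ := subspaceZ a sP Pu; rewrite bilinZl// bilinZr//; ring. Qed.

Context (b0 : psd P b).

Lemma psd_CS u v : P u -> P v -> b u v ^+ 2 <= b u u * b v v.
Proof.
move=> Pu Pv; rewrite mulrC; apply: discriminant_le => [|t]; first exact: b0.
have Ptv := subspaceZ t sP Pv.
have := b0 (subspaceD sP Pu Ptv); rewrite bilin_sqD// bilin_sqZ// bilinZr//.
by congr (_ <= _); ring.
Qed.

Lemma psd_sqD_le u v : P u -> P v -> b (u + v) (u + v) <= 2 * b u u + 2 * b v v.
Proof.
move=> Pu Pv; have := b0 (subspaceB sP Pu Pv).
by rewrite bilin_sqB// bilin_sqD//; lra.
Qed.

Lemma psd_sqB_le u v : P u -> P v -> b (u - v) (u - v) <= 2 * b u u + 2 * b v v.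
Proof.
move=> Pu Pv; have := b0 (subspaceD sP Pu Pv).
by rewrite bilin_sqB// bilin_sqD//; lra.
Qed.

Lemma psd_triangle u v : P u -> P v ->
  Num.sqrt (b (u + v) (u + v)) <= Num.sqrt (b u u) + Num.sqrt (b v v).
Proof.
move=> Pu Pv; have [bu bv] : 0 <= b u u /\ 0 <= b v v by split; exact: b0.
rewrite -[leRHS]ger0_norm ?addr_ge0 ?sqrtr_ge0// -sqrtr_sqr ler_wsqrtr//.
rewrite bilin_sqD// sqrrD !sqr_sqrtr// lerD2r lerD2l.
have : b u v <= Num.sqrt (b u u) * Num.sqrt (b v v).
  rewrite -sqrtrM// (le_trans (ler_norm _))// -sqrtr_sqr ler_wsqrtr//.
  exact: psd_CS.
by rewrite -mulr_natl; lra.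
Qed.

End Bilin.

Lemma ler_of_sqr (a c : R) : 0 <= c -> a ^+ 2 <= c ^+ 2 -> a <= c.
Proof.
move=> c0 ac; apply: le_trans (ler_norm a) _.
by rewrite -(@ler_pXn2r _ 2) ?nnegrE// real_normK ?num_real.
Qed.

Lemma closed_sq_le (a C : R) : (forall e : R, 0 < e -> a ^+ 2 <= C * e) -> a = 0.
Proof.
move=> H; apply/eqP; rewrite -sqrf_eq0 eq_le sqr_ge0 andbT.
apply/ler_addgt0Pl => e e0; rewrite addr0.
have C0 : 0 < `|C| + 1 by have := normr_ge0 C; lra.
have := H (e / (`|C| + 1)) (divr_gt0 e0 C0); move=> /le_trans; apply.
have := ler_norm C => CC; rewrite mulrCA ger_pMr// ler_pdivrMr// mul1r; lra.
Qed.

Lemma natinv_small (e : R) : 0 < e -> exists N, forall n, (N <= n)%N -> harmonic n < e :> R.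
Proof.
move=> e0; exists (Num.truncn e^-1) => n Nn.
rewrite /harmonic/= invf_plt ?posrE ?ltr0n//; apply: lt_le_trans (truncnS_gt _) _.
by rewrite ler_nat ltnS.
Qed.

Lemma minimizing_sequence K (J : V -> R) (m : R) : (exists v, K v) ->
  (forall v, K v -> m <= J v) ->
  exists2 i, (forall v, K v -> i <= J v) &
    exists v_ : nat -> V, forall n, K (v_ n) /\ J (v_ n) < i + harmonic n.
Proof.
move=> [v0 Kv0] Jm; pose A := [set J v | v in K].
have Alb : has_inf A.
  by split; [exists (J v0), v0|exists m => _ [v Kv <-]; exact: Jm].
exists (inf A); first by move=> v Kv; apply: ge_inf; [exact: Alb.2|exists v].
suff /choice[v_ ?] : forall n : nat, exists v, K v /\ J v < inf A + harmonic n.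
  by exists v_.
move=> n; have n0 : 0 < harmonic n :> R by exact: harmonic_gt0.
by have [_ [v Kv <-] lt] := inf_adherent n0 Alb; exists v.
Qed.

(** The representer minimises [q v v - 2 f v]: a minimising sequence is Cauchy
    by the parallelogram identity. *)
Lemma lax_milgram P K s q f (C kappa : R) : subspace P -> subspace K ->
  (forall u, K u -> P u) -> form_complete P s -> form_closed P K s ->
  bilin P s -> psd P s -> bilin P q -> linf P f ->
  0 < kappa -> 0 <= C ->
  (forall v, K v -> kappa * s v v <= q v v) ->
  (forall v, P v -> q v v <= C * s v v) ->
  (forall v, P v -> f v ^+ 2 <= C * s v v) ->
  exists2 w, K w & forall v, K v -> q w v = f v.
Proof.
move=> sP sK KP cP clK bs s0 bq lf k0 C0 qge qle fle.
have bqK := bilinS KP bq; have lfK := linfS KP lf.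
have q0 : psd K q.
  by move=> v Kv; apply: le_trans (qge v Kv); apply: mulr_ge0; [exact: ltW|exact/s0/KP].
pose J v := q v v - 2 * f v.
have Jlb v : K v -> - (C / kappa) <= J v.
  move=> Kv; rewrite /J.
  have h1 := qge v Kv; have h2 := fle v (KP _ Kv); have h3 := s0 v (KP _ Kv).
  have h4 : f v ^+ 2 <= (C / kappa) * q v v.
    apply: le_trans h2 _; rewrite -mulrA ler_wpM2l//.
    by rewrite ler_pdivlMl.
  have h5 := q0 v Kv.
  have h6 : 0 <= C / kappa by rewrite divr_ge0// ltW.
  have h7 : (2 * f v) ^+ 2 <= (C / kappa + q v v) ^+ 2.
    have := sqr_ge0 (C / kappa - q v v); move: h4; set D := C / kappa.
    by rewrite !expr2; nra.
  have h8 : 2 * f v <= C / kappa + q v v.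
    by apply: ler_of_sqr => //; rewrite addr_ge0.
  by lra.
have [i Jge [v_ Hv]] := minimizing_sequence (ex_intro _ _ sK.1) Jlb.
have Kv n := (Hv n).1.
have near_crit n v : K v -> (q (v_ n) v - f v) ^+ 2 <= harmonic n * q v v.
  move=> Kw; rewrite mulrC; apply: discriminant_le => [|t]; first exact: q0.
  have Kt := subspaceZ t sK Kw.
  have := Jge _ (subspaceD sK (Kv n) Kt); have := (Hv n).2; rewrite /J.
  rewrite (bilin_sqD sK bqK)// (bilin_sqZ sK bqK)// (bilinZr sK bqK)//.
  rewrite (linfD lfK)// (linfZ sK lfK)//.
  move: (harmonic n) (q (v_ n) _) (q _ _) (q v v) (f (v_ n)) (f v) => e a b c d g.
  by nra.
have cau : form_cauchy s v_.
  move=> e e0; have [N HN] := natinv_small (divr_gt0 (mulr_gt0 k0 e0) (ltr0n _ 4)).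
  exists N => n m Nn Nm.
  have KB := subspaceB sK (Kv n) (Kv m).
  rewrite -(ltr_pM2l k0); apply: le_lt_trans (qge _ KB) _.
  have KD := subspaceZ 2^-1 sK (subspaceD sK (Kv n) (Kv m)).
  have := Jge _ KD; have := (Hv n).2; have := (Hv m).2; rewrite /J.
  have KDD := subspaceD sK (Kv n) (Kv m).
  rewrite (bilin_sqZ sK bqK)// (bilin_sqD sK bqK)// (bilin_sqB sK bqK)//.
  rewrite (linfZ sK lfK)// (linfD lfK)//.
  have := HN _ Nn; have := HN _ Nm.
  rewrite (_ : 2^-1 ^+ 2 = 4^-1); last by field.
  by move: (kappa * e) (harmonic m) (harmonic n) => ke e1 e2; lra.
have [w Pw wlim] := cP _ (fun n => KP _ (Kv n)) cau.
have Kw : K w := clK _ _ Kv Pw wlim.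
exists w => // v Kv'; apply/eqP; rewrite -subr_eq0; apply/eqP.
apply: (@closed_sq_le _ (2 * (C + 1) * q v v)) => e e0.
have [N1 HN1] := natinv_small e0; have [N2 HN2] := wlim e e0.
pose n := maxn N1 N2.
have a1 := HN1 n (leq_maxl _ _); have a2 := HN2 n (leq_maxr _ _).
have KB := subspaceB sK (Kv n) Kw.
have -> : q w v - f v = - q (v_ n - w) v + (q (v_ n) v - f v).
  by rewrite (bilinBl bqK)//; ring.
have b1 := psd_CS sK bqK q0 KB Kv'.
have b2 := near_crit n v Kv'.
have b3 := qle _ (KP _ KB).
have b4 : q (v_ n - w) (v_ n - w) * q v v <= C * e * q v v.
  by rewrite ler_wpM2r ?q0// (le_trans b3)// ler_wpM2l// ltW.
have b5 : harmonic n * q v v <= e * q v v by rewrite ler_wpM2r ?q0// ltW.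
set x := q (v_ n - w) v in b1 *; set y := q (v_ n) v - f v in b2 *.
have b6 : (- x + y) ^+ 2 <= 2 * x ^+ 2 + 2 * y ^+ 2.
  by have := sqr_ge0 (x + y); rewrite !expr2; nra.
by lra.
Qed.

Lemma bounded_seq_cluster d (r : nat -> 'rV[R]_d) (M : R) :
  (forall n j, `|r n 0 j| <= M) ->
  exists p : 'rV[R]_d, forall i : nat, exists2 n, (i <= n)%N &
    forall j, `|r n 0 j - p 0 j| < harmonic i.
Proof.
move=> rM.
pose A := [set v : 'rV[R]_d | forall i, v ord0 i \in `[- M, M]].
have cA : compact A.
  apply: (@rV_compact _ _ (fun=> `[- M, M]%classic)) => _.
  exact: segment_compact.
have [|p [_ clp]] := cA (r @ \oo) _.
  by exists 0%N => // n _ /= i; rewrite in_itv/= -ler_norml.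
exists p => i.
have H1 : (r @ \oo) [set r n | n in [set n | (i <= n)%N]].
  by exists i => // n /= iN; exists n.
have [_ [[n /= iN <-] pn]] := clp _ _ H1 (nbhsx_ballx p _ (harmonic_gt0 i)).
by exists n => // j; rewrite distrC; exact: (pn.2 0 j).
Qed.

(** A minimising sequence of the Rayleigh quotient has a subsequence along which
    the finitely many functionals [f_] converge.  If the infimum is not
    positive, the shifted form [l - i q] is nonnegative and controls [s] up to
    these functionals, so that the parallelogram identity makes the subsequence
    Cauchy; its limit is an eigenvector. *)
Lemma spectral_gap_or_eigenvector P K s q l (d : nat) (f_ : 'I_d -> V -> R)
    (C kappa : R) : subspace P -> subspace K ->
  (forall u, K u -> P u) -> form_complete P s -> form_closed P K s ->
  bilin P s -> psd P s -> bilin P q -> psd P q -> bilin P l ->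
  0 < kappa -> 0 <= C ->
  (forall v, P v -> q v v <= s v v) ->
  (forall v, P v -> l v v <= C * s v v) ->
  (forall j, linf P (f_ j)) ->
  (forall j v, P v -> f_ j v ^+ 2 <= C * q v v) ->
  (forall v, P v -> kappa * s v v <= l v v + C * \sum_j f_ j v ^+ 2) ->
  (exists2 g : R, 0 < g & forall v, K v -> g * q v v <= l v v) \/
  (exists v (g : R), [/\ K v, g <= 0, 0 < q v v &
                   forall w, K w -> l v w = g * q v w]).
Proof.
move=> sP sK KP cP clK bs s0 bq q0 bl k0 C0 qs lC lf fC gard.
have bqK := bilinS KP bq; have blK := bilinS KP bl.
have l0 v : P v -> q v v = 0 -> 0 <= l v v.
  move=> Pv qv; have := gard v Pv; rewrite big1 ?mulr0 ?addr0.
    by apply: le_trans; rewrite mulr_ge0 ?s0// ltW.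
  by move=> j _; apply/eqP; rewrite eq_le sqr_ge0 (le_trans (fC j v Pv))// qv mulr0.
pose S v := K v /\ q v v = 1.
have [[v0 Sv0]|noS] := pselect (exists v, S v); last first.
  left; exists 1 => // v Kv; rewrite mul1r.
  have := q0 v (KP _ Kv); rewrite le_eqVlt => /predU1P[qv|qv].
    by rewrite -qv; apply: l0 => //; exact: KP.
  exfalso; apply: noS; exists ((Num.sqrt (q v v))^-1 *: v); split.
    exact: subspaceZ.
  rewrite (bilin_sqZ sP bq _ (KP _ Kv)) exprVn (sqr_sqrtr (ltW qv)) mulVf//.
  by rewrite gt_eqF.
have lb v : S v -> - (C * \sum_(j < d) C) <= l v v.
  move=> [Kv qv]; have Pv := KP _ Kv; have := gard v Pv.
  have : C * \sum_j f_ j v ^+ 2 <= C * \sum_(j < d) C.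
    apply: ler_wpM2l => //; apply: ler_sum => j _.
    by rewrite (le_trans (fC j v Pv))// qv mulr1.
  have : 0 <= kappa * s v v by rewrite mulr_ge0 ?s0// ltW.
  by lra.
have [i Ige [v_ Hv]] := minimizing_sequence (ex_intro _ _ Sv0) lb.
have scal (v : V) : K v -> i * q v v <= l v v.
  move=> Kv; have := q0 v (KP _ Kv); rewrite le_eqVlt => /predU1P[qv|qv].
    by rewrite -qv mulr0; apply: l0 => //; exact: KP.
  have a0 : 0 < Num.sqrt (q v v) by rewrite sqrtr_gt0.
  have Sv : S ((Num.sqrt (q v v))^-1 *: v).
    split; first exact: subspaceZ.
    rewrite (bilin_sqZ sP bq _ (KP _ Kv)) exprVn (sqr_sqrtr (ltW qv)) mulVf//.
    by rewrite gt_eqF.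
  have := Ige _ Sv; rewrite (bilin_sqZ sP bl _ (KP _ Kv)) exprVn (sqr_sqrtr (ltW qv)).
  by rewrite mulrC ler_pdivlMr.
have [i0|i0] := ltP 0 i; first by left; exists i.
right.
pose b u v := l u v - i * q u v.
have bb : bilin K b.
  split=> [u v Ku Kv|a u v w Ku Kv Kw]; rewrite /b.
    by rewrite (bilinC blK)// (bilinC bqK).
  by rewrite (blK.2)// (bqK.2)//; ring.
have b0 : psd K b by move=> v Kv; rewrite subr_ge0 scal.
have bv n : b (v_ n) (v_ n) < harmonic n.
  by have [[Kv qv] lt] := Hv n; rewrite /b qv mulr1 ltrBlDl.
have Kv n := (Hv n).1.1.
have fb n j : `|f_ j (v_ n)| <= C + 1.
  apply: ler_of_sqr; first by lra.
  rewrite real_normK ?num_real// (le_trans (fC j _ (KP _ (Kv n))))//.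
  by rewrite (Hv n).1.2 mulr1 expr2; nra.
have [p Hp] := @bounded_seq_cluster d (fun n => \row_j f_ j (v_ n)) _
  (fun n j => eq_ind_r (fun z => `|z| <= _) (fb n j) (mxE _ _ _ _)).
have /choice[t Ht] : forall i : nat, exists n, (i <= n)%N /\
    forall j, `|f_ j (v_ n) - p 0 j| < harmonic i.
  by move=> k; have [n kn H] := Hp k; exists n; split=> // j; have := H j; rewrite mxE.
pose w_ n := v_ (t n).
have Kw n : K (w_ n) by exact: Kv.
have har n m : (n <= m)%N -> harmonic m <= harmonic n :> R.
  by move=> nm; rewrite /harmonic/= lef_pV2 ?posrE ?ltr0n// ler_nat ltnS.
have bw n : b (w_ n) (w_ n) < harmonic n.
  by apply: lt_le_trans (bv _) (har _ _ (Ht n).1).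
have cau : form_cauchy s w_.
  move=> e e0; pose D : R := 4 + C * \sum_(j < d) 4.
  have D0 : 0 < D.
    have : 0 <= C * \sum_(j < d) 4 by rewrite mulr_ge0// sumr_ge0.
    by rewrite /D; lra.
  have [N HN] := natinv_small (divr_gt0 (mulr_gt0 k0 e0) D0).
  exists N => n m Nn Nm.
  have KB := subspaceB sK (Kw n) (Kw m).
  rewrite -(ltr_pM2l k0); apply: le_lt_trans (gard _ (KP _ KB)) _.
  have B1 := psd_sqB_le sK bb b0 (Kw n) (Kw m).
  have B2 : l (w_ n - w_ m) (w_ n - w_ m) <= b (w_ n - w_ m) (w_ n - w_ m).
    by rewrite lerBrDr gerDl; apply: mulr_le0_ge0 => //; exact/q0/KP.
  have := HN N (leqnn _); rewrite ltr_pdivlMr// => HN1.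
  have hN0 := @harmonic_gt0 R N; have hN1 : harmonic N <= 1 :> R.
    by rewrite /harmonic/= invf_le1 ?ltr0n// ler1n.
  have B3 : C * \sum_j f_ j (w_ n - w_ m) ^+ 2 <=
      C * (\sum_(j < d) 4 * harmonic N).
    apply: ler_wpM2l => //; apply: ler_sum => j _.
    rewrite (linfB (lf j))//; [|exact: KP|exact: KP].
    have := lt_le_trans ((Ht n).2 j) (har _ _ Nn).
    have := lt_le_trans ((Ht m).2 j) (har _ _ Nm).
    rewrite !ltr_norml => /andP[a1 a2] /andP[a3 a4].
    set x := _ - f_ j _.
    have x1 : - (2 * harmonic N) <= x by rewrite /x /w_; lra.
    have x2 : x <= 2 * harmonic N by rewrite /x /w_; lra.
    by move: (harmonic N) hN0 hN1 x1 x2 => h ? ? ? ?; rewrite expr2; nra.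
  rewrite -mulr_suml in B3.
  have := lt_le_trans (bw n) (har _ _ Nn); have := lt_le_trans (bw m) (har _ _ Nm).
  move: (har) B1 B2 B3 HN1 hN0; rewrite /D; move: (harmonic N) => h.
  move: (\sum_(j < d) 4) (\sum_j _) => z1 z2; by nra.
have [w Pw wlim] := cP _ (fun n => KP _ (Kw n)) cau.
have Kww : K w := clK _ _ Kw Pw wlim.
exists w, i; split => //.
- have [N HN] := wlim 4^-1 ltac:(by rewrite invr_gt0).
  have KB := subspaceB sK (Kw N) Kww.
  have := psd_sqD_le sP bq q0 (KP _ KB) (KP _ Kww).
  rewrite subrK (Hv _).1.2 => H1.
  have := qs _ (KP _ KB); have := HN N (leqnn _).
  by move: H1; lra.
- move=> v Kv'; apply/eqP; rewrite -subr_eq0 -/(b w v); apply/eqP.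
  apply: (@closed_sq_le _ (2 * (C - i + 1) * b v v)) => e e0.
  have [N1 HN1] := natinv_small e0; have [N2 HN2] := wlim e e0.
  pose n := maxn N1 N2.
  have a1 := HN1 n (leq_maxl _ _); have a2 := HN2 n (leq_maxr _ _).
  have KB := subspaceB sK (Kw n) Kww; have PB := KP _ KB.
  have -> : b w v = - b (w_ n - w) v + b (w_ n) v.
    by rewrite (bilinBl bb)//; ring.
  have b1 := psd_CS sK bb b0 KB Kv'.
  have b2 := psd_CS sK bb b0 (Kw n) Kv'.
  have b3 : b (w_ n - w) (w_ n - w) <= (C - i) * e.
    have := lC _ PB; have := qs _ PB; have := q0 _ PB; rewrite /b.
    move: (l _ _) (q _ _) (s _ _) a2 => x y z; nra.
  have bvv := b0 v Kv'.
  have b4 : b (w_ n - w) (w_ n - w) * b v v <= (C - i) * e * b v v.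
    by rewrite ler_wpM2r.
  have b5 : b (w_ n) (w_ n) * b v v <= e * b v v.
    by rewrite ler_wpM2r// ltW// (lt_trans (bw n)).
  set x := b (w_ n - w) v in b1 *; set y := b (w_ n) v in b2 *.
  have b6 : (- x + y) ^+ 2 <= 2 * x ^+ 2 + 2 * y ^+ 2.
    by have := sqr_ge0 (x + y); rewrite !expr2; nra.
  by lra.
Qed.

(** The spectral decomposition: [l] has one negative direction [chi], the
    kernel direction [p], and is at least [g q] on the [q]-orthogonal [K] of
    both. *)
Section OneNegativeDirection.
Context {P : V -> Prop} {s q l : V -> V -> R} {chi p : V}.
Context {lambda g C kappa : R}.
Context (sP : subspace P) (bs : bilin P s) (s0 : psd P s).
Context (bq : bilin P q) (q0 : psd P q) (bl : bilin P l).
Context (Pchi : P chi) (Pp : P p) (lambda0 : lambda < 0) (g0 : 0 < g).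
Context (qchi : 0 < q chi chi) (qp : 0 < q p p).
Context (lchi : forall v, P v -> l chi v = lambda * q chi v).
Context (lp : forall v, P v -> l p v = 0).
Context (kappa0 : 0 < kappa) (C0 : 0 <= C).
Context (gard : forall v, P v -> kappa * s v v <= l v v + C * q v v).

Definition spectral_complement v := [/\ P v, q v chi = 0 & q v p = 0].
Local Notation K := spectral_complement.
Context (gap : forall v, K v -> g * q v v <= l v v).

Lemma spectral_complement_sub v : K v -> P v.
Proof. by case. Qed.

Lemma spectral_complement_subspace : subspace K.
Proof.
split; first by split; [exact: sP.1|rewrite (bilin0l sP bq)..].
move=> a u v [Pu u1 u2] [Pv v1 v2]; split; first by apply: sP.2.
  by rewrite bq.2// u1 v1; ring.
by rewrite bq.2// u2 v2; ring.
Qed.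

Lemma q_chi_p : q chi p = 0.
Proof.
have := lchi Pp; rewrite (bilinC bl)// lp// => /esym/eqP.
by rewrite mulf_eq0 => /orP[/eqP l0|/eqP//]; move: lambda0; rewrite l0 ltxx.
Qed.

Lemma spectral_decomposition v : P v ->
  exists2 w, K w & v = (q v chi / q chi chi) *: chi + (q v p / q p p) *: p + w.
Proof.
move=> Pv; set a := _ / _; set b := q v p / _.
have PD := subspaceD sP (subspaceZ a sP Pchi) (subspaceZ b sP Pp).
exists (v - (a *: chi + b *: p)); last by rewrite addrC subrK.
have Pa := subspaceZ a sP Pchi; have Pb := subspaceZ b sP Pp.
split; first exact: subspaceB.
- rewrite (bilinBl bq)// (bilinDl bq)// !(bilinZl sP bq)//.
  rewrite (bilinC bq Pp)// q_chi_p mulr0 addr0 /a divfK ?subrr//.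
  by rewrite gt_eqF.
- rewrite (bilinBl bq)// (bilinDl bq)// !(bilinZl sP bq)//.
  by rewrite q_chi_p mulr0 add0r /b divfK ?subrr// gt_eqF.
Qed.

Lemma l_spectral (a b a' b' : R) u v : K u -> K v ->
  l (a *: chi + b *: p + u) (a' *: chi + b' *: p + v) =
  a * a' * lambda * q chi chi + l u v.
Proof.
move=> [Pu u1 u2] [Pv v1 v2].
have Pa := subspaceZ a sP Pchi; have Pb := subspaceZ b sP Pp.
have Pa' := subspaceZ a' sP Pchi; have Pb' := subspaceZ b' sP Pp.
have PD := subspaceD sP Pa Pb; have PD' := subspaceD sP Pa' Pb'.
have PDD := subspaceD sP PD' Pv.
rewrite (bilinDl bl)// (bilinDl bl)// (bilinZl sP bl)// (bilinZl sP bl)// lp//.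
rewrite lchi// (bilinDr sP bq)// (bilinDr sP bq)// !(bilinZr sP bq)// q_chi_p.
rewrite (bilinC bq Pchi Pv) v1 (bilinDr sP bl)// (bilinDr sP bl)// !(bilinZr sP bl)//.
rewrite (bilinC bl Pu Pchi) (bilinC bl Pu Pp) lp// lchi// (bilinC bq Pchi Pu) u1.
by ring.
Qed.

Lemma coercive_complement v : K v -> (kappa / (1 + C / g)) * s v v <= l v v.
Proof.
move=> Kv; have [Pv _ _] := Kv; have := gard Pv; have := gap Kv => h1 h2.
have Cg : 0 <= C / g by rewrite divr_ge0// ltW.
rewrite mulrAC ler_pdivrMr; last by lra.
apply: le_trans h2 _; rewrite mulrDr mulr1 lerD2l mulrCA ler_wpM2l//.
by rewrite mulrC ler_pdivlMl.
Qed.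

(** If [l Phi Phi < 0], then [l] is coercive on the vectors orthogonal to [p]
    and [l]-orthogonal to [Phi]: the component of [v] along [chi] is paid for by
    the Cauchy-Schwarz inequality for [l] on [K]. *)
Lemma coercive_of_negative Phi : P Phi -> l Phi Phi < 0 ->
  exists k D : R, [/\ 0 < k, 0 <= D & forall v, P v -> q v p = 0 ->
    k * s v v <= l v v + D * l Phi v ^+ 2].
Proof.
move=> PPhi lPhi; have [P1 KP1 EPhi] := spectral_decomposition PPhi.
set a := q Phi chi / _ in EPhi; set b := _ / q p p in EPhi.
pose A : R := - lambda * q chi chi.
have A0 : 0 < A by rewrite mulr_gt0// oppr_gt0.
have lKK : psd K l.
  move=> v Kv; apply: le_trans (gap Kv); have [Pv _ _] := Kv.
  by rewrite mulr_ge0 ?q0// ltW.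
have blK := bilinS spectral_complement_sub bl.
have sK := spectral_complement_subspace.
pose B := l P1 P1; have B0 : 0 <= B by exact: lKK.
have BA : B < a ^+ 2 * A.
  move: lPhi; rewrite EPhi l_spectral// -/B /A.
  by have -> : a ^+ 2 * (- lambda * q chi chi) = - (a * a * lambda * q chi chi);
    [ring|lra].
have a2 : 0 < a ^+ 2 by rewrite -(pmulr_lgt0 _ A0); exact: le_lt_trans BA.
pose t := B / (a ^+ 2 * A); have aA : 0 < a ^+ 2 * A by rewrite mulr_gt0.
have t0 : 0 <= t by rewrite divr_ge0// ltW.
have t1 : t < 1 by rewrite ltr_pdivrMr// mul1r.
pose h := (1 - t) / 2; have h0 : 0 < h by rewrite /h; lra.
pose D := (1 + h^-1) / (a ^+ 2 * A).
have D0 : 0 <= D by rewrite divr_ge0 ?ltW// ltr_wpDr// ?invr_ge0 ltW.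
(* the negative part [al ^+ 2 * A] is at most a fraction of [l w w] *)
have key v al w : K w -> v = al *: chi + w -> l v v = l w w - al ^+ 2 * A /\
    al ^+ 2 * A <= (1 + t) / 2 * l w w + D * l Phi v ^+ 2.
  move=> Kw Ev; have Ev' : v = al *: chi + 0 *: p + w by rewrite scale0r addr0.
  split; first by rewrite Ev' l_spectral// /A expr2; ring.
  have CS := psd_CS sK blK lKK KP1 Kw.
  have th : l Phi v = l P1 w - a * al * A.
    by rewrite EPhi Ev' l_spectral// /A; ring.
  have wpos := lKK _ Kw; rewrite -/B in CS.
  have e1 : (a * al * A) ^+ 2 <= (1 + h) * (l P1 w) ^+ 2 + (1 + h^-1) * l Phi v ^+ 2.
    rewrite th; set x := l P1 w; set y := a * al * A.
    have : 0 <= (h * x + (x - y)) ^+ 2 / h by rewrite divr_ge0 ?sqr_ge0// ltW.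
    have -> : (h * x + (x - y)) ^+ 2 / h =
      (1 + h) * x ^+ 2 + (1 + h^-1) * (x - y) ^+ 2 - y ^+ 2.
      by field; rewrite gt_eqF.
    by rewrite subr_ge0.
  have e2 : (1 + h) * (l P1 w) ^+ 2 <= (1 + h) * B * l w w.
    by rewrite -mulrA ler_wpM2l//; lra.
  have e3 : al ^+ 2 * A = (a * al * A) ^+ 2 / (a ^+ 2 * A).
    have an : a != 0 by rewrite -sqrf_eq0 gt_eqF.
    by field; rewrite an gt_eqF.
  have e4 : (1 + h) * B / (a ^+ 2 * A) <= (1 + t) / 2.
    rewrite -mulrA -/t /h; have := sqr_ge0 (1 - t); rewrite expr2; nra.
  rewrite e3 ler_pdivrMr//; apply: le_trans e1 _.
  rewrite [leRHS]mulrDl; apply: lerD; last by rewrite /D mulrAC divfK// gt_eqF.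
  apply: le_trans e2 _; rewrite [leRHS]mulrAC.
  by apply: ler_wpM2r => //; rewrite -ler_pdivrMr.
(* hence [l v v] controls [l w w], hence [q v v], hence [s v v] *)
pose c := (1 - t) / 2; have c0 : 0 < c by rewrite /c; lra.
pose M := q chi chi / A + 1 / g.
have M0 : 0 < M.
  by rewrite /M addr_gt0// divr_gt0.
pose E := D * (1 + c); have E0 : 0 <= E by rewrite mulr_ge0//; lra.
have CM : 0 <= C * M / c by rewrite divr_ge0 ?(ltW c0)// mulr_ge0// ltW.
exists (kappa / (1 + C * M / c)), E; split=> // [|v Pv vp].
  by rewrite divr_gt0//; lra.
have [w Kw Ev] := spectral_decomposition Pv.
rewrite vp mul0r scale0r addr0 in Ev; set al := _ / _ in Ev.
have [lv al2] := key v al w Kw Ev.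
set th2 := l Phi v ^+ 2 in al2 *.
have th0 : 0 <= th2 by exact: sqr_ge0.
have [Pw w1 w2] := Kw.
have qv : q v v = al ^+ 2 * q chi chi + q w w.
  have Pal := subspaceZ al sP Pchi.
  rewrite {1 2}Ev (bilin_sqD sP bq)// (bilin_sqZ sP bq)// (bilinZl sP bq)//.
  by rewrite (bilinC bq Pchi Pw) w1; ring.
have lw0 : 0 <= l w w by exact: lKK.
have u1 : c * l w w <= l v v + D * th2.
  by rewrite lv /c; move: al2; set z := l w w; set y := al ^+ 2 * A; lra.
have u2 : q v v <= M * (l w w + D * th2).
  have Dt : 0 <= D * th2 by rewrite mulr_ge0.
  have al3 : al ^+ 2 * A <= l w w + D * th2.
    apply: le_trans al2 _; rewrite lerD2r ler_piMl//; lra.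
  have : q w w <= 1 / g * (l w w + D * th2).
    rewrite mulrAC mul1r ler_pdivlMr// mulrC (le_trans (gap Kw))//; lra.
  rewrite qv /M mulrDl => ?; apply: lerD => //.
  rewrite [leRHS]mulrAC ler_pdivlMr// mulrAC [leRHS]mulrC.
  by apply: ler_wpM2r => //; exact: ltW.
have u3 : c * q v v <= M * (l v v + E * th2).
  have : c * (l w w + D * th2) <= l v v + E * th2.
    by rewrite /E; move: u1; set z := l w w; lra.
  move=> /(ler_wpM2l (ltW M0)); apply: le_trans.
  by rewrite mulrCA ler_wpM2l ?(ltW c0).
have tot0 : 0 <= l v v + E * th2.
  by rewrite -(pmulr_rge0 _ M0); apply: le_trans u3; rewrite mulr_ge0 ?q0// ltW.
rewrite mulrAC ler_pdivrMr; last by lra.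
apply: le_trans (gard Pv) _; rewrite mulrDr mulr1.
apply: lerD.
  by rewrite lerDl mulr_ge0.
have -> : (l v v + E * th2) * (C * M / c) = C * (M * (l v v + E * th2) / c).
  by field; rewrite gt_eqF.
by rewrite ler_wpM2l// ler_pdivlMr// mulrC.
Qed.

Lemma spectral_complement_closed : (forall v, P v -> q v v <= s v v) ->
  form_closed P K s.
Proof.
move=> qs v_ u Kv Pu lim; have Pv n := spectral_complement_sub (Kv n).
suff H r : P r -> (forall n, q (v_ n) r = 0) -> q u r = 0.
  by split=> //; apply: H => // n; have [] := Kv n.
move=> Pr vr; apply: (@closed_sq_le _ (q r r)) => e e0.
have [N /(_ _ (leqnn _)) HN] := lim e e0.
have PB := subspaceB sP (Pv N) Pu.
have := psd_CS sP bq q0 PB Pr; rewrite (bilinBl bq)// vr sub0r sqrrN.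
move=> /le_trans; apply; rewrite mulrC ler_wpM2l ?q0//.
by rewrite (le_trans (qs _ PB))// ltW.
Qed.

Lemma solve_form f (D : R) : form_complete P s ->
  (forall v, P v -> q v v <= s v v) ->
  linf P f -> 0 <= D -> (forall v, P v -> l v v <= D * s v v) ->
  (forall v, P v -> f v ^+ 2 <= D * s v v) -> f p = 0 ->
  exists2 w, P w & forall v, P v -> l w v = f v.
Proof.
move=> cP qs lf D0 lD fD fp.
have Cg : 0 <= C / g by rewrite divr_ge0// ltW.
have k0 : 0 < kappa / (1 + C / g) by rewrite divr_gt0//; lra.
have [w Kw Hw] := lax_milgram sP spectral_complement_subspace
  spectral_complement_sub cP (spectral_complement_closed qs) bs s0 bl lf k0 D0
  coercive_complement lD fD.
have [Pw w1 w2] := Kw.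
have Pz a := subspaceZ a sP Pchi.
exists ((f chi / (lambda * q chi chi)) *: chi + 0 *: p + w).
  by apply: subspaceD => //; apply: subspaceD => //; exact: subspaceZ.
move=> v Pv; have [z Kz] := spectral_decomposition Pv.
move: (q v chi / _) (q v p / _) => a1 a2 ->; have [Pz' _ _] := Kz.
have Pzp := subspaceZ a2 sP Pp.
rewrite l_spectral// Hw// (linfD lf)//; last exact: subspaceD.
rewrite (linfD lf)// !(linfZ sP lf)// fp; field.
by rewrite (gt_eqF qchi) (lt_eqF lambda0).
Qed.
End OneNegativeDirection.

(** If [v] is in the closed span of the orthonormal family [e_], it is the sum
    of its expansion; totality and completeness provide this for every [v]. *)
Lemma parseval P b (e_ : nat -> V) : subspace P -> bilin P b -> psd P b ->
  form_complete P b -> (forall j, P (e_ j)) ->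
  (forall i j, b (e_ i) (e_ j) = (i == j)%:R) ->
  (forall v, P v -> (forall j, b v (e_ j) = 0) -> b v v = 0) ->
  forall u v, P u -> P v ->
  (fun N => \sum_(j < N) b u (e_ j) * b v (e_ j)) @ \oo --> b u v.
Proof.
move=> sP bb b0 cP Pe ee tot u v Pu Pv.
pose S w N := \sum_(j < N) b w (e_ j) *: e_ j.
have PS w N : P (S w N) by apply: subspace_sum => // j; exact: subspaceZ.
have bS w z N : P z -> b (S w N) z = \sum_(j < N) b w (e_ j) * b z (e_ j).
  move=> Pz; rewrite (linf_sum sP (bilin_linl bb Pz)); last first.
    by move=> j; exact: subspaceZ.
  by apply: eq_bigr => j _; rewrite (bilinZl sP bb)// (bilinC bb Pz).
have bSe w N i : b (S w N) (e_ i) = if (i < N)%N then b w (e_ i) else 0.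
  rewrite bS//; case: ltnP => iN.
    rewrite (bigD1 (Ordinal iN))//= ee eqxx mulr1 big1 ?addr0// => j ji.
    by rewrite ee eq_sym (negbTE (ji : nat_of_ord j != i)) mulr0.
  rewrite big1// => j _; rewrite ee gtn_eqF ?mulr0//.
  exact: leq_trans (ltn_ord j) iN.
have bSS w N M : (N <= M)%N -> P w -> b (S w N) (S w M) =
    \sum_(j < N) b w (e_ j) ^+ 2.
  move=> NM Pw; rewrite bS//; apply: eq_bigr => j _.
  by rewrite bSe (leq_trans (ltn_ord j) NM) expr2.
pose T w N := \sum_(j < N) b w (e_ j) ^+ 2.
have bSB w N M : (N <= M)%N -> P w -> b (S w N - S w M) (S w N - S w M) =
    T w M - T w N.
  by move=> NM Pw; rewrite (bilin_sqB sP bb)// !bSS//; rewrite /T; ring.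
have bessel w N : P w -> T w N <= b w w.
  move=> Pw; have := b0 _ (subspaceB sP Pw (PS w N)).
  rewrite (bilin_sqB sP bb)// bSS// (bilinC bb)// bS//.
  under [X in _ - 2 * X + _]eq_bigr do rewrite -expr2.
  by rewrite -/(T w N); lra.
have ndT w : nondecreasing_seq (T w).
  apply/nondecreasing_seqP => N; rewrite /T big_ord_recr/= lerDl.
  exact: sqr_ge0.
have cvS : forall w, P w -> form_lim b (S w) w.
  move=> w Pw.
  have cT : cvgn (T w).
    by apply: nondecreasing_is_cvgn => //; exists (b w w) => _ [N _ <-]; exact: bessel.
  have cau : form_cauchy b (S w).
    move=> e e0; have [N _ HN] := (@cvgrPdist_lt _ _ _ _ _ _ _).1 cT _ (divr_gt0 e0 (ltr0n _ 2)).
    exists N => n m Nn Nm; have := HN _ Nn; have := HN _ Nm => /=.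
    set x := limn _; rewrite !ltr_norml => /andP[? ?] /andP[? ?].
    case: (leqP n m) => nm; first by rewrite bSB//; lra.
    rewrite -opprB (_ : - _ = (-1) *: (S w m - S w n)); last by rewrite scaleN1r.
    rewrite (bilin_sqZ sP bb) ?bSB//; [|exact: ltnW|exact: subspaceB].
    by lra.
  have [z Pz lim] := cP _ (PS w) cau.
  have PB := subspaceB sP Pw Pz.
  have wz : b (w - z) (w - z) = 0.
    apply: tot => // j; apply: (@closed_sq_le _ 1) => e e0.
    have [N HN] := lim e e0; pose n := maxn N j.+1.
    have -> : b (w - z) (e_ j) = b (S w n - z) (e_ j).
      by rewrite !(bilinBl bb)// bSe leq_max ltnSn orbT.
    have PSz := subspaceB sP (PS w n) Pz.
    apply: (le_trans (psd_CS sP bb b0 PSz (Pe j))).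
    by rewrite ee eqxx mulr1 mul1r ltW// HN// leq_maxl.
  move=> e e0; have [N HN] := lim (e / 2) (divr_gt0 e0 (ltr0n _ 2)).
  exists N => n Nn.
  have -> : S w n - w = (S w n - z) - (w - z).
    by rewrite opprB addrA subrK.
  have PSz := subspaceB sP (PS w n) Pz.
  have := psd_sqB_le sP bb b0 PSz PB; rewrite wz; have := HN n Nn; lra.
apply/cvgrPdist_lt => e e0.
have bv0 : 0 < b v v + 1 by have := b0 v Pv; lra.
have [N HN] := cvS u Pu (e ^+ 2 / (b v v + 1)) (divr_gt0 (exprn_gt0 2 e0) bv0).
exists N => // n /= Nn; rewrite -bS// distrC -(bilinBl bb)//.
have PSu := subspaceB sP (PS u n) Pu.
rewrite -(@ltr_pXn2r _ 2) ?nnegrE// ?real_normK ?num_real ?ltW//.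
apply: le_lt_trans (psd_CS sP bb b0 PSu Pv) _.
have := HN n Nn; rewrite ltr_pdivlMr// => h; apply: le_lt_trans h.
by apply: ler_wpM2l; [exact: b0|lra].
Qed.

End Forms.

(** * Integration over a period *)

Section Circle.
Context {R : realType}.
Notation mu := (@lebesgue_measure R).
Implicit Types (L : R) (f g : R -> R).

Lemma measurable_shift (y : R) :
  measurable_fun [set: R] (fun x : R => x + y).
Proof. by exact: measurable_funD. Qed.

Lemma measurable_fun_shift d (T : measurableType d) (f : R -> T) (y : R) :
  measurable_fun [set: R] f -> measurable_fun [set: R] (fun x => f (x + y)).
Proof. by move=> mf; apply: (measurableT_comp mf); exact: measurable_shift. Qed.

Lemma lebesgue_measure_shift (y : R) (B : set R) : measurable B ->
  mu B = mu ((fun x => x + y) @^-1` B).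
Proof.
move=> mB; have mT : measurable_fun [set: measurableTypeR R]
  ((fun x => x + y) : _ -> measurableTypeR R) := measurable_shift y.
pose T_mixin := isMeasurableFun.Build _ _ _ _ _ mT.
pose T : {mfun measurableTypeR R >-> measurableTypeR R} :=
  HB.pack (fun x : R => x + y) T_mixin.
apply: (@lebesgue_measure_unique R (pushforward mu T)) mB => _ [[a b]] _ <-.
transitivity (mu `]a - y, b - y]%classic); last first.
  by congr (mu _); apply/seteqP; split => x /=; rewrite !in_itv/= ltrBlDr lerBrDr.
rewrite !lebesgue_measure_itv/= !lte_fin ltrD2r -!EFinD.
by have -> : b - y - (a - y) = b - a by ring.
Qed.

Lemma ge0_integral_shift (y : R) (B : set R) (g : R -> \bar R) : measurable B ->
  measurable_fun [set: R] g -> (forall x, 0 <= g x)%E ->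
  (\int[mu]_(x in B) g x = \int[mu]_(x in (fun x : R => (x + y)%R) @^-1` B) g (x + y)%R)%E.
Proof.
move=> mB mg g0.
have mT : measurable_fun [set: measurableTypeR R]
  ((fun x => x + y) : _ -> measurableTypeR R) := measurable_shift y.
transitivity (\int[pushforward mu ((fun x => x + y)%R : _ -> measurableTypeR R)]_(x in B) g x)%E; last first.
  by apply: (ge0_integral_pushforward mT) => //; exact: measurable_funS mg.
by apply: eq_measure_integral => X mX _; exact: lebesgue_measure_shift.
Qed.

Lemma periodic_int (T : Type) (f : R -> T) L (k : int) x :
  (forall x, f (x + L) = f x) -> f (x + k%:~R * L) = f x.
Proof.
move=> pf; case: k => n.
  elim: n x => [|n IH] x; first by rewrite mul0r addr0.
  by rewrite -[RHS]IH -[RHS]pf -addn1 PoszD intrD mulrDl mul1r addrA.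
rewrite NegzE; elim: n.+1 x => [|m IH] x; first by rewrite oppr0 mul0r addr0.
rewrite -[RHS]IH -[LHS]pf; congr f.
by rewrite -addn1 PoszD opprD intrD mulrDl mulN1r -!addrA addNr addr0.
Qed.

Lemma ge0_integral_period L (y : R) (g : R -> \bar R) : 0 < L ->
  (forall x, g (x + L) = g x) -> measurable_fun [set: R] g -> (forall x, 0 <= g x)%E ->
  (\int[mu]_(x in `[0%R, L]) g (x + y)%R = \int[mu]_(x in `[0%R, L]) g x)%E.
Proof.
move=> L0 pg mg g0.
wlog /andP[y0 yL] : y / 0 <= y < L.
  move=> wl; pose k := Num.floor (y / L).
  have /andP[ky yk] : 0 <= y + (- k)%:~R * L < L.
    rewrite intrN mulNr subr_ge0 -ler_pdivlMr// floor_le/= ltrBlDr addrC.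
    by rewrite -{2}[L]mul1r -mulrDl -ltr_pdivrMr// -[1]/(1%:~R) -intrD floorD1_gt.
  rewrite -(wl (y + (- k)%:~R * L)) ?ky//.
  by apply: eq_integral => x _; rewrite addrA periodic_int.
have co (h : R -> \bar R) a b : measurable_fun [set: R] h ->
    (\int[mu]_(x in `[a, b[) h x = \int[mu]_(x in `[a, b]) h x)%E.
  by move=> mh; rewrite -integral_itv_bndo_bndc//; exact: measurable_funS mh.
have mgs z := measurable_fun_shift z mg.
have split (h : R -> \bar R) a b c : a <= b -> b <= c ->
    measurable_fun [set: R] h -> (forall x, 0 <= h x)%E ->
    (\int[mu]_(x in `[a, c[) h x =
     \int[mu]_(x in `[a, b[) h x + \int[mu]_(x in `[b, c[) h x)%E.
  move=> ab bc mh h0.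
  have -> : `[a, c[%classic = `[a, b[%classic `|` `[b, c[%classic.
    apply/seteqP; split => x /=; rewrite !in_itv/=; last by lra.
    by move=> /andP[-> ->]; rewrite andbT/=; case: (ltP x b) => _; [left|right].
  rewrite ge0_integral_setU//=; first exact: measurable_funS mh.
  by apply/disj_set2P/seteqP; split => // x [] /=; rewrite !in_itv/=; lra.
rewrite -!co//.
have [Ly yL' yL2] : [/\ 0 <= L - y, L - y <= L & y <= L] by split; lra.
rewrite (split (fun x : R => g (x + y)) 0 (L - y) L)// (split g 0 y L)//.
rewrite addeC; congr (_ + _)%E.
- rewrite [RHS](@ge0_integral_shift (y - L))//.
  have -> : (fun x : R => x + (y - L)) @^-1` `[0, y[ = `[L - y, L[%classic.
    by apply/seteqP; split => x /=; rewrite !in_itv/=; lra.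
  by apply: eq_integral => x _; rewrite addrA -{1}[x + y](subrK L) pg.
- rewrite [RHS](@ge0_integral_shift y)//.
  by congr integral; apply/seteqP; split => x /=; rewrite !in_itv/=; lra.
Qed.

Definition CI L f := measurable_fun [set: R] f /\ mu.-integrable `[0, L] (EFin \o f).
Local Notation I L f := (\int[mu]_(x in `[0, L]) f x).

Lemma mper L : measurable (`[0, L]%classic : set (measurableTypeR R)).
Proof. exact: measurable_itv. Qed.
Local Hint Extern 0 (measurable _) => exact: mper : core.

Lemma CID L f g : CI L f -> CI L g -> CI L (fun x => f x + g x).
Proof.
move=> [mf If] [mg Ig]; split; first exact: measurable_funD.
have := integrableD (mper L) If Ig.
by apply: eq_integrable => // x _; rewrite /= EFinD.
Qed.

Lemma CIZ L (a : R) f : CI L f -> CI L (fun x => a * f x).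
Proof.
move=> [mf If]; split; first exact: measurable_funM.
have := integrableZl (mper L) a If.
by apply: eq_integrable => // x _; rewrite /= EFinM.
Qed.

Lemma CIN L f : CI L f -> CI L (fun x => - f x).
Proof. by move=> /(CIZ (-1)); congr CI; apply/funext => x; rewrite mulN1r. Qed.

Lemma CIB L f g : CI L f -> CI L g -> CI L (fun x => f x - g x).
Proof. by move=> cf /CIN; exact: CID. Qed.

Lemma CI_dom L f g : measurable_fun [set: R] f -> CI L g ->
  (forall x, `|f x| <= g x) -> CI L f.
Proof.
move=> mf [mg Ig] fg; split=> //; apply: le_integrable Ig => //.
  by apply/measurable_EFinP; exact: measurable_funS mf.
by move=> x _ /=; rewrite lee_fin (le_trans (fg x))// ler_norm.
Qed.

Lemma CI_cst L (a : R) : CI L (fun=> a).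
Proof.
split=> //; apply: measurable_bounded_integrable => //=.
  by rewrite lebesgue_measure_itv/=; case: ifP => _; rewrite ?ltry// ltry.
by exists `|a|; split; rewrite ?num_real// => y /ltW ay x _.
Qed.

Lemma CI_bounded L f (M : R) : measurable_fun [set: R] f ->
  (forall x, `|f x| <= M) -> CI L f.
Proof. by move=> mf fM; apply: CI_dom fM => //; exact: CI_cst. Qed.

Lemma CI_norm L f : CI L f -> CI L (fun x => `|f x|).
Proof.
move=> cf; have [mf If] := cf; split; first exact: measurableT_comp.
exact: integrable_norm.
Qed.

Lemma CI_sum L (J : Type) (r : seq J) (F : J -> R -> R) :
  (forall j, CI L (F j)) -> CI L (fun x => \sum_(j <- r) F j x).
Proof.
move=> cF; elim: r => [|j r IH].
  by under [X in CI _ X]eq_fun do rewrite big_nil; exact: CI_cst.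
by under [X in CI _ X]eq_fun do rewrite big_cons; exact: CID.
Qed.

Lemma CI_mul_bounded L f g (M : R) : CI L f -> measurable_fun [set: R] g ->
  (forall x, `|g x| <= M) -> CI L (fun x => f x * g x).
Proof.
move=> cf mg gM; apply: (@CI_dom _ _ (fun x => M * `|f x|)).
- by apply: measurable_funM => //; case: cf.
- exact/CIZ/CI_norm.
- by move=> x; rewrite normrM mulrC ler_wpM2r.
Qed.

Lemma int_ext L f g : (forall x, f x = g x) -> I L f = I L g.
Proof. by move=> fg; congr Rintegral; apply/funext. Qed.

Lemma intD L f g : CI L f -> CI L g ->
  I L (fun x => f x + g x) = I L f + I L g.
Proof. by move=> [_ ?] [_ ?]; rewrite RintegralD. Qed.

Lemma intZ L (a : R) f : CI L f -> I L (fun x => a * f x) = a * I L f.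
Proof. by move=> [_ ?]; rewrite RintegralZl. Qed.

Lemma intN L f : CI L f -> I L (fun x => - f x) = - I L f.
Proof.
move=> cf; rewrite -mulN1r -intZ//; apply: eq_Rintegral => x _.
by rewrite mulN1r.
Qed.

Lemma intB L f g : CI L f -> CI L g ->
  I L (fun x => f x - g x) = I L f - I L g.
Proof. by move=> cf cg; rewrite intD ?intN//; exact: CIN. Qed.

Lemma int_le L f g : CI L f -> CI L g -> (forall x, f x <= g x) ->
  I L f <= I L g.
Proof. by move=> [_ ?] [_ ?] fg; apply: le_Rintegral. Qed.

Lemma int_ge0 L f : (forall x, 0 <= f x) -> 0 <= I L f.
Proof. by move=> f0; apply: Rintegral_ge0. Qed.

Lemma int_norm_le L f g : CI L f -> CI L g -> (forall x, `|f x| <= g x) ->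
  `|I L f| <= I L g.
Proof.
move=> cf cg fg; have [_ If] := cf.
by apply: (le_trans (le_normr_Rintegral _ If)) => //; apply: int_le => //; exact: CI_norm.
Qed.

Lemma int_sum L (J : Type) (r : seq J) (F : J -> R -> R) :
  (forall j, CI L (F j)) ->
  I L (fun x => \sum_(j <- r) F j x) = \sum_(j <- r) I L (F j).
Proof.
move=> cF; elim: r => [|j r IH].
  rewrite big_nil; under eq_Rintegral do rewrite big_nil.
  by rewrite Rintegral_cst// mul0r.
rewrite big_cons -IH; under eq_Rintegral do rewrite big_cons.
by rewrite intD//; exact: CI_sum.
Qed.

Lemma int_cst L (a : R) : 0 < L -> I L (fun=> a) = a * L.
Proof.
by move=> L0; rewrite Rintegral_cst//= lebesgue_measure_itv/= lte_fin L0 oppr0 addr0.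
Qed.

Lemma int_shift L f (y : R) : 0 < L -> periodic f L ->
  measurable_fun [set: R] f -> I L (fun x => f (x + y)) = I L f.
Proof.
move=> L0 pf mf; rewrite /Rintegral; congr fine.
rewrite integralE [RHS]integralE.
have mf' : measurable_fun [set: R] (EFin \o f) by exact/measurable_EFinP.
rewrite -(@ge0_integral_period L y (EFin \o f)^\+%E)//; last 2 first.
- by move=> x; rewrite !funeposE/= pf.
- exact: measurable_funepos.
rewrite -(@ge0_integral_period L y (EFin \o f)^\-%E)//.
- by congr (_ - _)%E; apply: eq_integral => x _; rewrite ?funeposE ?funenegE.
- by move=> x; rewrite !funenegE/= pf.
- exact: measurable_funeneg.
Qed.

Lemma CI_shift L f (y : R) : 0 < L -> periodic f L -> CI L f ->
  CI L (fun x => f (x + y)).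
Proof.
move=> L0 pf [mf /integrableP[_ If]]; have mfs := measurable_fun_shift y mf.
split => //; apply/integrableP; split.
  by apply/measurable_EFinP; exact: measurable_funS mfs.
apply: le_lt_trans If.
rewrite -[leRHS](@ge0_integral_period L y (fun x => `|(f x)%:E|%E))//.
- by move=> x; rewrite /= pf.
- by apply: measurableT_comp => //; exact/measurable_EFinP.
Qed.

Lemma aeS (P Q : R -> Prop) : (forall x, P x -> Q x) ->
  {ae mu, forall x, P x} -> {ae mu, forall x, Q x}.
Proof. by move=> PQ; apply: negligibleS => x /= + /PQ. Qed.

Lemma aeI (P Q : R -> Prop) : {ae mu, forall x, P x} ->
  {ae mu, forall x, Q x} -> {ae mu, forall x, P x /\ Q x}.
Proof.
move=> aP aQ; apply: negligibleS (negligibleU aP aQ) => x /= nPQ.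
by apply: contrapT => /not_orP[/contrapT ? /contrapT ?]; apply: nPQ.
Qed.

Lemma ae_all (P : nat -> R -> Prop) : (forall n, {ae mu, forall x, P n x}) ->
  {ae mu, forall x, forall n, P n x}.
Proof.
move=> aP; apply: negligibleS (negligible_bigcup aP) => x /= /existsNP[n nP].
by exists n.
Qed.

Lemma aeW (P : R -> Prop) : (forall x, P x) -> {ae mu, forall x, P x}.
Proof.
move=> aP; apply: (@negligibleS _ _ _ mu set0); last exact: negligible_set0.
by move=> x /=; apply.
Qed.

Lemma ae_neq (a : R) : {ae mu, forall x, x != a}.
Proof.
exists [set a]; split; [exact: measurable_set1|exact: lebesgue_measure_set1|].
by move=> x /= /negP; rewrite negbK => /eqP.
Qed.

Lemma ae_periodic L (P : R -> Prop) : 0 < L ->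
  (forall x, P x -> P (x + L)) -> (forall x, P (x + L) -> P x) ->
  {ae mu, forall x, `[0, L]%classic x -> P x} -> {ae mu, forall x, P x}.
Proof.
move=> L0 PL PR [N [mN N0 NP]].
pose Nk (k : int) := (fun x : R => x + k%:~R * L) @^-1` N.
have PK (k : int) x : P (x + k%:~R * L) -> P x.
  have Q : forall n : nat, (forall x, P (x + n%:R * L) -> P x) /\
      (forall x, P (x - n%:R * L) -> P x).
    elim=> [|n [IH1 IH2]]; first by split=> z; rewrite mul0r ?subr0 ?addr0.
    split=> z; rewrite -natr1 mulrDl mul1r.
      by rewrite addrA => /PR /IH1.
    by rewrite opprD addrA => Pz; apply: IH2; move: (PL _ Pz); rewrite subrK.
  case: k => n; first exact: (Q n).1.
  by rewrite NegzE intrN mulNr; exact: (Q n.+1).2.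
have mNk k : measurable (Nk k).
  by rewrite /Nk -[X in measurable X]setTI; apply: measurable_shift.
pose ek (k : nat) : int := if odd k then - (k./2)%:Z - 1 else (k./2)%:Z.
have neg : mu.-negligible (\bigcup_k Nk (ek k)).
  apply: negligible_bigcup => k; exists (Nk (ek k)).
  by split; [exact: mNk|rewrite -N0; exact/esym/lebesgue_measure_shift|].
apply: negligibleS neg => x /= nPx.
pose k := Num.floor (x / L).
have kx : `[0, L]%classic (x + (- k)%:~R * L).
  rewrite /= in_itv/= intrN mulNr subr_ge0 -ler_pdivlMr// floor_le/=.
  rewrite lerBlDr -{1}[L]mul1r -mulrDl -ler_pdivrMr// addrC -[1]/(1%:~R) -intrD.
  exact/ltW/floorD1_gt.
have : N (x + (- k)%:~R * L) by apply: NP => /= /(_ kx)/PK.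
case: (- k) => [j|j] Nx; first by exists j.*2 => //=; rewrite /ek odd_double doubleK.
exists j.*2.+1 => //=; rewrite /ek/= odd_double/= uphalf_double.
by move: Nx; rewrite /Nk/= NegzE -addn1 PoszD opprD.
Qed.

Lemma int_ae_eq0 L f : 0 < L -> periodic f L -> CI L f ->
  (forall x, 0 <= f x) -> I L f = 0 -> {ae mu, forall x, f x = 0}.
Proof.
move=> L0 pf [mf If] f0 Hf; apply: (@ae_periodic L) => //.
- by move=> x; rewrite pf.
- by move=> x; rewrite pf.
have mfD : measurable_fun `[0, L] (EFin \o f) by case/integrableP: If.
have E : (\int[mu]_(x in `[0%R, L]) `|(EFin \o f) x| = 0)%E.
  transitivity (\int[mu]_(x in `[0%R, L]) (f x)%:E)%E.
    by apply: eq_integral => x _; rewrite /= ger0_norm.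
  by rewrite -[LHS]fineK ?(integrable_fin_num _ If)//; congr EFin; exact: Hf.
have H := (ae_eq_integral_abs mu (mper L) mfD).1 E.
by apply: aeS H => x /= /[apply] -[].
Qed.

Lemma int_ae_eq L f g : measurable_fun [set: R] f -> measurable_fun [set: R] g ->
  {ae mu, forall x, f x = g x} -> I L f = I L g.
Proof.
move=> mf mg fg; rewrite /Rintegral; congr fine; apply: ae_eq_integral => //.
- by apply/measurable_EFinP; exact: measurable_funS mf.
- by apply/measurable_EFinP; exact: measurable_funS mg.
by apply: aeS fg => x ->.
Qed.

End Circle.

(** * The Hartley basis *)

Section DominatedConvergence.
Context {R : realType}.
Notation mu := (@lebesgue_measure R).
Local Notation I L f := (\int[mu]_(x in `[0, L]) f x).

Lemma int_dominated_cvg (L : R) (f_ : nat -> R -> R) (f g : R -> R) :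
  (forall n, measurable_fun [set: R] (f_ n)) -> measurable_fun [set: R] f ->
  {ae mu, forall x, f_ ^~ x @ \oo --> f x} -> CI L g ->
  (forall n x, `|f_ n x| <= g x) ->
  (fun n => I L (f_ n)) @ \oo --> I L f.
Proof.
move=> mf_ mf ff cg fg; have cf n : CI L (f_ n) by apply: CI_dom (fg n).
have aS (h : R -> R) : measurable_fun [set: R] h ->
    measurable_fun (`[0, L]%classic : set (measurableTypeR R)) (EFin \o h).
  by move=> mh; apply/measurable_EFinP; exact: measurable_funS mh.
have h3 : {ae mu, forall x, `[0, L]%classic x ->
    (fun n => (f_ n x)%:E) @ \oo --> (f x)%:E}.
  by apply: aeS ff => x ? _; apply/fine_cvgP; split=> //; exact: nearW.
have h5 : {ae mu, forall x n, `[0, L]%classic x -> (`|(f_ n x)%:E| <= (g x)%:E)%E}.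
  by apply: aeW => x n _; rewrite lee_fin.
have [If _ H] := dominated_convergence (mper L) (fun n => aS _ (mf_ n)) (aS _ mf) h3
  cg.2 h5.
by apply: fine_cvg; rewrite fineK//; exact: integrable_fin_num.
Qed.
End DominatedConvergence.

Section PowerThreshold.
Context {R : realType}.
Implicit Types (q r y : R).

Lemma bernoulli_le y (m : nat) : 0 <= y <= 1 -> 1 - m%:R * y <= (1 - y) ^+ m.
Proof.
move=> /andP[y0 y1]; elim: m => [|m IH]; first by rewrite mul0r subr0 expr0.
rewrite exprS; apply: (@le_trans _ _ ((1 - y) * (1 - m%:R * y))).
  have : 0 <= m%:R * y * y by rewrite !mulr_ge0.
  by rewrite -natr1; lra.
by apply: ler_wpM2l => //; lra.
Qed.

Lemma bernoulli_ge y (m : nat) : 0 <= y -> 1 + m%:R * y <= (1 + y) ^+ m.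
Proof.
move=> y0; elim: m => [|m IH]; first by rewrite mul0r addr0 expr0.
rewrite exprS; apply: (@le_trans _ _ ((1 + y) * (1 + m%:R * y))).
  have : 0 <= m%:R * y * y by rewrite !mulr_ge0.
  by rewrite -natr1; lra.
by apply: ler_wpM2l => //; lra.
Qed.

Lemma cvg_nat_mul_expr r : 0 <= r < 1 -> (fun n : nat => n%:R * r ^+ n) @ \oo --> (0 : R).
Proof.
move=> /andP[r0 r1].
have [->|rn] := eqVneq r 0.
  apply: cvg_near_cst; exists 1%N => // n /= n0.
  by case: n n0 => // n _; rewrite expr0n mulr0.
have rp : 0 < r by rewrite lt_def rn.
pose t := Num.sqrt r.
have t0 : 0 < t by rewrite sqrtr_gt0.
have tt : t * t = r by rewrite -expr2 sqr_sqrtr.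
have t1 : t < 1.
  by rewrite -(@ltr_pXn2r _ 2) ?nnegrE ?(ltW t0)// expr1n expr2 tt.
pose h := t^-1 - 1; have h0 : 0 < h by rewrite /h subr_gt0 invf_cp1.
have B n : n%:R * t ^+ n <= h^-1.
  have H := @bernoulli_ge h n (ltW h0).
  rewrite (_ : 1 + h = t^-1) in H; last by rewrite /h addrC subrK.
  rewrite -ler_pdivlMr ?exprn_gt0// -exprVn ler_pdivlMl//.
  by rewrite mulrC; apply: le_trans H; lra.
apply: (@squeeze_cvgr _ _ _ _ (fun=> 0) (fun n => h^-1 * t ^+ n)).
- apply: nearW => n; rewrite mulr_ge0 ?exprn_ge0//=.
  by rewrite -{1}tt exprMn mulrA ler_wpM2r// exprn_ge0// ltW.
- exact: cvg_cst.
- by apply: cvg_geometric; rewrite ger0_norm// ltW.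
Qed.

(** Polynomials approximating a step function: [q ^+ n] is compared with
    [2 ^- n]. *)
Lemma power_threshold q : 0 <= q <= 1 ->
  (fun n : nat => (1 - q ^+ n) ^+ (n * 2 ^ n)) @ \oo --> ((q < 2^-1)%R%:R : R).
Proof.
move=> /andP[q0 q1]; have qn n : 0 <= q ^+ n <= 1 by rewrite exprn_ge0// exprn_ile1.
have pw (n : nat) : (n * 2 ^ n)%:R * q ^+ n = n%:R * (2 * q) ^+ n.
  by rewrite natrM natrX exprMn mulrA.
case: ltP => qh.
- apply: (@squeeze_cvgr _ _ _ _ (fun n : nat => 1 - n%:R * (2 * q) ^+ n) (fun=> 1)).
  + apply: nearW => n; have /andP[a b] := qn n; rewrite exprn_ile1 ?andbT; [|lra|lra].
    by rewrite -pw; exact: bernoulli_le.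
  + rewrite -[X in _ --> X]subr0; apply: cvgB; first exact: cvg_cst.
    by apply: cvg_nat_mul_expr; apply/andP; split; lra.
  + exact: cvg_cst.
- apply: (@squeeze_cvgr _ _ _ _ (fun=> 0) (@harmonic R)).
  + apply: nearW => n; have /andP[a b] := qn n.
    have c0 : 0 <= 1 - q ^+ n by lra.
    rewrite exprn_ge0//= /harmonic/= -[leRHS]mul1r ler_pdivlMr ?ltr0n//.
    apply: (@le_trans _ _ ((1 - q ^+ n) ^+ (n * 2 ^ n) * (1 + q ^+ n) ^+ (n * 2 ^ n))).
      apply: ler_wpM2l; first exact: exprn_ge0.
      apply: le_trans (bernoulli_ge _ a); rewrite pw -natr1 addrC lerD2l.
      rewrite -[leLHS]mulr1 ler_wpM2l// exprn_ege1//; lra.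
    rewrite -exprMn exprn_ile1//.
      by rewrite mulr_ge0//; lra.
    by have := sqr_ge0 (q ^+ n); rewrite [X in 0 <= X]expr2; move: (q ^+ n) => z; nra.
  + exact: cvg_cst.
  + exact: cvg_harmonic.
Qed.
End PowerThreshold.

Section Hartley.
Context {R : realType}.
Notation mu := (@lebesgue_measure R).
Implicit Types (L x y : R) (k l : int) (f g : R -> R).
Local Notation I L f := (\int[mu]_(x in `[0, L]) f x).

Definition phase L k x : R := 2 * pi * k%:~R * x / L.

(** The real Hartley system [cos + sin], indexed by all integers, is an
    orthogonal basis that makes every operator commuting with translations and
    reflections diagonal; it avoids complex coefficients altogether. *)
Definition cas L k x : R := cos (phase L k x) + sin (phase L k x).

Lemma phase0 L x : phase L 0 x = 0.
Proof. by rewrite /phase mulr0 !mul0r. Qed.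

Lemma phaseN L k x : phase L (- k) x = - phase L k x.
Proof. by rewrite /phase rmorphN/= mulrN !mulNr. Qed.

Lemma phaseDk L k l x : phase L (k + l) x = phase L k x + phase L l x.
Proof. by rewrite /phase rmorphD/=; ring. Qed.

Lemma phaseBk L k l x : phase L (k - l) x = phase L k x - phase L l x.
Proof. by rewrite phaseDk phaseN. Qed.

Lemma phaseDx L k x y : phase L k (x + y) = phase L k x + phase L k y.
Proof. by rewrite /phase; ring. Qed.

Lemma cosD2kpi x k : cos (x + k%:~R * (2 * pi)) = cos x :> R.
Proof.
apply: (@periodic_int _ _ cos (2 * pi)) => z.
by rewrite mulrC -[pi * 2]/(pi * 2%:R) mulr_natr cosD2pi.
Qed.

Lemma sinD2kpi x k : sin (x + k%:~R * (2 * pi)) = sin x :> R.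
Proof.
apply: (@periodic_int _ _ sin (2 * pi)) => z.
by rewrite mulrC -[pi * 2]/(pi * 2%:R) mulr_natr sinD2pi.
Qed.

Section Period.
Context (L : R) (L0 : 0 < L).
Let Ln0 : L != 0. Proof. by rewrite gt_eqF. Qed.

Lemma phaseL k x : phase L k (x + L) = phase L k x + k%:~R * (2 * pi).
Proof. by rewrite /phase; field. Qed.

Lemma cos_phase_periodic k : periodic (fun x => cos (phase L k x)) L.
Proof. by move=> x; rewrite phaseL cosD2kpi. Qed.

Lemma sin_phase_periodic k : periodic (fun x => sin (phase L k x)) L.
Proof. by move=> x; rewrite phaseL sinD2kpi. Qed.

Lemma cas_periodic k : periodic (cas L k) L.
Proof. by move=> x; rewrite /cas phaseL cosD2kpi sinD2kpi. Qed.

Lemma measurable_phase k : measurable_fun [set: R] (phase L k).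
Proof.
by do 2 (apply: measurable_funM => //).
Qed.

Lemma measurable_cos_phase k : measurable_fun [set: R] (fun x => cos (phase L k x)).
Proof.
apply: measurableT_comp; last exact: measurable_phase.
by apply: continuous_measurable_fun; exact: continuous_cos.
Qed.

Lemma measurable_sin_phase k : measurable_fun [set: R] (fun x => sin (phase L k x)).
Proof.
apply: measurableT_comp; last exact: measurable_phase.
by apply: continuous_measurable_fun; exact: continuous_sin.
Qed.

Lemma measurable_cas k : measurable_fun [set: R] (cas L k).
Proof.
by apply: measurable_funD; [exact: measurable_cos_phase|exact: measurable_sin_phase].
Qed.

Lemma CI_cos_phase k : CI L (fun x => cos (phase L k x)).
Proof. by apply: CI_bounded (measurable_cos_phase k) _ => x; exact: cos_max. Qed.

Lemma CI_sin_phase k : CI L (fun x => sin (phase L k x)).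
Proof. by apply: CI_bounded (measurable_sin_phase k) _ => x; exact: sin_max. Qed.

Lemma cas_bounded k x : `|cas L k x| <= 2.
Proof.
apply: le_trans (ler_normD _ _) _.
by have := cos_max (phase L k x); have := sin_max (phase L k x); lra.
Qed.

Lemma cas_sq_bounded k x : cas L k x ^+ 2 <= 2.
Proof.
have := cos2Dsin2 (phase L k x); rewrite /cas.
by have := sqr_ge0 (cos (phase L k x) - sin (phase L k x)); rewrite !expr2; lra.
Qed.

(** Translation by half a wavelength changes the sign of the integrand. *)
Lemma int_cos_sin_phase k : k != 0 ->
  I L (fun x => cos (phase L k x)) = 0 /\ I L (fun x => sin (phase L k x)) = 0.
Proof.
move=> k0; have kr : k%:~R != 0 :> R by rewrite intr_eq0.
pose y := L / (2 * k%:~R).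
have ph x : phase L k (x + y) = phase L k x + pi.
  by rewrite /phase /y; field; rewrite Ln0 kr.
split.
- have := int_shift y L0 (cos_phase_periodic k) (measurable_cos_phase k).
  under eq_Rintegral do rewrite ph cosDpi.
  by rewrite intN; [lra|exact: CI_cos_phase].
- have := int_shift y L0 (sin_phase_periodic k) (measurable_sin_phase k).
  under eq_Rintegral do rewrite ph sinDpi.
  by rewrite intN; [lra|exact: CI_sin_phase].
Qed.

Lemma int_cos_phase k : I L (fun x => cos (phase L k x)) = (k == 0)%:R * L.
Proof.
have [->|k0] := eqVneq k 0; last by rewrite (int_cos_sin_phase k0).1 mul0r.
by under eq_Rintegral do rewrite phase0 cos0; exact: int_cst.
Qed.

Lemma int_sin_phase k : I L (fun x => sin (phase L k x)) = 0.
Proof.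
have [->|k0] := eqVneq k 0; last exact: (int_cos_sin_phase k0).2.
by under eq_Rintegral do rewrite phase0 sin0; rewrite int_cst// mul0r.
Qed.

Lemma cas_mul k l x : cas L k x * cas L l x =
  cos (phase L (k - l) x) + sin (phase L (k + l) x).
Proof. by rewrite /cas phaseBk phaseDk cosB sinD; ring. Qed.

Lemma cas_orthogonal k l : I L (fun x => cas L k x * cas L l x) = (k == l)%:R * L.
Proof.
under eq_Rintegral do rewrite cas_mul.
rewrite intD; [|exact: CI_cos_phase|exact: CI_sin_phase].
by rewrite int_cos_phase int_sin_phase addr0 subr_eq0.
Qed.

(** Multiplication by [cos] and [sin] of the fundamental phase preserves the
    space of the functions [g] such that [f g] is orthogonal to the basis. *)
Definition annihilates f g := [/\ measurable_fun [set: R] g,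
  exists M : R, forall x, `|g x| <= M &
  forall k, I L (fun x => f x * g x * cos (phase L k x)) = 0 /\
            I L (fun x => f x * g x * sin (phase L k x)) = 0].

Lemma annihilates_lin f g h (a b : R) : CI L f -> annihilates f g ->
  annihilates f h -> annihilates f (fun x => a * g x + b * h x).
Proof.
move=> cf [mg [M1 gM] Hg] [mh [M2 hM] Hh]; split.
- by apply: measurable_funD; exact: measurable_funM.
- exists (`|a| * M1 + `|b| * M2) => x; apply: le_trans (ler_normD _ _) _.
  by rewrite !normrM lerD// ler_wpM2l.
have cg := CI_mul_bounded cf mg gM; have ch := CI_mul_bounded cf mh hM.
move=> k; split.
- have cgc := CI_mul_bounded cg (measurable_cos_phase k) (fun x => cos_max _).
  have chc := CI_mul_bounded ch (measurable_cos_phase k) (fun x => cos_max _).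
  rewrite (@int_ext _ _ _ (fun x => a * (f x * g x * cos (phase L k x))
     + b * (f x * h x * cos (phase L k x)))); last by move=> x; ring.
  by rewrite intD ?intZ ?(Hg k).1 ?(Hh k).1 ?mulr0 ?addr0//; exact: CIZ.
- have cgc := CI_mul_bounded cg (measurable_sin_phase k) (fun x => sin_max _).
  have chc := CI_mul_bounded ch (measurable_sin_phase k) (fun x => sin_max _).
  rewrite (@int_ext _ _ _ (fun x => a * (f x * g x * sin (phase L k x))
     + b * (f x * h x * sin (phase L k x)))); last by move=> x; ring.
  by rewrite intD ?intZ ?(Hg k).2 ?(Hh k).2 ?mulr0 ?addr0//; exact: CIZ.
Qed.

Lemma annihilates_cos f g : CI L f -> annihilates f g ->
  annihilates f (fun x => g x * cos (phase L 1 x)).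
Proof.
move=> cf [mg [M gM] Hg]; split.
- by apply: measurable_funM => //; exact: measurable_cos_phase.
- by exists M => x; rewrite normrM -[M]mulr1 ler_pM//; exact: cos_max.
have cg := CI_mul_bounded cf mg gM.
have cgc k := CI_mul_bounded cg (measurable_cos_phase k) (fun x => cos_max _).
have cgs k := CI_mul_bounded cg (measurable_sin_phase k) (fun x => sin_max _).
move=> k; split.
- rewrite (@int_ext _ _ _ (fun x =>
     2^-1 * (f x * g x * cos (phase L (k + 1) x))
     + 2^-1 * (f x * g x * cos (phase L (k - 1) x)))); last first.
    by move=> x; rewrite phaseBk phaseDk cosB cosD; field.
  by rewrite intD ?intZ ?(Hg _).1 ?mulr0 ?addr0//; exact: CIZ.
- rewrite (@int_ext _ _ _ (fun x =>
     2^-1 * (f x * g x * sin (phase L (k + 1) x))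
     + 2^-1 * (f x * g x * sin (phase L (k - 1) x)))); last first.
    by move=> x; rewrite phaseBk phaseDk sinD sinB; field.
  by rewrite intD ?intZ ?(Hg _).2 ?mulr0 ?addr0//; exact: CIZ.
Qed.

Lemma annihilates_sin f g : CI L f -> annihilates f g ->
  annihilates f (fun x => g x * sin (phase L 1 x)).
Proof.
move=> cf [mg [M gM] Hg]; split.
- by apply: measurable_funM => //; exact: measurable_sin_phase.
- by exists M => x; rewrite normrM -[M]mulr1 ler_pM//; exact: sin_max.
have cg := CI_mul_bounded cf mg gM.
have cgc k := CI_mul_bounded cg (measurable_cos_phase k) (fun x => cos_max _).
have cgs k := CI_mul_bounded cg (measurable_sin_phase k) (fun x => sin_max _).
move=> k; split.
- rewrite (@int_ext _ _ _ (fun x =>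
     2^-1 * (f x * g x * sin (phase L (k + 1) x))
     + (- 2^-1) * (f x * g x * sin (phase L (k - 1) x)))); last first.
    by move=> x; rewrite phaseBk phaseDk sinD sinB; field.
  by rewrite intD ?intZ ?(Hg _).2 ?mulr0 ?addr0//; exact: CIZ.
- rewrite (@int_ext _ _ _ (fun x =>
     2^-1 * (f x * g x * cos (phase L (k - 1) x))
     + (- 2^-1) * (f x * g x * cos (phase L (k + 1) x)))); last first.
    by move=> x; rewrite phaseBk phaseDk cosB cosD; field.
  by rewrite intD ?intZ ?(Hg _).1 ?mulr0 ?addr0//; exact: CIZ.
Qed.

Lemma annihilates_affine f g (a b c : R) : CI L f -> annihilates f g ->
  annihilates f
    (fun x => g x * (a * cos (phase L 1 x) + b * sin (phase L 1 x) + c)).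
Proof.
move=> cf ag.
have := annihilates_lin 1 c cf (annihilates_lin a b cf (annihilates_cos cf ag)
  (annihilates_sin cf ag)) ag.
by congr annihilates; apply/funext => x; ring.
Qed.

Lemma annihilates_pow f g q (m : nat) : CI L f ->
  (forall h, annihilates f h -> annihilates f (fun x => h x * q x)) ->
  annihilates f g -> annihilates f (fun x => g x * q x ^+ m).
Proof.
move=> cf Hq ag; elim: m => [|m IH].
  by move: ag; congr annihilates; apply/funext => x; rewrite expr0 mulr1.
by move: (Hq _ IH); congr annihilates; apply/funext => x; rewrite exprSr mulrA.
Qed.

Lemma annihilates1 f : CI L f -> (forall k, I L (fun x => f x * cas L k x) = 0) ->
  annihilates f (fun=> 1).
Proof.
move=> cf Hf; split; [exact: measurable_cst|by exists 1 => x; rewrite normr1|].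
move=> k; have cc k' := CI_mul_bounded cf (measurable_cos_phase k') (fun x => cos_max _).
have cs k' := CI_mul_bounded cf (measurable_sin_phase k') (fun x => sin_max _).
under eq_Rintegral do rewrite mulr1.
under [X in _ /\ X = _]eq_Rintegral do rewrite mulr1.
have := Hf k; have := Hf (- k).
under eq_Rintegral do rewrite /cas phaseN cosN sinN mulrBr.
under [X in _ -> X = _ -> _]eq_Rintegral do rewrite /cas mulrDr.
by rewrite intB// intD//; lra.
Qed.

Lemma int_arc f (a : R) : 0 < a < L -> CI L f ->
  (forall k, I L (fun x => f x * cas L k x) = 0) ->
  \int[mu]_(x in `[0, a]) f x = 0.
Proof.
move=> /andP[a0 aL] cf Hf.
pose t x : R := sin (pi * x / L) * sin (pi * (a - x) / L).
pose q x : R := 2^-1 - t x / 4.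
have qE x : q x = - 8^-1 * cos (pi * a / L) * cos (phase L 1 x)
    + (- 8^-1 * sin (pi * a / L)) * sin (phase L 1 x)
    + (2^-1 + 8^-1 * cos (pi * a / L)).
  rewrite /q /t -!mulrA; set A := pi * (a / L); set X := pi * (x / L).
  have -> : phase L 1 x = X + X by rewrite /phase /X; field.
  have -> : pi * ((a - x) / L) = A - X by rewrite /A /X; field.
  have H := cos2Dsin2 X; rewrite sinB cosD sinD.
  rewrite (_ : cos X * cos X = 1 - sin X ^+ 2); last by rewrite -H; ring.
  by field.
have q01 x : 0 <= q x <= 1.
  have : `|t x| <= 1 by rewrite normrM -[leRHS]mulr1 ler_pM//; exact: sin_max.
  by rewrite ler_norml /q => /andP[? ?]; apply/andP; split; lra.
have mq : measurable_fun [set: R] q.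
  rewrite (funext qE); apply: measurable_funD => //; apply: measurable_funD.
    by apply: measurable_funM => //; exact: measurable_cos_phase.
  by apply: measurable_funM => //; exact: measurable_sin_phase.
pose h (n : nat) x := (1 - q x ^+ n) ^+ (n * 2 ^ n).
have mh n : measurable_fun [set: R] (h n).
  apply: measurable_funX; apply: measurable_funB => //; exact: measurable_funX.
have h01 n x : 0 <= h n x <= 1.
  have /andP[q0 q1] := q01 x.
  by rewrite /h exprn_ge0 ?exprn_ile1// ?subr_ge0 ?exprn_ile1// gerBl exprn_ge0.
have hq g : annihilates f g -> annihilates f (fun x => g x * q x).
  move=> ag; have := annihilates_affine (- 8^-1 * cos (pi * a / L))
    (- 8^-1 * sin (pi * a / L)) (2^-1 + 8^-1 * cos (pi * a / L)) cf ag.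
  by congr annihilates; apply/funext => x; rewrite qE.
have hqn n g : annihilates f g -> annihilates f (fun x => g x * (1 - q x ^+ n)).
  move=> ag; have := annihilates_lin 1 (-1) cf ag (annihilates_pow n cf hq ag).
  by congr annihilates; apply/funext => x; ring.
have fh n : I L (fun x => f x * h n x) = 0.
  have [_ _ H] := annihilates_pow (n * 2 ^ n) cf (hqn n) (annihilates1 cf Hf).
  rewrite -[RHS](H 0).1; apply: int_ext => x.
  by rewrite phase0 cos0 mulr1 mul1r.
pose S x := (q x < 2^-1)%R%:R : R.
have mS : measurable_fun [set: R] S.
  have -> : S = (fun x => if q x < 2^-1 then 1 else 0).
    by apply/funext => x; rewrite /S; case: ifP.
  apply: measurable_fun_ifT => //.
  by apply: measurable_fun_ltr => //.
have cvg : (fun n => I L (fun x => f x * h n x)) @ \oo --> I L (fun x => f x * S x).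
  apply: (@int_dominated_cvg _ _ _ _ (fun x => `|f x|)).
  - by move=> n; apply: measurable_funM => //; case: cf.
  - by apply: measurable_funM => //; case: cf.
  - apply: aeW => x; apply: cvgM; first exact: cvg_cst.
    exact: power_threshold.
  - exact: CI_norm.
  - move=> n x; have /andP[? ?] := h01 n x.
    by rewrite normrM -[leRHS]mulr1 ler_wpM2l// ger0_norm.
have : I L (fun x => f x * S x) = 0.
  move: cvg; rewrite (_ : (fun n => _) = fun=> 0); last exact/funext.
  by move=> /(cvg_lim (@Rhausdorff _)) <-; rewrite lim_cst.
(* [q x < 1/2] singles out the points of the period strictly between [0] and [a] *)
have Sx x : 0 < x < L -> S x = (x < a)%R%:R.
  move=> /andP[x0 xL]; rewrite /S /q; congr (_%:R); congr nat_of_bool.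
  have s1 : 0 < sin (pi * x / L).
    apply: sin_gt0_pi; rewrite divr_gt0 ?mulr_gt0 ?pi_gt0//=.
    by rewrite ltr_pdivrMr// ltr_pM2l ?pi_gt0.
  have -> : (2^-1 - t x / 4 < 2^-1) = (0 < t x).
    by rewrite gtrDl oppr_lt0 pmulr_lgt0.
  rewrite /t pmulr_rgt0//; case: (ltgtP x a) => xa.
  - apply: sin_gt0_pi; rewrite divr_gt0 ?mulr_gt0 ?pi_gt0 ?subr_gt0//=.
    by rewrite ltr_pdivrMr// ltr_pM2l ?pi_gt0//; lra.
  - apply/negbTE; rewrite -leNgt -oppr_ge0 -sinN ltW// -mulNr -mulrN opprB.
    apply: sin_gt0_pi; rewrite divr_gt0 ?mulr_gt0 ?pi_gt0 ?subr_gt0//=.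
    by rewrite ltr_pdivrMr// ltr_pM2l ?pi_gt0//; lra.
  - by rewrite xa subrr mulr0 mul0r sin0 ltxx.
move=> H0.
have cfS : CI L (fun x => f x * S x).
  apply: (CI_mul_bounded cf mS (M := 1)) => x.
  by rewrite /S; case: (_ < _); rewrite ?normr1 ?normr0.
have mf := cf.1.
have -> : `[0, a]%classic = `[0, L] `&` `[0, a].
  apply/seteqP; split=> x /=; rewrite !in_itv/=; last by case.
  by move=> /andP[x0 xa]; rewrite x0 xa/= (le_trans xa)// ltW.
rewrite Rintegral_mkcondr -[RHS]H0 /Rintegral; congr fine.
apply: ae_eq_integral => //.
- apply/measurable_EFinP; apply: (measurable_funS (E := [set: R])) => //.
  by apply/(measurable_restrictT _ (mper a)); exact: measurable_funS mf.
- by apply/measurable_EFinP; exact: measurable_funS cfS.1.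
apply: aeS (aeI (ae_neq 0) (aeI (ae_neq a) (ae_neq L))).
move=> x [x0 [xa xL]]; rewrite /= in_itv/= => /andP[x0' xL'].
have x0L : 0 < x < L by rewrite !lt_neqAle x0' xL' xL eq_sym x0.
rewrite Sx// /patch mem_setE in_itv/= x0' le_eqVlt (negbTE xa)/=.
by case: ifP; rewrite ?mulr1 ?mulr0.
Qed.

(** An integrable periodic function with vanishing coefficients has vanishing
    integrals over arcs, hence vanishes at its Lebesgue points. *)
Lemma hartley_total f : periodic f L -> CI L f ->
  (forall k, I L (fun x => f x * cas L k x) = 0) ->
  {ae mu, forall x, f x = 0}.
Proof.
move=> pf cf Hf; have [mf If] := cf.
apply: (ae_periodic L0) => [x|x|]; rewrite ?pf//.
pose g := f \_ `[0, L].
have mg : measurable_fun [set: R] g.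
  by apply/(measurable_restrictT _ (mper L)); exact: measurable_funS mf.
have Ig : mu.-integrable [set: R] (EFin \o g).
  rewrite -restrict_EFin; apply/integrable_restrict => //.
  by rewrite setTI.
have gI y : mu.-integrable `]0, y] (EFin \o g).
  by apply: integrableS Ig.
have := FTC1 (a := BRight 0) gI (open_integrable_locally openT Ig).
move=> H; apply: aeS (aeI H (aeI (ae_neq 0) (ae_neq L))).
move=> x [Hx [x0 xL]]; rewrite /= in_itv/= => /andP[x0' xL'].
have x0p : 0 < x by rewrite lt_neqAle x0' eq_sym x0.
have xLp : x < L by rewrite lt_neqAle xL' xL.
have [|_] := Hx; first exact: x0p.
have -> : g x = f x by rewrite /g patchE mem_setE in_itv/= x0' xL'.
move=> <-.
rewrite derive1E (near_eq_derive (g := cst 0)) ?derive_cst// ?oner_eq0//.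
near=> y.
have y0 : 0 < y by near: y; exact: lt_nbhsr.
have yL : y < L by near: y; exact: lt_nbhsl.
have -> : \int[mu]_(t in `]0, y]) g t = \int[mu]_(t in `[0, y]) f t.
  rewrite -Rintegral_itv_obnd_cbnd; last first.
    apply: integrableS If => // z /=; rewrite !in_itv/= => /andP[z0 zy].
    by rewrite (ltW z0) (le_trans zy)// ltW.
  apply: eq_Rintegral => z; rewrite inE/= in_itv/= => /andP[z0 zy].
  by rewrite /g patchE mem_setE in_itv/= (ltW z0) (le_trans zy)// ltW.
by rewrite int_arc// y0.
Unshelve. all: by end_near. Qed.

End Period.
End Hartley.

(** * Completeness of the square-integrable periodic functions *)

Section RieszFischer.
Context {R : realType}.
Notation mu := (@lebesgue_measure R).
Local Notation I L f := (\int[mu]_(x in `[0, L]) f x).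
Implicit Types (f g : R -> R).

Definition L2s (L : R) f := [/\ periodic f L, measurable_fun [set: R] f &
  mu.-integrable `[0, L] (fun x => (f x ^+ 2)%:E)].

Section Fixed.
Context {L : R} (L0 : 0 < L).

Lemma L2s_CI_sq f : L2s L f -> CI L (fun x => f x ^+ 2).
Proof. by move=> [_ mf If]; split=> //; exact: measurable_funX. Qed.

Lemma L2s_CI_mul f g : L2s L f -> L2s L g -> CI L (fun x => f x * g x).
Proof.
move=> lf lg; apply: (@CI_dom _ _ _ (fun x => f x ^+ 2 + g x ^+ 2)).
- by case: lf => _ mf _; case: lg => _ mg _; exact: measurable_funM.
- by apply: CID; exact: L2s_CI_sq.
- move=> x; rewrite ler_norml.
  by have := sqr_ge0 (f x + g x); have := sqr_ge0 (f x - g x);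
    have := sqr_ge0 (f x); have := sqr_ge0 (g x); rewrite !expr2; lra.
Qed.

Lemma L2s_bounded f (M : R) : periodic f L -> measurable_fun [set: R] f ->
  (forall x, `|f x| <= M) -> L2s L f.
Proof.
move=> pf mf fM; split=> //.
have mf2 : measurable_fun [set: R] (fun x => f x ^+ 2) by exact: measurable_funX.
apply: (@CI_bounded _ L _ (M ^+ 2) mf2 _).2 => x.
by rewrite normrX ler_pXn2r ?nnegrE// (le_trans _ (fM x)).
Qed.

Lemma L2s_lin f g (a : R) : L2s L f -> L2s L g -> L2s L (fun x => a * f x + g x).
Proof.
move=> lf lg; have [pf mf _] := lf; have [pg mg _] := lg.
have m : measurable_fun [set: R] (fun x => a * f x + g x).
  by apply: measurable_funD => //; exact: measurable_funM.
split=> //; first by move=> x; rewrite pf pg.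
apply: (CI_dom (g := fun x => 2 * a ^+ 2 * f x ^+ 2 + 2 * g x ^+ 2) _ _ _).2.
- exact: measurable_funX.
- by apply: CID; apply: CIZ; exact: L2s_CI_sq.
- move=> x; rewrite ger0_norm ?sqr_ge0//.
  by have := sqr_ge0 (a * f x - g x); rewrite !expr2; lra.
Qed.

Lemma L2s_cas k : L2s L (cas L k).
Proof.
apply: (@L2s_bounded _ 2); [exact: cas_periodic|exact: measurable_cas|].
exact: cas_bounded.
Qed.

Lemma L2s_CI f : L2s L f -> CI L f.
Proof.
move=> lf; have [_ mf _] := lf; apply: (CI_dom mf (CID (CI_cst L 1) (L2s_CI_sq lf))).
move=> x; rewrite ler_norml.
by have := sqr_ge0 (f x - 1); have := sqr_ge0 (f x + 1); rewrite !expr2; lra.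
Qed.

Lemma L2s_shift f (y : R) : L2s L f -> L2s L (fun x => f (x + y)).
Proof.
move=> lf; have [pf mf If] := lf; split.
- by move=> x; rewrite addrAC pf.
- exact: measurable_fun_shift.
- apply: (CI_shift y L0 (f := fun x => f x ^+ 2) _ (L2s_CI_sq lf)).2.
  by move=> x; rewrite pf.
Qed.

Lemma L2s_complete (v_ : nat -> R -> R) : (forall n, L2s L (v_ n)) ->
  (forall e : R, 0 < e -> exists N, forall n m, (N <= n)%N -> (N <= m)%N ->
     I L (fun x => (v_ n x - v_ m x) ^+ 2) < e) ->
  exists2 v, L2s L v & forall e : R, 0 < e -> exists N, forall n, (N <= n)%N ->
     I L (fun x => (v_ n x - v x) ^+ 2) < e.
Proof.
move=> lv cau.
have lvB n m : L2s L (fun x => v_ n x - v_ m x).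
  by have := L2s_lin (-1) (lv m) (lv n); congr L2s; apply/funext => x; ring.
(* a subsequence whose increments are summable *)
have /choice[M HM] : forall j : nat, exists N, forall n m, (N <= n)%N -> (N <= m)%N ->
    I L (fun x => (v_ n x - v_ m x) ^+ 2) < 4^-1 ^+ j.
  by move=> j; apply: cau; rewrite exprn_gt0// invr_gt0.
pose N j := (j + \sum_(i < j.+1) M i)%N.
have MN i j : (i <= j)%N -> (M i <= N j)%N.
  move=> ij; rewrite /N (bigD1 (Ordinal (ij : (i < j.+1)%N)))//=.
  by rewrite addnCA leq_addr.
pose w j := v_ (N j).
have wB j : I L (fun x => `|w j.+1 x - w j x|) <= (L + 1) * 2^-1 ^+ j.
  have h0 : 0 < 2^-1 ^+ j :> R by rewrite exprn_gt0// invr_gt0.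
  have H : I L (fun x => (w j.+1 x - w j x) ^+ 2) <= 2^-1 ^+ j * 2^-1 ^+ j.
    rewrite -exprMn (_ : 2^-1 * 2^-1 = 4^-1); last by field.
    by apply/ltW/HM; exact: MN.
  have cs := CIZ (2^-1 ^+ j)^-1 (L2s_CI_sq (lvB (N j.+1) (N j))).
  apply: (@le_trans _ _ (I L (fun x => 2^-1 ^+ j + (2^-1 ^+ j)^-1 * (w j.+1 x - w j x) ^+ 2))).
    apply: int_le.
    - exact/CI_norm/L2s_CI/lvB.
    - by apply: CID; [exact: CI_cst|exact: cs].
    - move=> x; set z := w j.+1 x - w j x; set h := 2^-1 ^+ j in h0 *.
      have : 0 <= h^-1 * (h - `|z|) ^+ 2.
        by rewrite mulr_ge0 ?sqr_ge0// invr_ge0 ltW.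
      rewrite sqrrB mulrDr mulrBr -[h ^+ 2]/(h * h) mulKf ?gt_eqF//.
      rewrite real_normK ?num_real//.
      rewrite (_ : h^-1 * (h * `|z| *+ 2) = 2 * `|z|); last by field; rewrite gt_eqF.
      by have := normr_ge0 z; lra.
  rewrite intD; [|exact: CI_cst|exact: cs].
  rewrite int_cst// intZ; last exact: L2s_CI_sq (lvB _ _).
  rewrite mulrDl mul1r mulrC lerD2l.
  by rewrite ler_pdivrMl.
have wBe j : (\int[mu]_(x in `[0%R, L]) `|w j.+1 x - w j x|%:E
    <= ((L + 1) * 2^-1 ^+ j)%:E)%E.
  have ci := CI_norm (L2s_CI (lvB (N j.+1) (N j))).
  have := wB j; rewrite -lee_fin /Rintegral fineK//.
  exact: integrable_fin_num ci.2.
have mB j : measurable_fun (`[0, L]%classic : set (measurableTypeR R))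
    (fun x : R => `|w j.+1 x - w j x|%:E).
  apply/measurable_EFinP; apply: (measurable_funS (E := [set: R])) => //.
  exact: (CI_norm (L2s_CI (lvB (N j.+1) (N j)))).1.
have sumfin : (\int[mu]_(x in `[0%R, L]) (\sum_(j <oo) `|w j.+1 x - w j x|%:E) < +oo)%E.
  rewrite integral_nneseries//.
  apply: (@le_lt_trans _ _ (\sum_(j <oo) ((L + 1) * 2^-1 ^+ j)%:E)%E).
    by apply: lee_nneseries => j *; [exact: integral_ge0|exact: wBe].
  apply: (@le_lt_trans _ _ ((L + 1) * 2)%:E); last exact: ltry.
  apply: lime_le; first by apply: is_cvg_nneseries => j _ _; rewrite lee_fin mulr_ge0// addr_ge0// ltW.
  apply: nearW => n; rewrite sumEFin lee_fin -mulr_sumr ler_wpM2l ?(addr_ge0 (ltW L0))//.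
  suff -> : \sum_(0 <= j < n) 2^-1 ^+ j = 2 - 2 * 2^-1 ^+ n :> R.
    by rewrite gerBl mulr_ge0// exprn_ge0.
  elim: n => [|n IH]; first by rewrite big_nil expr0; ring.
  by rewrite big_nat_recr//= IH exprS; field.
have cvw : {ae mu, forall x, cvgn (fun j => w j x)}.
  have pw j x : w j (x + L) = w j x by have [p _ _] := lv (N j); rewrite /w p.
  apply: (ae_periodic L0) => [x|x|].
  - by under eq_fun do rewrite -pw.
  - by under eq_fun do rewrite pw.
  have Is : mu.-integrable `[0, L] (fun x => \sum_(j <oo) `|w j.+1 x - w j x|%:E)%E.
    apply/integrableP; split.
      by apply: ge0_emeasurable_sum => // j x _ _; exact: mB.
    apply: le_lt_trans sumfin; apply: ge0_le_integral => //.
    - by apply: measurableT_comp => //; apply: ge0_emeasurable_sum => // j x _ _; exact: mB.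
    - by apply: ge0_emeasurable_sum => // j x _ _; exact: mB.
    - by move=> x _; rewrite gee0_abs//; exact: nneseries_ge0.
  apply: aeS (integrable_ae (mper L) Is) => x /[apply] fx.
  have cn : cvgn [normed series (telescope (w ^~ x))].
    apply: nondecreasing_is_cvgn.
      by apply: nondecreasing_series => j _ _; exact: normr_ge0.
    exists (fine (\sum_(j <oo) `|w j.+1 x - w j x|%:E)%E) => _ [n _ <-].
    rewrite -lee_fin fineK// /series/= -sumEFin.
    exact: nneseries_lim_ge.
  rewrite (_ : (fun j => w j x) = cst (w 0 x) + series (telescope (w ^~ x))).
    by apply: is_cvgD; [exact: is_cvg_cst|exact: normed_cvg].
  by apply/funext => j; exact: eq_sum_telescope.
pose v x : R := fine (limn_esup (fun j => (w j x)%:E)).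
have mw j : measurable_fun [set: R] (w j) by case: (lv (N j)).
have mv : measurable_fun [set: R] v.
  apply: measurableT_comp => //; apply: measurable_fun_limn_esup => j.
  exact/measurable_EFinP.
have pv : periodic v L.
  move=> x; rewrite /v; congr (fine (limn_esup _)); apply/funext => j.
  by have [p _ _] := lv (N j); rewrite /w p.
have wv : {ae mu, forall x, (fun j => w j x) @ \oo --> v x}.
  apply: aeS cvw => x cx; rewrite /v.
  have cE : (fun j => (w j x)%:E) @ \oo --> (limn (w ^~ x))%:E.
    by apply/fine_cvgP; split; [exact: nearW|exact: cx].
  by rewrite (cvg_limn_einf_sup cE).2.
(* Fatou's lemma transfers the Cauchy estimates to the limit *)
have key n (e : R) (J : nat) : (forall j, (J <= j)%N -> I L (fun x => (v_ n x - w j x) ^+ 2) <= e) ->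
    (\int[mu]_(x in `[0%R, L]) ((v_ n x - v x) ^+ 2)%:E <= e%:E)%E.
  move=> He; have mvn : measurable_fun [set: R] (v_ n) by case: (lv n).
  pose F j x := ((v_ n x - w j x) ^+ 2)%:E.
  have mF j : measurable_fun (`[0, L]%classic : set (measurableTypeR R)) (F j).
    apply/measurable_EFinP; apply: (measurable_funS (E := [set: R])) => //.
    by apply: measurable_funX; exact: measurable_funB.
  have F0 j x : `[0, L]%classic x -> (0 <= F j x)%E by rewrite lee_fin sqr_ge0.
  have := fatou mu (mper L) mF F0.
  have -> : (\int[mu]_(x in `[0%R, L]) limn_einf (F ^~ x) =
    \int[mu]_(x in `[0%R, L]) ((v_ n x - v x) ^+ 2)%:E)%E.
    apply: ae_eq_integral => //.
    - rewrite /limn_einf; apply: measurableT_comp => //.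
      apply: (@measurable_fun_limn_esup _ _ _ _ (fun j x => - F j x)%E) => j.
      by apply: measurableT_comp => //; exact: mF.
    - apply/measurable_EFinP; apply: (measurable_funS (E := [set: R])) => //.
      by apply: measurable_funX; exact: measurable_funB.
    apply: aeS wv => x wx _.
    have cE : F ^~ x @ \oo --> ((v_ n x - v x) ^+ 2)%:E.
      apply/fine_cvgP; split; first exact: nearW.
      rewrite /F/= expr2; under eq_fun do rewrite expr2.
      by apply: cvgM; apply: cvgB => //; exact: cvg_cst.
    by rewrite (cvg_limn_einf_sup cE).1.
  move=> /le_trans; apply; rewrite limn_einf_lim.
  apply: lime_le; first exact: is_cvg_einfs.
  exists J => // j /= Jj; apply: (@le_trans _ _ (\int[mu]_(x in `[0%R, L]) F j x)%E).
    by apply: ereal_inf_lbound; exists j => /=.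
  have ci := L2s_CI_sq (lvB n (N j)).
  have := He j Jj; rewrite -lee_fin /Rintegral fineK//.
  exact: integrable_fin_num ci.2.
have small e : 0 < e -> exists n, forall m, (n <= m)%N -> exists J, forall j, (J <= j)%N ->
    I L (fun x => (v_ m x - w j x) ^+ 2) <= e.
  move=> e0; have [n Hn] := cau e e0; exists n => m nm; exists n => j nj.
  apply: ltW; apply: Hn => //; apply: leq_trans nj _.
  exact: leq_addr.
have lv' : L2s L v.
  have [n Hn] := small 1 ltr01; have [J HJ] := Hn n (leqnn n).
  suff lvv : L2s L (fun x => v_ n x - v x).
    by have := L2s_lin (-1) lvv (lv n); congr L2s; apply/funext => x; ring.
  have [pn mn _] := lv n; split.
  - by move=> x; rewrite pn pv.
  - exact: measurable_funB.
  - apply/integrableP; split.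
      apply/measurable_EFinP; apply: (measurable_funS (E := [set: R])) => //.
      by apply: measurable_funX; exact: measurable_funB.
    apply: (@le_lt_trans _ _ 1%:E); last exact: ltry.
    apply: le_trans (key n _ J HJ); rewrite le_eqVlt; apply/orP; left; apply/eqP.
    by apply: eq_integral => x _; rewrite gee0_abs// lee_fin sqr_ge0.
have lvv n : L2s L (fun x => v_ n x - v x).
  by have := L2s_lin (-1) lv' (lv n); congr L2s; apply/funext => x; ring.
exists v => // e e0; have [n Hn] := small (e / 2) (divr_gt0 e0 (ltr0n _ 2)).
exists n => m nm; have [J HJ] := Hn m nm; have := key m _ J HJ.
have ci := L2s_CI_sq (lvv m) => H.
have : I L (fun x => (v_ m x - v x) ^+ 2) <= e / 2.
  rewrite -lee_fin /Rintegral fineK//.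
  exact: integrable_fin_num ci.2.
by lra.
Qed.
End Fixed.
End RieszFischer.

(** * Hartley coefficients of vector-valued functions *)

Section VectorL2.
Context {R : realType}.
Notation mu := (@lebesgue_measure R).
Local Notation I L f := (\int[mu]_(x in `[0, L]) f x).
Implicit Types (u v w : R -> 'cV[R]_2).

Lemma sum2 (F : 'I_2 -> R) : \sum_i F i = F 0 + F 1.
Proof. by rewrite big_ord_recl big_ord1; congr (_ + F _); apply/val_inj. Qed.

Lemma dotC (a b : 'cV[R]_2) : dot a b = dot b a.
Proof. by apply: eq_bigr => i _; rewrite mulrC. Qed.

Lemma dot_lin (k : R) (a b d : 'cV[R]_2) : dot (k *: a + b) d = k * dot a d + dot b d.
Proof.
by rewrite /dot mulr_sumr -big_split; apply: eq_bigr => i _; rewrite !mxE mulrDl mulrA.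
Qed.

Lemma dot_bilin : bilin (fun=> True) (@dot R).
Proof. by split=> [*|*]; [exact: dotC|exact: dot_lin]. Qed.

Lemma dot_ge0 (a : 'cV[R]_2) : 0 <= dot a a.
Proof. by apply: sumr_ge0 => i _; rewrite -expr2 sqr_ge0. Qed.

Lemma dot0l (a : 'cV[R]_2) : dot 0 a = 0.
Proof. by rewrite /dot big1// => i _; rewrite mxE mul0r. Qed.

Lemma dot_eq0 (a : 'cV[R]_2) : dot a a = 0 -> a = 0.
Proof.
move=> /eqP; rewrite psumr_eq0 => [|i _]; last by rewrite -expr2 sqr_ge0.
move=> /allP H; apply/matrixP => i j; rewrite ord1 mxE.
by have := H i (mem_index_enum _); rewrite -expr2 sqrf_eq0 => /eqP.
Qed.

Lemma coord_sq_le (a : 'cV[R]_2) i : a i 0 ^+ 2 <= dot a a.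
Proof.
rewrite /dot (bigD1 i)//= -expr2 lerDl; apply: sumr_ge0 => j _.
by rewrite -expr2 sqr_ge0.
Qed.

Lemma dot_le (a b : 'cV[R]_2) : 2 * `|dot a b| <= dot a a + dot b b.
Proof.
have h (e : R) : e ^+ 2 = 1 -> 2 * (e * dot a b) <= dot a a + dot b b.
  move=> e1; have := dot_ge0 (e *: a - b).
  rewrite (bilin_sqB (P := fun=> True) _ dot_bilin)//.
  rewrite (bilin_sqZ (P := fun=> True) _ dot_bilin)// e1.
  by rewrite (bilinZl (P := fun=> True) _ dot_bilin)//; lra.
have := h 1 ltac:(by rewrite expr1n); have := h (-1) ltac:(by rewrite sqrrN expr1n).
by case: (ler0P (dot a b)) => _; lra.
Qed.

Lemma trueS : subspace (fun _ : 'cV[R]_2 => True).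
Proof. by []. Qed.

Section Fixed.
Context {L : R} (L0 : 0 < L).

Lemma L2perP u : L2per L u <-> forall i, L2s L (component u i).
Proof.
split=> [[pu mu'] i|H].
  by have [mi Ii] := mu' i; split=> // x; rewrite /component pu.
split=> [x|i]; last by have [_ ? ?] := H i.
by apply/matrixP => i j; rewrite ord1; have [p _ _] := H i; exact: p.
Qed.

Lemma componentE (a : R) u v i :
  component (a *: u + v) i = (fun x => a * component u i x + component v i x).
Proof. by apply/funext => x; rewrite /component /= !mxE. Qed.

Lemma L2per_subspace : subspace (L2per L).
Proof.
split=> [|a u v /L2perP lu /L2perP lv]; apply/L2perP => i.
  have -> : component (0 : R -> 'cV[R]_2) i = (fun=> 0).
    by apply/funext => x; rewrite /component mxE.
  by apply: (@L2s_bounded _ _ _ 0) => // x; rewrite normr0.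
by rewrite componentE; exact: L2s_lin.
Qed.

Lemma CI_dot u v : L2per L u -> L2per L v -> CI L (fun x => dot (u x) (v x)).
Proof.
by move=> /L2perP lu /L2perP lv; apply: CI_sum => i; exact: (L2s_CI_mul (lu i) (lv i)).
Qed.

Lemma L2dotE u v : L2per L u -> L2per L v ->
  L2dot L u v = \sum_i I L (fun x => component u i x * component v i x).
Proof.
move=> /L2perP lu /L2perP lv; rewrite /L2dot /dot int_sum// => i.
exact: (L2s_CI_mul (lu i) (lv i)).
Qed.

Lemma L2dot_bilin : bilin (L2per L) (L2dot L).
Proof.
split=> [u v _ _|a u v w lu lv lw].
  by apply: int_ext => x; exact: dotC.
have cu := CI_dot lu lw; have cv := CI_dot lv lw.
rewrite /L2dot -intZ// -intD//; last exact: CIZ.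
by apply: int_ext => x; rewrite dot_lin.
Qed.

Lemma L2dot_psd : psd (L2per L) (L2dot L).
Proof. by move=> u _; apply: int_ge0 => x; exact: dot_ge0. Qed.

Lemma L2dot_complete : form_complete (L2per L) (L2dot L).
Proof.
move=> v_ lv cau; have lvi n i := (L2perP (v_ n)).1 (lv n) i.
have le n m i : I L (fun x => (component (v_ n) i x - component (v_ m) i x) ^+ 2)
    <= L2dot L (v_ n - v_ m) (v_ n - v_ m).
  have lB := subspaceB L2per_subspace (lv n) (lv m).
  apply: int_le; last 1 first.
  - by move=> x; apply: le_trans (coord_sq_le _ i); rewrite /component/= !mxE.
  - have := L2s_CI_sq (L2s_lin (-1) (lvi m i) (lvi n i)).
    by congr CI; apply/funext => x; congr (_ ^+ 2); ring.
  - exact: CI_dot.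
have cv i : exists2 f, L2s L f & forall e : R, 0 < e -> exists N, forall n, (N <= n)%N ->
     I L (fun x => (component (v_ n) i x - f x) ^+ 2) < e.
  apply: (L2s_complete L0 (fun n => lvi n i)) => e e0.
  have [N HN] := cau e e0; exists N => n m Nn Nm.
  exact: le_lt_trans (le n m i) (HN n m Nn Nm).
have [f0 l0 H0] := cv 0; have [f1 l1 H1] := cv 1.
pose u x : 'cV[R]_2 := \col_i (if i == 0 then f0 x else f1 x).
have cu i : component u i = if i == 0 then f0 else f1.
  by apply/funext => x; rewrite /component mxE; case: ifP.
have lu : L2per L u by apply/L2perP => i; rewrite cu; case: ifP.
exists u => // e e0; have e2 : 0 < e / 2 by rewrite divr_gt0.
have [N0 HN0] := H0 _ e2; have [N1 HN1] := H1 _ e2.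
exists (maxn N0 N1) => n; rewrite geq_max => /andP[n0 n1].
have lB := subspaceB L2per_subspace (lv n) lu.
rewrite L2dotE// sum2.
have E i : I L (fun x => component (v_ n - u) i x * component (v_ n - u) i x) =
    I L (fun x => (component (v_ n) i x - component u i x) ^+ 2).
  by apply: int_ext => x; rewrite /component/= !mxE expr2.
by rewrite !E !cu/=; have := HN0 n n0; have := HN1 n n1; lra.
Qed.

Lemma L2dot_eq0 u : L2per L u -> L2dot L u u = 0 -> ae_equal u (fun=> 0).
Proof.
move=> lu u0; have [pu _] := lu.
have pd : periodic (fun x => dot (u x) (u x)) L by move=> x; rewrite pu.
apply: aeS (int_ae_eq0 L0 pd (CI_dot lu lu) (fun x => dot_ge0 _) u0) => x.
exact: dot_eq0.
Qed.

Definition zint (n : nat) : int := if odd n then - (n./2.+1)%:Z else (n./2)%:Z.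

Definition hcoef u (n : nat) : 'cV[R]_2 :=
  \col_i (L^-1 * I L (fun x => component u i x * cas L (zint n) x)).

Lemma hcoef_lin (a : R) u v n : L2per L u -> L2per L v ->
  hcoef (a *: u + v) n = a *: hcoef u n + hcoef v n.
Proof.
move=> /L2perP lu /L2perP lv; apply/matrixP => i j; rewrite !mxE componentE.
have lc := L2s_cas L0 (zint n).
have cu := L2s_CI_mul (lu i) lc; have cv := L2s_CI_mul (lv i) lc.
rewrite [a * (_ * _)]mulrCA -mulrDr; congr (_ * _).
rewrite -(intZ a cu) -(intD (CIZ a cu) cv).
by apply: int_ext => x; ring.
Qed.

Lemma hcoef_linf n i : linf (L2per L) (fun u => hcoef u n i 0).
Proof. by move=> a u v lu lv; rewrite hcoef_lin// !mxE. Qed.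

Lemma hcoef_ae u v n : L2per L u -> L2per L v -> ae_equal u v -> hcoef u n = hcoef v n.
Proof.
move=> /L2perP lu /L2perP lv uv; apply/matrixP => i j; rewrite !mxE; congr (_ * _).
apply: int_ae_eq.
- exact: (L2s_CI_mul (lu i) (L2s_cas L0 _)).1.
- exact: (L2s_CI_mul (lv i) (L2s_cas L0 _)).1.
- by apply: aeS uv => x xuv; rewrite /component xuv.
Qed.

Lemma L2dot_ae u u' v : L2per L u -> L2per L u' -> L2per L v -> ae_equal u u' ->
  L2dot L u v = L2dot L u' v.
Proof.
move=> lu lu' lv uu'; apply: int_ae_eq.
- exact: (CI_dot lu lv).1.
- exact: (CI_dot lu' lv).1.
- by apply: aeS uu' => x ->.
Qed.

(** The scalar system times the unit vectors, in one sequence: index [j] stands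
    for frequency number [j./2] and component [odd j]. *)
Definition hbasis (j : nat) : R -> 'cV[R]_2 :=
  fun x => ((Num.sqrt L)^-1 * cas L (zint j./2) x) *: delta_mx (inord (odd j)) 0.

Lemma component_hbasis j i x : component (hbasis j) i x =
  (Num.sqrt L)^-1 * cas L (zint j./2) x * (i == inord (odd j))%:R.
Proof. by rewrite /component /hbasis !mxE eqxx andbT. Qed.

Lemma hbasis_L2per j : L2per L (hbasis j).
Proof.
apply/L2perP => i.
have := L2s_lin ((Num.sqrt L)^-1 * (i == inord (odd j))%:R)
  (L2s_cas L0 (zint j./2)) (((L2perP 0).1 L2per_subspace.1) i).
congr L2s; apply/funext => x; rewrite component_hbasis /component mxE; ring.
Qed.

Lemma L2dot_hbasis u j : L2per L u ->
  L2dot L u (hbasis j) = Num.sqrt L * hcoef u j./2 (inord (odd j)) 0.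
Proof.
move=> lu; have lui := (L2perP u).1 lu.
rewrite L2dotE//; last exact: hbasis_L2per.
rewrite (bigD1 (inord (odd j)))//= big1 ?addr0 => [|i ij].
  rewrite mxE; set f := fun x => component u _ x * _.
  rewrite mulrA (_ : Num.sqrt L / L = (Num.sqrt L)^-1); last first.
    by rewrite -{2}(sqr_sqrtr (ltW L0)) expr2 invfM mulrA divff ?mul1r// sqrtr_eq0 -ltNge.
  rewrite -intZ; last exact: (L2s_CI_mul (lui _) (L2s_cas L0 _)).
  by apply: int_ext => x; rewrite /f component_hbasis eqxx mulr1; ring.
rewrite (@int_ext _ _ _ (fun=> 0)) ?int_cst ?mul0r// => x.
by rewrite component_hbasis (negbTE ij) !mulr0.
Qed.

Lemma zint_inj : injective zint.
Proof.
move=> a b; rewrite /zint; have := odd_double_half a; have := odd_double_half b.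
by case: (odd a); case: (odd b) => /= <- <-; rewrite ?add0n ?add1n ?doubleK/= ?uphalf_double => H; lia.
Qed.

Lemma zint_surj (k : int) : exists n, zint n = k.
Proof.
case: k => n; first by exists n.*2; rewrite /zint odd_double doubleK.
by exists n.*2.+1; rewrite /zint/= odd_double/= uphalf_double NegzE.
Qed.

Lemma hbasis_orthonormal i j : L2dot L (hbasis i) (hbasis j) = (i == j)%:R.
Proof.
rewrite L2dot_hbasis; last exact: hbasis_L2per.
rewrite mxE; set o := inord (odd j).
have -> : I L (fun x => component (hbasis i) o x * cas L (zint j./2) x) =
    (Num.sqrt L)^-1 * (o == inord (odd i))%:R * ((zint i./2 == zint j./2)%:R * L).
  rewrite -cas_orthogonal// -intZ.
    by apply: int_ext => x; rewrite component_hbasis; ring.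
  exact: (L2s_CI_mul (L2s_cas L0 _) (L2s_cas L0 _)).
have sL : Num.sqrt L != 0 by rewrite sqrtr_eq0 -ltNge.
rewrite (inj_eq zint_inj) /o -val_eqE/= !inordK ?ltnS ?leq_b1//.
have -> : (i == j) = (odd j == odd i :> nat) && (i./2 == j./2).
  apply/eqP/andP => [->|[/eqP o1 /eqP h1]]; first by rewrite !eqxx.
  by rewrite -(odd_double_half i) -(odd_double_half j) o1 h1.
case: (_ == _ :> nat); case: (_ == _); rewrite ?mulr1 ?mulr0 ?mul0r ?mulr0//=.
by field; rewrite sL gt_eqF.
Qed.

Lemma hcoef_total u : L2per L u -> (forall n, hcoef u n = 0) -> ae_equal u (fun=> 0).
Proof.
move=> lu u0; have lui := (L2perP u).1 lu.
have H i : {ae mu, forall x, component u i x = 0}.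
  have [pu _ _] := lui i.
  apply: (hartley_total L0 pu (L2s_CI (lui i))) => k.
  have [n <-] := zint_surj k; have /matrixP/(_ i 0) := u0 n; rewrite !mxE => /eqP.
  by rewrite mulf_eq0 invr_eq0 gt_eqF//= => /eqP.
apply: aeS (aeI (H 0) (H 1)) => x [x0 x1]; apply/matrixP => i j; rewrite ord1 mxE.
have [->|->] : i = 0 \/ i = 1; [|exact: x0|exact: x1].
by case: i => [[|[|//]] ?]; [left|right]; apply/val_inj.
Qed.

Lemma L2dot_ae0 u v : L2per L u -> L2per L v -> ae_equal u (fun=> 0) -> L2dot L u v = 0.
Proof.
move=> lu lv u0; have l0 := L2per_subspace.1.
by rewrite (L2dot_ae lu l0 lv u0) (bilin0l L2per_subspace L2dot_bilin).
Qed.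

Lemma hartley_parseval u v : L2per L u -> L2per L v ->
  series (fun n => dot (hcoef u n) (hcoef v n)) @ \oo --> L^-1 * L2dot L u v.
Proof.
move=> lu lv.
have tot w : L2per L w -> (forall j, L2dot L w (hbasis j) = 0) -> L2dot L w w = 0.
  move=> lw w0; apply: L2dot_ae0 => //; apply: hcoef_total => // n.
  apply/matrixP => i j; rewrite ord1 mxE.
  have := w0 (i + n.*2)%N; rewrite L2dot_hbasis// => /eqP.
  rewrite mulf_eq0 sqrtr_eq0 leNgt L0/= oddD odd_double addbF.
  rewrite halfD odd_double andbF add0n doubleK.
  have i2 : (i./2 = 0)%N by case: (i) => [[|[|]]].
  have io : inord (odd i) = i.
    by apply/val_inj; rewrite /= inordK ?ltnS ?leq_b1//; case: (i) => [[|[|]]].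
  by rewrite i2 add0n io => /eqP; rewrite !mxE.
have H := parseval L2per_subspace L2dot_bilin L2dot_psd L2dot_complete
  hbasis_L2per hbasis_orthonormal tot lu lv.
have E N : \sum_(j < N.*2) L2dot L u (hbasis j) * L2dot L v (hbasis j) =
    L * series (fun n => dot (hcoef u n) (hcoef v n)) N.
  elim: N => [|N IH]; first by rewrite /series/= big_ord0 big_nil mulr0.
  rewrite seriesSr mulrDr -IH doubleS !big_ord_recr/=.
  rewrite -addrA; congr (_ + _); rewrite !L2dot_hbasis// /= odd_double/= uphalf_double doubleK.
  rewrite /dot sum2 (_ : inord 0 = 0 :> 'I_2); last by apply/val_inj; rewrite /= inordK.
  rewrite (_ : inord 1 = 1 :> 'I_2); last by apply/val_inj; rewrite /= inordK.
  have qL : Num.sqrt L * Num.sqrt L = L by rewrite -expr2 sqr_sqrtr// ltW.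
  by rewrite -[X in X * (_ + _)]qL; ring.
have -> : series (fun n => dot (hcoef u n) (hcoef v n)) =
    (fun N => L^-1 * \sum_(j < N.*2) L2dot L u (hbasis j) * L2dot L v (hbasis j)).
  by apply/funext => N; rewrite E mulKf// gt_eqF.
apply: cvgM; first exact: cvg_cst.
apply: cvg_comp H; apply/cvgnyPge => A; exists A => // n /= An.
by rewrite -addnn (leq_trans An)// leq_addr.
Qed.

Definition acoef f (k : int) : R := L^-1 * I L (fun x => f x * cos (phase L k x)).
Definition bcoef f (k : int) : R := L^-1 * I L (fun x => f x * sin (phase L k x)).

Lemma fourierE f k : fourier L f k = (acoef f k -i* bcoef f k)%C.
Proof. by []. Qed.

Lemma acoefN f k : acoef f (- k) = acoef f k.
Proof. by congr (_ * _); apply: int_ext => x; rewrite phaseN cosN. Qed.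

Lemma bcoefN f k : CI L f -> bcoef f (- k) = - bcoef f k.
Proof.
move=> cf; rewrite -mulrN; congr (_ * _); rewrite -intN.
  by apply: int_ext => x; rewrite phaseN sinN mulrN.
exact: (CI_mul_bounded cf (measurable_sin_phase L k) (fun x => sin_max _)).
Qed.

Lemma hcoefE u n i : L2per L u ->
  hcoef u n i 0 = acoef (component u i) (zint n) + bcoef (component u i) (zint n).
Proof.
move=> /L2perP lu; rewrite mxE -mulrDr; congr (_ * _).
have cf := L2s_CI (lu i).
rewrite -(intD (CI_mul_bounded cf (measurable_cos_phase L _) (fun x => cos_max _))
  (CI_mul_bounded cf (measurable_sin_phase L _) (fun x => sin_max _))).
by apply: int_ext => x; rewrite /cas mulrDr.
Qed.

Lemma esum_zint (F : int -> R) : (forall k, 0 <= F k) ->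
  (\esum_(k in [set: int]) (F k)%:E = \sum_(n <oo) (F (zint n))%:E)%E.
Proof.
move=> F0; rewrite nneseries_esumT => [|n]; last by rewrite lee_fin.
rewrite (reindex_esum [set: nat] [set: int] zint)//; split=> //.
- by move=> a b _ _; exact: zint_inj.
- by move=> k _; have [n <-] := zint_surj k; exists n.
Qed.

Lemma esum_sym (F G : int -> R) : (forall k, 0 <= F k) -> (forall k, 0 <= G k) ->
  (forall k, F k + F (- k) = G k + G (- k)) ->
  (\esum_(k in [set: int]) (F k)%:E = \esum_(k in [set: int]) (G k)%:E)%E.
Proof.
move=> F0 G0 FG.
have op (H : int -> R) : (\esum_(k in [set: int]) (H k)%:E =
    \esum_(k in [set: int]) (H (- k)%R)%:E)%E.
  rewrite (reindex_esum [set: int] [set: int] (fun k : int => - k))//.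
have dbl (H : int -> R) : (forall k, 0 <= H k) -> (\esum_(k in [set: int]) (H k)%:E +
    \esum_(k in [set: int]) (H k)%:E = \esum_(k in [set: int]) (H k + H (- k)%R)%:E)%E.
  move=> H0; rewrite {2}op -esumD.
  - by apply: eq_esum => k _; rewrite EFinD.
  - by move=> k _; rewrite lee_fin.
  - by move=> k _; rewrite lee_fin.
have FGe : (\esum_(k in [set: int]) (F k + F (- k)%R)%:E =
    \esum_(k in [set: int]) (G k + G (- k)%R)%:E)%E.
  by apply: eq_esum => k _; rewrite FG.
have := dbl F F0; rewrite FGe -(dbl G G0).
have : (0 <= \esum_(k in [set: int]) (F k)%:E)%E by apply: esum_ge0 => k _; rewrite lee_fin.
have : (0 <= \esum_(k in [set: int]) (G k)%:E)%E by apply: esum_ge0 => k _; rewrite lee_fin.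
case: (\esum_(k in _) (F k)%:E)%E => [x| |]; case: (\esum_(k in _) (G k)%:E)%E => [y| |] //.
by move=> _ _ /= [xy]; congr EFin; lra.
Qed.

Lemma fourier_hcoef_esum (W : int -> R) u : L2per L u -> (forall k, 0 <= W k) ->
  (forall k, W (- k) = W k) ->
  (\esum_(k in [set: int]) (W k * \sum_(i < 2) sqmod (fourier L (component u i) k))%:E =
   \sum_(n <oo) (W (zint n) * dot (hcoef u n) (hcoef u n))%:E)%E.
Proof.
move=> lu W0 WN; have cu i := L2s_CI ((L2perP u).1 lu i).
pose F k := W k * \sum_(i < 2) (acoef (component u i) k + bcoef (component u i) k) ^+ 2.
transitivity (\esum_(k in [set: int]) (F k)%:E)%E; last first.
  rewrite esum_zint => [|k]; last by rewrite mulr_ge0// sumr_ge0// => i _; exact: sqr_ge0.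
  apply: eq_eseriesr => n _; congr (_ * _)%:E; apply: eq_bigr => i _.
  by rewrite hcoefE// expr2.
apply: esum_sym => k.
- by rewrite mulr_ge0// sumr_ge0// => i _; rewrite addr_ge0 ?sqr_ge0.
- by rewrite mulr_ge0// sumr_ge0// => i _; exact: sqr_ge0.
rewrite /F WN -!mulrDr; congr (_ * _); rewrite -!big_split; apply: eq_bigr => i _.
by rewrite !fourierE /sqmod/= acoefN bcoefN//; ring.
Qed.

Lemma sum_symmetric (T : nmodType) (F : int -> T) n :
  \sum_(l < n.*2.+1) F (l%:Z - n%:Z) = \sum_(l < n.*2.+1) F (zint l).
Proof.
elim: n => [|n IH]; first by rewrite !big_ord1 /zint subr0.
rewrite doubleS big_ord_recl [RHS]big_ord_recr/= [in RHS]big_ord_recr/= -IH.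
rewrite big_ord_recr/= [LHS]addrC -[RHS]addrA -addrA; congr (_ + _).
  by apply: eq_bigr => l _; congr F; rewrite /bump/=; lia.
rewrite /zint/= odd_double/= uphalf_double addrC; congr (F _ + F _).
  by rewrite /bump/=; lia.
by rewrite /bump/= doubleK; lia.
Qed.

Lemma sum_opp_symmetric (T : nmodType) (F : int -> T) n :
  \sum_(l < n.*2.+1) F (- (l%:Z - n%:Z)) = \sum_(l < n.*2.+1) F (l%:Z - n%:Z).
Proof.
rewrite [RHS](reindex_inj rev_ord_inj)/=; apply: eq_bigr => l _; congr F.
by have := ltn_ord l; lia.
Qed.

Definition qseries (B : nat -> 'M[R]_2) u v : R^nat :=
  series (fun n => dot (B n *m hcoef u n) (hcoef v n)).

Lemma dot_mulmx (B : 'M[R]_2) (a b : 'cV[R]_2) :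
  dot (B *m a) b = \sum_i \sum_j B i j * a j 0 * b i 0.
Proof. by apply: eq_bigr => i _; rewrite mxE mulr_suml. Qed.

(** Summing over [k] and [- k] turns the Hermitian products of the Fourier
    coefficients into the products of the Hartley coefficients. *)
Lemma MformE (m : R -> 'M[R]_2) u v : L2per L u -> L2per L v ->
  (forall (i j : 'I_2) (x : R), m (- x) i j = m x i j) ->
  Mform L m u v = L * limn (fun n => qseries (fun n => m (zint n)%:~R) u v n.*2.+1).
Proof.
move=> lu lv mN; have cu i := L2s_CI ((L2perP u).1 lu i).
have cv i := L2s_CI ((L2perP v).1 lv i); rewrite /Mform.
apply: (congr1 (fun f : R^nat => L * limn f)); apply/funext => n.
pose a i k := acoef (component u i) k; pose b i k := bcoef (component u i) k.
pose a' i k := acoef (component v i) k; pose b' i k := bcoef (component v i) k.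
pose F (k : int) := \sum_i \sum_j m k%:~R i j * (a j k * a' i k + b j k * b' i k).
pose G (k : int) := \sum_i \sum_j m k%:~R i j * (a j k + b j k) * (a' i k + b' i k).
transitivity (\sum_(l < n.*2.+1) F (l%:Z - n%:Z)).
  apply: eq_bigr => l _; rewrite /F; move: (l%:Z - n%:Z) => k.
  rewrite raddf_sum; apply: eq_bigr => i _; rewrite raddf_sum; apply: eq_bigr => j _.
  by rewrite !fourierE /a /b /a' /b'/=; ring.
transitivity (\sum_(l < n.*2.+1) G (l%:Z - n%:Z)); last first.
  rewrite sum_symmetric /qseries seriesEnat/= big_mkord; apply: eq_bigr => l _.
  rewrite dot_mulmx; apply: eq_bigr => i _; apply: eq_bigr => j _.
  by rewrite !hcoefE.
have FG k : F k + F (- k) = G k + G (- k).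
  rewrite /F /G -!big_split/=; apply: eq_bigr => i _; rewrite -!big_split/=.
  apply: eq_bigr => j _; rewrite /a /b /a' /b' !acoefN !bcoefN// intrN mN; ring.
have dbl (H : int -> R) : 2 * \sum_(l < n.*2.+1) H (l%:Z - n%:Z) =
    \sum_(l < n.*2.+1) (H (l%:Z - n%:Z) + H (- (l%:Z - n%:Z))).
  by rewrite big_split/= sum_opp_symmetric; ring.
suff : 2 * \sum_(l < n.*2.+1) F (l%:Z - n%:Z) = 2 * \sum_(l < n.*2.+1) G (l%:Z - n%:Z).
  by lra.
by rewrite !dbl; apply: eq_bigr => l _; exact: FG.
Qed.

End Fixed.
End VectorL2.

Arguments hcoef {R} L u n.
Arguments hbasis {R} L j.
Arguments acoef {R} L f k.
Arguments bcoef {R} L f k.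
Arguments qseries {R} L B u v.

(** * The energy space *)

Section EnergySpace.
Context {R : realType}.
Notation mu := (@lebesgue_measure R).
Local Notation I L f := (\int[mu]_(x in `[0, L]) f x).
Implicit Types (u v w : R -> 'cV[R]_2).

Definition freq (n : nat) : R := (uphalf n)%:R.

Lemma freqE n : `|(zint n)%:~R| = freq n :> R.
Proof.
rewrite -intr_norm /freq /zint uphalf_half; case: (odd n) => /=.
  by rewrite normrN add1n.
by rewrite add0n.
Qed.

Definition sweight (s : R) n : R := (1 + freq n ^+ 2) `^ (s / 2).

Section Fixed.
Context {L s : R} (L0 : 0 < L) (s0 : 0 < s).
Local Notation c := (hcoef L).
Local Notation wt := (sweight s).
Local Notation X := (Xspace L s).

Lemma freq_ge0 n : 0 <= freq n. Proof. exact: ler0n. Qed.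

Lemma sweight_ge1 n : 1 <= wt n.
Proof.
rewrite /sweight -{1}(powRr0 (1 + freq n ^+ 2)); apply: ler_powR.
  by rewrite lerDl sqr_ge0.
by rewrite divr_ge0// ltW.
Qed.

Lemma sweight_gt0 n : 0 < wt n.
Proof. exact: lt_le_trans (sweight_ge1 n). Qed.

Lemma sweight_ge0 n : 0 <= wt n.
Proof. exact/ltW/sweight_gt0. Qed.

Lemma freq_powE n : freq n `^ s = (freq n ^+ 2) `^ (s / 2).
Proof.
by rewrite -powR_mulrn ?freq_ge0// -powRrM; congr (_ `^ _); field.
Qed.

Lemma freq_pow_le n : freq n `^ s <= wt n.
Proof.
rewrite freq_powE; apply: ge0_ler_powR.
- by rewrite divr_ge0// ltW.
- by rewrite nnegrE sqr_ge0.
- by rewrite nnegrE addr_ge0// sqr_ge0.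
- by rewrite lerDr.
Qed.

Lemma sweight_le n : wt n <= 2 `^ (s / 2) * freq n `^ s + 1.
Proof.
have s2 : 0 <= s / 2 by rewrite divr_ge0// ltW.
have p0 : 0 <= 2 `^ (s / 2) * freq n `^ s by rewrite mulr_ge0 ?powR_ge0.
have [n0|n0] := posnP (uphalf n).
  by rewrite /sweight /freq n0 expr0n/= addr0 powR1; move: p0; rewrite /freq n0; lra.
have f1 : 1 <= freq n by rewrite /freq ler1n.
apply: (@le_trans _ _ (2 `^ (s / 2) * freq n `^ s)); last by lra.
rewrite freq_powE -powRM ?sqr_ge0//; apply: ge0_ler_powR => //.
- by rewrite nnegrE addr_ge0// sqr_ge0.
- by rewrite nnegrE mulr_ge0// sqr_ge0.
- have f2 : 1 <= freq n ^+ 2 by rewrite exprn_ege1.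
  by lra.
Qed.

Lemma sweight_large (M : R) : exists N, forall n, (N <= n)%N -> M <= wt n.
Proof.
have s2 : 0 < s^-1 by rewrite invr_gt0.
pose A := (Num.max M 0) `^ s^-1.
exists (Num.truncn A).+1.*2 => n Nn; apply: le_trans (freq_pow_le n).
have fA : A <= freq n.
  apply: (@le_trans _ _ (Num.truncn A).+1%:R); first exact/ltW/truncnS_gt.
  rewrite ler_nat -(doubleK (Num.truncn A).+1); apply: leq_trans (half_leq Nn) _.
  by rewrite uphalf_half leq_addl.
apply: (@le_trans _ _ (A `^ s)).
  by rewrite /A -powRrM mulVf ?gt_eqF// powRr1 ?le_max ?lexx ?orbT//.
by apply: ge0_ler_powR => //; rewrite ?nnegrE ?powR_ge0 ?freq_ge0 ?ltW.
Qed.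

Definition bounded_energy u := exists B : R, forall N,
  \sum_(n < N) wt n * dot (c u n) (c u n) <= B.

Definition energy_series u : R^nat := series (fun n => wt n * dot (c u n) (c u n)).

Lemma energy_seriesE u N : energy_series u N = \sum_(n < N) wt n * dot (c u n) (c u n).
Proof. by rewrite /energy_series seriesEnat/= big_mkord. Qed.

Lemma energy_series_nd u : nondecreasing_seq (energy_series u).
Proof.
apply: nondecreasing_series => n _ _; rewrite mulr_ge0 ?dot_ge0//.
exact: sweight_ge0.
Qed.

Lemma sobolev_sqE r u : L2per L u -> sobolev_sq L r u =
  (L%:E * \sum_(n <oo) ((1 + freq n ^+ 2) `^ r * dot (c u n) (c u n))%:E)%E.
Proof.
move=> lu; rewrite /sobolev_sq.
have W0 (k : int) : 0 <= (1 + `|k%:~R| ^+ 2) `^ r :> R by exact: powR_ge0.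
have WN (k : int) : (1 + `|(- k)%:~R| ^+ 2) `^ r = (1 + `|k%:~R| ^+ 2) `^ r :> R.
  by rewrite intrN normrN.
rewrite (fourier_hcoef_esum L0 lu W0 WN).
by under eq_eseriesr do rewrite freqE.
Qed.

Lemma series_EFin_lim (f : nat -> R) (B : R) : (forall n, 0 <= f n) ->
  (forall N, \sum_(n < N) f n <= B) ->
  cvgn (series f) /\ (\sum_(n <oo) (f n)%:E)%E = (limn (series f))%:E.
Proof.
move=> f0 fB; have cf : cvgn (series f).
  apply: nondecreasing_is_cvgn; first exact: nondecreasing_series.
  by exists B => _ [N _ <-]; rewrite seriesEnat/= big_mkord.
split=> //; apply/cvg_lim => //.
under eq_fun do rewrite sumEFin; apply/fine_cvgP; split; first exact: nearW.
exact: cf.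
Qed.

Lemma sum_le_nneseries (f : nat -> R) (B : R) : (forall n, 0 <= f n) ->
  (\sum_(n <oo) (f n)%:E <= B%:E)%E -> forall N, \sum_(n < N) f n <= B.
Proof.
move=> f0 fB N; rewrite -lee_fin -sumEFin; apply: le_trans fB.
rewrite -(big_mkord xpredT (fun n => (f n)%:E)).
by apply: nneseries_lim_ge => n _; rewrite lee_fin.
Qed.

Lemma XspaceP u : X u <-> L2per L u /\ bounded_energy u.
Proof.
have f0 n : 0 <= wt n * dot (c u n) (c u n).
  by rewrite mulr_ge0 ?dot_ge0// sweight_ge0.
split=> [[lu]|[lu [B HB]]].
  rewrite sobolev_sqE// => fin; split=> //.
  have n0 : (0 <= \sum_(n <oo) (wt n * dot (c u n) (c u n))%:E)%E.
    by apply: nneseries_ge0 => n _ _; rewrite lee_fin.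
  have [B EB] : exists B : R, (\sum_(n <oo) (wt n * dot (c u n) (c u n))%:E)%E = B%:E.
    move: fin n0; rewrite /sweight; case: (\sum_(n <oo) _)%E => [B _ _||//]; first by exists B.
    by rewrite mulry gtr0_sg// mul1e ltxx.
  by exists B; apply: (sum_le_nneseries f0); rewrite EB.
split=> //; rewrite sobolev_sqE//.
by have [_ ->] := series_EFin_lim f0 HB; rewrite -EFinM ltry.
Qed.

Lemma X_L2 u : X u -> L2per L u. Proof. by case. Qed.

Lemma energy_cvg u : X u -> cvgn (energy_series u).
Proof.
move=> /XspaceP[_ [B HB]]; apply: (series_EFin_lim _ HB).1 => n.
by rewrite mulr_ge0 ?dot_ge0// sweight_ge0.
Qed.

Lemma X_subspace : subspace X.
Proof.
have sL := L2per_subspace (L := L); split.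
  apply/XspaceP; split; first exact: sL.1.
  exists 0 => N; rewrite big1// => n _.
  have -> : c (0 : R -> 'cV[R]_2) n = 0.
    apply/matrixP => i j; rewrite ord1 (linf0 sL (hcoef_linf L0 n i)).
    by rewrite mxE.
  by rewrite dot0l mulr0.
move=> a u v /XspaceP[lu [B HB]] /XspaceP[lv [D HD]]; apply/XspaceP.
split; first exact: sL.2.
exists (2 * a ^+ 2 * B + 2 * D) => N.
apply: (@le_trans _ _ (\sum_(n < N) (2 * a ^+ 2 * (wt n * dot (c u n) (c u n))
    + 2 * (wt n * dot (c v n) (c v n))))).
  apply: ler_sum => n _; rewrite hcoef_lin//.
  have := psd_sqD_le trueS dot_bilin (fun x _ => dot_ge0 x) (u := a *: c u n) (v := c v n).
  rewrite (bilin_sqZ trueS dot_bilin)// => /(_ Logic.I Logic.I) H.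
  have := ler_wpM2l (sweight_ge0 n) H; lra.
rewrite big_split -!mulr_sumr/=; apply: lerD; last exact: ler_wpM2l (HD N).
by apply: ler_wpM2l (HB N); rewrite mulr_ge0// sqr_ge0.
Qed.

(** ** Diagonal quadratic forms *)

Definition dominated (B : nat -> 'M[R]_2) (C : R) := forall n a b,
  `|dot (B n *m a) b| <= C * wt n * (dot a a + dot b b).

Definition qform (B : nat -> 'M[R]_2) u v := L * limn (qseries L B u v).

Lemma qseries_cvg B C u v : dominated B C -> X u -> X v -> cvgn (qseries L B u v).
Proof.
move=> dB Xu Xv; apply: normed_cvg.
apply: (series_le_cvg _ _ (fun n => dB n (c u n) (c v n))) => [n|n|].
- exact: normr_ge0.
- exact: le_trans (normr_ge0 _) (dB n (c u n) (c v n)).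
- rewrite (_ : series _ = cst C * (energy_series u + energy_series v)); last first.
    apply/funext => N; rewrite /energy_series/= !seriesEnat/=.
    rewrite -[RHS]/(C * (_ + _)) -big_split mulr_sumr/=.
    by apply: eq_bigr => n _; ring.
  apply: is_cvgM; first exact: is_cvg_cst.
  by apply: is_cvgD; exact: energy_cvg.
Qed.

Lemma qform_lin B C a u v w : dominated B C -> X u -> X v -> X w ->
  qform B (a *: u + v) w = a * qform B u w + qform B v w.
Proof.
move=> dB Xu Xv Xw; rewrite /qform.
have cu := qseries_cvg dB Xu Xw; have cv := qseries_cvg dB Xv Xw.
rewrite mulrCA -mulrDr; congr (_ * _); apply/cvg_lim => //.
rewrite (_ : qseries _ _ _ _ = (fun N => a * qseries L B u w N + qseries L B v w N)).
  by apply: cvgD; [apply: cvgM; [exact: cvg_cst|exact: cu]|exact: cv].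
apply/funext => N; rewrite /qseries /= !seriesEnat/= mulr_sumr -big_split/=.
apply: eq_bigr => n _; rewrite (hcoef_lin L0 _ _ (X_L2 Xu) (X_L2 Xv)).
by rewrite mulmxDr -scalemxAr dot_lin.
Qed.

Lemma qform_bilin B C : dominated B C ->
  (forall n a b, dot (B n *m a) b = dot (B n *m b) a) -> bilin X (qform B).
Proof.
move=> dB sB; split=> [u v _ _|a u v w]; last exact: (qform_lin _ dB).
rewrite /qform /qseries; congr (L * limn _).
by apply: (congr1 (fun f : R^nat => series f)); apply/funext => n; rewrite sB.
Qed.

Lemma qform_le B B' C C' K u : dominated B C -> dominated B' C' -> X u ->
  (forall n a, dot (B n *m a) a <= K * dot (B' n *m a) a) ->
  qform B u u <= K * qform B' u u.
Proof.
move=> dB dB' Xu H; rewrite /qform mulrCA ler_wpM2l ?(ltW L0)//.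
have cu := qseries_cvg dB Xu Xu; have cu' := qseries_cvg dB' Xu Xu.
have -> : K * limn (qseries L B' u u) = limn (fun N => K * qseries L B' u u N).
  by apply/esym/cvg_lim => //; apply: cvgM => //; exact: cvg_cst.
apply: ler_lim => //; first by apply: is_cvgM => //; exact: is_cvg_cst.
apply: nearW => N; rewrite /qseries !seriesEnat/= mulr_sumr.
by apply: ler_sum => n _; exact: H.
Qed.

Lemma qform_ge0 B u : (forall n a, 0 <= dot (B n *m a) a) -> 0 <= qform B u u.
Proof.
move=> H; rewrite mulr_ge0 ?(ltW L0)//.
have [cu|ncu] := pselect (cvgn (qseries L B u u)).
  apply: limr_ge => //; apply: nearW => N; rewrite /qseries seriesEnat/=.
  by apply: sumr_ge0 => n _; exact: H.
rewrite dvgP//.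
Qed.

Lemma qform_ae B u u' v : L2per L u -> L2per L u' -> ae_equal u u' ->
  qform B u v = qform B u' v.
Proof.
move=> lu lu' uu'; rewrite /qform /qseries.
apply: (congr1 (fun f : R^nat => L * limn (series f))); apply/funext => n.
by rewrite (hcoef_ae L0 n lu lu' uu').
Qed.

Definition xdot u v := qform (fun n => (wt n)%:M) u v.

Lemma dot_scalar (k : R) (a b : 'cV[R]_2) : dot (k%:M *m a) b = k * dot a b.
Proof. by rewrite mul_scalar_mx -[_ *: _]addr0 dot_lin dot0l addr0. Qed.

Lemma dominated_weight : dominated (fun n => (wt n)%:M) 2^-1.
Proof.
move=> n a b; rewrite dot_scalar normrM ger0_norm ?sweight_ge0//.
by have := ler_wpM2l (sweight_ge0 n) (dot_le a b); lra.
Qed.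

Lemma dominated1 : dominated (fun n => 1%:M) 2^-1.
Proof.
move=> n a b; rewrite dot_scalar mul1r.
have := dot_le a b; have := sweight_ge1 n; have := dot_ge0 a; have := dot_ge0 b.
by nra.
Qed.

Lemma xdot_bilin : bilin X xdot.
Proof.
apply: (qform_bilin dominated_weight) => n a b.
by rewrite !dot_scalar dotC.
Qed.

Lemma xdot_psd : psd X xdot.
Proof.
move=> u _; apply: qform_ge0 => n a.
by rewrite dot_scalar mulr_ge0 ?dot_ge0// sweight_ge0.
Qed.

Lemma L2dot_qform u v : L2per L u -> L2per L v -> L2dot L u v = qform (fun=> 1%:M) u v.
Proof.
move=> lu lv; rewrite /qform.
have := hartley_parseval L0 lu lv => H.
rewrite (_ : qseries L (fun=> 1%:M) u v = series (fun n => dot (c u n) (c v n))).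
  by rewrite (cvg_lim _ H)// mulrA divff ?mul1r// gt_eqF.
by congr series; apply/funext => n; rewrite mul1mx.
Qed.

Lemma L2dot_le_xdot u : X u -> L2dot L u u <= xdot u u.
Proof.
move=> Xu; rewrite L2dot_qform; [|exact: X_L2|exact: X_L2].
rewrite -[leRHS]mul1r; apply: (qform_le dominated1 dominated_weight Xu) => n a.
by rewrite !dot_scalar !mul1r ler_peMl ?dot_ge0// sweight_ge1.
Qed.

Lemma xdotE u : X u -> xdot u u = L * limn (energy_series u).
Proof.
move=> _; congr (L * limn _); rewrite /qseries /energy_series; congr series.
by apply/funext => n; rewrite dot_scalar.
Qed.

Lemma energy_partial_le u N : X u ->
  L * \sum_(n < N) wt n * dot (c u n) (c u n) <= xdot u u.
Proof.
move=> Xu; rewrite xdotE// ler_wpM2l ?(ltW L0)// -energy_seriesE.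
exact: (nondecreasing_cvgn_le (energy_series_nd u) (energy_cvg Xu)).
Qed.

Lemma xdot_le u (B : R) : X u ->
  (forall N, L * \sum_(n < N) wt n * dot (c u n) (c u n) <= B) -> xdot u u <= B.
Proof.
move=> Xu H; rewrite xdotE// -ler_pdivlMl//.
apply: limr_le; first exact: energy_cvg.
by apply: nearW => N; rewrite energy_seriesE ler_pdivlMl.
Qed.

Lemma Xnorm_sqr u : X u -> Xnorm L s u ^+ 2 = xdot u u.
Proof.
move=> Xu; have [lu HB] := (XspaceP u).1 Xu; have [B HB'] := HB.
rewrite /Xnorm /Hnorm sobolev_sqE//.
have [|_ E] := series_EFin_lim (f := fun n => wt n * dot (c u n) (c u n)) _ HB'.
  by move=> n; rewrite mulr_ge0 ?dot_ge0// sweight_ge0.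
rewrite -/(sweight s _) E /= sqr_sqrtr; first by rewrite xdotE.
by have := xdot_psd Xu; rewrite xdotE.
Qed.

Lemma Xnorm_ge0 u : 0 <= Xnorm L s u. Proof. exact: sqrtr_ge0. Qed.

Lemma XnormE u : X u -> Xnorm L s u = Num.sqrt (xdot u u).
Proof. by move=> Xu; rewrite -Xnorm_sqr// sqrtr_sqr ger0_norm// Xnorm_ge0. Qed.

Lemma Xnorm_lt u (e : R) : 0 < e -> X u -> (Xnorm L s u < e) = (xdot u u < e ^+ 2).
Proof.
by move=> e0 Xu; rewrite -Xnorm_sqr// ltr_pXn2r// nnegrE ?Xnorm_ge0// ltW.
Qed.

Lemma Xnorm_triangle u v : X u -> X v -> Xnorm L s (u + v) <= Xnorm L s u + Xnorm L s v.
Proof.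
move=> Xu Xv; rewrite (XnormE (subspaceD X_subspace Xu Xv)) (XnormE Xu) (XnormE Xv).
exact: (psd_triangle X_subspace xdot_bilin xdot_psd).
Qed.

Lemma XnormN u : X u -> Xnorm L s (- u) = Xnorm L s u.
Proof.
move=> Xu; rewrite (XnormE (subspaceN X_subspace Xu)) (XnormE Xu).
by rewrite -scaleN1r (bilin_sqZ X_subspace xdot_bilin)// sqrrN expr1n mul1r.
Qed.

Lemma XnormZ (a : R) u : X u -> Xnorm L s (a *: u) = `|a| * Xnorm L s u.
Proof.
move=> Xu; rewrite (XnormE (subspaceZ a X_subspace Xu)) (XnormE Xu).
by rewrite (bilin_sqZ X_subspace xdot_bilin)// sqrtrM ?sqr_ge0// sqrtr_sqr.
Qed.

Lemma hcoef_lim (v_ : nat -> R -> 'cV[R]_2) u n i : (forall k, L2per L (v_ k)) -> L2per L u ->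
  form_lim (L2dot L) v_ u -> (fun k => c (v_ k) n i 0) @ \oo --> c u n i 0.
Proof.
move=> lv lu lim; apply/cvgrPdist_lt => e e0.
have [N HN] := lim (L * e ^+ 2) (mulr_gt0 L0 (exprn_gt0 2 e0)).
exists N => // k /= Nk; have := HN k Nk.
have lB := subspaceB (L2per_subspace (L := L)) (lv k) lu.
rewrite distrC -(linfB (hcoef_linf L0 n i))// => H.
have := L2dot_hbasis L0 (i + n.*2)%N lB.
rewrite oddD odd_double addbF halfD odd_double andbF add0n doubleK.
have i2 : (i./2 = 0)%N by case: (i) => [[|[|]]].
have io : inord (odd i) = i.
  by apply/val_inj; rewrite /= inordK ?ltnS ?leq_b1//; case: (i) => [[|[|]]].
rewrite i2 add0n io => Hc.
have := psd_CS (L2per_subspace (L := L)) (L2dot_bilin (L := L)) (L2dot_psd (L := L)) lB (hbasis_L2per L0 (i + n.*2)).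
rewrite (hbasis_orthonormal L0) eqxx mulr1 Hc exprMn sqr_sqrtr ?(ltW L0)// => H2.
rewrite -(@ltr_pXn2r _ 2) ?nnegrE ?(ltW e0)// real_normK ?num_real//.
by rewrite -(ltr_pM2l L0); exact: le_lt_trans H2 H.
Qed.

Lemma X_complete : form_complete X xdot.
Proof.
move=> v_ Xv cau; have sX := X_subspace.
have lv k := X_L2 (Xv k).
have cau2 : form_cauchy (L2dot L) v_.
  move=> e e0; have [N HN] := cau e e0; exists N => n m Nn Nm.
  exact: le_lt_trans (L2dot_le_xdot (subspaceB sX (Xv n) (Xv m))) (HN n m Nn Nm).
have [u lu lim] := L2dot_complete L0 lv cau2.
have cl n i := @hcoef_lim v_ u n i lv lu lim.
have part (e : R) k M N : (forall m, (M <= m)%N -> xdot (v_ k - v_ m) (v_ k - v_ m) <= e) ->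
    L * \sum_(n < N) wt n * dot (c (v_ k - u) n) (c (v_ k - u) n) <= e.
  move=> He.
  have E w : L2per L w -> L * \sum_(n < N) wt n * dot (c (v_ k - w) n) (c (v_ k - w) n) =
      L * \sum_(n < N) wt n * \sum_i (c (v_ k) n i 0 - c w n i 0) ^+ 2.
    move=> lw; congr (_ * _); apply: eq_bigr => n _; congr (_ * _); apply: eq_bigr => i _.
    by rewrite (linfB (hcoef_linf L0 n i) (lv k) lw) -expr2.
  pose T m := L * \sum_(n < N) wt n * \sum_i (c (v_ k) n i 0 - c (v_ m) n i 0) ^+ 2.
  have cT : T @ \oo --> L * \sum_(n < N) wt n * \sum_i (c (v_ k) n i 0 - c u n i 0) ^+ 2.
    apply: cvgM; first exact: cvg_cst.
    apply: cvg_big; [exact: add_continuous|move=> n _]; apply: cvgM; first exact: cvg_cst.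
    apply: cvg_big; [exact: add_continuous|move=> i _]; rewrite expr2; under eq_fun do rewrite expr2.
    by apply: cvgM; (apply: cvgB; [exact: cvg_cst|exact: cl]).
  rewrite (E u lu) -(cvg_lim (@Rhausdorff _) cT).
  apply: limr_le; first by apply/cvg_ex; eexists; exact: cT.
  exists M => // m /= Mm; rewrite /T -(E _ (lv m)).
  apply: le_trans (He m Mm).
  exact: (energy_partial_le N (subspaceB sX (Xv k) (Xv m))).
have XB k M (e : R) : (forall m, (M <= m)%N -> xdot (v_ k - v_ m) (v_ k - v_ m) <= e) ->
    X (v_ k - u).
  move=> He; apply/XspaceP; split.
    exact: (subspaceB (L2per_subspace (L := L)) (lv k) lu).
  by exists (L^-1 * e) => N; rewrite ler_pdivlMl//; exact: part He.
have [N0 HN0] := cau 1 ltr01.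
have Xu : X u.
  have XB0 := XB N0 N0 1 (fun m Nm => ltW (HN0 N0 m (leqnn _) Nm)).
  by have := subspaceB sX (Xv N0) XB0; rewrite opprB addrC subrK.
exists u; first exact: Xu.
move=> e e0; have [N HN] := cau (e / 2) (divr_gt0 e0 (ltr0n _ 2)).
exists N => k Nk; have He m (Nm : (N <= m)%N) := ltW (HN k m Nk Nm).
have := xdot_le (XB k N _ He) (fun M => part _ _ _ M He).
by move: (xdot _ _) => z; lra.
Qed.

End Fixed.
End EnergySpace.

Section Translation.
Context {R : realType} {L : R} (L0 : 0 < L).
Notation mu := (@lebesgue_measure R).
Local Notation I L f := (\int[mu]_(x in `[0, L]) f x).
Implicit Types (u v : R -> 'cV[R]_2).

Lemma coef_shift (f : R -> R) (y : R) (k : int) : periodic f L -> CI L f ->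
  acoef L (fun x => f (x + y)) k =
    cos (phase L k y) * acoef L f k + sin (phase L k y) * bcoef L f k /\
  bcoef L (fun x => f (x + y)) k =
    cos (phase L k y) * bcoef L f k - sin (phase L k y) * acoef L f k.
Proof.
move=> pf cf; have [mf _] := cf.
have cc := CI_mul_bounded cf (measurable_cos_phase L k) (fun x => cos_max _).
have cs := CI_mul_bounded cf (measurable_sin_phase L k) (fun x => sin_max _).
have sh (h : R -> R) : measurable_fun [set: R] h -> (forall x, h (x + L) = h x) ->
    I L (fun x => f (x + y) * h (x + y)) = I L (fun x => f x * h x).
  move=> mh ph; apply: (int_shift y L0 (f := fun x => f x * h x)).
    by move=> x; rewrite pf ph.
  exact: measurable_funM.
have ph x : phase L k x = phase L k (x + y) - phase L k y by rewrite phaseDx addrK.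
set C := cos (phase L k y); set S := sin (phase L k y).
have mC := measurable_cos_phase L k; have mS := measurable_sin_phase L k.
have pC := cos_phase_periodic L0 k; have pS := sin_phase_periodic L0 k.
split.
- rewrite /acoef /bcoef mulrCA [S * _]mulrCA -mulrDr; congr (_ * _).
  rewrite -(intZ C cc) -(intZ S cs) -(intD (CIZ C cc) (CIZ S cs)).
  pose h x := C * cos (phase L k x) + S * sin (phase L k x).
  have mh : measurable_fun [set: R] h.
    by apply: measurable_funD; exact: measurable_funM.
  transitivity (I L (fun x => f (x + y) * h (x + y))).
    by apply: int_ext => x; rewrite [in LHS]ph cosB /h /C /S; ring.
  rewrite sh => [|//|x]; last by rewrite /h pC pS.
  by apply: int_ext => x; rewrite /h; ring.
- rewrite /acoef /bcoef mulrCA [S * _]mulrCA -mulrBr; congr (_ * _).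
  rewrite -(intZ C cs) -(intZ S cc) -(intB (CIZ C cs) (CIZ S cc)).
  pose h x := C * sin (phase L k x) - S * cos (phase L k x).
  have mh : measurable_fun [set: R] h.
    by apply: measurable_funB; exact: measurable_funM.
  transitivity (I L (fun x => f (x + y) * h (x + y))).
    by apply: int_ext => x; rewrite [in LHS]ph sinB /h /C /S; ring.
  rewrite sh => [|//|x]; last by rewrite /h pC pS.
  by apply: int_ext => x; rewrite /h; ring.
Qed.

Lemma L2per_translate u y : L2per L u -> L2per L (translate y u).
Proof. by move=> /L2perP lu; apply/L2perP => i; exact: (L2s_shift L0 y (lu i)). Qed.

Lemma fourier_translate u y i k : L2per L u ->
  acoef L (component (translate y u) i) k = cos (phase L k y) * acoef L (component u i) k
    + sin (phase L k y) * bcoef L (component u i) k /\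
  bcoef L (component (translate y u) i) k = cos (phase L k y) * bcoef L (component u i) k
    - sin (phase L k y) * acoef L (component u i) k.
Proof.
move=> /L2perP lu; have [p _ _] := lu i.
exact: (coef_shift y k p (L2s_CI (lu i))).
Qed.

Lemma sobolev_sq_translate r u y : L2per L u ->
  sobolev_sq L r (translate y u) = sobolev_sq L r u.
Proof.
move=> lu; rewrite /sobolev_sq; congr (_ * _)%E; apply: eq_esum => k _.
congr (_ * _)%:E; apply: eq_bigr => i _; rewrite !fourierE /sqmod/=.
have [-> ->] := fourier_translate y i k lu.
have H := cos2Dsin2 (phase L k y).
set C := cos _ in H *; set S := sin _ in H *; set a := acoef _ _ _; set b := bcoef _ _ _.
rewrite (_ : (C * a + S * b) ^+ 2 + (- (C * b - S * a)) ^+ 2 = (C ^+ 2 + S ^+ 2) * (a ^+ 2 + (- b) ^+ 2)); last by ring.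
by rewrite H mul1r.
Qed.

Lemma Hper_translate r u y : Hper L r u -> Hper L r (translate y u).
Proof.
move=> [lu fu]; split; first exact: L2per_translate.
by rewrite sobolev_sq_translate.
Qed.

Lemma Hnorm_translate r u y : L2per L u -> Hnorm L r (translate y u) = Hnorm L r u.
Proof. by move=> lu; rewrite /Hnorm sobolev_sq_translate. Qed.

Lemma Mform_translate (m : R -> 'M[R]_2) u v y : L2per L u -> L2per L v ->
  Mform L m (translate y u) (translate y v) = Mform L m u v.
Proof.
move=> lu lv; rewrite /Mform; apply: (congr1 (fun f : R^nat => L * limn f)).
apply/funext => n; apply: eq_bigr => l _; congr complex.Re.
set k := _ - _; apply: eq_bigr => i _; apply: eq_bigr => j _.
rewrite -!mulrA; congr (_ * _); rewrite !fourierE.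
have [-> ->] := fourier_translate y j k lu.
have [-> ->] := fourier_translate y i k lv.
have H := cos2Dsin2 (phase L k y).
set C := cos _ in H *; set S := sin _ in H *.
set a := acoef _ _ _; set b := bcoef _ _ _; set a' := acoef _ _ _; set b' := bcoef _ _ _.
apply/eqP; rewrite eq_complex/= !opprK; apply/andP; split; apply/eqP.
- rewrite (_ : _ - _ = (C ^+ 2 + S ^+ 2) * (a * a' + b * b')); last by ring.
  by rewrite H; ring.
- transitivity ((C ^+ 2 + S ^+ 2) * (a * b' - b * a')); first by ring.
  by rewrite H; ring.
Qed.

Lemma L2dot_translate u v y : L2per L u -> L2per L v ->
  L2dot L (translate y u) (translate y v) = L2dot L u v.
Proof.
move=> lu lv; have [pu _] := lu; have [pv _] := lv.
apply: (int_shift y L0 (f := fun x => dot (u x) (v x))); last exact: (CI_dot lu lv).1.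
by move=> x; rewrite pu pv.
Qed.

Lemma translate_translate u y z : translate y (translate z u) = translate (y + z) u.
Proof. by apply/funext => x; rewrite /translate addrA. Qed.

Lemma translate0 u : translate 0 u = u.
Proof. by apply/funext => x; rewrite /translate addr0. Qed.

End Translation.

(** * The form of the dispersive operator *)

Section Symbol.
Context {R : realType} {L s c1 c2 : R} {m : R -> 'M[R]_2}.
Context (L0 : 0 < L) (s0 : 0 < s) (c10 : 0 < c1) (c20 : 0 < c2).
Context (adm : admissible_symbol s c1 c2 m).
Local Notation X := (Xspace L s).
Local Notation wt := (sweight s).
Implicit Types (u v w : R -> 'cV[R]_2).

Definition msymb (n : nat) : 'M[R]_2 := m (zint n)%:~R.

Lemma msymb_bounds n a : c1 * freq n `^ s * dot a a <= dot (msymb n *m a) a <=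
  c2 * freq n `^ s * dot a a.
Proof.
have [_ _ _ H] := adm.
have [a0|an] := eqVneq (dot a a) 0.
  by rewrite (dot_eq0 a0) mulmx0 dot0l !mulr0 lexx.
have ap : 0 < dot a a by rewrite lt_def an dot_ge0.
pose t := (Num.sqrt (dot a a))^-1.
have t2 : t ^+ 2 = (dot a a)^-1 by rewrite exprVn sqr_sqrtr// dot_ge0.
have e1 : dot (t *: a) (t *: a) = 1.
  by rewrite (bilin_sqZ trueS dot_bilin)// t2 mulVf.
have := H (zint n) (t *: a) e1; rewrite freqE -/(msymb n) -scalemxAr.
rewrite (bilinZl trueS dot_bilin)// (bilinZr trueS dot_bilin)// mulrA -expr2 t2.
by rewrite ler_pdivlMl// ler_pdivrMl// ![dot a a * _]mulrC.
Qed.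

Lemma msymb_sym n a b : dot (msymb n *m a) b = dot (msymb n *m b) a.
Proof.
have [tr _ _ _] := adm; rewrite !dot_mulmx exchange_big; apply: eq_bigr => i _.
apply: eq_bigr => j _; have /matrixP/(_ i j) := tr (zint n); rewrite mxE /msymb => ->.
by ring.
Qed.

Lemma freq_pow_ge0 n : 0 <= freq n `^ s :> R. Proof. exact: powR_ge0. Qed.

Lemma msymb_psd n a : 0 <= dot (msymb n *m a) a.
Proof.
have /andP[le _] := msymb_bounds n a; apply: le_trans le.
by rewrite mulr_ge0 ?dot_ge0// mulr_ge0 ?freq_pow_ge0// ltW.
Qed.

Lemma msymb_dominated : dominated (s := s) msymb (c2 / 2).
Proof.
move=> n a b.
have bm : bilin (fun=> True) (fun a b => dot (msymb n *m a) b).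
  split=> [x y _ _|k x y z _ _ _]; first exact: msymb_sym.
  by rewrite mulmxDr -scalemxAr dot_lin.
have CS := psd_CS trueS bm (fun x _ => msymb_psd n x) (u := a) (v := b) Logic.I Logic.I.
have /andP[_ ha] := msymb_bounds n a; have /andP[_ hb] := msymb_bounds n b.
have a0 := msymb_psd n a; have b0 := msymb_psd n b.
have da := dot_ge0 a; have db := dot_ge0 b.
have f0 := freq_pow_ge0 n; have fw := freq_pow_le s0 n.
set F := freq n `^ s in ha hb f0 fw.
have cF : 0 <= c2 * F by rewrite mulr_ge0// ltW.
have cw : c2 * F <= c2 * wt n by rewrite ler_wpM2l// ltW.
have K0 : 0 <= c2 / 2 * wt n * (dot a a + dot b b).
  by rewrite mulr_ge0 ?addr_ge0// mulr_ge0 ?sweight_ge0// divr_ge0// ltW.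
rewrite -(@ler_pXn2r _ 2) ?nnegrE// real_normK ?num_real//.
apply: (le_trans CS); apply: (@le_trans _ _ ((c2 * wt n * dot a a) * (c2 * wt n * dot b b))).
  apply: ler_pM => //; [apply: le_trans ha _|apply: le_trans hb _]; exact: ler_wpM2r.
have := sqr_ge0 (dot a a - dot b b) => sq.
have c2w : 0 <= (c2 * wt n) ^+ 2 by exact: sqr_ge0.
rewrite -subr_ge0 (_ : _ - _ = (c2 * wt n) ^+ 2 * (dot a a - dot b b) ^+ 2 / 4).
  by rewrite divr_ge0// mulr_ge0.
by field.
Qed.

Lemma qform_subseq (f : R^nat) (l : R) : f @ \oo --> l ->
  (fun n => f n.*2.+1) @ \oo --> l.
Proof.
move=> H; apply: cvg_comp H; apply/cvgnyPge => A; exists A => // n /= An.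
by rewrite -addnn (leq_trans An)// ltnW// ltnS leq_addr.
Qed.

Lemma Mform_qform u v : X u -> X v -> Mform L m u v = qform (L := L) msymb u v.
Proof.
move=> Xu Xv; have [_ mN _ _] := adm.
rewrite (MformE L0 (X_L2 Xu) (X_L2 Xv) mN); congr (_ * _); apply/cvg_lim => //.
apply: (qform_subseq (f := qseries L msymb u v)).
exact: (qseries_cvg L0 s0 msymb_dominated Xu Xv).
Qed.

Lemma Mform_bilin : bilin X (Mform L m).
Proof.
have [qC qL] := qform_bilin L0 s0 msymb_dominated msymb_sym (L := L).
have sX := X_subspace L0 s0.
split=> [u v Xu Xv|a u v w Xu Xv Xw].
  rewrite (Mform_qform Xu Xv) (Mform_qform Xv Xu); exact: qC.
have Xuv := sX.2 a u v Xu Xv.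
by rewrite (Mform_qform Xuv Xw) (Mform_qform Xu Xw) (Mform_qform Xv Xw); exact: qL.
Qed.

Lemma Mform_ge u : X u ->
  c1 / 2 `^ (s / 2) * (xdot (L := L) (s := s) u u - L2dot L u u) <= Mform L m u u.
Proof.
move=> Xu; rewrite (Mform_qform Xu Xu) (L2dot_qform L0 (X_L2 Xu) (X_L2 Xu)).
have p0 : 0 < 2 `^ (s / 2) :> R by rewrite powR_gt0.
have dW := dominated_weight (s := s) s0; have d1 := dominated1 (s := s) s0.
have dD : dominated (s := s) (fun n => (wt n - 1)%:M) 1.
  move=> n a b; rewrite dot_scalar normrM ger0_norm ?subr_ge0 ?sweight_ge1//.
  rewrite mul1r; have := dot_le a b; have := sweight_ge1 s0 n.
  by have := dot_ge0 a; have := dot_ge0 b; have := normr_ge0 (dot a b); nra.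
have E : xdot (L := L) (s := s) u u - qform (L := L) (fun=> 1%:M) u u =
    qform (L := L) (fun n => (wt n - 1)%:M) u u.
  rewrite /xdot /qform -mulrBr; congr (_ * _).
  have cW := qseries_cvg L0 s0 dW Xu Xu; have cc := qseries_cvg L0 s0 d1 Xu Xu.
  apply/esym/cvg_lim => //.
  rewrite (_ : qseries _ _ _ _ = (fun N => qseries L (fun n => (wt n)%:M) u u N -
      qseries L (fun=> 1%:M) u u N)); first by apply: cvgB; [exact: cW|exact: cc].
  apply/funext => N; rewrite /qseries !seriesEnat/= -sumrB; apply: eq_bigr => n _.
  by rewrite !dot_scalar; ring.
rewrite E mulrAC ler_pdivrMr// [leRHS]mulrC -ler_pdivlMl// mulrA.
apply: (qform_le L0 s0 dD msymb_dominated Xu) => n a.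
have /andP[H _] := msymb_bounds n a.
rewrite dot_scalar -mulrA ler_pdivlMl//.
have h1 := sweight_le s0 n; have h2 := dot_ge0 a.
have h3 : (wt n - 1) * dot a a <= 2 `^ (s / 2) * freq n `^ s * dot a a.
  by apply: ler_wpM2r => //; lra.
have h4 := ler_wpM2l (ltW c10) h3; have h5 := ler_wpM2l (ltW p0) H.
by apply: le_trans h4 _; apply: le_trans h5; rewrite le_eqVlt; apply/orP; left; apply/eqP; ring.
Qed.

Lemma Mform_le u : X u -> Mform L m u u <= c2 * xdot (L := L) (s := s) u u.
Proof.
move=> Xu; rewrite (Mform_qform Xu Xu).
apply: (qform_le L0 s0 msymb_dominated (dominated_weight s0) Xu) => n a.
have /andP[_ H] := msymb_bounds n a; apply: le_trans H _.
rewrite dot_scalar mulrA ler_wpM2r ?dot_ge0// ler_wpM2l ?(ltW c20)//.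
exact: freq_pow_le.
Qed.

Lemma multiplier_coef u w k i :
  fourier L (component w i) k =
    \sum_(j < 2) ((m k%:~R i j)%:C)%C * fourier L (component u j) k <->
  acoef L (component w i) k = \sum_j m k%:~R i j * acoef L (component u j) k /\
  bcoef L (component w i) k = \sum_j m k%:~R i j * bcoef L (component u j) k.
Proof.
have E : \sum_(j < 2) ((m k%:~R i j)%:C)%C * fourier L (component u j) k =
    ((\sum_j m k%:~R i j * acoef L (component u j) k)
    -i* (\sum_j m k%:~R i j * bcoef L (component u j) k))%C.
  have fu j : fourier L (component u j) k = (acoef L (component u j) k
    -i* bcoef L (component u j) k)%C by rewrite fourierE.
  under eq_bigr do rewrite fu.
  apply/eqP; rewrite eq_complex; apply/andP; split; apply/eqP; rewrite raddf_sum/=.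
    by apply: eq_bigr => j _; ring.
  by rewrite -sumrN; apply: eq_bigr => j _; ring.
rewrite E fourierE; split=> [[] -> /oppr_inj -> //|[-> ->] //].
Qed.

Lemma multiplier_hcoef u w : is_multiplier L m u w ->
  forall n, hcoef L w n = msymb n *m hcoef L u n.
Proof.
move=> [lu lw H] n; apply/matrixP => i j0; rewrite ord1 {j0} [RHS]mxE (hcoefE _ _ lw).
have /multiplier_coef[-> ->] := H (zint n) i.
rewrite -big_split/=; apply: eq_bigr => j _.
by rewrite (hcoefE _ _ lu) mulrDr.
Qed.

Lemma hcoef_multiplier u w : L2per L u -> L2per L w ->
  (forall n, hcoef L w n = msymb n *m hcoef L u n) -> is_multiplier L m u w.
Proof.
move=> lu lw H; split=> // k i; apply/multiplier_coef.
have [_ mN _ _] := adm.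
have cu j := L2s_CI ((L2perP u).1 lu j); have cw j := L2s_CI ((L2perP w).1 lw j).
have K (k' : int) : acoef L (component w i) k' + bcoef L (component w i) k' =
    \sum_j m k'%:~R i j * (acoef L (component u j) k' + bcoef L (component u j) k').
  have [n <-] := zint_surj k'; rewrite -(hcoefE _ _ lw) H mxE.
  by apply: eq_bigr => j _; rewrite (hcoefE _ _ lu).
have K1 := K k; have K2 := K (- k).
rewrite acoefN (bcoefN _ (cw i)) in K2.
have K2' : acoef L (component w i) k - bcoef L (component w i) k =
    \sum_j m k%:~R i j * (acoef L (component u j) k - bcoef L (component u j) k).
  by rewrite K2; apply: eq_bigr => j _; rewrite acoefN (bcoefN _ (cu j)) intrN mN.
move: K1 K2'; set a := acoef _ _ _; set b := bcoef _ _ _ => K1 K2'; split.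
- have -> : a = 2^-1 * ((a + b) + (a - b)) by field.
  by rewrite K1 K2' -big_split mulr_sumr/=; apply: eq_bigr => j _; field.
- have -> : b = 2^-1 * ((a + b) - (a - b)) by field.
  by rewrite K1 K2' -sumrB mulr_sumr/=; apply: eq_bigr => j _; field.
Qed.

Lemma Mform_multiplier u v w : is_multiplier L m u w -> L2per L v ->
  Mform L m u v = L2dot L w v.
Proof.
move=> mul lv; have [lu lw _] := mul; have [_ mN _ _] := adm.
rewrite (MformE L0 lu lv mN).
have P := hartley_parseval L0 lw lv.
have -> : limn (fun n => qseries L (fun n => m (zint n)%:~R) u v n.*2.+1) = L^-1 * L2dot L w v.
  apply/cvg_lim => //; apply: (qform_subseq (f := qseries L msymb u v)).
  rewrite (_ : qseries L msymb u v = series (fun n => dot (hcoef L w n) (hcoef L v n)))//.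
  by congr series; apply/funext => n; rewrite (multiplier_hcoef mul).
by rewrite mulrA divff ?mul1r// gt_eqF.
Qed.

End Symbol.

(** * Periodic bumps *)

Section Bumps.
Context {R : realType} {L : R} (L0 : 0 < L).
Notation mu := (@lebesgue_measure R).
Local Notation I L f := (\int[mu]_(x in `[0, L]) f x).
Implicit Types (x y z w : R).

Definition lattice_dist x : R :=
  let t := x - (Num.floor (x / L))%:~R * L in Num.min t (L - t).
Local Notation D := lattice_dist.

Lemma lattice_offset x : 0 <= x - (Num.floor (x / L))%:~R * L < L.
Proof.
have /andP[h1 h2] := mem_rg1_floor (x / L).
move: h1 h2; rewrite ler_pdivlMr// ltr_pdivrMr// mulrDl mul1r => h1 h2.
by apply/andP; split; lra.
Qed.

Lemma lattice_dist_le x (k : int) : D x <= `|x - k%:~R * L|.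
Proof.
have /andP[h1 h2] := lattice_offset x; rewrite /D; move: h1 h2.
set f := Num.floor _; set t := x - f%:~R * L => h1 h2.
have -> : x - k%:~R * L = t + (f - k)%:~R * L by rewrite /t intrB; ring.
have [fk|fk] := leP k f.
  have h : 0 <= (f - k)%:~R * L by rewrite mulr_ge0 ?(ltW L0)// ler0z subr_ge0.
  by rewrite (ger0_norm (addr_ge0 h1 h)); apply: (@le_trans _ _ t); rewrite ?lerDl// ge_min lexx.
have h : (f - k)%:~R * L <= - L.
  rewrite -(mulN1r L) ler_pM2r// -[-1]/((-1)%:~R) ler_int; lia.
have h0 : t + (f - k)%:~R * L <= 0 by lra.
by rewrite (ler0_norm h0); apply: (@le_trans _ _ (L - t)); [rewrite ge_min lexx orbT|lra].
Qed.

Lemma lattice_dist_attained x : exists k : int, D x = `|x - k%:~R * L|.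
Proof.
have /andP[h1 h2] := lattice_offset x; rewrite /D; move: h1 h2.
set f := Num.floor _; set t := x - f%:~R * L => h1 h2.
have [_|_] := leP t (L - t); first by exists f; rewrite ger0_norm.
exists (f + 1); rewrite (_ : x - _ = t - L); last by rewrite /t intrD; ring.
by rewrite distrC ger0_norm//; lra.
Qed.

Lemma lattice_dist_lip x y : D x <= D y + `|x - y|.
Proof.
have [k ->] := lattice_dist_attained y.
apply: le_trans (lattice_dist_le x k) _.
have -> : x - k%:~R * L = (x - y) + (y - k%:~R * L) by ring.
by rewrite addrC ler_normD.
Qed.

Lemma lattice_dist_periodic : periodic D L.
Proof.
move=> x; rewrite /D mulrDl divff ?gt_eqF//.
by rewrite floorDrz ?rpred1// floor1 intrD mulrDl mul1r opprD addrACA subrr addr0.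
Qed.

Lemma lattice_dist_itv x : 0 <= x <= L -> D x = Num.min x (L - x).
Proof.
move=> /andP[x0]; rewrite le_eqVlt => /predU1P[->|xL].
  have := lattice_dist_periodic 0; rewrite add0r => ->.
  by rewrite /D mul0r floor0 mul0r subr0 subrr subr0 minC.
rewrite /D (_ : Num.floor (x / L) = 0) ?mul0r ?subr0//.
by apply/floor_def; rewrite divr_ge0 ?(ltW L0)//= add0r ltr_pdivrMr// mul1r.
Qed.

Lemma lipschitz_measurable (f : R -> R) (K : R) :
  (forall x y, `|f x - f y| <= K * `|x - y|) -> measurable_fun [set: R] f.
Proof.
move=> lf; apply: continuous_measurable_fun => x.
have K1 : 0 < `|K| + 1 by have := normr_ge0 K; lra.
apply/cvgrPdist_lt => e e0; near=> y.
apply: le_lt_trans (lf x y) _; apply: (@le_lt_trans _ _ ((`|K| + 1) * `|x - y|)).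
  by apply: ler_wpM2r => //; have := ler_norm K; lra.
rewrite -ltr_pdivlMl//; near: y; apply: cvgr_dist_lt; last by rewrite mulr_gt0 ?invr_gt0.
exact: cvg_id.
Unshelve. all: by end_near.
Qed.

Lemma lattice_dist_lip_norm x y : `|D x - D y| <= 1 * `|x - y|.
Proof.
have h1 := lattice_dist_lip x y; have h2 := lattice_dist_lip y x.
by rewrite mul1r ler_norml; rewrite distrC in h2; apply/andP; split; lra.
Qed.

Lemma clampE (a : R) : Num.max 0 (Num.min 1 a) = if a <= 0 then 0 else if a <= 1 then a else 1.
Proof.
case: (lerP a 0) => h0.
  by rewrite (@min_r _ _ 1 a) ?max_l//; lra.
case: (lerP a 1) => h1; first by rewrite (max_r (ltW h0)).
by rewrite (max_r ler01).
Qed.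

Definition trapezoid (z r : R) x : R := Num.max 0 (Num.min 1 (2 - D (x - z) / r)).

Section Fixed.
Context (z r : R) (r0 : 0 < r).
Local Notation f := (trapezoid z r).

Lemma trapezoid_itv x : 0 <= f x <= 1.
Proof. by rewrite /trapezoid le_max lexx ge_max ler01 ge_min lexx. Qed.

Lemma trapezoid1 x : D (x - z) <= r -> f x = 1.
Proof.
move=> h; rewrite /trapezoid; have h1 : D (x - z) / r <= 1 by rewrite ler_pdivrMr// mul1r.
by rewrite min_l ?max_r//; lra.
Qed.

Lemma trapezoid0 x : 2 * r <= D (x - z) -> f x = 0.
Proof.
move=> h; rewrite /trapezoid; have h1 : 2 <= D (x - z) / r by rewrite ler_pdivlMr.
by rewrite max_l// ge_min; apply/orP; right; lra.
Qed.

Lemma trapezoid_lip x y : `|f x - f y| <= r^-1 * `|x - y|.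
Proof.
have cl (a b : R) : `|Num.max 0 (Num.min 1 a) - Num.max 0 (Num.min 1 b)| <= `|a - b|.
  wlog ab : a b / a <= b.
    by move=> H; case: (leP a b) => [/H//|/ltW/H]; rewrite distrC [leRHS]distrC.
  rewrite distrC [leRHS]distrC ger0_norm; last first.
    rewrite subr_ge0 !clampE.
    by repeat (case: ifPn; rewrite -?ltNge => ?); lra.
  rewrite ger0_norm ?subr_ge0//.
  by rewrite !clampE; repeat (case: ifPn; rewrite -?ltNge => ?); lra.
apply: le_trans (cl _ _) _; rewrite (_ : _ - _ = r^-1 * (D (y - z) - D (x - z))); last by ring.
rewrite normrM gtr0_norm ?invr_gt0// ler_pM2l ?invr_gt0// distrC.
apply: le_trans (lattice_dist_lip_norm _ _) _.
by rewrite mul1r (_ : x - z - _ = x - y)//; ring.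
Qed.

Lemma trapezoid_periodic : periodic f L.
Proof. by move=> x; rewrite /trapezoid (addrAC x) lattice_dist_periodic. Qed.

Lemma measurable_trapezoid : measurable_fun [set: R] f.
Proof. exact: lipschitz_measurable trapezoid_lip. Qed.

Definition near_lattice x : R := (D x < 2 * r)%R%:R.

Lemma measurable_near_lattice : measurable_fun [set: R] near_lattice.
Proof.
have mD := lipschitz_measurable lattice_dist_lip_norm.
have -> : near_lattice = (\1_(D @^-1` `]-oo, 2 * r[%classic) : R -> R).
  apply/funext => x; rewrite indicE /near_lattice.
    have [h|h] := ltP (D x) (2 * r); first by rewrite mem_set//= in_itv.
    by rewrite memNset//= in_itv/=; apply/negP; rewrite -leNgt.
by apply: measurable_indic; rewrite -[_ @^-1` _]setTI; exact: mD.
Qed.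

Lemma near_lattice_periodic : periodic near_lattice L.
Proof. by move=> x; rewrite /near_lattice lattice_dist_periodic. Qed.

Lemma near_lattice_CI : CI L near_lattice.
Proof.
apply: (@CI_bounded _ _ _ 1); first exact: measurable_near_lattice.
by move=> x; rewrite /near_lattice; case: (_ < _); rewrite ?normr1 ?normr0.
Qed.

Lemma int_near_lattice : I L near_lattice <= 4 * r.
Proof.
have mI (a b : R) : a <= b -> [/\ CI L (\1_(`[a, b]%classic : set R) : R -> R) &
    I L (\1_(`[a, b]%classic : set R) : R -> R) <= b - a].
  move=> ab; have c : CI L (\1_(`[a, b]%classic : set R) : R -> R).
    apply: (@CI_bounded _ _ _ 1); first by apply: measurable_indic; exact: measurable_itv.
    by move=> x; rewrite indicE; case: (_ \in _); rewrite ?normr1 ?normr0.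
  split=> //; rewrite /Rintegral.
  rewrite integral_indic; [|exact: mper|exact: measurable_itv].
  have le : (mu (`[a, b] `&` `[0%R, L]) <= (b - a)%:E)%E.
    apply: (@le_trans _ _ (mu (`[a, b]%classic : set R))); first exact: measureIl.
    rewrite lebesgue_measure_itv/= lte_fin; case: ltP => h//.
    by rewrite lee_fin subr_ge0.
  have fn : mu (`[a, b] `&` `[0%R, L]) \is a fin_num.
    by rewrite ge0_fin_numE//; exact: le_lt_trans le (ltry _).
  by rewrite -lee_fin (fineK fn).
have r20 : 0 <= 2 * r by rewrite mulr_ge0 ?(ltW r0).
have r2L : L - 2 * r <= L by rewrite gerBl.
have [cA lA] := mI _ _ r20; have [cB lB] := mI _ _ r2L.
have lAB := lerD lA lB.
pose A := `[0, 2 * r]%classic; pose B := `[L - 2 * r, L]%classic.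
apply: (@le_trans _ _ (I L (fun x => (\1_A : R -> R) x + (\1_B : R -> R) x))); last first.
  by rewrite (intD cA cB); apply: le_trans lAB _; rewrite le_eqVlt; apply/orP; left; apply/eqP; ring.
have [_ IN] := near_lattice_CI; have [_ IAB] := CID cA cB.
apply: (le_Rintegral (mper L) IN IAB) => x /=; rewrite in_itv/= => xL.
have /andP[x0 xl] := xL; rewrite /near_lattice lattice_dist_itv// gt_min !indicE.
case: (ltP x (2 * r)) => /= h1.
  have -> : x \in A by rewrite inE /A /= in_itv/= x0 ltW.
  by rewrite lerDl.
case: (ltP (L - x) (2 * r)) => /= h2; last by rewrite addr_ge0.
have -> : x \in B by rewrite inE /B /= in_itv/= xl andbT; lra.
by rewrite lerDr.
Qed.

End Fixed.
End Bumps.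

Section VectorBump.
Context {R : realType} {L : R} (L0 : 0 < L).
Notation mu := (@lebesgue_measure R).
Local Notation I L f := (\int[mu]_(x in `[0, L]) f x).
Implicit Types (u v w : R -> 'cV[R]_2).

Definition bump (z r : R) (a : 'cV[R]_2) : R -> 'cV[R]_2 := fun x => trapezoid (L := L) z r x *: a.

Section Fixed.
Context (z r : R) (r0 : 0 < r) (a : 'cV[R]_2).
Local Notation f := (trapezoid (L := L) z r).

Lemma bump_L2per : L2per L (bump z r a).
Proof.
apply/L2perP => i; rewrite (_ : component _ i = fun x => f x * a i 0); last first.
  by apply/funext => x; rewrite /component /bump mxE.
apply: (@L2s_bounded _ _ _ `|a i 0|) => [x||x].
- by rewrite (trapezoid_periodic L0).
- by apply: measurable_funM => //; exact: measurable_trapezoid.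
- have /andP[f0 f1] := trapezoid_itv (L := L) z r x.
  by rewrite normrM ger0_norm// ler_piMl.
Qed.

Lemma dot_scale (k : R) : dot (k *: a) (k *: a) = k ^+ 2 * dot a a.
Proof. exact: (bilin_sqZ trueS dot_bilin). Qed.

Lemma near_lattice_shift_CI y : CI L (fun x => near_lattice (L := L) r (x + y)).
Proof. exact: (CI_shift y L0 (near_lattice_periodic L0 r) (near_lattice_CI L0 r)). Qed.

Lemma near_lattice_shift_int y : I L (fun x => near_lattice (L := L) r (x + y)) <= 4 * r.
Proof.
rewrite (int_shift y L0 (near_lattice_periodic L0 r)); first exact: int_near_lattice.
exact: (near_lattice_CI L0 r).1.
Qed.

Lemma trapezoid_near x : f x != 0 -> near_lattice (L := L) r (x - z) = 1.
Proof.
apply: contraNeq; rewrite /near_lattice; case: ltP => [_|h _]; first by rewrite eqxx.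
by rewrite (trapezoid0 r0 h).
Qed.

Lemma near_lattice_ge0 x : 0 <= near_lattice (L := L) r x.
Proof. exact: ler0n. Qed.

Lemma bump_L2dot : L2dot L (bump z r a) (bump z r a) <= 4 * r * dot a a.
Proof.
have lb := bump_L2per; have cN := near_lattice_shift_CI (- z).
apply: (@le_trans _ _ (I L (fun x => dot a a * near_lattice (L := L) r (x - z)))).
  apply: int_le; [exact: (CI_dot lb lb)|exact: CIZ|move=> x].
  rewrite /bump dot_scale mulrC; apply: ler_wpM2l; first exact: dot_ge0.
  have [->|/trapezoid_near ->] := eqVneq (f x) 0.
    by rewrite expr0n/= near_lattice_ge0.
  have /andP[f0 f1] := trapezoid_itv (L := L) z r x.
  by rewrite expr_le1.
rewrite (intZ _ cN) mulrC; apply: ler_wpM2r; first exact: dot_ge0.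
exact: near_lattice_shift_int.
Qed.

Lemma bump_translate_diff y :
  L2dot L (translate y (bump z r a) - bump z r a) (translate y (bump z r a) - bump z r a) <=
  8 * r^-1 * dot a a * y ^+ 2.
Proof.
have lb := bump_L2per; have lt := L2per_translate L0 y lb.
have ld := subspaceB (L2per_subspace (L := L)) lt lb.
have cN := near_lattice_shift_CI (- z); have cN' := near_lattice_shift_CI (y - z).
set k := dot a a * (r^-1 * y) ^+ 2.
have k0 : 0 <= k by rewrite mulr_ge0 ?dot_ge0// sqr_ge0.
apply: (@le_trans _ _ (I L (fun x => k * (near_lattice (L := L) r (x - z) +
    near_lattice (L := L) r (x + (y - z)))))).
  apply: int_le; [exact: (CI_dot ld ld)|by apply: CIZ; exact: CID|move=> x].
  have -> : (translate y (bump z r a) - bump z r a) x = (f (x + y) - f x) *: a.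
    by rewrite -[LHS]/(f (x + y) *: a - f x *: a) scalerBl.
  rewrite dot_scale mulrC /k -mulrA; apply: ler_wpM2l; first exact: dot_ge0.
  have lip : (f (x + y) - f x) ^+ 2 <= (r^-1 * y) ^+ 2.
    have := trapezoid_lip L0 z r0 (x + y) x; rewrite addrAC subrr add0r => h.
    rewrite -real_normK ?num_real// -[leRHS]real_normK ?num_real// ler_pXn2r ?nnegrE//.
    by rewrite normrM (@gtr0_norm _ r^-1) ?invr_gt0.
  have [f1|/trapezoid_near h] := eqVneq (f x) 0; last first.
    apply: le_trans lip _; rewrite h; apply: ler_peMr; first exact: sqr_ge0.
    by rewrite lerDl near_lattice_ge0.
  have [f2|/trapezoid_near h] := eqVneq (f (x + y)) 0; last first.
    apply: le_trans lip _; rewrite addrA h; apply: ler_peMr; first exact: sqr_ge0.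
    by rewrite lerDr near_lattice_ge0.
  rewrite f1 f2 subrr expr0n/=; apply: mulr_ge0; first exact: sqr_ge0.
  by rewrite addr_ge0 ?near_lattice_ge0.
rewrite intZ; last exact: CID.
rewrite intD//; apply: (@le_trans _ _ (k * (8 * r))).
  apply: ler_wpM2l => //; have := near_lattice_shift_int (- z).
  by have := near_lattice_shift_int (y - z); lra.
by rewrite /k le_eqVlt; apply/orP; left; apply/eqP; field; rewrite gt_eqF.
Qed.

End Fixed.

Lemma cos_quadratic : exists2 eta : R, 0 < eta &
  forall t : R, `|t| < eta -> t ^+ 2 / 4 <= 2 - 2 * cos t.
Proof.
have : \forall t \near (0 : R), 2^-1 < cos t.
  have : cos x @[x --> (0 : R)] --> (1 : R) by rewrite -[X in _ --> X]cos0; exact: continuous_cos.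
  move=> /cvgr_gt; apply; by rewrite invf_lt1// ltr1n.
move=> /nbhs_ballP[e /= e0 He]; exists e => // t te.
have half (x : R) : 0 <= x -> x < e -> x / 2 <= sin x.
  move=> x0 xe; have [->|xn] := eqVneq x 0; first by rewrite sin0 mul0r.
  have xp : 0 < x by rewrite lt_def xn.
  have [c] := @MVT R sin cos 0 x xp (fun y _ => is_derive_sin y)
    (continuous_subspaceT (@continuous_sin R)).
  rewrite in_itv/= => /andP[c0 cx]; rewrite sin0 !subr0 => ->.
  rewrite mulrC ler_wpM2r// ltW//; apply: He.
  by rewrite /ball/= sub0r normrN gtr0_norm//; exact: lt_trans xe.
have h := half (`|t| / 2) (divr_ge0 (normr_ge0 t) (ler0n _ 2)) _.
have {}h : `|t| / 2 / 2 <= sin (`|t| / 2) by apply: h; have := normr_ge0 t; lra.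
have ct : cos t = cos (`|t|) by case: (ger0P t) => //; rewrite cosN.
have -> : 2 - 2 * cos t = 4 * sin (`|t| / 2) ^+ 2.
  rewrite ct {1}(splitr `|t|) cosD; have := cos2Dsin2 (`|t| / 2) => E.
  have -> : cos (`|t| / 2) * cos (`|t| / 2) = 1 - sin (`|t| / 2) ^+ 2 by apply/esym/eqP; rewrite subr_eq -expr2 E.
  by ring.
have h2 : (`|t| / 2 / 2) ^+ 2 <= sin (`|t| / 2) ^+ 2.
  by rewrite ler_pXn2r// nnegrE ?divr_ge0//; apply: le_trans h; rewrite ?divr_ge0.
rewrite -real_normK ?num_real//; move: h2; rewrite !exprMn.
by move: (`|t| ^+ 2) (sin _ ^+ 2) => A B; lra.
Qed.

Lemma fourier_diff u v i k : L2per L u -> L2per L v ->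
  acoef L (component (u - v) i) k = acoef L (component u i) k - acoef L (component v i) k /\
  bcoef L (component (u - v) i) k = bcoef L (component u i) k - bcoef L (component v i) k.
Proof.
move=> /L2perP lu /L2perP lv; have cu := L2s_CI (lu i); have cv := L2s_CI (lv i).
have K (h : R -> R) : measurable_fun [set: R] h -> (forall x, `|h x| <= 1) ->
    I L (fun x => component (u - v) i x * h x) =
    I L (fun x => component u i x * h x) - I L (fun x => component v i x * h x).
  move=> mh h1; rewrite -intB; [|exact: CI_mul_bounded cu mh h1|exact: CI_mul_bounded cv mh h1].
  by apply: int_ext => x; rewrite /component !mxE; ring.
rewrite /acoef /bcoef -!mulrBr; split; congr (_ * _); apply: K.
- exact: measurable_cos_phase.
- by move=> x; exact: cos_max.
- exact: measurable_sin_phase.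
- by move=> x; exact: sin_max.
Qed.

Lemma translate_diff_sum w y N : L2per L w ->
  \sum_(n < N) (2 - 2 * cos (phase L (zint n) y)) * dot (hcoef L w n) (hcoef L w n) <=
  L^-1 * L2dot L (translate y w - w) (translate y w - w).
Proof.
move=> lw; have lt := L2per_translate L0 y lw.
have lv := subspaceB (L2per_subspace (L := L)) lt lw; set v := _ - w in lv *.
have W0 k : 0 <= 2 - 2 * cos (phase L k y) :> R by have := cos_le1 (phase L k y); lra.
have WN k : 2 - 2 * cos (phase L (- k) y) = 2 - 2 * cos (phase L k y) :> R.
  by rewrite phaseN cosN.
have E := fourier_hcoef_esum L0 lw W0 WN.
have E1 := fourier_hcoef_esum L0 lv (fun=> ler01) (fun=> erefl 1).
apply: (sum_le_nneseries (f := fun n =>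
  (2 - 2 * cos (phase L (zint n) y)) * dot (hcoef L w n) (hcoef L w n))).
  by move=> n; rewrite mulr_ge0 ?dot_ge0.
rewrite -E.
have -> : (\esum_(k in [set: int]) ((2 - 2 * cos (phase L k y)) *
     \sum_(i < 2) sqmod (fourier L (component w i) k))%:E =
   \esum_(k in [set: int]) (1 * \sum_(i < 2) sqmod (fourier L (component v i) k))%:E)%E.
  apply: eq_esum => k _; congr (_%:E); rewrite mul1r mulr_sumr; apply: eq_bigr => i _.
  rewrite !fourierE /sqmod/=.
  have [-> ->] := fourier_diff i k lt lw; have [-> ->] := fourier_translate L0 y i k lw.
  have H := cos2Dsin2 (phase L k y).
  set C := cos _ in H *; set S := sin _ in H *; set A := acoef _ _ _; set B := bcoef _ _ _.
  transitivity ((1 + (C ^+ 2 + S ^+ 2) - 2 * C) * (A ^+ 2 + (- B) ^+ 2)); last by ring.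
  by rewrite H; ring.
rewrite E1; have P := hartley_parseval L0 lv lv.
have f0 n : 0 <= 1 * dot (hcoef L v n) (hcoef L v n) by rewrite mul1r dot_ge0.
have nd : nondecreasing_seq (series (fun n => dot (hcoef L v n) (hcoef L v n))).
  by apply: nondecreasing_series => n _ _; exact: dot_ge0.
have B M : \sum_(n < M) 1 * dot (hcoef L v n) (hcoef L v n) <= L^-1 * L2dot L v v.
  have := nondecreasing_cvgn_le nd (cvgP _ P) M; rewrite (cvg_lim _ P)// seriesEnat/= big_mkord.
  by under [in X in _ -> X]eq_bigr do rewrite mul1r.
have [_ ->] := series_EFin_lim f0 B; rewrite lee_fin.
have -> : series (fun n => 1 * dot (hcoef L v n) (hcoef L v n)) =
    series (fun n => dot (hcoef L v n) (hcoef L v n)).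
  by congr series; apply/funext => n; rewrite mul1r.
by rewrite (cvg_lim _ P).
Qed.

(** An L2 bound on the difference quotients bounds the H^1 energy: at frequencies
below any given N, a small enough shift y makes [2 - 2 cos] of the phase
comparable with its square. *)
Lemma H1_of_translations : exists2 C : R, 0 <= C & forall w (K : R), L2per L w ->
  (forall y, L2dot L (translate y w - w) (translate y w - w) <= K * y ^+ 2) ->
  forall N, L * \sum_(n < N) freq n ^+ 2 * dot (hcoef L w n) (hcoef L w n) <= C * K.
Proof.
have [eta eta0 Heta] := cos_quadratic.
exists ((L / pi) ^+ 2); first exact: sqr_ge0.
move=> w K lw HK N; have pi0 := pi_gt0 R.
have N0 : 0 < N.+1%:R :> R by rewrite ltr0n.
have [y y0 yE] : exists2 y : R, 0 < y & y = eta * L / (4 * pi * N.+1%:R).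
  by eexists; last reflexivity; rewrite divr_gt0 ?mulr_gt0.
have H n : (n < N)%N -> (pi * y / L) ^+ 2 * freq n ^+ 2 <= 2 - 2 * cos (phase L (zint n) y).
  move=> nN; have E : `|phase L (zint n) y| = 2 * pi * freq n * y / L.
    by rewrite /phase !normrM normfV freqE (gtr0_norm pi0) (gtr0_norm y0) (gtr0_norm L0) ger0_norm.
  have fN : freq n <= N.+1%:R :> R.
    by rewrite /freq ler_nat uphalfE; have := odd_double_half n.+1; rewrite -addnn; lia.
  apply: le_trans (Heta _ _); last first.
    rewrite E; apply: (@le_lt_trans _ _ (2 * pi * N.+1%:R * y / L)).
      by rewrite ler_pM2r ?invr_gt0// ler_pM2r// ler_pM2l// mulr_gt0.
    rewrite yE; move: N.+1%:R N0 (pi : R) pi0 => M M0 p p0; rewrite (_ : _ / L = eta / 2); first by lra.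
    by field; rewrite !gt_eqF.
  rewrite -(real_normK (num_real (phase L (zint n) y))) E le_eqVlt.
  by apply/orP; left; apply/eqP; field; rewrite gt_eqF.
have := translate_diff_sum y N lw; move: (HK y) => h1 h2.
have p2 : 0 < (pi * y / L) ^+ 2 by rewrite exprn_gt0// divr_gt0// mulr_gt0.
have h3 : (pi * y / L) ^+ 2 * \sum_(n < N) freq n ^+ 2 * dot (hcoef L w n) (hcoef L w n) <=
    L^-1 * (K * y ^+ 2).
  apply: (le_trans _ (le_trans h2 _)); last by rewrite ler_pM2l ?invr_gt0.
  rewrite mulr_sumr; apply: ler_sum => n _; rewrite mulrA; apply: ler_wpM2r; first exact: dot_ge0.
  exact: H.
rewrite -(ler_pM2l p2); rewrite mulrCA; apply: (le_trans (ler_wpM2l (ltW L0) h3)).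
rewrite le_eqVlt; apply/orP; left; apply/eqP.
by move: (pi : R) pi0 => p p0; field; rewrite !gt_eqF.
Qed.

End VectorBump.

Section Hump.
Context {R : realType} {L s : R} (L0 : 0 < L) (s0 : 0 < s).
Local Notation c := (hcoef L).
Local Notation wt := (sweight s).
Local Notation X := (Xspace L s).
Local Notation xd := (xdot (L := L) (s := s)).
Local Notation D := (lattice_dist (L := L)).
Implicit Types (u v w : R -> 'cV[R]_2).

Lemma ler_add3 (x y p q t : R) : x <= y -> p <= q -> t <= q -> x + 2 * p + t <= y + q * 3.
Proof. by move=> *; lra. Qed.

Lemma bilin_sqN (V : lmodType R) (P : V -> Prop) (q : V -> V -> R) (u : V) :
  subspace P -> bilin P q -> P u -> q (- u) (- u) = q u u.
Proof. by move=> sP bq Pu; rewrite -scaleN1r (bilin_sqZ sP bq)// sqrrN expr1n mul1r. Qed.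

(** Interpolation: the energy product pairs the operator of symbol [wt ^ 2],
applied to u, with v in L2. *)
Lemma xdot_le_prod u v (A B : R) : 0 < A -> 0 < B -> X u -> X v ->
  (forall N, L * \sum_(n < N) wt n ^+ 2 * dot (c u n) (c u n) <= A ^+ 2) ->
  L2dot L v v <= B ^+ 2 -> xd u v <= A * B.
Proof.
move=> A0 B0 Xu Xv HA HB; rewrite /xdot /qform -ler_pdivlMl//.
have cvg := qseries_cvg L0 s0 (dominated_weight s0) Xu Xv.
apply: limr_le; first exact: cvg.
apply: nearW => N; rewrite /qseries seriesEnat/= big_mkord.
have lv := X_L2 Xv.
have P := hartley_parseval L0 lv lv.
have nd : nondecreasing_seq (series (fun n => dot (c v n) (c v n))).
  by apply: nondecreasing_series => n _ _; exact: dot_ge0.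
have Hv : \sum_(n < N) dot (c v n) (c v n) <= L^-1 * B ^+ 2.
  have := nondecreasing_cvgn_le nd (cvgP _ P) N; rewrite (cvg_lim _ P)// seriesEnat/= big_mkord.
  by move=> h; apply: (le_trans h); rewrite ler_pM2l ?invr_gt0.
have Hu : \sum_(n < N) wt n ^+ 2 * dot (c u n) (c u n) <= L^-1 * A ^+ 2.
  by rewrite ler_pdivlMl.
apply: (@le_trans _ _ (A * B / 2 * (A ^- 2 * (\sum_(n < N) wt n ^+ 2 * dot (c u n) (c u n)) +
    B ^- 2 * \sum_(n < N) dot (c v n) (c v n)))).
  rewrite !mulr_sumr -big_split mulr_sumr/=; apply: ler_sum => n _; rewrite dot_scalar.
  have := dot_le ((wt n / A) *: c u n) (B^-1 *: c v n).
  rewrite !dot_scale (bilinZl trueS dot_bilin)// (bilinZr trueS dot_bilin)//.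
  move=> h; have {}h := le_trans (ler_wpM2l (ler0n _ 2) (ler_norm _)) h.
  have AB : 0 < A * B / 2 by rewrite divr_gt0// mulr_gt0.
  have := ler_wpM2l (ltW AB) h; rewrite (_ : _ * (2 * _) = wt n * dot (c u n) (c v n)).
    by move=> h1; apply: (le_trans h1); rewrite le_eqVlt; apply/orP; left; apply/eqP; field; rewrite !gt_eqF.
  by field; rewrite !gt_eqF.
have A2 : 0 <= A ^- 2 by rewrite invr_ge0 exprn_ge0 ?ltW.
have B2 : 0 <= B ^- 2 by rewrite invr_ge0 exprn_ge0 ?ltW.
apply: (@le_trans _ _ (A * B / 2 * (A ^- 2 * (L^-1 * A ^+ 2) + B ^- 2 * (L^-1 * B ^+ 2)))).
  apply: ler_wpM2l; first by rewrite ltW// divr_gt0// mulr_gt0.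
  by apply: lerD; apply: ler_wpM2l.
by rewrite le_eqVlt; apply/orP; left; apply/eqP; field; rewrite !gt_eqF.
Qed.

Definition growth_ratio : R := 4 `^ s.
Local Notation rr := growth_ratio.

Lemma growth_ratio_gt0 : 0 < rr. Proof. exact: powR_gt0. Qed.

Lemma growth_ratio_gt1 : 1 < rr.
Proof.
by rewrite /growth_ratio /powR gt_eqF// expR_gt1 mulr_gt0// ln_gt0// ltr1n.
Qed.

Lemma growth_ratioX i : (4 ^+ i) `^ s = rr ^+ i :> R.
Proof.
elim: i => [|i IH]; first by rewrite !expr0 powR1.
by rewrite !exprS powRM ?exprn_ge0// IH.
Qed.

Lemma sweight_ge_dyadic J n : (4 ^ J <= n)%N -> rr ^+ J <= rr * wt n.
Proof.
move=> Jn; have r0 := growth_ratio_gt0.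
have h : (4 ^+ J) `^ s <= (4 * freq n) `^ s :> R.
  apply: ge0_ler_powR; rewrite ?nnegrE ?(ltW s0)// ?mulr_ge0 ?freq_ge0//.
  apply: (@le_trans _ _ n%:R); first by rewrite -natrX ler_nat.
  by rewrite /freq -natrM ler_nat uphalfE; have := odd_double_half n.+1; rewrite -addnn; lia.
rewrite -growth_ratioX; apply: (le_trans h); rewrite powRM ?freq_ge0// -/rr.
by rewrite ler_pM2l//; exact: freq_pow_le.
Qed.

Context (s1 : s <= 1).

Lemma sweight_sq_le (i : nat) n :
  wt n ^+ 2 <= rr ^+ i ^+ 2 * (1 + (1 + freq n ^+ 2) / 16 ^+ i).
Proof.
set x := 1 + freq n ^+ 2; set lam : R := 16 ^+ i.
have x1 : 1 <= x by rewrite lerDl sqr_ge0.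
have x0 : 0 <= x by exact: le_trans x1.
have lam0 : 0 < lam by rewrite exprn_gt0.
have -> : wt n ^+ 2 = x `^ s.
  rewrite /sweight -/x -powR_mulrn ?powR_ge0// -powRrM; congr (_ `^ _); by field.
have lamE : rr ^+ i ^+ 2 = lam `^ s.
  rewrite -growth_ratioX expr2 -powRM ?exprn_ge0// -exprMn; congr ((_ ^+ _) `^ _); ring.
have r0 : 0 <= lam `^ s by exact: powR_ge0.
rewrite lamE; have [xl|xl] := leP x lam.
  apply: (@le_trans _ _ (lam `^ s)); first by apply: ge0_ler_powR; rewrite ?nnegrE ?(ltW s0) ?(ltW lam0).
  by rewrite ler_peMr// lerDl divr_ge0// ltW.
rewrite (_ : x = lam * (x / lam)); last by field; rewrite gt_eqF.
have xl1 : 1 <= x / lam by rewrite ler_pdivlMr// mul1r ltW.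
rewrite powRM ?(ltW lam0)//; last exact: le_trans xl1.
apply: ler_wpM2l => //; rewrite [lam * _]mulrC divfK ?gt_eqF//.
apply: (@le_trans _ _ (x / lam)); last by lra.
by rewrite -[leRHS]powRr1 ?(le_trans _ xl1)//; apply: ler_powR.
Qed.

Lemma growth_ratio_le4 : rr <= 4.
Proof. by rewrite -[leRHS]powRr1//; apply: ler_powR => //; rewrite ler1n. Qed.

Definition dyadic_sum (J : nat) : R := \sum_(j < J.+1) (4 / rr) ^+ j.
Local Notation bb := dyadic_sum.

Lemma dyadic_ratio_ge1 : 1 <= 4 / rr.
Proof. by rewrite ler_pdivlMr ?growth_ratio_gt0// mul1r growth_ratio_le4. Qed.

Lemma dyadic_sum_ge_nat J : J.+1%:R <= bb J.
Proof.
have -> : J.+1%:R = \sum_(j < J.+1) (1 : R) by rewrite sumr_const card_ord.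
apply: ler_sum => j _.
by rewrite exprn_ege1// dyadic_ratio_ge1.
Qed.

Lemma dyadic_sum_gt0 J : 0 < bb J.
Proof. by apply: lt_le_trans (dyadic_sum_ge_nat J); rewrite ltr0n. Qed.

Section Bump.
Context (z rho : R) (rho0 : 0 < rho) (a : 'cV[R]_2) (a0 : a != 0).
Let w (i : nat) := bump (L := L) z (rho / 4 ^+ i) a.
Let al : R := dot a a.

Let al0 : 0 < al.
Proof. by rewrite lt_def dot_ge0 andbT; apply: contra a0 => /eqP/dot_eq0 ->. Qed.

Let ri0 i : 0 < rho / 4 ^+ i. Proof. by rewrite divr_gt0// exprn_gt0. Qed.

Let lw i : L2per L (w i). Proof. exact: (bump_L2per L0 _ (ri0 i)). Qed.

Lemma L2dot_partial v N : L2per L v -> L * \sum_(n < N) dot (c v n) (c v n) <= L2dot L v v.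
Proof.
move=> lv; have P := hartley_parseval L0 lv lv.
have nd : nondecreasing_seq (series (fun n => dot (c v n) (c v n))).
  by apply: nondecreasing_series => n _ _; exact: dot_ge0.
have := nondecreasing_cvgn_le nd (cvgP _ P) N; rewrite (cvg_lim _ P)// seriesEnat/= big_mkord.
by rewrite ler_pdivlMl.
Qed.

Lemma bump_strong_bound : exists2 Gam : R, 4 * rho <= Gam &
  forall i N, L * \sum_(n < N) wt n ^+ 2 * dot (c (w i) n) (c (w i) n) <=
    (rr ^+ i / 2 ^+ i) ^+ 2 * (Gam * al).
Proof.
have [C C0 HC] := H1_of_translations L0.
exists (8 * rho + C * 8 / rho).
  have : 0 <= C * 8 / rho by rewrite divr_ge0 ?mulr_ge0// ltW.
  by move: rho0; lra.
move=> i N.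
have h1 : L * \sum_(n < N) dot (c (w i) n) (c (w i) n) <= 4 * (rho / 4 ^+ i) * al.
  exact: le_trans (L2dot_partial N (lw i)) (bump_L2dot L0 z (ri0 i) a).
have h2 := HC _ _ (lw i) (bump_translate_diff L0 z (ri0 i) a) N.
set S1 := \sum_(n < N) _ in h1; set S2 := \sum_(n < N) _ in h2.
apply: (@le_trans _ _ (rr ^+ i ^+ 2 * (L * S1 + (L * S1 + L * S2) / 16 ^+ i))).
  rewrite -mulrDr -mulrA -mulrDr mulrCA ler_pM2l// /S1 /S2 -big_split mulr_suml -big_split mulr_sumr/=.
  apply: ler_sum => n _; have := ler_wpM2r (dot_ge0 (c (w i) n)) (sweight_sq_le i n).
  by move=> h; apply: (le_trans h); rewrite le_eqVlt; apply/orP; left; apply/eqP; ring.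
rewrite [leRHS]mulrC [in leRHS]exprMn [leRHS]mulrC -[leRHS]mulrA; apply: ler_wpM2l; first by rewrite sqr_ge0.
have p4 : 1 <= 4 ^+ i :> R by rewrite exprn_ege1// ler1n.
have -> : 16 ^+ i = 4 ^+ i ^+ 2 :> R by rewrite -exprM mulnC exprM; congr (_ ^+ _); ring.
have -> : (2 ^+ i)^-1 ^+ 2 = (4 ^+ i)^-1 :> R.
  by rewrite exprVn -exprM mulnC exprM; congr (_ ^+ _)^-1; ring.
move: (4 ^+ i) p4 h1 h2 => p p4 h1 h2.
have p0 : 0 < p by exact: lt_le_trans p4.
have h3 : (L * S1 + L * S2) / p ^+ 2 <= (4 * (rho / p) * al + C * (8 * (rho / p)^-1 * al)) / p ^+ 2.
  by rewrite ler_pM2r ?invr_gt0 ?exprn_gt0//; exact: lerD h1 h2.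
apply: le_trans (lerD h1 h3) _.
have -> : 4 * (rho / p) * al + (4 * (rho / p) * al + C * (8 * (rho / p)^-1 * al)) / p ^+ 2 =
  p^-1 * ((4 * rho + 4 * rho / p ^+ 2 + C * 8 / rho) * al).
  by field; rewrite !gt_eqF.
rewrite ler_pM2l ?invr_gt0// ler_pM2r// lerD2r.
have : 4 * rho / p ^+ 2 <= 4 * rho.
  rewrite ler_pdivrMr ?exprn_gt0// ler_peMr// ?exprn_ege1//.
  by rewrite mulr_ge0// ltW.
by lra.
Qed.

Lemma bump_X i : X (w i).
Proof.
have [Gam _ HG] := bump_strong_bound; apply/XspaceP => //; split; first exact: lw.
exists (L^-1 * ((rr ^+ i / 2 ^+ i) ^+ 2 * (Gam * al))) => N.
rewrite ler_pdivlMl//; apply: le_trans (HG i N); rewrite ler_pM2l//.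
apply: ler_sum => n _; apply: ler_wpM2r; first exact: dot_ge0.
by rewrite expr2 ler_peMl ?sweight_ge1// ltW// sweight_gt0.
Qed.

(** Bumps of very different widths are almost orthogonal in X, since a wide bump is
smooth and a narrow one is small in L2. *)
Lemma bump_xdot : exists2 Gam : R, 0 < Gam & forall i j,
  xd (w i) (w j) <= Gam * al * (rr ^+ i / 2 ^+ i / 2 ^+ j).
Proof.
have [Gam Gr HG] := bump_strong_bound; have r0 := growth_ratio_gt0.
have G0 : 0 < Gam by apply: lt_le_trans Gr; rewrite mulr_gt0.
exists Gam => // i j; have Ga0 : 0 < Gam * al by rewrite mulr_gt0.
have -> : Gam * al * (rr ^+ i / 2 ^+ i / 2 ^+ j) =
    (rr ^+ i / 2 ^+ i * Num.sqrt (Gam * al)) * ((2 ^+ j)^-1 * Num.sqrt (Gam * al)).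
  by rewrite -{1}(sqr_sqrtr (ltW Ga0)); ring.
have q0 : 0 < Num.sqrt (Gam * al) by rewrite sqrtr_gt0.
apply: (xdot_le_prod _ _ (bump_X i) (bump_X j)).
- by rewrite mulr_gt0// divr_gt0// exprn_gt0.
- by rewrite mulr_gt0// invr_gt0 exprn_gt0.
- by move=> N; rewrite [leRHS]exprMn sqr_sqrtr ?(ltW Ga0)//; exact: HG.
- rewrite exprMn sqr_sqrtr ?(ltW Ga0)//; apply: le_trans (bump_L2dot L0 z (ri0 j) a) _.
  have -> : (2 ^+ j)^-1 ^+ 2 = (4 ^+ j)^-1 :> R.
    by rewrite exprVn -exprM mulnC exprM; congr (_ ^+ _)^-1; ring.
  rewrite -/al mulrA mulrAC [leRHS]mulrC ler_pM2r ?invr_gt0 ?exprn_gt0//.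
  by rewrite ler_pM2r.
Qed.

Let S (J : nat) : R -> 'cV[R]_2 := \sum_(j < J) (4 / rr) ^+ j *: w j.

Let S_X J : X (S J).
Proof.
rewrite /S; apply: (subspace_sum _ (X_subspace L0 s0)) => j.
by apply: (subspaceZ _ (X_subspace L0 s0)); exact: bump_X.
Qed.

Lemma bump_sum_xdot : exists2 Gam : R, 0 < Gam & forall J,
  xd (S J.+1) (S J.+1) <= Gam * al * bb J.
Proof.
have [Gam G0 HG] := bump_xdot; have r0 := growth_ratio_gt0.
have sX := X_subspace L0 s0 (L := L) (s := s); have bX := xdot_bilin L0 s0 (L := L) (s := s).
exists (3 * Gam); first by rewrite mulr_gt0.
have Ga0 : 0 < Gam * al by rewrite mulr_gt0.
have cross J : xd (S J) (w J) <= Gam * al.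
  rewrite /S (linf_sum (f := fun v => xd v (w J)) sX); first last.
  - by move=> j; apply: (subspaceZ _ sX); exact: bump_X.
  - by move=> k u v Xu Xv; exact: (bX.2 k u v (w J) Xu Xv (bump_X J)).
  apply: (@le_trans _ _ (\sum_(j < J) Gam * al * (2 ^+ j / 2 ^+ J))).
    apply: ler_sum => j _; rewrite (bilinZl sX bX _ (bump_X j) (bump_X J)).
    have q0 : 0 <= (4 / rr) ^+ j by rewrite exprn_ge0// divr_ge0// ltW.
    apply: (le_trans (ler_wpM2l q0 (HG j J))).
    have -> : (4 / rr) ^+ j = (2 ^+ j * 2 ^+ j) / rr ^+ j :> R.
      by rewrite exprMn exprVn -exprMn; congr (_ ^+ _ / _); ring.
    rewrite le_eqVlt; apply/orP; left; apply/eqP; field.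
    by rewrite !expf_neq0// ?gt_eqF.
  rewrite -mulr_sumr -mulr_suml ler_piMr ?(ltW Ga0)// ler_pdivrMr ?exprn_gt0// mul1r.
  elim: J => [|J IH]; first by rewrite big_ord0 expr0.
  by rewrite big_ord_recr/= exprS; move: IH; lra.
have HS J : xd (S J) (S J) <= 3 * (Gam * al) * \sum_(j < J) (4 / rr) ^+ j.
  elim: J => [|J IH].
    by rewrite /S !big_ord0 (bilin0l sX bX sX.1) mulr0.
  have -> : S J.+1 = S J + (4 / rr) ^+ J *: w J by rewrite /S big_ord_recr.
  have Xq := subspaceZ ((4 / rr) ^+ J) sX (bump_X J).
  rewrite (bilin_sqD sX bX (S_X J) Xq) (bilinZr sX bX _ (bump_X J) (S_X J)).
  rewrite (bilin_sqZ sX bX _ (bump_X J)) big_ord_recr/= mulrDr.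
  have q0 : 0 <= (4 / rr) ^+ J by rewrite exprn_ge0// divr_ge0// ltW.
  have h1 := ler_wpM2l q0 (cross J).
  have h2 : (4 / rr) ^+ J ^+ 2 * xd (w J) (w J) <= (4 / rr) ^+ J * (Gam * al).
    rewrite expr2 -mulrA ler_wpM2l//; apply: (le_trans (ler_wpM2l q0 (HG J J))).
    have -> : (4 / rr) ^+ J = (2 ^+ J * 2 ^+ J) / rr ^+ J :> R.
      by rewrite exprMn exprVn -exprMn; congr (_ ^+ _ / _); ring.
    rewrite le_eqVlt; apply/orP; left; apply/eqP; field.
    by rewrite !expf_neq0// ?gt_eqF.
  have -> : 3 * (Gam * al) * (4 / rr) ^+ J = (4 / rr) ^+ J * (Gam * al) * 3 by ring.
  exact: ler_add3 IH h1 h2.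
by move=> J; apply: (le_trans (HS J.+1)); rewrite /bb mulrA.
Qed.

Lemma bump_sum_plateau J x : D (x - z) <= rho / 4 ^+ J -> S J.+1 x = bb J *: a.
Proof.
move=> h; rewrite /S fct_sumE /bb scaler_suml; apply: eq_bigr => j _.
rewrite -[LHS]/((4 / rr) ^+ j *: w j x); congr (_ *: _).
rewrite /w /bump trapezoid1 ?scale1r//; apply: (le_trans h).
rewrite ler_pM2l// lef_pV2 ?posrE ?exprn_gt0//.
by rewrite ler_weXn2l ?ler1n// -ltnS.
Qed.

Lemma bump_sum_far J x : 2 * rho <= D (x - z) -> S J.+1 x = 0.
Proof.
move=> h; rewrite /S fct_sumE big1// => j _.
rewrite -[LHS]/((4 / rr) ^+ j *: w j x) /w /bump trapezoid0 ?scale0r ?scaler0//.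
apply: le_trans h; rewrite ler_pM2l// ler_pdivrMr ?exprn_gt0// ler_peMr ?(ltW rho0)//.
by rewrite exprn_ege1// ler1n.
Qed.

(** Adding bumps of widths 4^-j with weights (4 / rr)^j makes all the scales
contribute equally to the energy, while the heights add up on the smallest bump:
the square of the height gains a factor [bb J] over the energy. *)
Lemma hump_nonzero : exists2 C : R, 0 < C & forall J, exists u,
  [/\ X u, xd u u <= C * dot a a / bb J,
     (forall x, D (x - z) <= rho / 4 ^+ J -> u x = a) &
     (forall x, 2 * rho <= D (x - z) -> u x = 0)].
Proof.
have [Gam G0 HG] := bump_sum_xdot; exists Gam => // J.
have sX := X_subspace L0 s0 (L := L) (s := s); have bX := xdot_bilin L0 s0 (L := L) (s := s).
have b0 := dyadic_sum_gt0 J.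
exists ((bb J)^-1 *: S J.+1); split.
- exact: (subspaceZ _ sX (S_X _)).
- rewrite (bilin_sqZ sX bX _ (S_X _)); apply: (le_trans (ler_wpM2l (sqr_ge0 _) (HG J))).
  by rewrite le_eqVlt; apply/orP; left; apply/eqP; rewrite -/al; field; rewrite gt_eqF.
- move=> x h; rewrite -[LHS]/((bb J)^-1 *: S J.+1 x) (bump_sum_plateau h) scalerA mulVf ?scale1r//.
  by rewrite gt_eqF.
- by move=> x h; rewrite -[LHS]/((bb J)^-1 *: S J.+1 x) (bump_sum_far J h) scaler0.
Qed.

End Bump.

Lemma hump (z rho : R) : 0 < rho -> exists2 C : R, 0 < C &
  forall J (a : 'cV[R]_2), exists u,
  [/\ X u, xd u u <= C * dot a a / bb J,
     (forall x, D (x - z) <= rho / 4 ^+ J -> u x = a) &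
     (forall x, 2 * rho <= D (x - z) -> u x = 0)].
Proof.
move=> rho0; pose e (i : 'I_2) : 'cV[R]_2 := delta_mx i 0.
have e_neq0 i : e i != 0.
  by apply/eqP => /matrixP/(_ i 0)/eqP; rewrite !mxE !eqxx oner_eq0.
have e_unit i : dot (e i) (e i) = 1.
  rewrite /dot (bigD1 i)//= big1 ?addr0 ?mxE ?eqxx ?mulr1// => j ji.
  by rewrite !mxE (negPf ji) mul0r.
have [C0 C00 H0] := hump_nonzero z rho0 (e_neq0 0).
have [C1 C10 H1] := hump_nonzero z rho0 (e_neq0 1).
exists (2 * C0 + 2 * C1); first by rewrite addr_gt0 ?mulr_gt0.
move=> J a; have [u [Xu hu u1 u0]] := H0 J; have [v [Xv hv v1 v0]] := H1 J.
have sX := X_subspace L0 s0 (L := L) (s := s); have bX := xdot_bilin L0 s0 (L := L) (s := s).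
have pX := xdot_psd L0 s0 (L := L) (s := s).
have Xau := subspaceZ (a 0 0) sX Xu; have Xav := subspaceZ (a 1 0) sX Xv.
have aE : a = a 0 0 *: e 0 + a 1 0 *: e 1.
  apply/matrixP => i j; rewrite ord1 !mxE; case: i => [[|[|]]]//= i2.
    by rewrite -/(GRing.zero _) mulr1 mulr0 addr0; congr (a _ _); apply/val_inj.
  by rewrite mulr0 mulr1 add0r; congr (a _ _); apply/val_inj.
exists (a 0 0 *: u + a 1 0 *: v); split.
- exact: subspaceD sX Xau Xav.
- apply: (le_trans (psd_sqD_le sX bX pX Xau Xav)).
  rewrite (bilin_sqZ sX bX _ Xu) (bilin_sqZ sX bX _ Xv).
  rewrite !e_unit !mulr1 in hu hv.
  have h1 := ler_pM (sqr_ge0 _) (pX _ Xu) (coord_sq_le a 0) hu.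
  have h2 := ler_pM (sqr_ge0 _) (pX _ Xv) (coord_sq_le a 1) hv.
  have -> : (2 * C0 + 2 * C1) * dot a a / bb J =
     2 * (dot a a * (C0 / bb J)) + 2 * (dot a a * (C1 / bb J)) by ring.
  exact: (lerD (ler_wpM2l (ler0n _ 2) h1) (ler_wpM2l (ler0n _ 2) h2)).
- by move=> x h; rewrite -[LHS]/(a 0 0 *: u x + a 1 0 *: v x) (u1 x h) (v1 x h) -aE.
- by move=> x h; rewrite -[LHS]/(a 0 0 *: u x + a 1 0 *: v x) (u0 x h) (v0 x h) !scaler0 addr0.
Qed.

(** ** Growth of functions whose superposition maps X into L^1 *)

Lemma form_cauchy_geometric (V : lmodType R) (P : V -> Prop) (q : V -> V -> R) (u_ : nat -> V) :
  subspace P -> bilin P q -> psd P q -> (forall n, P (u_ n)) ->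
  (forall n, q (u_ n) (u_ n) <= 4^-1 ^+ n) ->
  form_cauchy q (fun n => \sum_(i < n) u_ i).
Proof.
move=> sP bq q0 Pu hu.
have Ps n : P (\sum_(i < n) u_ i) by apply: (subspace_sum _ sP).
have tail n k : q (\sum_(i < n + k) u_ i - \sum_(i < n) u_ i)
    (\sum_(i < n + k) u_ i - \sum_(i < n) u_ i) <= (2 * 2^-1 ^+ n - 2^-1 ^+ (n + k) * 2) ^+ 2.
  have Pd k' := subspaceB sP (Ps (n + k')) (Ps n).
  elim: k => [|k IH].
    by rewrite addn0 subrr (bilin0l sP bq sP.1) mulrC subrr expr0n.
  have -> : \sum_(i < n + k.+1) u_ i - \sum_(i < n) u_ i =
      (\sum_(i < n + k) u_ i - \sum_(i < n) u_ i) + u_ (n + k)%N.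
    by rewrite addnS big_ord_recr/= addrAC.
  set d := _ - _ in IH *; have Pd' : P d := Pd k.
  rewrite addnS (exprS _ (n + k)).
  have h2 := hu (n + k)%N.
  have -> : 2 * 2^-1 ^+ n - 2^-1 * 2^-1 ^+ (n + k) * 2 =
    (2 * 2^-1 ^+ n - 2^-1 ^+ (n + k) * 2) + 2^-1 ^+ (n + k) :> R by field.
  set A := 2 * _ - _ in IH *; set B := 2^-1 ^+ (n + k).
  have B0 : 0 <= B by rewrite exprn_ge0// invr_ge0.
  have A0 : 0 <= A.
    rewrite /A exprD subr_ge0 [leRHS]mulrC ler_pM2r// ler_piMr ?exprn_ge0 ?invr_ge0//.
    by rewrite exprn_ile1 ?invr_ge0// invf_le1// ler1n.
  have hB : q (u_ (n + k)%N) (u_ (n + k)%N) <= B ^+ 2.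
    apply: (le_trans h2); rewrite /B -exprM mulnC exprM le_eqVlt; apply/orP; left; apply/eqP.
    by congr (_ ^+ _); field.
  have T := psd_triangle sP bq q0 Pd' (Pu (n + k)%N).
  have qd := q0 _ (subspaceD sP Pd' (Pu (n + k)%N)).
  rewrite -(sqr_sqrtr qd); apply: lerXn2r; rewrite ?nnegrE ?sqrtr_ge0 ?(addr_ge0 A0 B0)//.
  apply: (le_trans T); apply: lerD.
    by rewrite -(ger0_norm A0) -sqrtr_sqr ler_wsqrtr.
  by rewrite -(ger0_norm B0) -sqrtr_sqr ler_wsqrtr.
have small (e : R) : 0 < e -> exists N, forall n, (N <= n)%N -> (2 * 2^-1 ^+ n) ^+ 2 < e.
  move=> e0.
  have : (fun n => (2 * 2^-1 ^+ n) ^+ 2 : R) @ \oo --> (2 * 0) ^+ 2 * (1 : R).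
    rewrite mulr1 expr2; under eq_fun do rewrite expr2.
    have C : (fun n => 2 * 2^-1 ^+ n : R) @ \oo --> 2 * (0 : R).
      apply: cvgM; first exact: cvg_cst.
      by apply: cvg_expr; rewrite ger0_norm ?invr_ge0// invf_lt1// ltr1n.
    exact: cvgM.
  rewrite mulr0 expr0n/= mul0r => /cvgr_lt/(_ e e0)[N _ HN]; exists N => n Nn; exact: HN.
move=> e /small[N HN]; exists N => n m Nn Nm.
wlog nm : n m Nn Nm / (n <= m)%N => [H|].
  have [/H H'|/ltnW/H H'] := leqP n m; first exact: H'.
  by rewrite -opprB (bilin_sqN sP bq) ?H'//; exact: subspaceB.
rewrite -opprB (bilin_sqN sP bq); last exact: (subspaceB sP (Ps m) (Ps n)).
have := tail n (m - n)%N; rewrite subnKC// => h; apply: (le_lt_trans h).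
apply: le_lt_trans (HN n Nn); rewrite ler_pXn2r// ?nnegrE.
- by rewrite gerBl mulr_ge0// exprn_ge0// invr_ge0.
- rewrite subr_ge0 mulrC ler_pM2l// ler_wiXn2l// ?invr_ge0// invf_le1// ler1n.
- by [].
- by rewrite mulr_ge0// exprn_ge0// invr_ge0.
Qed.

End Hump.

Section Superposition.
Context {R : realType}.
Notation mu := (@lebesgue_measure R).
Local Notation I L f := (\int[mu]_(x in `[0, L]) f x).

Lemma measurable_superposition (N : 'cV[R]_2 -> R) (u : R -> 'cV[R]_2) :
  continuous N -> (forall i, measurable_fun [set: R] (component u i)) ->
  measurable_fun [set: R] (fun x => N (u x)).
Proof.
move=> cN mu'; apply: (measurability _ (RGenOInfty.measurableE R)) => //.
move=> _ [_ [t ->] <-]; rewrite setTI.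
pose box (p : rat * rat * rat) := [set a : 'cV[R]_2 |
  forall i, `|a i 0 - (if i == 0 then ratr p.1.1 else ratr p.1.2)| < ratr p.2].
pose good := [set p | box p `<=` [set a | t < N a]].
have -> : (fun x => N (u x)) @^-1` `]t, +oo[%classic =
    \bigcup_(p in good) (u @^-1` box p).
  apply/seteqP; split=> [x /= | x [p gp] /= ux]; last first.
    by rewrite in_itv/= andbT; exact: (gp _ ux).
  rewrite in_itv/= andbT => tN.
  have : \forall b \near u x, t < N b by apply: cvgr_gt (cN (u x)) _ tN.
  move=> /nbhs_ballP[e /= e0 He].
  have [r /andP[r0 re]] : exists r : rat, 0 < (ratr r : R) < e / 2.
    by have [r] := @rat_in_itvoo R 0 (e / 2) (divr_gt0 e0 (ltr0n _ 2)); rewrite in_itv/=; exists r.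
  have q i : exists q : rat, `|u x i 0 - ratr q| < ratr r.
    have [q] := @rat_in_itvoo R (u x i 0 - ratr r) (u x i 0) (ltac:(by rewrite gtrBl)).
    by rewrite in_itv/= => /andP[h1 h2]; exists q; rewrite ger0_norm; lra.
  have [q0 hq0] := q 0; have [q1 hq1] := q 1.
  have hb i : `|u x i 0 - (if i == 0 then ratr q0 else ratr q1)| < ratr r.
    case: i => [[|[|]]]//= i2.
      by rewrite (_ : Ordinal i2 = 0) ?eqxx//; apply/val_inj.
    by rewrite (_ : Ordinal i2 = 1) ?oner_eq0//; apply/val_inj.
  exists (q0, q1, r) => // b hbb; apply: He; split=> // i j; rewrite ord1.
  rewrite -ball_normE/=.
  have h1 := hb i; have h2 := hbb i; rewrite /= in h1 h2.
  have -> : u x i 0 - b i 0 = (u x i 0 - (if i == 0 then ratr q0 else ratr q1)) -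
     (b i 0 - (if i == 0 then ratr q0 else ratr q1)) by ring.
  by apply: le_lt_trans (ler_normB _ _) _; lra.
rewrite bigcup_mkcond; apply: countable_bigcupT_measurable => [|p].
  by apply: countableP.
case: ifP => // _.
have -> : u @^-1` box p = \bigcap_(i in [set: 'I_2]) ((fun x => component u i x) @^-1`
   (ball (if i == 0 then ratr p.1.1 else ratr p.1.2 : R) (ratr p.2))).
  apply/seteqP; split=> x /= h i; first by move=> _ /=; rewrite /ball/= distrC; exact: h.
  by have := h i Logic.I; rewrite /ball/= distrC.
apply: fin_bigcap_measurable => // i _; rewrite -[_ @^-1` _]setTI; apply: mu' => //.
exact: measurable_ball.
Qed.

Context {L s : R} (L0 : 0 < L) (s0 : 0 < s) (s1 : s <= 1).
Local Notation X := (Xspace L s).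
Local Notation D := (lattice_dist (L := L)).
Local Notation bb := (dyadic_sum (s := s)).

Lemma L2per_cst (a : 'cV[R]_2) : L2per L (fun=> a).
Proof.
apply/L2perP => i; rewrite (_ : component _ i = fun=> a i 0)//.
by apply: (@L2s_bounded _ _ _ `|a i 0|).
Qed.

Lemma lattice_dist_small (t : R) : `|t| <= L / 2 -> `|t| <= D t.
Proof.
move=> tL; have [k ->] := lattice_dist_attained L0 t.
have [->|k0] := eqVneq k 0; first by rewrite mul0r subr0.
have : L <= `|k%:~R * L|.
  by rewrite normrM (gtr0_norm L0) ler_peMl ?(ltW L0)// -intr_norm ler1z -gtz0_ge1 normr_gt0.
have := ler_normD (k%:~R * L - t) t; rewrite subrK distrC.
by move: `|k%:~R * L| `|t - _| `|t| tL => A B T; lra.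
Qed.

Lemma lattice_dist_sub (x y z : R) : D (y - z) <= D (x - y) + D (x - z).
Proof.
have [k ->] := lattice_dist_attained L0 (x - y); have [l ->] := lattice_dist_attained L0 (x - z).
apply: le_trans (lattice_dist_le L0 (y - z) (l - k)) _.
have -> : y - z - (l - k)%:~R * L = (x - z - l%:~R * L) - (x - y - k%:~R * L) by rewrite intrB; ring.
by rewrite [leRHS]addrC ler_normB.
Qed.

Lemma superposition_CI (N : 'cV[R]_2 -> R) u : continuous N ->
  (forall u, X u -> mu.-integrable `[0, L] (fun x => (N (u x))%:E)) -> X u ->
  CI L (fun x => N (u x)).
Proof.
move=> cN HN Xu; split; last exact: HN.
by apply: measurable_superposition => // i; exact: ((X_L2 Xu).2 i).1.
Qed.

Let z (n : nat) : R := L * 4^-1 ^+ n.+1.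
Let rho (n : nat) : R := z n / 16.

Let z0 n : 0 < z n. Proof. by rewrite mulr_gt0// exprn_gt0// invr_gt0. Qed.
Let rho0 n : 0 < rho n. Proof. by rewrite divr_gt0. Qed.

Let z_le n m : (n < m)%N -> z m <= z n / 4.
Proof.
move=> nm; rewrite /z -mulrA ler_pM2l// -exprSr ler_wiXn2l// ?invr_ge0// invf_le1//.
by rewrite ler1n.
Qed.

Let z_leL n : z n <= L / 4.
Proof.
rewrite /z ler_pM2l// exprS ler_piMr ?invr_ge0// exprn_ile1 ?invr_ge0// invf_le1//.
by rewrite ler1n.
Qed.

Let separated n m x : n != m -> D (x - z n) <= rho n -> 2 * rho m <= D (x - z m).
Proof.
move=> nm h; have h1 := lattice_dist_sub x (z n) (z m).
have h2 : `|z n - z m| <= D (z n - z m).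
  apply: lattice_dist_small; rewrite ler_norml; apply/andP.
  by have := z0 n; have := z0 m; have := z_leL n; have := z_leL m; split; lra.
have h3 : 3 / 16 * (z n + z m) <= `|z n - z m|.
  have a0 := z0 n; have b0 := z0 m; move: nm; rewrite neq_lt => /orP[] /z_le h'.
    by rewrite ger0_norm; lra.
  by rewrite distrC ger0_norm; lra.
have a0 := z0 n; have b0 := z0 m; move: h; rewrite /rho => h.
move: (D _) (D (x - z m)) (D (z n - z m)) h h1 h2 => d1 d2 d3 h h1 h2.
by move: `|z n - z m| h2 h3 => d4 h2 h3; lra.
Qed.

Definition plateau (n : nat) (r x : R) : R := (D (x - z n) <= r)%R%:R.

Let plateau_CI n r : CI L (plateau n r).
Proof.
apply: (@CI_bounded _ _ _ 1); last first.
  by move=> x; rewrite /plateau; case: (D _ <= r); rewrite ?normr1 ?normr0 ?ler01.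
have mD := lipschitz_measurable (lattice_dist_lip_norm L0).
have -> : plateau n r = (\1_((fun x => D (x - z n)) @^-1` `]-oo, r]%classic) : R -> R).
  apply/funext => x; rewrite indicE /plateau.
  have [h|h] := leP (D (x - z n)) r; first by rewrite mem_set//= in_itv.
  by rewrite memNset//= in_itv/=; apply/negP; rewrite -ltNge.
apply: measurable_indic; rewrite -[_ @^-1` _]setTI; apply: (measurable_fun_shift (- z n) mD) => //.
Qed.

Let plateau_mul n r f : CI L f -> CI L (fun x => plateau n r x * f x).
Proof.
move=> cf; apply: (CI_dom _ (CI_norm cf)).
  exact: measurable_funM (plateau_CI n r).1 cf.1.
move=> x; rewrite /plateau; case: (D _ <= r); first by rewrite mul1r.
by rewrite mul0r normr0.
Qed.

Let plateau_periodic n r : periodic (plateau n r) L.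
Proof. by move=> x; rewrite /plateau (addrAC x) (lattice_dist_periodic L0). Qed.

Let plateau_int n (r : R) : 0 <= r -> r <= rho n -> r <= I L (plateau n r).
Proof.
move=> r0 rn; have zl := z_leL n; have zp := z0 n.
have m1 : measurable (`[z n, z n + r]%classic : set R) by exact: measurable_itv.
have c : CI L (\1_(`[z n, z n + r]%classic : set R) : R -> R).
  apply: (@CI_bounded _ _ _ 1); first exact: measurable_indic.
  by move=> x; rewrite indicE; case: (_ \in _); rewrite ?normr1 ?normr0.
apply: (@le_trans _ _ (I L (\1_(`[z n, z n + r]%classic : set R) : R -> R))); last first.
  apply: (int_le c (plateau_CI n r)) => x; rewrite indicE /plateau; case: (boolP (x \in _)) => //.
  rewrite inE/= in_itv/= => /andP[h1 h2].
  suff -> : D (x - z n) <= r by [].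
  apply: le_trans (lattice_dist_le L0 _ 0) _; rewrite mul0r subr0 ger0_norm; lra.
rewrite /Rintegral integral_indic; [|exact: mper|exact: m1].
have -> : `[z n, z n + r]%classic `&` `[0, L]%classic = `[z n, z n + r]%classic :> set R.
  apply/setIidPl => x /=; rewrite !in_itv/= => /andP[h1 h2].
  by move: rn; rewrite /rho => rn; apply/andP; split; lra.
have E : mu (`[z n, z n + r]%classic : set R) = r%:E.
  rewrite lebesgue_measure_itv/= lte_fin ltrDl; case: ltP => h; first by rewrite -EFinB addrAC subrr add0r.
  by congr (_%:E); apply/eqP; rewrite eq_le h r0.
by rewrite (_ : fine _ = r)//; exact: (congr1 fine E).
Qed.

(** A gliding hump: if N exceeded every such bound, humps placed at separated points,
on plateaus wide enough for the integral of N(u) over each to be bounded below,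
could be chosen with summable norms. *)
Lemma superposition_growth (N : 'cV[R]_2 -> R) : continuous N -> (forall a, 0 <= N a) ->
  (forall u, X u -> mu.-integrable `[0, L] (fun x => (N (u x))%:E)) ->
  exists C theta : R, [/\ 0 < C, 0 < theta &
    forall J a, dot a a <= theta * bb J -> N a <= C * 4 ^+ J].
Proof.
move=> cN N0 HN; apply: contrapT => H.
have many (C th : R) : 0 < C -> 0 < th ->
    exists p : nat * 'cV[R]_2, dot p.2 p.2 <= th * bb p.1 /\ C * 4 ^+ p.1 < N p.2.
  move=> C0 th0; apply: contrapT => no; apply: H; exists C, th; split=> // J a h.
  by rewrite leNgt; apply/negP => h2; apply: no; exists (J, a).
have sX := X_subspace L0 s0 (L := L) (s := s); have bX := xdot_bilin L0 s0 (L := L) (s := s).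
have /choice[K HK] : forall n, exists C, 0 < C /\ forall J (a : 'cV[R]_2), exists u,
  [/\ X u, xdot (L := L) (s := s) u u <= C * dot a a / bb J,
     (forall x, D (x - z n) <= rho n / 4 ^+ J -> u x = a) &
     (forall x, 2 * rho n <= D (x - z n) -> u x = 0)].
  by move=> n; have [C C0 HC] := hump L0 s0 s1 (z n) (rho0 n); exists C.
have /choice[p Hp] : forall n, exists p : nat * 'cV[R]_2,
    dot p.2 p.2 <= 4^-1 ^+ n / K n * bb p.1 /\ (rho n)^-1 * 4 ^+ p.1 < N p.2.
  move=> n; have [K0 _] := HK n; apply: many; first by rewrite invr_gt0.
  by rewrite divr_gt0// exprn_gt0// invr_gt0.
pose r n := rho n / 4 ^+ (p n).1; pose a n := (p n).2.
have r0 n : 0 < r n by rewrite divr_gt0// exprn_gt0.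
have r_le n : r n <= rho n by rewrite ler_pdivrMr ?exprn_gt0// ler_peMr ?(ltW (rho0 n))// exprn_ege1// ler1n.
have /choice[u Hu] : forall n, exists u, [/\ X u, xdot (L := L) (s := s) u u <= 4^-1 ^+ n,
     (forall x, D (x - z n) <= r n -> u x = a n) &
     (forall x, 2 * rho n <= D (x - z n) -> u x = 0)].
  move=> n; have [K0 HKn] := HK n; have [u [Xu hu u1 u0]] := HKn (p n).1 (a n).
  exists u; split=> //; apply: (le_trans hu); rewrite ler_pdivrMr ?dyadic_sum_gt0// mulrC -ler_pdivlMr//.
  by rewrite mulrAC; exact: (Hp n).1.
have Xu n : X (u n) by case: (Hu n).
have cau : form_cauchy (xdot (L := L) (s := s)) (fun n => \sum_(i < n) u i).
  by apply: (form_cauchy_geometric sX bX (xdot_psd L0 s0) Xu) => n; case: (Hu n).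
have XU k : X (\sum_(i < k) u i) by apply: (subspace_sum _ sX).
have [v Xv lim] := X_complete L0 s0 XU cau.
have Upl n k x : (n < k)%N -> D (x - z n) <= r n -> (\sum_(i < k) u i) x = a n.
  move=> nk h; rewrite fct_sumE (bigD1 (Ordinal nk))//= big1 ?addr0.
    by have [_ _ h1 _] := Hu n; exact: h1.
  move=> i; rewrite -val_eqE/= eq_sym => ni; have [_ _ _ h0] := Hu i; apply: h0.
  by apply: (separated ni); exact: le_trans (r_le n).
have ae_n n : {ae mu, forall x, plateau n (r n) x * dot (a n - v x) (a n - v x) = 0}.
  have lc := L2per_cst (a n).
  have lv := X_L2 Xv; have ld := subspaceB (L2per_subspace (L := L)) lc lv.
  have cg : CI L (fun x => plateau n (r n) x * dot (a n - v x) (a n - v x)).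
    exact: (plateau_mul n (r n) (CI_dot ld ld)).
  have g0 x : 0 <= plateau n (r n) x * dot (a n - v x) (a n - v x).
    by rewrite mulr_ge0 ?dot_ge0// ler0n.
  apply: (int_ae_eq0 L0 _ cg g0).
    by move=> x; rewrite (plateau_periodic n (r n)) lv.1.
  apply/eqP; rewrite eq_le int_ge0// andbT; apply/ler_addgt0Pl => e e0; rewrite addr0.
  have [M HM] := lim e e0; have := HM (maxn M n.+1) (leq_maxl _ _).
  set U := \sum_(i < _) _ => h; have XUv := subspaceB sX (XU (maxn M n.+1)) Xv.
  have lU := X_L2 XUv.
  apply: le_trans (ltW (le_lt_trans (L2dot_le_xdot L0 s0 XUv) h)).
  apply: (int_le cg (CI_dot lU lU)) => x; rewrite /plateau.
  have [h1|_] := leP (D (x - z n)) (r n); last by rewrite mul0r dot_ge0.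
  by rewrite mul1r -[(_ - v) x]/((\sum_(i < _) u i) x - v x) (Upl n _ x (leq_maxr _ _) h1).
have cNv := superposition_CI cN HN Xv.
have K_le k : k%:R <= I L (fun x => N (v x)).
  pose F x := \sum_(n < k) plateau n (r n) x * N (a n).
  pose F' x := \sum_(n < k) plateau n (r n) x * N (v x).
  have cP n (f : R -> R) : CI L f -> CI L (fun x => plateau n (r n) x * f x).
    exact: plateau_mul.
  have cF : CI L F by apply: CI_sum => n; apply: cP; exact: CI_cst.
  have cF' : CI L F' by apply: CI_sum => n; exact: cP.
  apply: (@le_trans _ _ (I L F)).
    rewrite /F int_sum => [|n]; last by apply: cP; exact: CI_cst.
    have -> : k%:R = \sum_(n < k) (1 : R) by rewrite sumr_const card_ord.
    apply: ler_sum => n _.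
    have -> : I L (fun x => plateau n (r n) x * N (a n)) = N (a n) * I L (plateau n (r n)).
      by rewrite -(intZ _ (plateau_CI n (r n))); apply: int_ext => x; rewrite mulrC.
    have h1 := plateau_int (ltW (r0 n)) (r_le n); have [_ h2] := Hp n.
    apply: (@le_trans _ _ (N (a n) * r n)); last by rewrite ler_wpM2l.
    rewrite -ler_pdivrMr ?r0// div1r /r invf_div mulrC; exact: ltW.
  rewrite (@int_ae_eq _ _ F F' cF.1 cF'.1); last first.
    apply: aeS (ae_all ae_n) => x hx; apply: eq_bigr => n _.
    have := hx n; rewrite /plateau; case: (D _ <= _); last by rewrite !mul0r.
    by rewrite mul1r => /dot_eq0/eqP; rewrite subr_eq0 => /eqP ->.
  apply: (int_le cF' cNv) => x; rewrite /F' -mulr_suml ler_piMl ?N0//.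
  have [[n nx]|no] := pselect (exists n : 'I_k, D (x - z n) <= r n).
    rewrite (bigD1 n)//= big1 ?addr0; first by rewrite /plateau nx.
    move=> i ni; rewrite /plateau; suff -> : (D (x - z i) <= r i) = false by [].
    have h1 : D (x - z n) <= rho n := le_trans nx (r_le n).
    have ni' : val n != val i by rewrite eq_sym.
    have := separated ni' h1; have := r_le i; have := rho0 i.
    by move=> h2 h3 h4; apply/negP => h5; move: (D _) h4 h5 => d; lra.
  rewrite big1// => n _; rewrite /plateau; case: leP => // h; case: no; by exists n.
have := K_le (Num.truncn (I L (fun x => N (v x)))).+1.
by rewrite leNgt truncnS_gt.
Qed.

End Superposition.

(** * Low and high frequencies *)

Section LowHigh.
Context {R : realType} {L s : R} (L0 : 0 < L) (s0 : 0 < s).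
Notation mu := (@lebesgue_measure R).
Local Notation I L f := (\int[mu]_(x in `[0, L]) f x).
Local Notation c := (hcoef L).
Local Notation wt := (sweight s).
Local Notation X := (Xspace L s).
Local Notation xd := (xdot (L := L) (s := s)).
Local Notation rr := (growth_ratio (s := s)).
Local Notation bb := (dyadic_sum (s := s)).
Implicit Types (u v w h : R -> 'cV[R]_2).

Definition wave (n : nat) (a : 'cV[R]_2) : R -> 'cV[R]_2 := fun x => cas L (zint n) x *: a.

Lemma wave_L2per n a : L2per L (wave n a).
Proof.
apply/L2perP => i; rewrite (_ : component _ i = fun x => a i 0 * cas L (zint n) x + 0).
  apply: (L2s_lin _ (L2s_cas L0 (zint n))).
  by apply: (@L2s_bounded _ _ _ 0) => // x; rewrite normr0.
by apply/funext => x; rewrite /component /wave mxE addr0 mulrC.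
Qed.

Lemma hcoef_wave n a k : c (wave n a) k = (k == n)%:R *: a.
Proof.
apply/matrixP => i j; rewrite ord1 !mxE.
have cc : CI L (fun x => cas L (zint n) x * cas L (zint k) x).
  exact: L2s_CI_mul (L2s_cas L0 _) (L2s_cas L0 _).
have -> : I L (fun x => component (wave n a) i x * cas L (zint k) x) =
    a i 0 * I L (fun x => cas L (zint n) x * cas L (zint k) x).
  by rewrite -(intZ _ cc); apply: int_ext => x; rewrite /component /wave mxE; ring.
rewrite (cas_orthogonal L0) (inj_eq (zint_inj L0)) [n == k]eq_sym.
by field; rewrite gt_eqF.
Qed.

Definition low (M : nat) h : R -> 'cV[R]_2 := \sum_(n < M) wave n (c h n).

Lemma low_L2per M h : L2per L (low M h).
Proof.
rewrite /low; apply: (subspace_sum _ (L2per_subspace (L := L))) => n.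
exact: wave_L2per.
Qed.

Lemma hcoef_low M h k : c (low M h) k = (k < M)%N%:R *: c h k.
Proof.
apply/matrixP => i j; rewrite ord1 /low.
rewrite (linf_sum (L2per_subspace (L := L)) (hcoef_linf L0 k i)); last first.
  by move=> n; exact: wave_L2per.
under eq_bigr do rewrite hcoef_wave mxE.
rewrite mxE; have [kM|Mk] := ltnP k M.
  rewrite (bigD1 (Ordinal kM))//= eqxx !mul1r big1 ?addr0// => n.
  by rewrite -val_eqE/= eq_sym => /negPf ->; rewrite mul0r.
by rewrite mul0r big1// => n _; rewrite gtn_eqF ?mul0r// (leq_trans (ltn_ord n)).
Qed.

Lemma hcoef_high M h k : L2per L h -> c (h - low M h) k = (M <= k)%N%:R *: c h k.
Proof.
move=> lh; apply/matrixP => i j; rewrite ord1.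
rewrite (linfB (hcoef_linf L0 k i) lh (low_L2per M h)).
rewrite hcoef_low [RHS]mxE [X in _ - X]mxE ltnNge.
by case: (M <= k)%N; rewrite /= ?mul1r ?mul0r ?subrr ?subr0.
Qed.

Lemma high_L2per M h : L2per L h -> L2per L (h - low M h).
Proof. by move=> lh; exact: (subspaceB (L2per_subspace (L := L)) lh (low_L2per M h)). Qed.

Lemma high_cvg M h : L2per L h ->
  (fun N => L * \sum_(n < N) (M <= n)%N%:R * dot (c h n) (c h n)) @ \oo -->
  L2dot L (h - low M h) (h - low M h).
Proof.
move=> lh; have lq := high_L2per M lh.
have P := hartley_parseval L0 lq lq.
have -> : L2dot L (h - low M h) (h - low M h) = L * (L^-1 * L2dot L (h - low M h) (h - low M h)).
  by rewrite mulrA divff ?mul1r// gt_eqF.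
apply: cvgM; first exact: cvg_cst.
rewrite (_ : (fun N => _) = series (fun n => dot (c (h - low M h) n) (c (h - low M h) n)))//.
apply/funext => N; rewrite seriesEnat/= big_mkord; apply: eq_bigr => n _.
rewrite hcoef_high// dot_scale; case: leqP => _; rewrite ?mul1r ?expr1n ?mul1r//.
by rewrite mul0r expr0n mul0r.
Qed.

Definition inv_weight_sum (M : nat) : R := \sum_(n < M) (wt n)^-1.

Lemma sum_CS (M : nat) (w f g : nat -> R) : (forall n, 0 < w n) ->
  (\sum_(n < M) f n * g n) ^+ 2 <= (\sum_(n < M) w n * f n ^+ 2) * \sum_(n < M) (w n)^-1 * g n ^+ 2.
Proof.
move=> w0; pose b (f g : nat -> R^o) := \sum_(n < M) w n * (f n * g n).
have bb : bilin (fun=> True) b.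
  split=> [u v _ _|a u v x _ _ _]; first by apply: eq_bigr => n _; rewrite [u n * _]mulrC.
  rewrite /b mulr_sumr -big_split/=; apply: eq_bigr => n _.
  have -> : (a *: u + v) n = a * u n + v n :> R by [].
  by ring.
have b0 : psd (fun=> True) b.
  by move=> u _; apply: sumr_ge0 => n _; rewrite mulr_ge0 ?(ltW (w0 n))// -expr2 sqr_ge0.
have sT : subspace (fun _ : nat -> R^o => True) by [].
have := psd_CS sT bb b0 (u := f) (v := fun n => (w n)^-1 * g n) Logic.I Logic.I.
have -> : b f (fun n => (w n)^-1 * g n) = \sum_(n < M) f n * g n.
  by apply: eq_bigr => n _; field; rewrite gt_eqF.
have -> : b f f = \sum_(n < M) w n * f n ^+ 2 by apply: eq_bigr => n _; rewrite expr2.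
have -> : b (fun n => (w n)^-1 * g n) (fun n => (w n)^-1 * g n) = \sum_(n < M) (w n)^-1 * g n ^+ 2.
  by apply: eq_bigr => n _; field; rewrite gt_eqF.
by [].
Qed.

(** On finitely many modes the supremum is controlled by the energy, by the
Cauchy-Schwarz inequality with the weights; the constant diverges with the number
of modes only in the critical range of s. *)
Lemma low_sup M h x : X h ->
  dot (low M h x) (low M h x) <= 2 * L^-1 * inv_weight_sum M * xd h h.
Proof.
move=> Xh; pose S i := \sum_(n < M) wt n * c h n i 0 ^+ 2.
have B0 : 0 <= inv_weight_sum M.
  by apply: sumr_ge0 => n _; rewrite invr_ge0 sweight_ge0.
have Hi i : low M h x i 0 * low M h x i 0 <= S i * (2 * inv_weight_sum M).
  have -> : low M h x i 0 = \sum_(n < M) c h n i 0 * cas L (zint n) x.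
    by rewrite /low fct_sumE summxE; apply: eq_bigr => n _; rewrite /wave mxE mulrC.
  rewrite -expr2; apply: (le_trans (sum_CS M (fun n => c h n i 0) (fun n => cas L (zint n) x) (sweight_gt0 s0))).
  apply: ler_wpM2l; first by apply: sumr_ge0 => n _; rewrite mulr_ge0 ?sqr_ge0// sweight_ge0.
  rewrite /inv_weight_sum mulr_sumr; apply: ler_sum => n _; rewrite mulrC ler_pM2r.
    exact: cas_sq_bounded.
  by rewrite invr_gt0 sweight_gt0.
apply: (@le_trans _ _ (\sum_(i < 2) S i * (2 * inv_weight_sum M))).
  by apply: ler_sum => i _; exact: Hi.
rewrite -mulr_suml (_ : \sum_(i < 2) S i = \sum_(n < M) wt n * dot (c h n) (c h n)); last first.
  rewrite /S exchange_big/=; apply: eq_bigr => n _; rewrite -mulr_sumr; congr (_ * _).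
have := energy_partial_le L0 s0 M Xh; rewrite -ler_pdivlMl// => H.
have := ler_wpM2r (mulr_ge0 (ler0n _ 2) B0) H.
by move=> K; apply: (le_trans K); rewrite le_eqVlt; apply/orP; left; apply/eqP; ring.
Qed.

(** By the supremum bound, low frequencies alone do not produce large values. *)
Lemma high_lower_bound M h x (lam : R) : X h -> lam < dot (h x) (h x) ->
  2 * L^-1 * inv_weight_sum M * xd h h <= lam / 4 ->
  lam / 4 <= dot ((h - low M h) x) ((h - low M h) x).
Proof.
move=> Xh hl small; have h1 := le_trans (low_sup M x Xh) small.
have := psd_sqD_le trueS dot_bilin (fun x _ => dot_ge0 x) (u := low M h x) (v := (h - low M h) x)
  Logic.I Logic.I.
have -> : low M h x + (h - low M h) x = h x.
  by rewrite -[(_ - _) x]/(h x - low M h x) addrC subrK.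
by move: h1 hl; move: (dot _ _) (dot _ _) (dot _ _) => a b d; lra.
Qed.

Lemma inv_weight_block J : \sum_(4 ^ J <= n < 4 ^ J.+1) (wt n)^-1 <= 3 * rr * (4 / rr) ^+ J.
Proof.
have r0 := growth_ratio_gt0 (s := s).
apply: (@le_trans _ _ (\sum_(4 ^ J <= n < 4 ^ J.+1) rr / rr ^+ J)).
  rewrite big_nat_cond [leRHS]big_nat_cond; apply: ler_sum => n /andP[/andP[Jn _] _].
  have := sweight_ge_dyadic L0 s0 Jn => h.
  rewrite ler_pdivlMr ?exprn_gt0// mulrC ler_pdivrMr ?sweight_gt0//.
have E4 : (4 ^ J.+1 - 4 ^ J = 3 * 4 ^ J)%N by rewrite expnS; lia.
rewrite sumr_const_nat E4.
rewrite -[leLHS]mulr_natr natrM natrX exprMn exprVn.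
by rewrite le_eqVlt; apply/orP; left; apply/eqP; ring.
Qed.

Lemma inv_weight_sum_dyadic J : inv_weight_sum (4 ^ J) <= 1 + 3 * rr * \sum_(j < J) (4 / rr) ^+ j.
Proof.
elim: J => [|J IH].
  rewrite /inv_weight_sum expn0 big_ord1 big_ord0 mulr0 addr0 invf_le1 ?sweight_gt0//.
  exact: sweight_ge1.
rewrite big_ord_recr/= mulrDr addrA.
have -> : inv_weight_sum (4 ^ J.+1) =
    inv_weight_sum (4 ^ J) + \sum_(4 ^ J <= n < 4 ^ J.+1) (wt n)^-1.
  rewrite /inv_weight_sum -!(big_mkord xpredT (fun n => (wt n)^-1)).
  by rewrite (big_cat_nat (n := 4 ^ J))//= leq_exp2l.
by apply: lerD IH (inv_weight_block J).
Qed.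

(** The sum over the levels J of r^J |Q_J h|^2 is a Sobolev norm, because at a fixed
    frequency the sum over J is geometric. *)
Lemma level_weights P K n :
  \sum_(J < K) (4 ^ (J + P) <= n)%N%:R * rr ^+ J <= rr ^+ 2 / (rr - 1) / rr ^+ P * wt n.
Proof.
have r1 := growth_ratio_gt1 s0; have r0 := growth_ratio_gt0 (s := s).
have w0 := sweight_ge0 s0 n.
elim: K => [|K IH].
  by rewrite big_ord0 mulr_ge0// !divr_ge0 ?exprn_ge0 ?subr_ge0// ltW.
have [h|h] := leqP (4 ^ (K + P)) n; last first.
  by rewrite big_ord_recr/= leqNgt h mul0r addr0.
apply: (@le_trans _ _ (\sum_(J < K.+1) rr ^+ J)).
  apply: ler_sum => J _; case: (_ <= _)%N; rewrite ?mul1r// mul0r.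
  by rewrite exprn_ge0// ltW.
have r10 : 0 < rr - 1 by rewrite subr_gt0.
have E : \sum_(J < K.+1) rr ^+ J = (rr ^+ K.+1 - 1) / (rr - 1).
  by rewrite subrX1 mulrAC divff ?mul1r// gt_eqF.
rewrite E; apply: (@le_trans _ _ (rr ^+ K.+1 / (rr - 1))).
  by rewrite ler_pM2r ?invr_gt0// gerBl.
have := sweight_ge_dyadic L0 s0 h; rewrite exprD => H.
have -> : rr ^+ 2 / (rr - 1) / rr ^+ P * wt n = (rr / (rr - 1) / rr ^+ P) * (rr * wt n) by ring.
have k0 : 0 <= rr / (rr - 1) / rr ^+ P by rewrite !divr_ge0 ?exprn_ge0 ?ltW.
apply: le_trans (ler_wpM2l k0 H); rewrite exprS le_eqVlt; apply/orP; left; apply/eqP.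
field; by rewrite expf_neq0 ?gt_eqF.
Qed.

Lemma high_levels P K h : X h ->
  \sum_(J < K) rr ^+ J * L2dot L (h - low (4 ^ (J + P)) h) (h - low (4 ^ (J + P)) h) <=
  rr ^+ 2 / (rr - 1) / rr ^+ P * xd h h.
Proof.
move=> Xh; have lh := X_L2 Xh; set Cp := rr ^+ 2 / _ / _.
have C0 : 0 <= Cp.
  have r1 := growth_ratio_gt1 s0; have r0 := growth_ratio_gt0 (s := s).
  by rewrite !divr_ge0 ?exprn_ge0 ?subr_ge0// ltW.
pose T N := \sum_(J < K) rr ^+ J * (L * \sum_(n < N) (4 ^ (J + P) <= n)%N%:R * dot (c h n) (c h n)).
have cT : T @ \oo --> \sum_(J < K) rr ^+ J * L2dot L (h - low (4 ^ (J + P)) h) (h - low (4 ^ (J + P)) h).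
  apply: cvg_big; [exact: add_continuous|move=> J _]; apply: cvgM; first exact: cvg_cst.
  exact: high_cvg.
rewrite -(cvg_lim (@Rhausdorff _) cT); apply: limr_le; first by apply/cvg_ex; eexists; exact: cT.
apply: nearW => N; apply: le_trans (ler_wpM2l C0 (energy_partial_le L0 s0 N Xh)).
rewrite mulrCA /T.
under eq_bigr do rewrite mulrCA.
rewrite -mulr_sumr ler_pM2l//.
under eq_bigr do rewrite mulr_sumr.
rewrite exchange_big mulr_sumr; apply: ler_sum => n _.
under eq_bigr do rewrite mulrA [rr ^+ _ * _]mulrC.
rewrite -mulr_suml mulrA; apply: ler_wpM2r; first exact: dot_ge0.
exact: level_weights.
Qed.

End LowHigh.

Arguments low {R} L M h.

(** * Tails of superposition operators *)

Section Tail.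
Context {R : realType} {L s : R} (L0 : 0 < L) (s0 : 0 < s).
Notation mu := (@lebesgue_measure R).
Local Notation I L f := (\int[mu]_(x in `[0, L]) f x).
Local Notation c := (hcoef L).
Local Notation wt := (sweight s).
Local Notation X := (Xspace L s).
Local Notation xd := (xdot (L := L) (s := s)).
Local Notation rr := (growth_ratio (s := s)).
Local Notation bb := (dyadic_sum (s := s)).
Local Notation B := (inv_weight_sum (s := s)).
Implicit Types (u v w h : R -> 'cV[R]_2).

Definition large_on (del : R) h x : R := (del < dot (h x) (h x))%R%:R.

Lemma measurable_dot h : L2per L h -> measurable_fun [set: R] (fun x => dot (h x) (h x)).
Proof. by move=> lh; exact: (CI_dot lh lh).1. Qed.

Lemma measurable_large_on del h : L2per L h -> measurable_fun [set: R] (large_on del h).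
Proof.
move=> lh; have -> : large_on del h =
    (\1_((fun x => dot (h x) (h x)) @^-1` `]del, +oo[%classic) : R -> R).
  apply/funext => x; rewrite indicE /large_on.
  have [hx|hx] := ltP del (dot (h x) (h x)); first by rewrite mem_set//= in_itv/= andbT.
  by rewrite memNset//= in_itv/= andbT; apply/negP; rewrite -leNgt.
by apply: measurable_indic; rewrite -[_ @^-1` _]setTI; exact: measurable_dot.
Qed.

Lemma large_on_itv del h x : 0 <= large_on del h x <= 1.
Proof. by rewrite /large_on; case: (_ < _); rewrite ?lexx ler01. Qed.

Lemma large_on_le (del : R) M h x : 0 < del -> X h ->
  2 * L^-1 * B M * xd h h <= del / 4 ->
  large_on del h x <= 4 / del * dot ((h - low L M h) x) ((h - low L M h) x).
Proof.
move=> del0 Xh small; rewrite /large_on.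
case: ltP => [hx|_]; last by rewrite mulr_ge0 ?dot_ge0// divr_ge0// ltW.
have := high_lower_bound L0 s0 Xh hx small.
rewrite -(ler_pM2l (_ : 0 < 4 / del)); last by rewrite divr_gt0.
by rewrite (_ : 4 / del * (del / 4) = 1)//; field; rewrite gt_eqF.
Qed.

Section Subcritical.
Context (s1 : 1 < s).

Lemma growth_ratio_gt4 : 4 < rr.
Proof.
rewrite -[ltLHS]powRr1// /growth_ratio /powR !gt_eqF// ltr_expR ltr_pM2r// ln_gt0//.
by rewrite ltr1n.
Qed.

Lemma inv_weight_sum_bounded : exists2 K : R, 0 < K & forall J, B (4 ^ J) <= K.
Proof.
have r4 := growth_ratio_gt4; have r0 := growth_ratio_gt0 (s := s).
pose q := 4 / rr; have q1 : q < 1 by rewrite ltr_pdivrMr// mul1r.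
have q0 : 0 <= q by rewrite divr_ge0// ltW.
have q1' : 0 < 1 - q by rewrite subr_gt0.
exists (1 + 3 * rr * (1 - q)^-1).
  by rewrite addr_gt0// !mulr_gt0// invr_gt0.
move=> J; apply: (le_trans (inv_weight_sum_dyadic L0 s0 J)).
rewrite lerD2l; apply: ler_wpM2l; first by rewrite mulr_ge0// ltW.
rewrite -/q -[leRHS]mul1r ler_pdivlMr//.
have E : (\sum_(j < J) q ^+ j) * (1 - q) = 1 - q ^+ J by have := subrX1 q J; lra.
by rewrite E gerBl exprn_ge0.
Qed.

(** For s > 1 the energy space embeds into the bounded functions, so that small
functions are nowhere large. *)
Lemma subcritical_small (del : R) : 0 < del -> exists2 d : R, 0 < d &
  forall h, X h -> xd h h < d -> {ae mu, forall x, large_on del h x = 0}.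
Proof.
move=> del0; have [K K0 HK] := inv_weight_sum_bounded.
exists (del / 4 / (2 * L^-1 * K)).
  by rewrite !divr_gt0 ?mulr_gt0 ?invr_gt0.
move=> h Xh hd; have lh := X_L2 Xh; have x0 := xdot_psd L0 s0 Xh.
have small J : 2 * L^-1 * B (4 ^ J) * xd h h <= del / 4.
  move: hd; rewrite ltr_pdivlMr ?mulr_gt0 ?invr_gt0// mulrC => /ltW; apply: le_trans.
  apply: ler_wpM2r => //; apply: ler_wpM2l; last exact: HK.
  by rewrite mulr_ge0// invr_ge0 ltW.
have cl : CI L (large_on del h).
  apply: (@CI_bounded _ _ _ 1); first exact: measurable_large_on.
  by move=> x; have /andP[a b] := large_on_itv del h x; rewrite ger0_norm.
apply: (int_ae_eq0 L0 _ cl) => [x|x|]; first by rewrite /large_on lh.1.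
  by case/andP: (large_on_itv del h x).
apply/eqP; rewrite eq_le int_ge0 => [|x]; last by case/andP: (large_on_itv del h x).
rewrite andbT.
have r1 := growth_ratio_gt1 s0; have r0 := growth_ratio_gt0 (s := s).
set T := xdot h h in x0 hd small.
pose k := 4 / del * (rr ^+ 2 / (rr - 1) * T).
have k0 : 0 <= k.
  have h1 : 0 <= 4 / del by rewrite divr_ge0// ltW.
  have h2 : 0 <= rr ^+ 2 / (rr - 1) by rewrite divr_ge0 ?sqr_ge0// subr_ge0 ltW.
  exact: mulr_ge0 h1 (mulr_ge0 h2 x0).
have H P : I L (large_on del h) <= k * rr^-1 ^+ P.
  have lq := high_L2per L0 (4 ^ (0 + P)) lh.
  apply: (@le_trans _ _ (4 / del * L2dot L (h - low L (4 ^ (0 + P)) h) (h - low L (4 ^ (0 + P)) h))).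
    rewrite -(intZ _ (CI_dot lq lq)).
    apply: (int_le cl (CIZ _ (CI_dot lq lq))) => x; exact: large_on_le.
  rewrite /k -[leRHS]mulrA; apply: ler_wpM2l; first by rewrite divr_ge0// ltW.
  have := high_levels L0 s0 P 1 Xh; rewrite big_ord1 expr0 mul1r => h1.
  by apply: (le_trans h1); rewrite exprVn le_eqVlt; apply/orP; left; apply/eqP; rewrite -/T; ring.
have cv : (fun P => k * rr^-1 ^+ P) @ \oo --> k * 0.
  apply: cvgM; first exact: cvg_cst.
  by apply: cvg_expr; rewrite ger0_norm ?invr_ge0 ?(ltW r0)// invf_lt1.
rewrite mulr0 in cv; apply: (le_trans (limr_ge (cvgP _ cv) (nearW _ H))).
by rewrite (cvg_lim (@Rhausdorff _) cv).
Qed.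

End Subcritical.

Section Critical.
Context (s1 : s <= 1).

Lemma dyadic_sum_ge_pow J : (4 / rr) ^+ J <= bb J.
Proof.
rewrite /bb big_ord_recr/= lerDr; apply: sumr_ge0 => j _; rewrite exprn_ge0//.
by rewrite divr_ge0// ltW// growth_ratio_gt0.
Qed.

Lemma dyadic_sum_shift P J : bb (J + P) <= 5 ^+ P * bb J.
Proof.
have r0 := growth_ratio_gt0 (s := s); have r1 := growth_ratio_gt1 s0.
elim: P => [|P IH]; first by rewrite addn0 expr0 mul1r.
have q4 : 4 / rr <= 4 by rewrite ler_pdivrMr// ler_peMr// ltW.
have b1 := dyadic_sum_ge_nat s1 (J + P).
have b1' : 1 <= bb (J + P) by apply: le_trans b1; rewrite ler1n.
have E : bb (J + P).+1 = 1 + 4 / rr * bb (J + P).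
  rewrite /bb big_ord_recl expr0 mulr_sumr; congr (_ + _).
  by apply: eq_bigr => j _; rewrite /= exprS.
rewrite addnS E exprS -(mulrA 5); apply: (@le_trans _ _ (5 * bb (J + P))); last by rewrite ler_pM2l.
have b0 : 0 <= bb (J + P) by exact: le_trans b1'.
have h := ler_wpM2r b0 q4; apply: (le_trans (lerD b1' h)).
by rewrite le_eqVlt; apply/orP; left; apply/eqP; ring.
Qed.

Lemma inv_weight_sum_le_dyadic J : B (4 ^ J) <= (1 + 3 * rr) * bb J.
Proof.
have r0 := growth_ratio_gt0 (s := s).
apply: (le_trans (inv_weight_sum_dyadic L0 s0 J)).
have b1 := dyadic_sum_ge_nat s1 J.
have b1' : 1 <= bb J by apply: le_trans b1; rewrite ler1n.
rewrite [leRHS]mulrDl mul1r; apply: lerD => //; apply: ler_wpM2l; first by rewrite mulr_ge0// ltW.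
rewrite /bb big_ord_recr/= lerDl exprn_ge0// divr_ge0// ltW//.
Qed.

Context (N : 'cV[R]_2 -> R) (phi : R -> 'cV[R]_2) (cN : continuous N) (N0 : forall a, 0 <= N a).
Context (HN : forall u, X u -> mu.-integrable `[0, L] (fun x => (N (u x))%:E)).
Context (Xphi : X phi) (M0 : R) (phiM : forall x, dot (phi x) (phi x) <= M0).

(** The set where h is large is cut along the levels [theta / 4 * bb (J1 + J)]: on
each layer the growth bound on N competes with the size of the high frequencies
of h, the cut-off frequency growing with the level. *)
Lemma critical_levels (C theta : R) : 0 < C -> 0 < theta ->
  (forall J a, dot a a <= theta * bb J -> N a <= C * 4 ^+ J) ->
  forall (del : R) (J1 P : nat) h, 0 < del -> M0 <= theta / 4 * bb J1 -> X h ->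
  2 * L^-1 * B (4 ^ P) * xd h h <= del / 4 ->
  (forall J, 2 * L^-1 * B (4 ^ (J + P)) * xd h h <= theta / 4 * bb J / 4) ->
  forall K x, large_on del h x * (1 - large_on (theta / 4 * bb (J1 + K)) h x) * N (phi x + h x) <=
    C * 4 ^+ J1 * (4 / del * dot ((h - low L (4 ^ P) h) x) ((h - low L (4 ^ P) h) x)) +
    \sum_(J < K) (64 * C * rr ^+ J1 / theta) * (rr ^+ J *
      dot ((h - low L (4 ^ (J + (J1 + P))) h) x) ((h - low L (4 ^ (J + (J1 + P))) h) x)).
Proof.
move=> C0 th0 HC del J1 P h del0 MJ Xh hP hJ K x.
have r0 := growth_ratio_gt0 (s := s).
have b_nd J K' : bb J <= bb (J + K').
  elim: K' => [|K' IH]; first by rewrite addn0.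
  apply: (le_trans IH); rewrite addnS /bb [leRHS]big_ord_recr/= lerDl exprn_ge0//.
  by rewrite divr_ge0// ltW.
have N_le J : dot (h x) (h x) <= theta / 4 * bb (J1 + J) -> N (phi x + h x) <= C * 4 ^+ (J1 + J).
  move=> hx; apply: HC.
  have := psd_sqD_le trueS dot_bilin (fun x _ => dot_ge0 x) (u := phi x) (v := h x) Logic.I Logic.I.
  have := phiM x; have th4 : 0 < theta / 4 by rewrite divr_gt0.
  have := b_nd J1 J; rewrite -(ler_pM2l th4) => h1 h2 h3.
  have h4 := le_trans h2 (le_trans MJ h1).
  move: hx h3 h4; rewrite -mulrA [4^-1 * _]mulrC mulrA; move: (theta * _) => tb.
  move: (dot (phi x + h x) _) (dot (phi x) _) (dot (h x) _) => a b d; lra.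
have q0 M : 0 <= dot ((h - low L M h) x) ((h - low L M h) x) by exact: dot_ge0.
have k0 : 0 <= 64 * C * rr ^+ J1 / theta.
  by rewrite divr_ge0 ?(ltW th0)// mulr_ge0 ?exprn_ge0 ?(ltW r0)// mulr_ge0// ltW.
have c4 : 0 <= C * 4 ^+ J1 by rewrite mulr_ge0 ?exprn_ge0// ltW.
elim: K => [|K IH].
  rewrite big_ord0 addr0 addn0.
  have H := large_on_le x del0 Xh hP; have [l0 l1] := andP (large_on_itv del h x).
  rewrite {2}/large_on; case: ltP => [_|hx].
    by rewrite subrr mulr0 mul0r mulr_ge0// (le_trans l0).
  rewrite subr0 mulr1 mulrC; apply: ler_pM => //.
  by rewrite -[J1 in leRHS]addn0; apply: N_le; rewrite addn0.
rewrite big_ord_recr/= addrA.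
have [hx|hx] := leP (dot (h x) (h x)) (theta / 4 * bb (J1 + K)).
  have e1 J : dot (h x) (h x) <= theta / 4 * bb (J1 + J) -> large_on (theta / 4 * bb (J1 + J)) h x = 0.
    by rewrite /large_on => hh; rewrite ltNge hh.
  rewrite e1 in IH; last exact: hx.
  rewrite e1; last first.
    apply: (le_trans hx); rewrite ler_pM2l ?divr_gt0//.
    by have := b_nd (J1 + K)%N 1%N; rewrite addn1 addnS.
  by apply: (le_trans IH); rewrite lerDl mulr_ge0// mulr_ge0// exprn_ge0// (ltW r0).
rewrite -[leLHS]add0r; apply: lerD.
  apply: addr_ge0; first by rewrite mulr_ge0// mulr_ge0// divr_ge0// ltW.
  by apply: sumr_ge0 => J _; rewrite mulr_ge0// mulr_ge0// exprn_ge0// ltW.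
have [l0 l1] := andP (large_on_itv del h x).
rewrite {2}/large_on; case: ltP => [_|hx'].
  by rewrite subrr mulr0 mul0r mulr_ge0// mulr_ge0// exprn_ge0// ltW.
rewrite subr0 mulr1; apply: (@le_trans _ _ (N (phi x + h x))); first exact: ler_piMl.
apply: (le_trans (N_le _ hx')).
have := high_lower_bound L0 s0 Xh hx (hJ (J1 + K)%N).
have -> : (J1 + K + P = K + (J1 + P))%N by rewrite [RHS]addnCA addnA.
set Q := dot _ _ => hQ; have b0 := dyadic_sum_gt0 s1 (J1 + K).
have hb := dyadic_sum_ge_pow (J1 + K).
have p4 : 4 ^+ (J1 + K) <= rr ^+ (J1 + K) * bb (J1 + K) :> R.
  move: hb; rewrite expr_div_n ler_pdivrMr ?exprn_gt0// mulrC; exact.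
rewrite addnS exprS.
apply: (@le_trans _ _ (4 * C * (rr ^+ (J1 + K) * bb (J1 + K)))).
  by rewrite mulrA [C * 4]mulrC ler_pM2l// mulr_gt0.
rewrite exprD; apply: (@le_trans _ _ (64 * C * rr ^+ J1 / theta * (rr ^+ K * (theta / 4 * bb (J1 + K) / 4)))).
  by rewrite le_eqVlt; apply/orP; left; apply/eqP; field; rewrite gt_eqF.
by apply: ler_wpM2l => //; apply: ler_wpM2l => //; rewrite exprn_ge0// ltW.
Qed.

Lemma critical_tail (del e : R) : 0 < del -> 0 < e -> exists2 d : R, 0 < d &
  forall h, X h -> xd h h < d ->
    I L (fun x => large_on del h x * N (phi x + h x)) <= e * xd h h.
Proof.
move=> del0 e0; have [C [th [C0 th0 HC]]] := superposition_growth L0 s0 s1 cN N0 HN.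
have r0 := growth_ratio_gt0 (s := s); have r1 := growth_ratio_gt1 s0.
have th4 : 0 < th / 4 by rewrite divr_gt0.
pose J1 := Num.truncn (M0 / (th / 4)).
have MJ : M0 <= th / 4 * bb J1.
  rewrite -ler_pdivrMl// mulrC; apply: le_trans (dyadic_sum_ge_nat s1 J1).
  exact/ltW/truncnS_gt.
pose Gam := rr ^+ 2 / (rr - 1).
have Gam0 : 0 <= Gam by rewrite /Gam divr_ge0 ?sqr_ge0// subr_ge0 ltW.
pose A1 := C * 4 ^+ J1 * (4 / del); pose A2 := 64 * C * rr ^+ J1 / th.
have C0' := ltW C0; have del0' := ltW del0; have th0' := ltW th0; have r0' := ltW r0.
have A10 : 0 <= A1 by rewrite /A1 mulr_ge0 ?divr_ge0// mulr_ge0 ?exprn_ge0.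
have A20 : 0 <= A2 by rewrite /A2 divr_ge0// mulr_ge0 ?exprn_ge0// mulr_ge0.
have [P HP] : exists P : nat, (A1 + A2) * Gam * rr^-1 ^+ P <= e.
  have cv : (fun P => (A1 + A2) * Gam * rr^-1 ^+ P) @ \oo --> (A1 + A2) * Gam * 0.
    apply: cvgM; first exact: cvg_cst.
    by apply: cvg_expr; rewrite ger0_norm ?invr_ge0 ?(ltW r0)// invf_lt1.
  rewrite mulr0 in cv; have [P _ HP] := (cvgr_lt (0 : R) cv e e0); exists P.
  exact: (ltW (HP P (leqnn P))).
pose B1 := 2 * L^-1 * B (4 ^ P); pose B2 := 2 * L^-1 * ((1 + 3 * rr) * 5 ^+ P).
have B10 : 0 <= B1.
  rewrite mulr_ge0// ?mulr_ge0 ?invr_ge0 ?(ltW L0)//.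
  by apply: sumr_ge0 => n _; rewrite invr_ge0 sweight_ge0.
have B20 : 0 <= B2.
  by rewrite !mulr_ge0 ?exprn_ge0 ?invr_ge0 ?(ltW L0)// addr_ge0// mulr_ge0// ltW.
exists (Num.min (del / 4 / (B1 + 1)) (th / 16 / (B2 + 1))).
  by rewrite lt_min !divr_gt0// ?ltr_wpDl.
move=> h Xh; rewrite lt_min !ltr_pdivlMr ?ltr_wpDl// => /andP[hd1 hd2].
have x0 := xdot_psd L0 s0 Xh; have lh := X_L2 Xh.
set T := xdot h h in hd1 hd2 x0 *.
have c1 : 2 * L^-1 * B (4 ^ P) * T <= del / 4.
  by rewrite ler_pdivlMr//; apply: le_trans (ltW hd1); rewrite ler_pM2r// mulrC; apply: ler_wpM2l => //; rewrite -/B1 lerDl.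
have c2 J : 2 * L^-1 * B (4 ^ (J + P)) * T <= th / 4 * bb J / 4.
  have b0 := dyadic_sum_gt0 s1 J.
  apply: (@le_trans _ _ (T * B2 * bb J)).
    rewrite mulrC -[leRHS]mulrA; apply: ler_wpM2l => //; rewrite /B2 -[leRHS]mulrA; apply: ler_wpM2l.
      by rewrite mulr_ge0// invr_ge0 ltW.
    apply: (le_trans (inv_weight_sum_le_dyadic (J + P))); rewrite -mulrA; apply: ler_wpM2l.
      by rewrite addr_ge0// mulr_ge0// ltW.
    exact: dyadic_sum_shift.
  have -> : th / 4 * bb J / 4 = th / 16 * bb J by field.
  rewrite ler_pM2r// ler_pdivlMr//; apply: le_trans (ltW hd2); rewrite ler_pM2r//.
  by apply: ler_wpM2l => //; rewrite lerDl.
have lev := critical_levels C0 th0 HC del0 MJ Xh c1 c2.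
have sX := X_subspace L0 s0 (L := L) (s := s).
have cNh := superposition_CI cN HN (subspaceD sX Xphi Xh).
have ml := measurable_large_on del lh.
have mk k := measurable_large_on k lh.
have cF k : CI L (fun x => large_on del h x * (1 - large_on k h x) * N (phi x + h x)).
  apply: (CI_dom _ (CI_norm cNh)).
    by apply: measurable_funM cNh.1; apply: measurable_funM => //; apply: measurable_funB.
  move=> x; rewrite normrM; have [a0 a1] := andP (large_on_itv del h x).
  have [b0 b1] := andP (large_on_itv k h x).
  apply: ler_piMl => //; rewrite ger0_norm; first by rewrite mulr_ile1// ?subr_ge0// gerBl.
  by rewrite mulr_ge0// subr_ge0.
have bound K : I L (fun x => large_on del h x * (1 - large_on (th / 4 * bb (J1 + K)) h x) *
    N (phi x + h x)) <= e * T.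
  have cq M : CI L (fun x => dot ((h - low L M h) x) ((h - low L M h) x)).
    by have lq := high_L2per L0 M lh; exact: (CI_dot lq lq).
  pose G x := C * 4 ^+ J1 * (4 / del * dot ((h - low L (4 ^ P) h) x) ((h - low L (4 ^ P) h) x)) +
    \sum_(J < K) (64 * C * rr ^+ J1 / th) * (rr ^+ J *
      dot ((h - low L (4 ^ (J + (J1 + P))) h) x) ((h - low L (4 ^ (J + (J1 + P))) h) x)).
  have cG1 : CI L (fun x => C * 4 ^+ J1 * (4 / del * dot ((h - low L (4 ^ P) h) x) ((h - low L (4 ^ P) h) x))).
    by do 2 apply: CIZ.
  have cG2 : CI L (fun x => \sum_(J < K) (64 * C * rr ^+ J1 / th) * (rr ^+ J *
      dot ((h - low L (4 ^ (J + (J1 + P))) h) x) ((h - low L (4 ^ (J + (J1 + P))) h) x))).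
    by apply: CI_sum => J; do 2 apply: CIZ.
  apply: (le_trans (int_le (cF _) (CID cG1 cG2) (lev K))).
  rewrite (intD cG1 cG2) int_sum => [|J]; last by do 2 apply: CIZ.
  rewrite intZ; last exact: CIZ.
  rewrite intZ//.
  have -> : \sum_(J < K) I L (fun x => 64 * C * rr ^+ J1 / th * (rr ^+ J *
      dot ((h - low L (4 ^ (J + (J1 + P))) h) x) ((h - low L (4 ^ (J + (J1 + P))) h) x))) =
    A2 * \sum_(J < K) rr ^+ J * L2dot L (h - low L (4 ^ (J + (J1 + P))) h) (h - low L (4 ^ (J + (J1 + P))) h).
    rewrite mulr_sumr; apply: eq_bigr => J _; rewrite intZ; last exact: CIZ.
    by rewrite intZ.
  have h1 := high_levels L0 s0 (J1 + P) K Xh.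
  have h2 := high_levels L0 s0 P 1 Xh; rewrite big_ord1 expr0 mul1r add0n in h2.
  have h3 : rr ^+ 2 / (rr - 1) / rr ^+ (J1 + P) * T <= Gam * rr^-1 ^+ P * T.
    apply: ler_wpM2r => //; rewrite exprVn; apply: ler_wpM2l => //.
    rewrite lef_pV2 ?posrE ?exprn_gt0//; apply: ler_weXn2l; first exact: ltW.
    exact: leq_addl.
  rewrite mulrA -/A1; apply: (le_trans (lerD (ler_wpM2l A10 h2) (ler_wpM2l A20 (le_trans h1 h3)))).
  apply: (@le_trans _ _ ((A1 + A2) * Gam * rr^-1 ^+ P * T)); last exact: ler_wpM2r.
  by rewrite -/T -/Gam exprVn le_eqVlt; apply/orP; left; apply/eqP; ring.
have lim := int_dominated_cvg (L := L)
  (f_ := fun K x => large_on del h x * (1 - large_on (th / 4 * bb (J1 + K)) h x) * N (phi x + h x))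
  (f := fun x => large_on del h x * N (phi x + h x)) (g := fun x => N (phi x + h x)).
have {}lim : (fun K => I L (fun x => large_on del h x * (1 - large_on (th / 4 * bb (J1 + K)) h x) *
   N (phi x + h x))) @ \oo --> I L (fun x => large_on del h x * N (phi x + h x)).
  apply: lim => [K||||K x].
  - exact: (cF _).1.
  - exact: measurable_funM ml cNh.1.
  - apply: aeW => x; apply: cvg_near_cst.
    exists (Num.truncn (dot (h x) (h x) / (th / 4))) => // K /= hK.
    suff -> : large_on (th / 4 * bb (J1 + K)) h x = 0 by rewrite subr0 mulr1.
    rewrite /large_on ltNge (_ : _ <= _ = true)//.
    rewrite -ler_pdivrMl// mulrC; apply: (le_trans _ (dyadic_sum_ge_nat s1 (J1 + K))).
    apply: (le_trans (ltW (truncnS_gt _))); rewrite ler_nat ltnS.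
    exact: leq_trans (leq_addl _ _).
  - exact: cNh.
  - have [a0 a1] := andP (large_on_itv del h x).
    have [b0 b1] := andP (large_on_itv (th / 4 * bb (J1 + K)) h x).
    rewrite normrM (ger0_norm (N0 _)); apply: ler_piMl => //.
    rewrite ger0_norm; first by rewrite mulr_ile1// ?subr_ge0// gerBl.
    by rewrite mulr_ge0// subr_ge0.
rewrite -(cvg_lim (@Rhausdorff _) lim); apply: limr_le; first by apply/cvg_ex; eexists; exact: lim.
exact: nearW.
Qed.

End Critical.

(** For s > 1 the set where h is large is negligible. For s <= 1 the function h is
carried there by its high frequencies, beyond a cut-off that grows as h gets
small, and their contribution is a small multiple of the square of its norm. *)
Lemma superposition_tail (N : 'cV[R]_2 -> R) (phi : R -> 'cV[R]_2) (M0 del e : R) :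
  continuous N -> (forall a, 0 <= N a) ->
  (forall u, X u -> mu.-integrable `[0, L] (fun x => (N (u x))%:E)) ->
  X phi -> (forall x, dot (phi x) (phi x) <= M0) -> 0 < del -> 0 < e ->
  exists2 d : R, 0 < d &
  forall h, X h -> xd h h < d ->
    I L (fun x => large_on del h x * N (phi x + h x)) <= e * xd h h.
Proof.
move=> cN N0 HN Xphi phiM del0 e0; have [s1|s1] := leP s 1.
  exact: (critical_tail s1 cN N0 HN Xphi phiM del0 e0).
have [d d0 Hd] := subcritical_small s1 del0; exists d => // h Xh hd.
have sX := X_subspace L0 s0 (L := L) (s := s).
have cNh := superposition_CI cN HN (subspaceD sX Xphi Xh).
have lh := X_L2 Xh; have x0 := xdot_psd L0 s0 Xh.
have ae0 := Hd h Xh hd.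
rewrite (@int_ae_eq _ _ _ (fun=> 0)).
- by rewrite int_cst// mul0r mulr_ge0// ltW.
- exact: measurable_funM (measurable_large_on del lh) cNh.1.
- exact: measurable_cst.
- by apply: aeS ae0 => x ->; rewrite mul0r.
Qed.

End Tail.
Arguments wave {R} L n a.

(** * Second-order expansion of a C^2 function of two variables *)

Section Calculus.
Context {R : realType}.
Implicit Types (F G : 'cV[R]_2 -> R) (a b h : 'cV[R]_2) (f g : R -> R).

Lemma dot_near F a (e : R) : continuous F -> 0 < e -> exists2 d : R, 0 < d &
  forall b, dot (b - a) (b - a) < d -> `|F b - F a| < e.
Proof.
move=> cF e0.
have : \forall b \near a, `|F a - F b| < e by apply: cvgr_dist_lt (cF a) e e0.
move=> /nbhs_ballP[r /= r0 Hr]; exists (r ^+ 2); first by rewrite exprn_gt0.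
move=> b hb; rewrite distrC; apply: Hr; split=> // i j; rewrite ord1 -ball_normE/= distrC.
have := coord_sq_le (b - a) i; rewrite !mxE => h; have {}h := le_lt_trans h hb.
by rewrite -(ltr_pXn2r (n := 2))// ?nnegrE ?(ltW r0)// real_normK ?num_real.
Qed.

Lemma bounded_cluster (a_ : nat -> 'cV[R]_2) (M : R) : (forall n, dot (a_ n) (a_ n) <= M) ->
  exists a, forall (d : R) N, 0 < d -> exists2 n, (N <= n)%N & dot (a_ n - a) (a_ n - a) < d.
Proof.
move=> aM; have M0 : 0 <= M by exact: le_trans (dot_ge0 _) (aM 0%N).
have [n j|p Hp] := @bounded_seq_cluster R 2 (fun n => (a_ n)^T) (1 + M).
  rewrite mxE; have := le_trans (coord_sq_le (a_ n) j) (aM n) => h.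
  rewrite -(ler_pXn2r (n := 2)) ?nnegrE ?addr_ge0// real_normK ?num_real//.
  by apply: (le_trans h); have := sqr_ge0 M; rewrite !expr2; nra.
exists p^T => d N d0; pose eta := Num.min 1 (d / 2).
have eta0 : 0 < eta by rewrite lt_min ltr01 divr_gt0.
have [N1 HN1] := natinv_small eta0; have [n nN Hn] := Hp (maxn N N1).
exists n; first exact: leq_trans (leq_maxl _ _) nN.
have small j : `|(a_ n - p^T) j 0| < eta.
  by have := lt_trans (Hn j) (HN1 _ (leq_maxr N N1)); rewrite !mxE.
have sq j : (a_ n - p^T) j 0 * (a_ n - p^T) j 0 < d / 2.
  have := small j; rewrite lt_min => /andP[h1 h2].
  rewrite -expr2 -real_normK ?num_real//; apply: le_lt_trans h2.
  by rewrite expr2 ler_piMr// ltW.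
by rewrite /dot sum2; have := sq 0; have := sq 1; lra.
Qed.

Lemma uniform_on_bounded F (M e : R) : continuous F -> 0 < e -> exists2 d : R, 0 < d &
  forall a h, dot a a <= M -> dot h h < d -> `|F (a + h) - F a| < e.
Proof.
move=> cF e0; apply: contrapT => no.
have /choice[p Hp] : forall n, exists p : 'cV[R]_2 * 'cV[R]_2,
    [/\ dot p.1 p.1 <= M, dot p.2 p.2 < harmonic n & e <= `|F (p.1 + p.2) - F p.1|].
  move=> n; apply: contrapT => no2; apply: no; exists (harmonic n); first exact: harmonic_gt0.
  move=> a h aM hn; rewrite ltNge; apply/negP => he; apply: no2; by exists (a, h).
have pM n : dot (p n).1 (p n).1 <= M by case: (Hp n).
have [a Ha] := bounded_cluster pM.
have [d d0 Hd] := dot_near a cF (divr_gt0 e0 (ltr0n R 2)).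
have d4 : 0 < d / 4 by rewrite divr_gt0.
have [N HN] := natinv_small d4; have [n nN hn] := Ha (d / 4) N d4.
have [_ h1 h2] := Hp n; have h3 := lt_trans h1 (HN n nN).
have k1 : `|F (p n).1 - F a| < e / 2 by apply: Hd; apply: (lt_trans hn); lra.
have k2 : `|F ((p n).1 + (p n).2) - F a| < e / 2.
  apply: Hd; rewrite addrAC.
  have := psd_sqD_le trueS dot_bilin (fun x _ => dot_ge0 x) (u := (p n).1 - a) (v := (p n).2)
    Logic.I Logic.I.
  by move=> k; apply: (le_lt_trans k); move: hn h3; lra.
have : `|F ((p n).1 + (p n).2) - F (p n).1| < e.
  rewrite (_ : _ - _ = (F ((p n).1 + (p n).2) - F a) - (F (p n).1 - F a)); last by ring.
  by apply: (le_lt_trans (ler_normB _ _)); lra.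
by rewrite ltNge h2.
Qed.

Lemma bounded_on_bounded F (M : R) : continuous F -> exists2 K : R, 0 <= K &
  forall a, dot a a <= M -> `|F a| <= K.
Proof.
move=> cF; apply: contrapT => no.
have /choice[p Hp] : forall n : nat, exists p : 'cV[R]_2, dot p p <= M /\ n%:R < `|F p|.
  move=> n; apply: contrapT => no2; apply: no; exists n%:R => // a aM.
  by rewrite leNgt; apply/negP => he; apply: no2; exists a.
have [a Ha] := bounded_cluster (fun n => (Hp n).1).
have [d d0 Hd] := dot_near a cF (ltr01 : 0 < 1 :> R).
have [n nN hn] := Ha d (Num.truncn (`|F a| + 1)).+1 d0.
have [_ h] := Hp n; have h1 := Hd _ hn.
have h2 : `|F (p n)| <= `|F a| + 1.
  rewrite (_ : F (p n) = F a + (F (p n) - F a)); last by ring.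
  by apply: (le_trans (ler_normD _ _)); lra.
have h3 : `|F a| + 1 < n%:R by apply: lt_le_trans (truncnS_gt _) _; rewrite ler_nat.
lra.
Qed.

Lemma mvt_sym f f' (y : R) : (forall t : R, is_derive t 1 f (f' t)) ->
  exists2 xi, `|xi| <= `|y| & f y - f 0 = f' xi * y.
Proof.
move=> df.
have cf (A : set R) : {within A, continuous f}.
  apply: continuous_subspaceT => t; apply: differentiable_continuous.
  by apply/derivable1_diffP; exact: (@ex_derive _ _ _ _ _ _ _ (df t)).
have [y0|y0|y0] := ltgtP 0 y.
- have [xi] := MVT y0 (fun t _ => df t) (cf _); rewrite in_itv/= => /andP[x0 xy].
  rewrite subr0 => ->; exists xi => //.
  by rewrite (gtr0_norm x0) (gtr0_norm y0) ltW.
- have [xi] := MVT y0 (fun t _ => df t) (cf _); rewrite in_itv/= => /andP[x0 xy].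
  rewrite sub0r => E; exists xi; last by rewrite -opprB E mulrN opprK.
  by rewrite (ltr0_norm xy) (ltr0_norm y0) lerN2 ltW.
- by exists 0; rewrite -?y0 ?subrr ?mulr0.
Qed.

Lemma taylor2 f f' f'' (kap e y : R) : (forall t : R, is_derive t 1 f (f' t)) ->
  (forall t : R, is_derive t 1 f' (f'' t)) -> (forall t, `|t| <= `|y| -> `|f'' t - kap| <= e) ->
  `|f y - f 0 - f' 0 * y - kap / 2 * y ^+ 2| <= e * y ^+ 2.
Proof.
move=> df df' H.
pose g t := f t - f' 0 * t - kap / 2 * t ^+ 2; pose k t := f' t - kap * t.
have dg t : is_derive t (1 : R) g (f' t - f' 0 - kap * t).
  have D := df t; rewrite /g; apply: is_derive_eq.
  by rewrite /GRing.scale/=; field.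
have dk t : is_derive t (1 : R) k (f'' t - kap).
  have D := df' t; rewrite /k; apply: is_derive_eq.
  by rewrite /GRing.scale/=; ring.
have [xi xy E] := mvt_sym y dg; have [z zx E2] := mvt_sym xi dk.
have -> : f y - f 0 - f' 0 * y - kap / 2 * y ^+ 2 = g y - g 0.
  by rewrite /g expr0n/= !mulr0; ring.
have E3 : f' xi - f' 0 - kap * xi = (f'' z - kap) * xi by rewrite -E2 /k mulr0; ring.
rewrite E E3 !normrM -[in leRHS]real_normK ?num_real// expr2 mulrA.
apply: ler_wpM2r => //; apply: ler_pM => //; apply: H; exact: le_trans zx xy.
Qed.

Definition unit_vec (i : 'I_2) : 'cV[R]_2 := delta_mx i 0.
Local Notation ee := unit_vec.

Lemma line_derive F i a t : (forall b, derivable F b (ee i)) ->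
  is_derive t (1 : R) (fun t => F (a + t *: ee i)) (partial i F (a + t *: ee i)).
Proof.
move=> dF.
have E : (fun h : R => h^-1 *: (F (a + (h *: (1 : R) + t) *: ee i) - F (a + t *: ee i))) =
    (fun h : R => h^-1 *: (F (h *: ee i + (a + t *: ee i)) - F (a + t *: ee i))).
  apply/funext => h; congr (_ *: (F _ - _)).
  by rewrite -[h *: 1]/(h * 1) mulr1 scalerDl addrCA.
have D := dF (a + t *: ee i).
apply: DeriveDef; first by rewrite /derivable/= E; exact: D.
by rewrite /partial /derive/= E.
Qed.

#[local] Opaque partial.

Lemma vec2E h : h = h 0 0 *: ee 0 + h 1 0 *: ee 1.
Proof.
apply/matrixP => i j; rewrite ord1 !mxE; case: i => [[|[|]]]//= i2.
  by rewrite mulr1 mulr0 addr0; congr (h _ _); apply/val_inj.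
by rewrite mulr0 mulr1 add0r; congr (h _ _); apply/val_inj.
Qed.

Lemma dot_coord (x y : R) : dot (x *: ee 0 + y *: ee 1) (x *: ee 0 + y *: ee 1) = x ^+ 2 + y ^+ 2.
Proof. by rewrite /dot sum2 !mxE/= !mulr1 !mulr0 addr0 add0r !expr2. Qed.

Lemma sq_le_of_norm (x y : R) : `|x| <= `|y| -> x ^+ 2 <= y ^+ 2.
Proof. by move=> h; rewrite -[x ^+ 2]real_normK ?num_real// -[y ^+ 2]real_normK ?num_real// ler_pXn2r ?nnegrE. Qed.

Lemma increment_split (f2 f1 f0 p0 q0 p1 q1 x y : R) : f1 - f0 = q0 * x -> f2 - f1 = q1 * y ->
  f2 - f0 - (p0 * x + p1 * y) = (q0 - p0) * x + (q1 - p1) * y.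
Proof. by move=> E1 E2; rewrite !mulrBl -E1 -E2; ring. Qed.

Lemma dist_half (p u v e : R) : `|p - v| < e / 2 -> `|p - u| < e / 2 -> `|u - v| <= e.
Proof.
move=> h1 h2; rewrite (_ : u - v = (p - v) - (p - u)); last by ring.
by apply: (le_trans (ler_normB _ _)); lra.
Qed.

Lemma first_order F (M e : R) : (forall i a, derivable F a (ee i)) ->
  (forall i, continuous (partial i F)) -> 0 < e -> exists2 d : R, 0 < d &
  forall a h, dot a a <= M -> dot h h < d ->
  `|F (a + h) - F a - \sum_j partial j F a * h j 0| <= e * (`|h 0 0| + `|h 1 0|).
Proof.
move=> dF cF e0; have [d0 d00 H0] := uniform_on_bounded M (cF 0) e0.
have [d1 d10 H1] := uniform_on_bounded M (cF 1) e0.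
exists (Num.min d0 d1); first by rewrite lt_min d00 d10.
move=> a h aM; rewrite lt_min => /andP[hd0 hd1]; set x := h 0 0; set y := h 1 0.
have hE : h = x *: ee 0 + y *: ee 1 := vec2E h.
rewrite hE dot_coord in hd0 hd1.
have [xi xx E1] := mvt_sym x (fun t => line_derive a t (dF 0)).
have [z zy E2] := mvt_sym y (fun t => line_derive (a + x *: ee 0) t (dF 1)).
rewrite /= !scale0r !addr0 in E1 E2.
have k0 : `|partial 0 F (a + xi *: ee 0) - partial 0 F a| < e.
  apply: H0 => //; have -> : xi *: ee 0 = xi *: ee 0 + 0 *: ee 1 by rewrite scale0r addr0.
  rewrite dot_coord expr0n addr0; apply: le_lt_trans hd0.
  by have := sq_le_of_norm xx; have := sqr_ge0 y; lra.
have k1 : `|partial 1 F (a + x *: ee 0 + z *: ee 1) - partial 1 F a| < e.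
  rewrite -addrA; apply: H1 => //; rewrite dot_coord; apply: le_lt_trans hd1.
  by have := sq_le_of_norm zy; lra.
rewrite sum2 -/x -/y hE addrA.
rewrite (increment_split _ _ E1 E2).
apply: (le_trans (ler_normD _ _)); rewrite !normrM mulrDr.
exact: (lerD (ler_wpM2r (normr_ge0 x) (ltW k0)) (ler_wpM2r (normr_ge0 y) (ltW k1))).
Qed.

Lemma quadratic_form2 (p q r x y : R) : p * x * x + q * y * x + (q * x * y + r * y * y) =
  p * x ^+ 2 + 2 * (q * x * y) + r * y ^+ 2.
Proof. ring. Qed.

Lemma norm_mul_le (x y : R) : `|x * y| <= x ^+ 2 + y ^+ 2.
Proof.
rewrite normrM -(real_normK (num_real x)) -(real_normK (num_real y)).
have := sqr_ge0 (`|x| - `|y|); have := sqr_ge0 (`|x| + `|y|).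
by move: `|x| `|y| => p q; rewrite !expr2; lra.
Qed.

Lemma expansion_combine (g2 g1 g0 q0 p1 p0 q00 q11 q01 P e x y : R) : p1 - p0 = P * x ->
  `|g1 - g0 - q0 * x - q00 / 2 * x ^+ 2| <= e / 2 * x ^+ 2 ->
  `|g2 - g1 - p1 * y - q11 / 2 * y ^+ 2| <= e / 2 * y ^+ 2 ->
  `|(P - q01) * (x * y)| <= e / 2 * (x ^+ 2 + y ^+ 2) ->
  `|g2 - g0 - (q0 * x + p0 * y) - 2^-1 * (q00 * x ^+ 2 + 2 * (q01 * x * y) + q11 * y ^+ 2)| <=
  e * (x ^+ 2 + y ^+ 2).
Proof.
move=> E T0 T1 T2.
have -> : g2 - g0 - (q0 * x + p0 * y) - 2^-1 * (q00 * x ^+ 2 + 2 * (q01 * x * y) + q11 * y ^+ 2) =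
   (g1 - g0 - q0 * x - q00 / 2 * x ^+ 2) +
   (g2 - g1 - p1 * y - q11 / 2 * y ^+ 2) + (P - q01) * (x * y).
  have -> : p1 = p0 + P * x by rewrite -E; ring.
  by field.
apply: (le_trans (ler_normD _ _)); apply: (le_trans (lerD (ler_normD _ _) (lexx _))).
by move: T0 T1 T2; lra.
Qed.

Section C2.
Context {G : 'cV[R]_2 -> R} (GC2 : class_C2 G).

Let dG i a : derivable G a (ee i). Proof. by case: GC2 => _ h _ _ _; exact: h. Qed.
Let dG2 j i a : derivable (partial j G) a (ee i). Proof. by case: GC2 => _ _ _ h _; exact: h. Qed.
Let cG2 i j : continuous (partial i (partial j G)). Proof. by case: GC2 => _ _ _ _ h; exact: h. Qed.

Lemma mixed_difference i j a (t : R) : i != j -> exists2 p, dot (p - a) (p - a) <= 2 * t ^+ 2 &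
  G (a + t *: ee i + t *: ee j) - G (a + t *: ee i) - G (a + t *: ee j) + G a =
  t ^+ 2 * partial j (partial i G) p.
Proof.
move=> ij.
pose psi s := G (a + t *: ee j + s *: ee i) - G (a + s *: ee i).
have dpsi s : is_derive s (1 : R) psi
    (partial i G (a + t *: ee j + s *: ee i) - partial i G (a + s *: ee i)).
  have D1 := line_derive (a + t *: ee j) s (@dG i); have D2 := line_derive a s (@dG i).
  exact: is_deriveB.
have [xi xt E] := mvt_sym t dpsi.
have [eta et E2] := mvt_sym t (fun u => line_derive (a + xi *: ee i) u (@dG2 i j)).
rewrite /= scale0r addr0 in E2.
exists (a + xi *: ee i + eta *: ee j).
  rewrite -(addrA a) (addrC a) addrK.
  have -> : dot (xi *: ee i + eta *: ee j) (xi *: ee i + eta *: ee j) = xi ^+ 2 + eta ^+ 2.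
    rewrite (bilin_sqD trueS dot_bilin)// !dot_scale (bilinZl trueS dot_bilin)// (bilinZr trueS dot_bilin)//.
    have u1 k : dot (ee k) (ee k) = 1.
      by rewrite /dot (bigD1 k)//= big1 ?addr0 ?mxE ?eqxx ?mulr1// => l lk; rewrite !mxE (negPf lk) mul0r.
    have u0 : dot (ee i) (ee j) = 0.
      by rewrite /dot big1// => l _; rewrite !mxE; case: eqP => [->|_]; rewrite ?(negPf ij) ?mul0r ?mulr0.
    by rewrite !u1 u0; ring.
  by have := sq_le_of_norm xt; have := sq_le_of_norm et; lra.
have E0 : G (a + t *: ee i + t *: ee j) - G (a + t *: ee i) - G (a + t *: ee j) + G a =
    psi t - psi 0 by rewrite /psi scale0r !addr0 (addrAC a (t *: ee j)); ring.
by rewrite E0 E (addrAC a (t *: ee j)) E2 expr2 -mulrA mulrC.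
Qed.

Lemma mixed_swap a u v : G (a + u + v) - G (a + u) - G (a + v) + G a =
  G (a + v + u) - G (a + v) - G (a + u) + G a.
Proof. by rewrite (addrAC a u v); ring. Qed.

(** Both mixed derivatives are limits of the same symmetric second difference. *)
Lemma clairaut a : partial 0 (partial 1 G) a = partial 1 (partial 0 G) a.
Proof.
apply/eqP; rewrite -subr_eq0 -normr_eq0 eq_le normr_ge0 andbT.
apply/ler_addgt0Pl => e e0; rewrite addr0.
have e2 : 0 < e / 2 by rewrite divr_gt0.
have [d0 d00 H0] := dot_near a (@cG2 0 1) e2; have [d1 d10 H1] := dot_near a (@cG2 1 0) e2.
pose d := Num.min 1 (Num.min d0 d1); have dp : 0 < d by rewrite !lt_min ltr01 d00 d10.
pose t := d / 2; have t0 : 0 < t by rewrite divr_gt0.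
have td : 2 * t ^+ 2 < d.
  have d1' : d <= 1 by rewrite ge_min lexx.
  by rewrite /t expr2; move: dp d1' => h1 h2; nra.
have [p pa E] := mixed_difference a t (isT : (0 : 'I_2) != 1).
have [q qa E'] := mixed_difference a t (isT : (1 : 'I_2) != 0).
have pq : partial 1 (partial 0 G) p = partial 0 (partial 1 G) q.
  have t2 : t ^+ 2 != 0 by rewrite expf_neq0// gt_eqF.
  have EE : t ^+ 2 * partial 1 (partial 0 G) p = t ^+ 2 * partial 0 (partial 1 G) q.
    exact: (etrans (etrans (esym E) (mixed_swap a _ _)) E').
  exact: (mulfI t2 EE).
have dd0 : d <= d0 by rewrite !ge_min lexx !orbT.
have dd1 : d <= d1 by rewrite !ge_min lexx !orbT.
have k1 := H1 p (lt_le_trans (le_lt_trans pa td) dd1).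
have k0 := H0 q (lt_le_trans (le_lt_trans qa td) dd0).
rewrite -pq in k0; exact: dist_half k1 k0.
Qed.

Lemma partial_comm i j a : partial i (partial j G) a = partial j (partial i G) a.
Proof.
have I2 (k : 'I_2) : k = 0 \/ k = 1.
  by case: k => [[|[|//]]] h; [left|right]; exact: val_inj.
case: (I2 i) (I2 j) => -> [] ->; [exact: erefl|exact: clairaut|exact: (esym (clairaut a))|exact: erefl].
Qed.

Lemma Hess_sym a b h : dot (Hess G a *m b) h = dot (Hess G a *m h) b.
Proof.
rewrite !dot_mulmx !sum2 !mxE.
have -> : partial 0 (partial 1 G) a = partial 1 (partial 0 G) a := clairaut a.
move: (partial 0 (partial 0 G) a) (partial 1 (partial 0 G) a) (partial 1 (partial 1 G) a).
move: (b 0 0) (b 1 0) (h 0 0) (h 1 0) => b0 b1 h0 h1 A B C; ring.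
Qed.

(** The increment is taken along the two sides of a rectangle; this uses partial
derivatives only, uniformly on bounded sets. *)
Lemma second_order (M e : R) : 0 < e -> exists2 d : R, 0 < d &
  forall a h, dot a a <= M -> dot h h < d ->
  `|G (a + h) - G a - dot (grad G a) h - 2^-1 * dot (Hess G a *m h) h| <= e * dot h h.
Proof.
move=> e0; have e2 : 0 < e / 2 by rewrite divr_gt0.
have [d0 d00 H0] := uniform_on_bounded M (@cG2 0 0) e2.
have [d1 d10 H1] := uniform_on_bounded M (@cG2 1 1) e2.
have [d2 d20 H2] := uniform_on_bounded M (@cG2 0 1) e2.
exists (Num.min d0 (Num.min d1 d2)); first by rewrite !lt_min d00 d10 d20.
move=> a h aM; rewrite !lt_min => /andP[hd0 /andP[hd1 hd2]].
set x := h 0 0; set y := h 1 0.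
have hE : h = x *: ee 0 + y *: ee 1 := vec2E h.
have hn : dot h h = x ^+ 2 + y ^+ 2 by rewrite hE dot_coord.
rewrite hn in hd0 hd1 hd2 *.
have E0 (xi : R) : xi *: ee 0 = xi *: ee 0 + 0 *: ee 1 by rewrite scale0r addr0.
have T0 := taylor2 (kap := partial 0 (partial 0 G) a) (e := e / 2) (y := x)
  (fun t => line_derive a t (@dG 0)) (fun t => line_derive a t (@dG2 0 0)).
have {}T0 := T0 _; have {}T0 : `|G (a + x *: ee 0) - G a - partial 0 G a * x -
    partial 0 (partial 0 G) a / 2 * x ^+ 2| <= e / 2 * x ^+ 2.
  have := T0; rewrite /= scale0r addr0; apply => t tx; apply: ltW; apply: H0 => //.
  rewrite E0 dot_coord expr0n addr0; apply: le_lt_trans hd0.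
  by have := sq_le_of_norm tx; have := sqr_ge0 y; lra.
have T1 := taylor2 (kap := partial 1 (partial 1 G) a) (e := e / 2) (y := y)
  (fun t => line_derive (a + x *: ee 0) t (@dG 1)) (fun t => line_derive (a + x *: ee 0) t (@dG2 1 1)).
have {}T1 : `|G (a + x *: ee 0 + y *: ee 1) - G (a + x *: ee 0) - partial 1 G (a + x *: ee 0) * y -
    partial 1 (partial 1 G) a / 2 * y ^+ 2| <= e / 2 * y ^+ 2.
  have := T1; rewrite /= scale0r addr0; apply => t ty; apply: ltW; rewrite -addrA; apply: H1 => //.
  rewrite dot_coord; apply: le_lt_trans hd1.
  by have := sq_le_of_norm ty; lra.
have [xi xx E2] := mvt_sym x (fun t => line_derive a t (@dG2 1 0)).
rewrite /= scale0r addr0 in E2.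
have T2 : `|partial 0 (partial 1 G) (a + xi *: ee 0) - partial 0 (partial 1 G) a| < e / 2.
  apply: H2 => //; rewrite E0 dot_coord expr0n addr0; apply: le_lt_trans hd2.
  by have := sq_le_of_norm xx; have := sqr_ge0 y; lra.
have gE : dot (grad G a) h = partial 0 G a * x + partial 1 G a * y by rewrite /dot sum2 !mxE.
have HE : dot (Hess G a *m h) h = partial 0 (partial 0 G) a * x ^+ 2 +
   2 * (partial 0 (partial 1 G) a * x * y) + partial 1 (partial 1 G) a * y ^+ 2.
  rewrite dot_mulmx !sum2 !mxE -/x -/y -(clairaut a).
  exact: quadratic_form2.
have T3 : `|(partial 0 (partial 1 G) (a + xi *: ee 0) - partial 0 (partial 1 G) a) * (x * y)| <=
    e / 2 * (x ^+ 2 + y ^+ 2).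
  rewrite normrM; apply: ler_pM => //; first exact: ltW.
  exact: norm_mul_le.
rewrite gE HE hE addrA; exact: expansion_combine E2 T0 T1 T3.
Qed.

End C2.
End Calculus.

(** * The linearized operator *)

Section Smooth.
Context {R : realType} {L : R} (L0 : 0 < L).
Notation mu := (@lebesgue_measure R).

Lemma periodic_reduce (T : Type) (f : R -> T) x : (forall x, f (x + L) = f x) ->
  exists2 t : R, 0 <= t <= L & f x = f t.
Proof.
move=> pf; have /andP[h1 h2] := lattice_offset L0 x.
exists (x - (Num.floor (x / L))%:~R * L); first by rewrite h1 ltW.
by rewrite -[LHS](periodic_int (- Num.floor (x / L)) x pf) intrN mulNr.
Qed.

Lemma continuous_periodic_bounded (f : R -> R) : continuous f -> periodic f L ->
  exists2 M : R, 0 <= M & forall x, `|f x| <= M.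
Proof.
move=> cf pf; have cn : {within `[0, L], continuous (fun x => `|f x|)}.
  apply: continuous_subspaceT => x; exact: (continuous_comp (cf x) (@norm_continuous _ _ _)).
have [t _ Ht] := EVT_max (ltW L0) cn.
exists `|f t| => // x; have [y yL ->] := periodic_reduce x pf.
by apply: Ht; rewrite in_itv.
Qed.

Lemma derivable_continuous_fun (f : R -> R) : (forall x, derivable f x 1) -> continuous f.
Proof. by move=> df x; apply/differentiable_continuous/derivable1_diffP/df. Qed.

Lemma smooth_component_continuous u i : smooth_periodic L u -> continuous (component u i : R -> R).
Proof. by move=> [_ H]; apply: derivable_continuous_fun => x; exact: (H i 0%N x). Qed.

Lemma smooth_bounded u : smooth_periodic L u -> exists2 M : R, 0 <= M & forall x, dot (u x) (u x) <= M.
Proof.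
move=> su; have [pu _] := su.
have pc i : periodic (component u i) L by move=> x; rewrite /component pu.
have [M0 M00 H0] := continuous_periodic_bounded (@smooth_component_continuous u 0 su) (pc 0).
have [M1 M10 H1] := continuous_periodic_bounded (@smooth_component_continuous u 1 su) (pc 1).
exists (M0 ^+ 2 + M1 ^+ 2); first by rewrite addr_ge0 ?sqr_ge0.
move=> x; rewrite /dot sum2 -!expr2; apply: lerD; rewrite -real_normK ?num_real// ler_pXn2r ?nnegrE//.
  exact: H0.
exact: H1.
Qed.

Lemma smooth_L2per u : smooth_periodic L u -> L2per L u.
Proof.
move=> su; have [pu _] := su; apply/L2perP => i.
have pc : periodic (component u i) L by move=> x; rewrite /component pu.
have [M _ H] := continuous_periodic_bounded (@smooth_component_continuous u i su) pc.
apply: (L2s_bounded pc _ H); apply: continuous_measurable_fun.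
exact: smooth_component_continuous.
Qed.

Lemma L2s_mul_bounded (f g : R -> R) (M : R) : L2s L f -> periodic g L ->
  measurable_fun [set: R] g -> (forall x, `|g x| <= M) -> L2s L (fun x => g x * f x).
Proof.
move=> lf pg mg gM; have [pf mf _] := lf.
have m : measurable_fun [set: R] (fun x => g x * f x) by exact: measurable_funM.
split=> //; first by move=> x; rewrite pf pg.
apply: (CI_dom (g := fun x => M ^+ 2 * f x ^+ 2) _ (CIZ _ (L2s_CI_sq lf)) _).2.
  exact: measurable_funX.
move=> x; rewrite ger0_norm ?sqr_ge0// exprMn; apply: ler_wpM2r; first exact: sqr_ge0.
rewrite -real_normK ?num_real// ler_pXn2r ?nnegrE//.
exact: le_trans (normr_ge0 _) (gM x).
Qed.

End Smooth.

Section Arithmetic.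
Context {R : realType}.
Implicit Types (a b d x y z k w f C : R).

Lemma sq_sum_le a b k x y : a ^+ 2 <= k * x -> b ^+ 2 <= k * y -> (a + b) ^+ 2 <= 2 * k * (x + y).
Proof. by move=> h1 h2; have := sqr_ge0 (a - b); rewrite sqrrB sqrrD; lra. Qed.

Lemma add_halves x y k d : x <= 2 * k * d -> y <= 2 * k * d -> y + x <= 4 * k * d.
Proof. by move=> h1 h2; lra. Qed.

Lemma form_lin_combine k x y z x' y' z' (t : R) :
  k * x + x' + t * (k * y + y') - (k * z + z') = k * (x + t * y - z) + (x' + t * y' - z').
Proof. ring. Qed.

Lemma mule_posI a (p q : \bar R) : 0 < a -> (a%:E * p = a%:E * q)%E -> p = q.
Proof.
move=> a0 E; have := congr1 (fun t : \bar R => (a^-1%:E * t)%E) E.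
by rewrite !muleA -!EFinM mulVf ?gt_eqF// !mul1e.
Qed.

Lemma garding_combine k x q M t h C K : k * x - k * q <= M -> - t <= C -> h <= K ->
  k * x <= M + t - h + (k * q + C + K).
Proof. by move=> *; lra. Qed.

Lemma garding_low_combine k x l q S T : k * x <= l + q -> q <= S + T -> T <= k / 2 * x ->
  k / 2 * x <= l + S.
Proof. by move=> *; lra. Qed.

Lemma sq_le_double w f : 0 <= w -> w <= f + 1 -> w ^+ 2 <= 2 * f ^+ 2 + 2.
Proof. by move=> h1 h2; have := sqr_ge0 (f - 1); rewrite !expr2; nra. Qed.

End Arithmetic.

Section Sobolev.
Context {R : realType} {L s : R} (L0 : 0 < L) (s0 : 0 < s).
Local Notation cf := (hcoef L).
Local Notation wt := (sweight s).
Local Notation X := (Xspace L s).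
Implicit Types (u v w : R -> 'cV[R]_2).

Lemma sweight_sqE n : wt n ^+ 2 = (1 + freq n ^+ 2) `^ s :> R.
Proof. by rewrite /sweight -powR_mulrn ?powR_ge0// -powRrM; congr (_ `^ _); field. Qed.

Definition strong_energy u (B : R) := forall N, L * \sum_(n < N) wt n ^+ 2 * dot (cf u n) (cf u n) <= B.

Lemma HperP u : Hper L s u <-> L2per L u /\ exists B, strong_energy u B.
Proof.
have f0 n : 0 <= wt n ^+ 2 * dot (cf u n) (cf u n) by rewrite mulr_ge0 ?sqr_ge0 ?dot_ge0.
have Eq : L2per L u -> sobolev_sq L s u = (L%:E * \sum_(n <oo) (wt n ^+ 2 * dot (cf u n) (cf u n))%:E)%E.
  move=> lu; rewrite (sobolev_sqE L0 s lu); congr (_ * _)%E.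
  by apply: eq_eseriesr => n _; rewrite sweight_sqE.
split=> [[lu]|[lu [B HB]]].
  rewrite Eq// => fin; split=> //.
  have n0 : (0 <= \sum_(n <oo) (wt n ^+ 2 * dot (cf u n) (cf u n))%:E)%E.
    by apply: nneseries_ge0 => n _ _; rewrite lee_fin.
  have [B EB] : exists B : R, (\sum_(n <oo) (wt n ^+ 2 * dot (cf u n) (cf u n))%:E)%E = B%:E.
    move: fin n0; case: (\sum_(n <oo) _)%E => [B _ _||//]; first by exists B.
    by rewrite mulry gtr0_sg// mul1e ltxx.
  exists (L * B) => N; rewrite ler_pM2l//; apply: (sum_le_nneseries f0); by rewrite EB.
split=> //; rewrite Eq//.
have HB' N : \sum_(n < N) wt n ^+ 2 * dot (cf u n) (cf u n) <= L^-1 * B by rewrite ler_pdivlMl.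
by have [_ ->] := series_EFin_lim f0 HB'; rewrite -EFinM ltry.
Qed.

Lemma strong_energy_translate u y B : L2per L u -> strong_energy u B -> strong_energy (translate y u) B.
Proof.
move=> lu HB.
have f0 v n : 0 <= wt n ^+ 2 * dot (cf v n) (cf v n) by rewrite mulr_ge0 ?sqr_ge0 ?dot_ge0.
have Eq v : L2per L v -> sobolev_sq L s v = (L%:E * \sum_(n <oo) (wt n ^+ 2 * dot (cf v n) (cf v n))%:E)%E.
  move=> lv; rewrite (sobolev_sqE L0 s lv); congr (_ * _)%E.
  by apply: eq_eseriesr => n _; rewrite sweight_sqE.
have lt := L2per_translate L0 y lu.
have := sobolev_sq_translate L0 s y lu; rewrite (Eq _ lt) (Eq _ lu) => E N.
have HB' M : \sum_(n < M) wt n ^+ 2 * dot (cf u n) (cf u n) <= L^-1 * B by rewrite ler_pdivlMl.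
have [_ E1] := series_EFin_lim (f0 u) HB'.
have LE : (L%:E != 0)%E by rewrite eqe gt_eqF.
rewrite -(ler_pdivlMl _ _ L0); apply: (sum_le_nneseries (f0 _)).
have -> : (\sum_(n <oo) (wt n ^+ 2 * dot (cf (translate y u) n) (cf (translate y u) n))%:E =
   \sum_(n <oo) (wt n ^+ 2 * dot (cf u n) (cf u n))%:E)%E.
  exact: (mule_posI L0 E).
rewrite E1 lee_fin.
apply: limr_le; first exact: (series_EFin_lim (f0 u) HB').1.
by apply: nearW => M; rewrite seriesEnat/= big_mkord.
Qed.

Lemma Hper_X u : Hper L s u -> X u.
Proof.
move=> /HperP[lu [B HB]]; apply/XspaceP => //; split=> //.
exists (L^-1 * B) => N; rewrite ler_pdivlMl//; apply: le_trans (HB N); rewrite ler_pM2l//.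
apply: ler_sum => n _; apply: ler_wpM2r; first exact: dot_ge0.
by rewrite expr2 ler_peMl ?sweight_ge1// ltW// sweight_gt0.
Qed.

(** The weights tend to infinity, so that high frequencies are negligible in L2. *)
Lemma L2_low_high (del : R) : 0 < del -> exists N : nat, forall u, X u ->
  L2dot L u u <= L * \sum_(n < N) dot (cf u n) (cf u n) + del * xdot (L := L) (s := s) u u.
Proof.
move=> del0; have [N HN] := sweight_large (s := s) s0 del^-1.
exists N => u Xu; have lu := X_L2 Xu; have := high_cvg L0 (M := 0%N) lu.
have low0 : low L 0 u = 0 by rewrite /low big_ord0.
rewrite low0 subr0 => cv; rewrite -(cvg_lim (@Rhausdorff _) cv).
apply: limr_le; first by apply/cvg_ex; eexists; exact: cv.
apply: nearW => M; apply: le_trans (lerD (lexx _) (ler_wpM2l (ltW del0) (energy_partial_le L0 s0 M Xu))).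
rewrite mulrCA -mulrDr ler_pM2l// mulr_sumr.
have -> : \sum_(n < N) dot (cf u n) (cf u n) = \sum_(n < maxn N M) (n < N)%N%:R * dot (cf u n) (cf u n).
  rewrite [LHS](big_ord_widen (maxn N M) (fun n => dot (cf u n) (cf u n)) (leq_maxl _ _)).
  by rewrite big_mkcond; apply: eq_bigr => n _; case: ltnP; rewrite ?mul1r ?mul0r.
have nn (n : nat) : 0 <= (n < N)%N%:R * dot (cf u n) (cf u n) by rewrite mulr_ge0 ?dot_ge0// ler0n.
apply: (@le_trans _ _ (\sum_(n < M) (n < N)%N%:R * dot (cf u n) (cf u n) +
   \sum_(n < M) del * (wt n * dot (cf u n) (cf u n)))).
  rewrite -big_split; apply: ler_sum => n _ /=; rewrite mul1r.
  have d0 := dot_ge0 (cf u n); case: ltnP => [_|/HN h].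
    by rewrite mul1r lerDl !mulr_ge0 ?sweight_ge0// ltW.
  rewrite mul0r add0r mulrA ler_peMl//.
  by rewrite -ler_pdivrMl// mulr1.
rewrite lerD2r [leRHS](bigID (fun n : 'I__ => (n < M)%N))/=.
rewrite -(big_ord_widen (maxn N M) (fun n => (n < N)%N%:R * dot (cf u n) (cf u n)) (leq_maxr _ _)).
by rewrite lerDl; apply: sumr_ge0 => n _; exact: nn.
Qed.

Lemma low_modes_sum u N : \sum_(n < N) dot (cf u n) (cf u n) =
  \sum_(j < N.*2) cf u j./2 (inord (odd j)) 0 ^+ 2.
Proof.
elim: N => [|N IH]; first by rewrite !big_ord0.
rewrite doubleS !big_ord_recr/= IH uphalf_double doubleK odd_double/= -addrA; congr (_ + _).
rewrite /dot sum2 -!expr2; congr (cf u N _ 0 ^+ 2 + cf u N _ 0 ^+ 2);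
  by apply/val_inj; rewrite /= inordK.
Qed.

End Sobolev.

Section Linearized.
Context {R : realType} {L s c c1 c2 : R} {m : R -> 'M[R]_2} {G : 'cV[R]_2 -> R}.
Context {phi : R -> 'cV[R]_2}.
Context (L0 : 0 < L) (s0 : 0 < s) (c10 : 0 < c1) (c20 : 0 < c2).
Context (adm : admissible_symbol s c1 c2 m) (GC2 : class_C2 G) (sphi : smooth_periodic L phi).
Notation mu := (@lebesgue_measure R).
Local Notation I L f := (\int[mu]_(x in `[0, L]) f x).
Local Notation cf := (hcoef L).
Local Notation wt := (sweight s).
Local Notation X := (Xspace L s).
Local Notation xd := (xdot (L := L) (s := s)).
Local Notation l := (Lform L c m G phi).
Implicit Types (u v w : R -> 'cV[R]_2).

Let sX : subspace X := X_subspace L0 s0.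
Let sL : subspace (L2per L) := L2per_subspace (L := L).

Definition Hop u : R -> 'cV[R]_2 := fun x => Hess G (phi x) *m u x.

Lemma Hess_bounded : exists2 K : R, 0 <= K & forall x i j, `|Hess G (phi x) i j| <= K.
Proof.
have [M _ HM] := smooth_bounded L0 sphi.
have [_ _ _ _ cG] := GC2.
have /choice[K HK] : forall p : 'I_2 * 'I_2, exists K : R, 0 <= K /\
    forall a, dot a a <= M -> `|partial p.1 (partial p.2 G) a| <= K.
  by move=> [i j]; have [K K0 HK] := bounded_on_bounded M (cG i j); exists K.
exists (\sum_p K p); first by apply: sumr_ge0 => p _; exact: (HK p).1.
move=> x i j; rewrite mxE (bigD1 (i, j))//=; apply: ler_wpDr; last exact: (HK (i, j)).2.
by apply: sumr_ge0 => p _; exact: (HK p).1.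
Qed.

Lemma Hop_L2per u : L2per L u -> L2per L (Hop u).
Proof.
move=> /L2perP lu; have [K K0 HK] := Hess_bounded; have [_ _ _ _ cG] := GC2; have [pphi _] := sphi.
have mphi i : measurable_fun [set: R] (component phi i) by have [_ /(_ i)[]] := smooth_L2per L0 sphi.
apply/L2perP => i.
have e j : L2s L (fun x => Hess G (phi x) i j * component u j x).
  apply: (L2s_mul_bounded (lu j)) => [x||x]; last exact: HK.
    by rewrite pphi.
  have := measurable_superposition (cG i j) mphi.
  by congr measurable_fun; apply/funext => x; rewrite mxE.
rewrite (_ : component (Hop u) i = fun x => 1 * (Hess G (phi x) i 0 * component u 0 x) +
   Hess G (phi x) i 1 * component u 1 x); first exact: L2s_lin.
by apply/funext => x; rewrite /component /Hop mxE sum2 mul1r.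
Qed.

Lemma Hop_lin (a : R) u v : Hop (a *: u + v) = a *: Hop u + Hop v.
Proof.
apply/funext => x; rewrite /Hop.
transitivity (a *: (Hess G (phi x) *m u x) + Hess G (phi x) *m v x); last exact: erefl.
by rewrite scalemxAr -mulmxDr.
Qed.

Lemma Hop_pointwise (K : R) u x : (forall x i j, `|Hess G (phi x) i j| <= K) ->
  dot (Hop u x) (Hop u x) <= 4 * K ^+ 2 * dot (u x) (u x).
Proof.
move=> HK; have K0 : 0 <= K := le_trans (normr_ge0 _) (HK 0 0 0).
have row i : Hop u x i 0 * Hop u x i 0 <= 2 * K ^+ 2 * dot (u x) (u x).
  rewrite /Hop mxE !sum2 -expr2.
  have t j : (Hess G (phi x) i j * u x j 0) ^+ 2 <= K ^+ 2 * u x j 0 ^+ 2.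
    rewrite exprMn; apply: ler_wpM2r; first exact: sqr_ge0.
    by rewrite -real_normK ?num_real// ler_pXn2r ?nnegrE.
  rewrite /dot sum2 -!expr2; exact: sq_sum_le (t 0) (t 1).
by rewrite {1}/dot sum2; have := row 0; have := row 1; exact: add_halves.
Qed.

Lemma Hop_bound : exists2 K : R, 0 <= K & forall u, L2per L u -> L2dot L (Hop u) (Hop u) <= K * L2dot L u u.
Proof.
have [K K0 HK] := Hess_bounded; exists (4 * K ^+ 2); first by rewrite mulr_ge0 ?sqr_ge0.
move=> u lu; have lH := Hop_L2per lu; have cu := CI_dot lu lu.
rewrite -(intZ _ cu); apply: (int_le (CI_dot lH lH) (CIZ _ cu)) => x.
exact: Hop_pointwise HK.
Qed.

Lemma LformE u v : l u v = Mform L m u v + c * L2dot L u v - L2dot L (Hop u) v.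
Proof. by []. Qed.

Lemma Hop_sym u v : L2dot L (Hop u) v = L2dot L (Hop v) u.
Proof. by apply: int_ext => x; rewrite /Hop Hess_sym. Qed.

Lemma Lform_bilin : bilin X l.
Proof.
have bM := Mform_bilin L0 s0 c10 c20 adm (L := L); have bL := L2dot_bilin (L := L).
split=> [u v Xu Xv|a u v w Xu Xv Xw].
  by rewrite !LformE (bM.1 _ _ Xu Xv) (bL.1 _ _ (X_L2 Xu) (X_L2 Xv)) Hop_sym.
have lu := X_L2 Xu; have lv := X_L2 Xv; have lw := X_L2 Xw.
rewrite !LformE (bM.2 _ _ _ _ Xu Xv Xw) (bL.2 _ _ _ _ lu lv lw) Hop_lin.
rewrite (bL.2 _ _ _ _ (Hop_L2per lu) (Hop_L2per lv) lw); exact: form_lin_combine.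
Qed.

Lemma Hop_quad : exists2 K : R, 0 <= K & forall u, L2per L u -> `|L2dot L (Hop u) u| <= K * L2dot L u u.
Proof.
have [K K0 HK] := Hop_bound; exists (K + 1); first by rewrite addr_ge0.
move=> u lu; have lH := Hop_L2per lu; have u0 := L2dot_psd lu.
have := psd_CS sL (L2dot_bilin (L := L)) (L2dot_psd (L := L)) lH lu => CS.
have {}CS := le_trans CS (ler_wpM2r u0 (HK u lu)).
rewrite -(ler_pXn2r (n := 2)) ?nnegrE ?mulr_ge0 ?addr_ge0// real_normK ?num_real//.
apply: (le_trans CS); rewrite exprMn -mulrA -expr2; apply: ler_wpM2r; first exact: sqr_ge0.
by rewrite expr2; nra.
Qed.

#[local] Opaque L2dot Mform xdot Hess Lform.

Lemma Lform_le : exists2 C : R, 0 <= C & forall u, X u -> l u u <= C * xd u u.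
Proof.
have [K K0 HK] := Hop_quad; exists (c2 + `|c| + K); first by rewrite !addr_ge0// ltW.
move=> u Xu; rewrite LformE.
have h1 := Mform_le L0 s0 c10 c20 adm Xu; have h2 := L2dot_le_xdot L0 s0 Xu.
have h3 := HK u (X_L2 Xu); have u0 := L2dot_psd (X_L2 Xu).
have h4 : c * L2dot L u u <= `|c| * xd u u.
  by apply: (le_trans (ler_wpM2r u0 (ler_norm c))); apply: ler_wpM2l.
have h5 : - L2dot L (Hop u) u <= K * xd u u.
  have := ler_norm (- L2dot L (Hop u) u); rewrite normrN => h.
  exact: (le_trans h (le_trans h3 (ler_wpM2l K0 h2))).
by rewrite !mulrDl; exact: (lerD (lerD h1 h4) h5).
Qed.

Lemma Lform_garding : exists kap C : R, [/\ 0 < kap, 0 <= C &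
  forall u, X u -> kap * xd u u <= l u u + C * L2dot L u u].
Proof.
have [K K0 HK] := Hop_quad; set kap := c1 / 2 `^ (s / 2).
have k0 : 0 < kap by rewrite divr_gt0// powR_gt0.
exists kap, (kap + `|c| + K); split=> // [|u Xu]; first by rewrite !addr_ge0// ltW.
have h1 := Mform_ge L0 s0 c10 c20 adm Xu; rewrite -/kap mulrBr in h1.
have h3 := HK u (X_L2 Xu); have u0 := L2dot_psd (X_L2 Xu).
have h4 : - (c * L2dot L u u) <= `|c| * L2dot L u u.
  by rewrite -mulNr; apply: ler_wpM2r => //; rewrite -normrN; exact: ler_norm.
have h5 := le_trans (ler_norm (L2dot L (Hop u) u)) h3.
rewrite LformE !mulrDl; exact: garding_combine h1 h4 h5.
Qed.

(** The compact perturbation in the inequality of Garding is seen by finitely many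
modes only; this is what a weak form of the evolution equation can control. *)
Lemma Lform_garding_low : exists kap C (N : nat), [/\ 0 < kap, 0 <= C &
  forall u, X u -> kap * xd u u <= l u u + C * \sum_(n < N) dot (cf u n) (cf u n)].
Proof.
have [kap [C [k0 C0 H]]] := Lform_garding.
have k2 : 0 < kap / 2 / (C + 1) by rewrite !divr_gt0// ltr_wpDl.
have [N HN] := L2_low_high L0 s0 k2.
exists (kap / 2), (C * L), N; split; first by rewrite divr_gt0.
  by rewrite mulr_ge0// ltW.
move=> u Xu; have h1 := H u Xu; have h2 := ler_wpM2l C0 (HN u Xu).
  have x0 := xdot_psd L0 s0 Xu.
  have h3 : C * (kap / 2 / (C + 1) * xd u u) <= kap / 2 * xd u u.
    rewrite mulrA; apply: ler_wpM2r => //; rewrite mulrA ler_pdivrMr ?ltr_wpDl//.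
    by rewrite mulrC; apply: ler_wpM2l; [rewrite divr_ge0// ltW|rewrite lerDl].
rewrite mulrDr in h2; rewrite -(mulrA C); exact: garding_low_combine h1 h2 h3.
Qed.

Lemma Hop_ae u u' : ae_equal u u' -> ae_equal (Hop u) (Hop u').
Proof. by apply: aeS => x; rewrite /Hop => ->. Qed.

Lemma Lform_ae u u' v : X u -> X u' -> X v -> ae_equal u u' -> l u v = l u' v.
Proof.
move=> Xu Xu' Xv uu'; have lu := X_L2 Xu; have lu' := X_L2 Xu'; have lv := X_L2 Xv.
rewrite !LformE (Mform_qform L0 s0 c10 c20 adm Xu Xv) (Mform_qform L0 s0 c10 c20 adm Xu' Xv).
rewrite (qform_ae L0 _ v lu lu' uu') (L2dot_ae lu lu' lv uu').
by rewrite (L2dot_ae (Hop_L2per lu) (Hop_L2per lu') lv (Hop_ae uu')).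
Qed.

(** ** Weak and strong eigenfunctions *)

Lemma msymb_norm_ge n a : c1 ^+ 2 * (freq n `^ s) ^+ 2 * dot a a <=
  dot (msymb (m := m) n *m a) (msymb (m := m) n *m a).
Proof.
have /andP[h _] := msymb_bounds adm n a.
have a0 := dot_ge0 a; have f0 := freq_pow_ge0 (s := s) n (R := R).
have CS := psd_CS trueS dot_bilin (fun x _ => dot_ge0 x) (u := msymb (m := m) n *m a) (v := a)
  Logic.I Logic.I.
have k0 : 0 <= c1 * freq n `^ s * dot a a by rewrite mulr_ge0// mulr_ge0// ltW.
have h2 : (c1 * freq n `^ s * dot a a) ^+ 2 <= dot (msymb (m := m) n *m a) a ^+ 2.
  by rewrite ler_pXn2r ?nnegrE// (le_trans k0).
have [E|an] := eqVneq (dot a a) 0; first by rewrite E mulr0 dot_ge0.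
have ap : 0 < dot a a by rewrite lt_def an.
rewrite -(ler_pM2r ap); apply: le_trans CS; apply: le_trans h2.
by rewrite le_eqVlt; apply/orP; left; apply/eqP; ring.
Qed.

Lemma multiplier_Hper u w : is_multiplier L m u w -> Hper L s u.
Proof.
move=> mul; have [lu lw _] := mul; have [_ K2] := HperP L0 (s := s) u; apply: K2; split; first exact: lu.
pose K : R := 2 * (2 `^ (s / 2)) ^+ 2 / c1 ^+ 2.
have K0 : 0 <= K by rewrite /K divr_ge0 ?sqr_ge0// mulr_ge0 ?sqr_ge0.
exists (K * L2dot L w w + 2 * L2dot L u u) => N.
apply: (le_trans _ (lerD (ler_wpM2l K0 (L2dot_partial L0 N lw)) (ler_wpM2l (ler0n _ 2) (L2dot_partial L0 N lu)))).
rewrite !(mulrCA _ L) -mulrDr ler_pM2l// !mulr_sumr -big_split/=; apply: ler_sum => n _.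
rewrite (multiplier_hcoef mul).
have h1 := msymb_norm_ge n (cf u n); have h2 := sweight_le s0 n (R := R).
have w0 := sweight_ge0 s0 n (R := R); have d0 := dot_ge0 (cf u n).
have p0 : 0 <= 2 `^ (s / 2) :> R by exact: powR_ge0.
have f0 := freq_pow_ge0 (s := s) n (R := R).
have c2' : 0 < c1 ^+ 2 by rewrite exprn_gt0.
apply: (@le_trans _ _ ((2 * (2 `^ (s / 2) * freq n `^ s) ^+ 2 + 2) * dot (cf u n) (cf u n))).
  by apply: ler_wpM2r => //; exact: sq_le_double w0 h2.
rewrite mulrDl lerD2r.
apply: (@le_trans _ _ (K * (c1 ^+ 2 * (freq n `^ s) ^+ 2 * dot (cf u n) (cf u n)))); last exact: ler_wpM2l.
by rewrite /K le_eqVlt; apply/orP; left; apply/eqP; field; rewrite gt_eqF.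
Qed.

Lemma Lop_weak u v : is_Lop L s c m G phi u v -> X u /\ forall w, X w -> l u w = L2dot L v w.
Proof.
move=> [Hu [lv [z mul vE]]]; have Xu := Hper_X L0 s0 Hu; split=> // w Xw.
have [lu lz _] := mul; have lw := X_L2 Xw; have lH := Hop_L2per lu.
rewrite LformE (Mform_multiplier L0 adm mul lw).
have bL := L2dot_bilin (L := L).
have lc := subspaceZ c sL lu; have lzc := subspaceD sL lz lc; have lall := subspaceB sL lzc lH.
have -> : L2dot L v w = L2dot L (z + c *: u - Hop u) w by apply: L2dot_ae.
by rewrite (bilinBl bL lzc lH lw) (bilinDl bL lz lc lw) (bilinZl sL bL c lu lw).
Qed.

Lemma L2dot_wave u n a : L2per L u -> L2dot L u (wave L n a) = L * dot (cf u n) a.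
Proof.
move=> lu; have lw := wave_L2per L0 n a.
have P := hartley_parseval L0 lu lw.
have E : L^-1 * L2dot L u (wave L n a) = dot (cf u n) a.
  rewrite -(cvg_lim (@Rhausdorff _) P); apply/cvg_lim => //; apply: cvg_near_cst.
  exists n.+1 => // N /= nN; rewrite seriesEnat/= big_mkord (bigD1 (Ordinal nN))//= big1 => [|k].
    by rewrite (hcoef_wave L0) eqxx scale1r addr0.
  rewrite -val_eqE/= => kn; rewrite (hcoef_wave L0) (negPf kn) scale0r.
  by rewrite dotC dot0l.
by rewrite -E mulrA divff ?mul1r// gt_eqF.
Qed.

Lemma wave_X n a : X (wave L n a).
Proof.
apply/XspaceP => //; split; first exact: wave_L2per.
exists (wt n * dot a a) => N.
have [nN|Nn] := ltnP n N; last first.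
  rewrite big1 ?mulr_ge0 ?sweight_ge0 ?dot_ge0// => k _.
  by rewrite (hcoef_wave L0) ltn_eqF ?scale0r ?dot0l ?mulr0// (leq_trans _ Nn).
rewrite (bigD1 (Ordinal nN))//= big1 => [|k].
  by rewrite (hcoef_wave L0) eqxx scale1r addr0.
rewrite -val_eqE/= => kn; by rewrite (hcoef_wave L0) (negPf kn) scale0r dot0l mulr0.
Qed.

Lemma Mform_wave u n a : X u -> Mform L m u (wave L n a) = L * dot (msymb (m := m) n *m cf u n) a.
Proof.
move=> Xu; rewrite (Mform_qform L0 s0 c10 c20 adm Xu (wave_X n a)); congr (_ * _).
apply/cvg_lim => //; apply: cvg_near_cst.
exists n.+1 => // N /= nN; rewrite /qseries seriesEnat/= big_mkord (bigD1 (Ordinal nN))//= big1 => [|k].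
  by rewrite (hcoef_wave L0) eqxx scale1r addr0.
rewrite -val_eqE/= => kn; rewrite (hcoef_wave L0) (negPf kn) scale0r.
by rewrite dotC dot0l.
Qed.

(** Regularity of weak eigenfunctions: testing with the basis identifies the
coefficients of Mv as those of an L2 function, and the lower bound on the symbol
then places v in the domain. *)
Lemma weak_Lop v (lam : R) : X v -> (forall w, X w -> l v w = lam * L2dot L v w) ->
  is_Lop L s c m G phi v (fun x => lam *: v x).
Proof.
move=> Xv H; have lv := X_L2 Xv; have lH := Hop_L2per lv; have bL := L2dot_bilin (L := L).
pose z := (lam - c) *: v + Hop v; have lz : L2per L z := sL.2 _ _ _ lv lH.
have mul : is_multiplier L m v z.
  apply: (hcoef_multiplier adm lv lz) => n.
  have E a : dot (cf z n) a = dot (msymb (m := m) n *m cf v n) a.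
    have Xw := wave_X n a; have lw := X_L2 Xw.
    have h := H _ Xw; rewrite LformE (Mform_wave n a Xv) in h.
    apply: (mulfI (lt0r_neq0 L0)); rewrite -(L2dot_wave n a lz) /z (bL.2 _ _ _ _ lv lH lw).
    move: h; move: (L * _) (L2dot L v _) (L2dot L (Hop v) _) => p q r h; lra.
  apply/eqP; rewrite -subr_eq0; apply/eqP/dot_eq0.
  by rewrite (bilinBl dot_bilin)// E subrr.
split; first exact: multiplier_Hper mul.
split; first exact: (subspaceZ lam sL lv).
exists z => //; apply: aeW => x; rewrite /z.
have -> : ((lam - c) *: v + Hop v) x = (lam - c) *: v x + Hop v x by [].
by rewrite /Hop scalerBl (addrAC _ _ (c *: v x)) subrK addrK.
Qed.

(** ** Coercivity away from the kernel *)

Context (H1 : hypothesis_H1 L s c m G phi).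
Local Notation phi' := (x_deriv phi).

Let bX : bilin X xd := xdot_bilin L0 s0.
Let pX : psd X xd := xdot_psd L0 s0.
Let bL : bilin X (L2dot L) := bilinS (@X_L2 R L s) (L2dot_bilin (L := L)).
Let pL : psd X (L2dot L). Proof. by move=> u Xu; exact: (L2dot_psd (X_L2 Xu)). Qed.
Let bl : bilin X l := Lform_bilin.
Let LX u : X u -> L2dot L u u <= xd u u. Proof. exact: (L2dot_le_xdot L0 s0). Qed.

Lemma eigenfunction_weak lam u : eigenfunction L s c m G phi lam u ->
  [/\ X u, 0 < L2dot L u u & forall w, X w -> l u w = lam * L2dot L u w].
Proof.
move=> [un0 eig]; have [Xu Hu] := Lop_weak eig; have lu := X_L2 Xu; split=> //.
  rewrite lt_def (L2dot_psd lu) andbT; apply/eqP => E; exact: un0 (L2dot_eq0 L0 lu E).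
move=> w Xw; rewrite (Hu w Xw); exact: (bilinZl sL (L2dot_bilin (L := L)) lam lu (X_L2 Xw)).
Qed.

Lemma kernel_direction : [/\ X phi', 0 < L2dot L phi' phi' & forall w, X w -> l phi' w = 0].
Proof.
have [_ _ _ [eig0 _]] := H1; have [X' p0 H] := eigenfunction_weak eig0; split=> // w Xw.
by rewrite (H w Xw) mul0r.
Qed.

Lemma weak_eigenfunction lam v : X v -> 0 < L2dot L v v ->
  (forall w, X w -> l v w = lam * L2dot L v w) -> eigenfunction L s c m G phi lam v.
Proof.
move=> Xv v0 H; split; last exact: weak_Lop.
move=> ae0; move: v0; rewrite (L2dot_ae0 (X_L2 Xv) (X_L2 Xv) ae0) ltxx //.
Qed.

Lemma spectral_data : exists chi lam g kap C, [/\ [/\ X chi, lam < 0, 0 < L2dot L chi chi &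
  forall v, X v -> l chi v = lam * L2dot L chi v], 0 < g,
  0 < kap /\ 0 <= C, (forall v, X v -> kap * xd v v <= l v v + C * L2dot L v v) &
  forall v, [/\ X v, L2dot L v chi = 0 & L2dot L v phi' = 0] -> g * L2dot L v v <= l v v].
Proof.
have [_ _ [lam [chi [lam0 [eig simp] only]]] [eig0 simp0]] := H1.
have [Xchi q0 Hchi] := eigenfunction_weak eig; have [X' p0 H0] := kernel_direction.
have [kap [C [k0 C0 gard]]] := Lform_garding.
have [kap' [C' [N [k0' C0' gard']]]] := Lform_garding_low.
have [B B0 HB] := Lform_le.
pose K := spectral_complement (P := X) (q := L2dot L) (chi := chi) (p := phi').
have sK : subspace K := spectral_complement_subspace sX bL Xchi X'.
have clK : form_closed X K xd := spectral_complement_closed sX bL pL Xchi X' LX.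
pose f (j : 'I_N.*2) u := cf u j./2 (inord (odd j)) 0.
have fl j : linf X (f j) := linfS (@X_L2 R L s) (hcoef_linf L0 (j./2) (inord (odd j))).
pose D := B + C' + L^-1; have Li : 0 <= L^-1 by rewrite invr_ge0 ltW.
have D0 : 0 <= D by rewrite !addr_ge0.
have LD v : X v -> l v v <= D * xd v v.
  move=> Xv; apply: (le_trans (HB v Xv)); apply: ler_wpM2r; first exact: pX.
  by rewrite /D -addrA lerDl addr_ge0.
have fD j v : X v -> f j v ^+ 2 <= D * L2dot L v v.
  move=> Xv; apply: (le_trans (coord_sq_le _ _)).
  have := L2dot_partial L0 (j./2).+1 (X_L2 Xv); rewrite -ler_pdivlMl// big_ord_recr/= => h.
  apply: (@le_trans _ _ (L^-1 * L2dot L v v)); last first.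
    by apply: ler_wpM2r; [exact: pL|rewrite /D lerDr addr_ge0].
  apply: le_trans h; rewrite lerDr; apply: sumr_ge0 => n _; exact: dot_ge0.
have gD v : X v -> kap' * xd v v <= l v v + D * \sum_j f j v ^+ 2.
  move=> Xv; apply: (le_trans (gard' v Xv)); rewrite lerD2l low_modes_sum.
  apply: ler_wpM2r; last by rewrite /D addrAC lerDr addr_ge0.
  by apply: sumr_ge0 => j _; exact: sqr_ge0.
have KX u : K u -> X u by case.
have [[g g0 gap]|[v [g [Kv gle v0 Hv]]]] := spectral_gap_or_eigenvector sX sK KX
    (X_complete L0 s0) clK bX pX bL pL bl k0' D0 LX LD fl fD gD.
  by exists chi, lam, g, kap, C; split=> //; exact: gap.
exfalso; have [Xv vchi vp] := Kv.
have Hall w : X w -> l v w = g * L2dot L v w.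
  move=> Xw; have [w' Kw' ->] := spectral_decomposition (chi := chi) (p := phi') sX bL bl Xchi X' lam0 q0 p0 Hchi H0 Xw.
  have [Xw' _ _] := Kw'; set a := _ / _; set b := _ / _.
  have Xa := subspaceZ a sX Xchi; have Xb := subspaceZ b sX X'; have Xab := subspaceD sX Xa Xb.
  rewrite (bilinDr sX bl Xab Xw' Xv) (bilinDr sX bL Xab Xw' Xv) (Hv w' Kw').
  rewrite (bilinDr sX bl Xa Xb Xv) (bilinDr sX bL Xa Xb Xv).
  rewrite (bilinZr sX bl a Xchi Xv) (bilinZr sX bl b X' Xv) (bilinZr sX bL a Xchi Xv) (bilinZr sX bL b X' Xv).
  rewrite vchi vp (bl.1 _ _ Xv Xchi) (Hchi v Xv) (bL.1 _ _ Xchi Xv) vchi (bl.1 _ _ Xv X') (H0 v Xv).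
  by rewrite !mulr0 !add0r.
have eigv := weak_eigenfunction Xv v0 Hall.
have contra u : X u -> L2dot L v u = 0 -> (exists a : R, ae_equal v (fun x => a *: u x)) -> False.
  move=> Xu vu [a va]; have lv := X_L2 Xv; have lu := X_L2 Xu.
  have lau := subspaceZ a sL lu.
  have E := L2dot_ae lv lau lv va.
  have E2 := bilinZl sL (L2dot_bilin (L := L)) a lu lv.
  move: v0; rewrite E (_ : L2dot L (fun x => a *: u x) v = L2dot L (a *: u) v)// E2.
  by rewrite ((L2dot_bilin (L := L)).1 _ _ lu lv) vu mulr0 ltxx.
have [glt|gge] := ltP g 0.
  by have E := only g v glt eigv; apply: (contra chi Xchi vchi); apply: simp; rewrite -E.
have gE : g = 0 by apply/eqP; rewrite eq_le gle.
by apply: (contra phi' X' vp); apply: simp0; rewrite -gE.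
Qed.

Lemma coercive_direction Phi : X Phi -> l Phi Phi < 0 -> exists k D : R, [/\ 0 < k, 0 <= D &
  forall v, X v -> L2dot L v phi' = 0 -> k * xd v v <= l v v + D * l Phi v ^+ 2].
Proof.
move=> XP lP; have [chi [lam [g [kap [C [[Xchi lam0 q0 Hchi] g0 [k0 C0] gard gap]]]]]] := spectral_data.
have [X' p0 H0] := kernel_direction.
exact: (coercive_of_negative sX bL pL bl Xchi X' lam0 g0 q0 p0 Hchi H0 k0 C0 gard gap XP lP).
Qed.

Lemma solve_linearized f (D : R) : linf X f -> 0 <= D -> (forall v, X v -> f v ^+ 2 <= D * xd v v) ->
  f phi' = 0 -> exists2 w, X w & forall v, X v -> l w v = f v.
Proof.
move=> lf D0 fD fp; have [chi [lam [g [kap [C [[Xchi lam0 q0 Hchi] g0 [k0 C0] gard gap]]]]]] := spectral_data.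
have [X' p0 H0] := kernel_direction; have [B B0 HB] := Lform_le.
have BD : 0 <= B + D by rewrite addr_ge0.
apply: (solve_form sX bX pX bL pL bl Xchi X' lam0 g0 q0 p0 Hchi H0 k0 C0 gard gap
  (X_complete L0 s0) LX lf BD _ _ fp) => v Xv.
  by apply: (le_trans (HB v Xv)); apply: ler_wpM2r; [exact: pX|rewrite lerDl].
by apply: (le_trans (fD v Xv)); apply: ler_wpM2r; [exact: pX|rewrite lerDr].
Qed.

End Linearized.

(** * Expansion of the action functional *)

Section ActionArithmetic.
Context {R : realType}.
Implicit Types (a g v k q h HH K : R).

Lemma action_algebra (Mpp Mpv Mvv Iu Ip Lpp Lpv Lvv Ap Av g H c : R) :
  Mpv + c * Lpv - g + Av = 0 ->
  2^-1 * (Mpp + 2 * Mpv + Mvv) - Iu + c * (2^-1 * (Lpp + 2 * Lpv + Lvv)) + (Ap + Av) -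
  (2^-1 * Mpp - Ip + c * (2^-1 * Lpp) + Ap) =
  2^-1 * (Mvv + c * Lvv - H) - (Iu - Ip - g - 2^-1 * H).
Proof.
move=> W; have -> : Av = g - Mpv - c * Lpv by lra.
by field.
Qed.

Lemma half_sum_le a g v k : 2 * a <= g + v -> g <= k -> 0 <= v -> 0 <= k -> a <= k + v.
Proof. by move=> *; lra. Qed.

Lemma hess_quarter h HH k v : HH <= k * v -> 2 * h <= HH + v -> 0 <= v -> 0 <= k * v ->
  2^-1 * h <= (1 + k) * v.
Proof. by move=> *; rewrite mulrDl mul1r; lra. Qed.

Lemma remainder_large (gv gp dg hh KG q k v del : R) : `|gp| <= KG -> `|dg| <= q + v ->
  `|hh| <= (1 + k) * v -> 0 <= KG -> 0 <= q -> 0 < del -> del / 2 < v ->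
  `|gv - gp - dg - hh| <= `|gv| + ((KG + q) * (2 / del) + 2 + k) * v.
Proof.
move=> h1 h2 h3 K0 q0 d0 dv.
have one : KG + q <= (KG + q) * (2 / del) * v.
  rewrite -mulrA; apply: ler_peMr; first exact: addr_ge0.
  by rewrite mulrAC ler_pdivlMr// mul1r; lra.
rewrite !mulrDl; rewrite !mulrDl in one h3.
have t1 := ler_normB (gv - gp - dg) hh; have t2 := ler_normB (gv - gp) dg; have t3 := ler_normB gv gp.
by move: t1 t2 t3 h1 h2 h3 one; move: `|gv| `|gp| `|dg| `|hh| => *; lra.
Qed.

Lemma norm_le_sq (x t : R) : 0 < t -> `|x| <= t / 2 + x ^+ 2 / t / 2.
Proof.
move=> t0; rewrite -(real_normK (num_real x)); move: `|x| (normr_ge0 x) => y y0.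
have : 0 <= (y - t) ^+ 2 / t / 2 by rewrite !divr_ge0 ?sqr_ge0// ltW.
have -> : (y - t) ^+ 2 / t / 2 = y ^+ 2 / t / 2 + t / 2 - y by field; rewrite gt_eqF.
lra.
Qed.

Lemma gradient_large (gv gp h KG k v del : R) : `|gp| <= KG -> h ^+ 2 <= k * v -> 0 <= KG ->
  0 < del -> del / 2 < v ->
  `|gv - gp - h| <= `|gv| + ((KG + 1) * (2 / del) + k) * v.
Proof.
move=> h1 h2 K0 d0 dv.
have one : KG + 1 <= (KG + 1) * (2 / del) * v.
  rewrite -mulrA; apply: ler_peMr; first by rewrite addr_ge0.
  by rewrite mulrAC ler_pdivlMr// mul1r; lra.
have hn : `|h| <= 1 + h ^+ 2.
  have := norm_le_sq h (ltr01 : 0 < 1 :> R); have := sqr_ge0 h; rewrite divr1; lra.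
rewrite mulrDl.
have t2 := ler_normB (gv - gp) h; have t3 := ler_normB gv gp.
by move: t2 t3 h1 hn one; move: `|gv| `|gp| `|h| => *; lra.
Qed.

End ActionArithmetic.

Section Action.
Context {R : realType} {L s c c1 c2 : R} {m : R -> 'M[R]_2} {G : 'cV[R]_2 -> R}.
Context {phi : R -> 'cV[R]_2} {A : 'cV[R]_2}.
Context (L0 : 0 < L) (s0 : 0 < s) (c10 : 0 < c1) (c20 : 0 < c2).
Context (adm : admissible_symbol s c1 c2 m) (GC2 : class_C2 G) (sphi : smooth_periodic L phi).
Context (phi_eq : profile_equation L c A m G phi).
Notation mu := (@lebesgue_measure R).
Local Notation I L f := (\int[mu]_(x in `[0, L]) f x).
Local Notation X := (Xspace L s).
Local Notation xd := (xdot (L := L) (s := s)).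
Local Notation l := (Lform L c m G phi).
Implicit Types (u v w h : R -> 'cV[R]_2).

Let sX : subspace X := X_subspace L0 s0.
Let sL : subspace (L2per L) := L2per_subspace (L := L).
Let bL := L2dot_bilin (L := L).

Lemma profile_Hper : Hper L s phi.
Proof. by have [w mul _] := phi_eq; exact: (multiplier_Hper L0 s0 c10 adm mul). Qed.

Lemma profile_X : X phi.
Proof. exact: (Hper_X L0 s0 profile_Hper). Qed.

Definition grad_profile : R -> 'cV[R]_2 := fun x => grad G (phi x).

Lemma grad_profile_L2per : L2per L grad_profile.
Proof.
have [_ _ cG _ _] := GC2; have [pphi _] := sphi; have [M _ HM] := smooth_bounded L0 sphi.
apply/L2perP => i; have [K _ HK] := bounded_on_bounded M (cG i).
rewrite (_ : component grad_profile i = fun x => partial i G (phi x)); last first.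
  by apply/funext => x; rewrite /component /grad_profile mxE.
apply: (@L2s_bounded _ _ _ K) => [x||x]; last exact: HK.
  by rewrite pphi.
apply: (measurable_superposition (cG i)) => j.
by have [_ /(_ j)[]] := smooth_L2per L0 sphi.
Qed.

Lemma profile_weak v : L2per L v ->
  Mform L m phi v + c * L2dot L phi v - L2dot L grad_profile v + L2dot L (fun=> A) v = 0.
Proof.
move=> lv; have [w mul E] := phi_eq; have [lp lw _] := mul.
have lg := grad_profile_L2per; have lA := L2per_cst (L := L) A.
rewrite (Mform_multiplier L0 adm mul lv).
have lc := subspaceZ c sL lp; have h1 := subspaceD sL lw lc; have h2 := subspaceB sL h1 lg.
have h3 := subspaceD sL h2 lA.
have Z : L2dot L (w + c *: phi - grad_profile + (fun=> A)) v = 0.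
  by apply: (L2dot_ae0 h3 lv); apply: aeS E => x.
rewrite -Z (bilinDl bL h2 lA lv) (bilinBl bL h1 lg lv) (bilinDl bL lw lc lv).
by rewrite (bilinZl sL bL c lp lv).
Qed.

Definition action u : R := energy L m G u + c * momentum L u + L2dot L (fun=> A) u.

Definition remainder v x : R :=
  G (phi x + v x) - G (phi x) - dot (grad_profile x) (v x) - 2^-1 * dot (Hop (G := G) (phi := phi) v x) (v x).

Context (E_def : energy_defined L s G).

Let cG : continuous G. Proof. by case: GC2. Qed.

Lemma energy_CI u : X u -> CI L (fun x => G (u x)).
Proof. exact: (superposition_CI cG E_def). Qed.

Lemma remainder_CI v : X v -> CI L (remainder v).
Proof.
move=> Xv; have lv := X_L2 Xv; have Xp := profile_X.
have c1' := energy_CI (subspaceD sX Xp Xv); have c2' := energy_CI Xp.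
have c3 := CI_dot grad_profile_L2per lv; have c4 := CI_dot (Hop_L2per L0 GC2 sphi lv) lv.
exact: (CIB (CIB (CIB c1' c2') c3) (CIZ _ c4)).
Qed.

Lemma remainder_int v : X v -> I L (remainder v) = I L (fun x => G (phi x + v x)) -
  I L (fun x => G (phi x)) - L2dot L grad_profile v - 2^-1 * L2dot L (Hop (G := G) (phi := phi) v) v.
Proof.
move=> Xv; have lv := X_L2 Xv; have Xp := profile_X.
have c1' := energy_CI (subspaceD sX Xp Xv); have c2' := energy_CI Xp.
have c3 := CI_dot grad_profile_L2per lv; have c4 := CI_dot (Hop_L2per L0 GC2 sphi lv) lv.
rewrite /remainder (intB (CIB (CIB c1' c2') c3) (CIZ _ c4)) (intB (CIB c1' c2') c3) (intB c1' c2').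
by rewrite (intZ _ c4).
Qed.

Lemma action_increment v : X v ->
  action (phi + v) - action phi = 2^-1 * l v v - I L (remainder v).
Proof.
move=> Xv; have lv := X_L2 Xv; have Xp := profile_X; have lp := X_L2 Xp.
have bM := Mform_bilin L0 s0 c10 c20 adm (L := L).
have W := profile_weak lv; rewrite (remainder_int Xv).
have lA := L2per_cst (L := L) A.
rewrite /action /energy /momentum (LformE (c := c)).
rewrite (bilin_sqD sX bM Xp Xv) (bilin_sqD sL bL lp lv) (bilinDr sL bL lp lv lA).
have -> : I L (fun x => G ((phi + v) x)) = I L (fun x => G (phi x + v x)) by [].
exact: action_algebra W.
Qed.

Lemma sq_integrable u : X u -> mu.-integrable `[0, L] (fun x => (dot (u x) (u x))%:E).
Proof. by move=> Xu; have lu := X_L2 Xu; exact: (CI_dot lu lu).2. Qed.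

Lemma large_tail (e del : R) (N : 'cV[R]_2 -> R) (K : R) : continuous N -> (forall a, 0 <= N a) ->
  (forall u, X u -> mu.-integrable `[0, L] (fun x => (N (u x))%:E)) -> 0 <= K -> 0 < del -> 0 < e ->
  exists2 d : R, 0 < d & forall v, X v -> xd v v < d ->
  [/\ CI L (fun x => large_on del v x * (N (phi x + v x) + K * dot (v x) (v x))) &
     I L (fun x => large_on del v x * (N (phi x + v x) + K * dot (v x) (v x))) <= e * xd v v].
Proof.
move=> cN N0 HN K0 del0 e0; have Xp := profile_X; have [M _ HM] := smooth_bounded L0 sphi.
have e2 : 0 < e / 2 by rewrite divr_gt0.
have e3 : 0 < e / 2 / (K + 1) by rewrite divr_gt0// ltr_wpDl.
have cdot : continuous (fun a : 'cV[R]_2 => dot a a).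
  have cc i : continuous (fun a : 'cV[R]_2 => a i 0) by exact: coord_continuous.
  rewrite (_ : (fun a => _) = fun a : 'cV[R]_2 => a 0 0 * a 0 0 + a 1 0 * a 1 0).
    by move=> a; exact: (cvgD (cvgM (cc 0 a) (cc 0 a)) (cvgM (cc 1 a) (cc 1 a))).
  by apply/funext => a; rewrite /dot sum2.
have [d1 d10 H1] := superposition_tail L0 s0 cN N0 HN Xp HM del0 e2.
have z0 x : dot ((0 : R -> 'cV[R]_2) x) ((0 : R -> 'cV[R]_2) x) <= 0 by rewrite dot0l.
have [d2 d20 H2] := superposition_tail L0 s0 cdot (@dot_ge0 R) sq_integrable sX.1 z0 del0 e3.
exists (Num.min d1 d2); first by rewrite lt_min d10 d20.
move=> v Xv; rewrite lt_min => /andP[hd1 hd2]; have lv := X_L2 Xv.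
have cl (f : R -> R) : CI L f -> CI L (fun x => large_on del v x * f x).
  move=> cf; apply: (CI_dom _ (CI_norm cf)).
    exact: (measurable_funM (measurable_large_on del lv) cf.1).
  move=> x; have /andP[a b] := large_on_itv del v x.
  by rewrite normrM (ger0_norm a) ler_piMl.
have cNv := superposition_CI cN HN (subspaceD sX Xp Xv).
have cd := CI_dot lv lv.
have E : (fun x => large_on del v x * (N (phi x + v x) + K * dot (v x) (v x))) =
  (fun x => large_on del v x * N (phi x + v x) + K * (large_on del v x * dot (v x) (v x))).
  by apply/funext => x; ring.
rewrite E; split; first exact: (CID (cl _ cNv) (CIZ K (cl _ cd))).
rewrite (intD (cl _ cNv) (CIZ K (cl _ cd))) (intZ K (cl _ cd)).
have h1 := H1 v Xv hd1; have := H2 v Xv hd2.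
have -> : I L (fun x => large_on del v x * dot ((0 : R -> 'cV[R]_2) x + v x) ((0 : R -> 'cV[R]_2) x + v x)) =
   I L (fun x => large_on del v x * dot (v x) (v x)).
  by apply: int_ext => x; rewrite (_ : (0 : R -> 'cV[R]_2) x + v x = v x)//; exact: add0r.
move=> h2; have x0 := xdot_psd L0 s0 Xv.
apply: (le_trans (lerD h1 (ler_wpM2l K0 h2))).
have -> : e * xd v v = e / 2 * xd v v + e / 2 * xd v v by field.
rewrite lerD2l mulrA; apply: ler_wpM2r => //.
rewrite mulrA ler_pdivrMr ?ltr_wpDl// mulrC; apply: ler_wpM2l; first exact: ltW.
by rewrite lerDl.
Qed.

(** Where v is small the expansion of G is uniform; where v is large every term of
the remainder is bounded by G(phi + v) and the square of v, and the tail estimate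
applies. *)
Lemma action_expansion (e : R) : 0 < e -> exists2 d : R, 0 < d & forall v, X v -> xd v v < d ->
  `|action (phi + v) - action phi - 2^-1 * l v v| <= e * xd v v.
Proof.
move=> e0; have e2 : 0 < e / 2 by rewrite divr_gt0.
have [M _ HM] := smooth_bounded L0 sphi.
have [del del0 Hdel] := second_order GC2 M e2.
have [KG KG0 HKG] := bounded_on_bounded M cG.
have [_ _ cGi _ _] := GC2.
have [K0 K00 HK0] := bounded_on_bounded M (cGi 0).
have [K1 K10 HK1] := bounded_on_bounded M (cGi 1).
have [KH KH0 HKH] := Hess_bounded L0 GC2 sphi.
pose K := (KG + (K0 ^+ 2 + K1 ^+ 2)) * (2 / del) + 2 + 4 * KH ^+ 2.
have q0 : 0 <= K0 ^+ 2 + K1 ^+ 2 by rewrite addr_ge0 ?sqr_ge0.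
have k0 : 0 <= 4 * KH ^+ 2 by rewrite mulr_ge0 ?sqr_ge0.
have K0' : 0 <= K.
  rewrite /K; apply: addr_ge0 k0; apply: addr_ge0 => //; apply: mulr_ge0; first exact: addr_ge0.
  by rewrite divr_ge0// ltW.
have del2 : 0 < del / 2 by rewrite divr_gt0.
have cN : continuous (fun a => `|G a|) by move=> a; exact: (continuous_comp (@cG a) (@norm_continuous _ _ _)).
have HN u : X u -> mu.-integrable `[0, L] (fun x => (`|G (u x)|)%:E).
  by move=> Xu; exact: (CI_norm (energy_CI Xu)).2.
have [d d0 Hd] := large_tail cN (fun a => normr_ge0 _) HN K0' del2 e2.
exists d => // v Xv hv; have [cT hT] := Hd v Xv hv; have lv := X_L2 Xv.
have -> : action (phi + v) - action phi - 2^-1 * l v v = - I L (remainder v).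
  by rewrite (action_increment Xv) addrAC subrr add0r.
rewrite normrN; have cd := CI_dot lv lv.
apply: (@le_trans _ _ (I L (fun x => e / 2 * dot (v x) (v x) +
   large_on (del / 2) v x * (`|G (phi x + v x)| + K * dot (v x) (v x))))).
  apply: (int_norm_le (remainder_CI Xv) (CID (CIZ _ cd) cT)) => x.
  have vv0 := dot_ge0 (v x).
  have [hx|hx] := ltP (del / 2) (dot (v x) (v x)); last first.
    have hx' : dot (v x) (v x) < del by apply: le_lt_trans hx _; rewrite gtr_pMr// invf_lt1// ltr1n.
    apply: (le_trans (Hdel (phi x) (v x) (HM x) hx')); rewrite lerDl.
    rewrite mulr_ge0 ?addr_ge0 ?mulr_ge0//; by case/andP: (large_on_itv (del / 2) v x).
  have -> : large_on (del / 2) v x = 1 by rewrite /large_on hx.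
  rewrite mul1r; apply: ler_wpDl; first by rewrite mulr_ge0// ltW.
  have g2 : `|dot (grad_profile x) (v x)| <= (K0 ^+ 2 + K1 ^+ 2) + dot (v x) (v x).
    have := dot_le (grad_profile x) (v x).
    have g1 : dot (grad_profile x) (grad_profile x) <= K0 ^+ 2 + K1 ^+ 2.
      rewrite /dot sum2 !mxE -!expr2; apply: lerD; rewrite -real_normK ?num_real// ler_pXn2r ?nnegrE//.
        exact: HK0.
      exact: HK1.
    by move=> h; exact: half_sum_le h g1 vv0 q0.
  have g3 : `|2^-1 * dot (Hop (G := G) (phi := phi) v x) (v x)| <= (1 + 4 * KH ^+ 2) * dot (v x) (v x).
    have := dot_le (Hop (G := G) (phi := phi) v x) (v x).
    have := Hop_pointwise v x HKH; rewrite normrM (@gtr0_norm _ 2^-1) ?invr_gt0// => h1 h2.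
    exact: hess_quarter h1 h2 vv0 (mulr_ge0 k0 vv0).
  exact: (remainder_large _ (HKG _ (HM x)) g2 g3 KG0 q0 del0 hx).
rewrite (intD (CIZ _ cd) cT) (intZ _ cd).
have -> : e * xd v v = e / 2 * xd v v + e / 2 * xd v v by field.
by apply: lerD hT; apply: ler_wpM2l; [exact: ltW|exact: (L2dot_le_xdot L0 s0 Xv)].
Qed.

Context (g_int : forall i u, X u -> mu.-integrable `[0, L] (fun x => (partial i G (u x))%:E)).

Definition gradient_defect v i x : R := partial i G (phi x + v x) - partial i G (phi x) - Hop (G := G) (phi := phi) v x i 0.

Lemma gradient_CI i u : X u -> CI L (fun x => partial i G (u x)).
Proof. by have [_ _ cGi _ _] := GC2; exact: (superposition_CI (cGi i) (g_int i)). Qed.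

Lemma gradient_defect_CI v i : X v -> CI L (gradient_defect v i).
Proof.
move=> Xv; have Xp := profile_X; have lH := Hop_L2per L0 GC2 sphi (X_L2 Xv).
apply: (CIB (CIB (gradient_CI i (subspaceD sX Xp Xv)) (gradient_CI i Xp))).
exact: (L2s_CI ((L2perP _).1 lH i)).
Qed.

(** The gradient expands to first order only; the parameter t is the scale at which
the linear error is balanced against the quadratic one. *)
Lemma gradient_expansion (e : R) i : 0 < e -> exists2 d : R, 0 < d & forall v, X v -> xd v v < d ->
  forall t, 0 < t -> I L (fun x => `|gradient_defect v i x|) <= e * (t + xd v v / t + xd v v).
Proof.
move=> e0; pose e1 := e / (L + 1); have e10 : 0 < e1 by rewrite divr_gt0// addr_gt0.
have [M _ HM] := smooth_bounded L0 sphi.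
have [_ _ cGi dGi cGij] := GC2.
have [del del0 Hdel] := first_order M (fun j a => dGi j i a) (fun j => cGij j i) e10.
have [KG KG0 HKG] := bounded_on_bounded M (cGi i).
have [KH KH0 HKH] := Hess_bounded L0 GC2 sphi.
pose K := (KG + 1) * (2 / del) + 4 * KH ^+ 2.
have k0 : 0 <= 4 * KH ^+ 2 by rewrite mulr_ge0 ?sqr_ge0.
have K0' : 0 <= K.
  rewrite /K; apply: addr_ge0 k0; apply: mulr_ge0; first by rewrite addr_ge0.
  by rewrite divr_ge0// ltW.
have del2 : 0 < del / 2 by rewrite divr_gt0.
have cN : continuous (fun a => `|partial i G a|) by move=> a; exact: (continuous_comp (@cGi i a) (@norm_continuous _ _ _)).
have HN u : X u -> mu.-integrable `[0, L] (fun x => (`|partial i G (u x)|)%:E).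
  by move=> Xu; exact: (CI_norm (gradient_CI i Xu)).2.
have [d d0 Hd] := large_tail cN (fun a => normr_ge0 _) HN K0' del2 e0.
exists d => // v Xv hv t t0; have [cT hT] := Hd v Xv hv; have lv := X_L2 Xv.
have cd := CI_dot lv lv; have c1' := CI_cst L (e1 * t).
have x0 := xdot_psd L0 s0 Xv; have u0 := L2dot_psd lv; have ux := L2dot_le_xdot L0 s0 Xv.
apply: (@le_trans _ _ (I L (fun x => (e1 * t + e1 / t * dot (v x) (v x)) +
   large_on (del / 2) v x * (`|partial i G (phi x + v x)| + K * dot (v x) (v x))))).
  apply: (int_le (CI_norm (gradient_defect_CI i Xv)) (CID (CID c1' (CIZ _ cd)) cT)) => x.
  have vv0 := dot_ge0 (v x).
  have p0 : 0 <= e1 * t + e1 / t * dot (v x) (v x).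
    by apply: addr_ge0; [rewrite mulr_ge0// ltW|apply: mulr_ge0 => //; rewrite divr_ge0// ltW].
  have [hx|hx] := ltP (del / 2) (dot (v x) (v x)); last first.
    have hx' : dot (v x) (v x) < del by apply: le_lt_trans hx _; rewrite gtr_pMr// invf_lt1// ltr1n.
    have L' : 0 <= large_on (del / 2) v x * (`|partial i G (phi x + v x)| + K * dot (v x) (v x)).
      by rewrite mulr_ge0 ?addr_ge0 ?mulr_ge0//; case/andP: (large_on_itv (del / 2) v x).
    apply: ler_wpDr L' _; have := Hdel (phi x) (v x) (HM x) hx'.
    have -> : \sum_j partial j (partial i G) (phi x) * v x j 0 = Hop (G := G) (phi := phi) v x i 0.
      rewrite /Hop mxE !sum2 !mxE.
      move: (v x 0 0) (v x 1 0) => p q.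
      exact: (f_equal2 (fun P Q : R => P * p + Q * q) (partial_comm GC2 0 i (phi x)) (partial_comm GC2 1 i (phi x))).
    move=> h; apply: (le_trans h); rewrite -mulrA -mulrDr ler_pM2l//.
    have := norm_le_sq (v x 0 0) t0; have := norm_le_sq (v x 1 0) t0.
    have -> : t^-1 * dot (v x) (v x) = v x 0 0 ^+ 2 / t + v x 1 0 ^+ 2 / t.
      by rewrite /dot sum2 -!expr2; ring.
    have a0 : 0 <= v x 0 0 ^+ 2 / t by rewrite divr_ge0 ?sqr_ge0// ltW.
    have b0 : 0 <= v x 1 0 ^+ 2 / t by rewrite divr_ge0 ?sqr_ge0// ltW.
    move: a0 b0; move: (v x 0 0 ^+ 2 / t) (v x 1 0 ^+ 2 / t) `|v x 0 0| `|v x 1 0| => *; lra.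
  have -> : large_on (del / 2) v x = 1 by rewrite /large_on hx.
  rewrite mul1r; apply: ler_wpDl => //.
  apply: (gradient_large _ (HKG _ (HM x)) _ KG0 del0 hx).
  apply: le_trans (Hop_pointwise v x HKH); exact: coord_sq_le.
rewrite (intD (CID c1' (CIZ _ cd)) cT) (intD c1' (CIZ _ cd)) (intZ _ cd) int_cst//.
rewrite mulrDr; apply: lerD hT; rewrite mulrDr; apply: lerD.
  rewrite mulrAC; apply: ler_wpM2r; first exact: ltW.
  by rewrite /e1 mulrAC ler_pdivrMr ?addr_gt0// ler_pM2l// lerDl.
rewrite -[e1 / t * _]mulrA; apply: ler_pM => //; first exact: ltW.
- by rewrite mulr_ge0// invr_ge0 ltW.
- by rewrite /e1 ler_pdivrMr ?addr_gt0// ler_peMr ?(ltW e0)// lerDr ltW.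
- by rewrite mulrC ler_pM2r ?invr_gt0.
Qed.

End Action.

(** * Translations and solutions *)

Section SmoothCalculus.
Context {R : realType} {L : R} (L0 : 0 < L).
Notation mu := (@lebesgue_measure R).
Local Notation I L f := (\int[mu]_(x in `[0, L]) f x).
Implicit Types (u v psi : R -> 'cV[R]_2).
Let sL : subspace (L2per L) := L2per_subspace (L := L).
Let bL := L2dot_bilin (L := L).

Lemma derive1_shift (f : R -> R) y : derive1 (fun x => f (x + y)) = (fun x => derive1 f (x + y)).
Proof.
apply: funext => x; rewrite /derive1.
suff -> : (fun h : R => h^-1 *: (f (h + x + y) - f (x + y))) = (fun h : R => h^-1 *: (f (h + (x + y)) - f (x + y))) by [].
by apply: funext => h; rewrite addrA.
Qed.

Lemma derive1n_shift (f : R -> R) y n : derive1n n (fun x => f (x + y)) = (fun x => derive1n n f (x + y)).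
Proof. by elim: n => [//|n IH]; rewrite !derive1nS IH derive1_shift. Qed.

Lemma derivable_shift (f : R -> R) y x : derivable f (x + y) 1 -> derivable (fun x => f (x + y)) x 1.
Proof.
rewrite /derivable; move=> h.
suff -> : (fun h : R => h^-1 *: (((fun x => f (x + y)) \o shift x) (h *: 1) - f (x + y))) =
  (fun h : R => h^-1 *: ((f \o shift (x + y)) (h *: 1) - f (x + y))) by exact: h.
by apply: funext => k /=; rewrite addrA.
Qed.

Lemma x_deriv_translate y u : x_deriv (translate y u) = translate y (x_deriv u).
Proof.
apply: funext => x; apply/matrixP => i j; rewrite /translate !mxE.
by rewrite -[component (fun _ => _) i]/(fun x => component u i (x + y)) derive1_shift.
Qed.

Lemma smooth_translate y u : smooth_periodic L u -> smooth_periodic L (translate y u).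
Proof.
move=> [pu du]; split; first by move=> x; rewrite /translate addrAC pu.
move=> i n x; rewrite -[component (translate y u) i]/(fun x => component u i (x + y)) derive1n_shift.
by apply: derivable_shift; exact: du.
Qed.

Lemma smooth_x_deriv u : smooth_periodic L u -> smooth_periodic L (x_deriv u).
Proof.
move=> [pu du]; split.
  move=> x; apply/matrixP => i j; rewrite !mxE.
  rewrite -[LHS]/((fun x => derive1 (component u i) (x + L)) x) -derive1_shift.
  by congr (derive1 _ x); apply: funext => z; rewrite /component pu.
move=> i n x.
have -> : component (x_deriv u) i = derive1 (component u i) by apply: funext => z; rewrite /component mxE.
by rewrite -derive1Sn; exact: du.
Qed.

Lemma smooth_cst (a : 'cV[R]_2) : smooth_periodic L (fun=> a).
Proof.
split=> // i n x.
have [b ->] : exists b : R, derive1n n (component (fun=> a) i) = cst b.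
  elim: n => [|n [b IH]]; first by exists (a i 0).
  by exists 0; rewrite derive1nS IH; apply: funext => z; rewrite derive1_cst.
exact: derivable_cst.
Qed.

Lemma x_deriv_cst (a : 'cV[R]_2) : x_deriv (fun=> a) = 0.
Proof. by apply: funext => x; apply/matrixP => i j; rewrite !mxE derive1_cst. Qed.

Lemma smooth_component_derive u i x : smooth_periodic L u ->
  is_derive x (1 : R) (component u i) (component (x_deriv u) i x).
Proof.
move=> [_ du]; rewrite /component mxE derive1E.
by apply: DeriveDef => //; exact: (du i 0%N x).
Qed.

Lemma smooth_component_bounded u i : smooth_periodic L u ->
  exists2 M : R, 0 <= M & forall x, `|component u i x| <= M.
Proof.
move=> su; have [pu _] := su.
have pc : periodic (component u i) L by move=> x; rewrite /component pu.
by have [M M0 H] := continuous_periodic_bounded L0 (@smooth_component_continuous R L u i su) pc; exists M.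
Qed.

Lemma smooth_lipschitz u : smooth_periodic L u -> exists2 C : R, 0 <= C &
  forall i x h, `|component u i (x + h) - component u i x| <= C * `|h|.
Proof.
move=> su; have sd := smooth_x_deriv su.
have [M0 M00 H0] := smooth_component_bounded 0 sd.
have [M1 M10 H1] := smooth_component_bounded 1 sd.
exists (M0 + M1); first exact: addr_ge0.
move=> i x h.
have dF (t : R) : is_derive t 1 (fun t => component u i (t + x)) (component (x_deriv u) i (t + x)).
  have := @is_derive1_comp R (component u i) (fun t => t + x) t _ _ (smooth_component_derive i (t + x) su).
  by move=> /(_ 1 _); rewrite mulr1; apply; apply: is_derive_eq; rewrite addr0.
have [xi _] := mvt_sym h dF; rewrite add0r (addrC x) => ->.
rewrite normrM; apply: ler_wpM2r => //.
case: i {dF} => [[|[|//]]] hi; [rewrite (_ : Ordinal hi = 0)|rewrite (_ : Ordinal hi = 1)]; try exact/val_inj.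
  by apply: (le_trans (H0 _)); rewrite lerDl.
by apply: (le_trans (H1 _)); rewrite lerDr.
Qed.

Lemma smooth_taylor u : smooth_periodic L u -> exists2 C : R, 0 <= C &
  forall i x h, `|component u i (x + h) - component u i x - h * component (x_deriv u) i x| <= C * h ^+ 2.
Proof.
move=> su; have [C C0 HC] := smooth_lipschitz (smooth_x_deriv su).
exists C => // i x h.
have dF (t : R) : is_derive t 1 (fun t => component u i (t + x)) (component (x_deriv u) i (t + x)).
  have := @is_derive1_comp R (component u i) (fun t => t + x) t _ _ (smooth_component_derive i (t + x) su).
  by move=> /(_ 1 _); rewrite mulr1; apply; apply: is_derive_eq; rewrite addr0.
have [xi hxi] := mvt_sym h dF; rewrite add0r (addrC x) => ->.
rewrite [h * _]mulrC -mulrBl normrM -[h ^+ 2]real_normK ?num_real// expr2 mulrA.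
apply: ler_wpM2r => //; rewrite [xi + x]addrC; apply: (le_trans (HC _ _ _)).
exact: ler_wpM2l.
Qed.

Lemma L2dot_pointwise u (K : R) : L2per L u -> 0 <= K -> (forall i x, `|component u i x| <= K) ->
  L2dot L u u <= 2 * L * K ^+ 2.
Proof.
move=> lu K0 H; rewrite -mulrA mulrCA -[leRHS]mulrC -(int_cst _ L0).
apply: int_le (CI_dot lu lu) (CI_cst _ _) _ => x.
have P i : (component u i x) ^+ 2 <= K ^+ 2.
  by rewrite -real_normK ?num_real// ler_pXn2r ?nnegrE.
rewrite /dot sum2 -!expr2 mulr_natl mulr2n; exact: lerD (P 0) (P 1).
Qed.

Lemma translate_lipschitz u : smooth_periodic L u -> exists2 C : R, 0 <= C &
  forall y, L2dot L (translate y u - u) (translate y u - u) <= C * y ^+ 2.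
Proof.
move=> su; have [C C0 HC] := smooth_lipschitz su; have lu := smooth_L2per L0 su.
exists (2 * L * C ^+ 2); first by rewrite !mulr_ge0 ?sqr_ge0// ltW.
move=> y; rewrite -[y ^+ 2]real_normK ?num_real// -mulrA -exprMn.
apply: L2dot_pointwise => [||i x].
- by apply: (subspaceB sL _ lu); exact: L2per_translate.
- exact: mulr_ge0.
by have := HC i x y; rewrite /component !mxE.
Qed.

Lemma is_derive_quadratic (f : R -> R) (t d C : R) :
  (forall h, `|f (t + h) - f t - h * d| <= C * h ^+ 2) -> is_derive t (1 : R) f d.
Proof.
move=> H.
have cv : (fun h : R => h^-1 *: (f (h *: (1 : R) + t) - f t)) @ 0^' --> d.
  apply/cvgrPdist_lt => e e0; near=> h.
  have h0 : h != 0 by near: h; exact: nbhs_dnbhs_neq.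
  have := H h; rewrite (addrC t) /GRing.scale/= mulr1 => Hh.
  have -> : d - h^-1 * (f (h + t) - f t) = - (h^-1 * (f (h + t) - f t - h * d)).
    by rewrite (mulrBr h^-1 (f (h + t) - f t)) mulKf// opprB.
  rewrite normrN normrM normfV ltr_pdivrMl ?normr_gt0//; apply: (le_lt_trans Hh).
  rewrite -[h ^+ 2]real_normK ?num_real// expr2 mulrCA ltr_pM2l ?normr_gt0//.
  have Cp : 0 < `|C| + 1 by rewrite ltr_wpDl.
  have hs : `|h| < e / (`|C| + 1) by near: h; apply: dnbhs0_lt; rewrite divr_gt0.
  apply: (@le_lt_trans _ _ ((`|C| + 1) * `|h|)); last by rewrite mulrC -ltr_pdivlMr.
  by apply: ler_wpM2r => //; apply: (le_trans (ler_norm C)); rewrite lerDl.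
apply: DeriveDef; first exact: cvgP cv.
exact: (cvg_lim _ cv).
Unshelve. all: by end_near. Qed.

(** Translations act differentiably on smooth functions, uniformly in x, which
gives time derivatives of pairings without differentiating under the integral. *)
Lemma translate_derivative u psi (k t : R) : L2per L u -> smooth_periodic L psi ->
  is_derive t (1 : R) (fun t => L2dot L u (translate (k * t) psi))
    (k * L2dot L u (translate (k * t) (x_deriv psi))).
Proof.
move=> lu sp; have [C C0 HC] := smooth_taylor sp; have lp := smooth_L2per L0 sp.
have ld := smooth_L2per L0 (smooth_x_deriv sp).
have lT y := L2per_translate L0 y lp; have lD y := L2per_translate L0 y ld.
have u0 := L2dot_psd lu; pose K := Num.sqrt (L2dot L u u * (2 * L * C ^+ 2)).
have K20 : 0 <= L2dot L u u * (2 * L * C ^+ 2) by rewrite !mulr_ge0 ?sqr_ge0// ltW.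
apply: (@is_derive_quadratic _ _ _ (K * k ^+ 2)) => h.
set v := translate (k * (t + h)) psi - translate (k * t) psi - (h * k) *: translate (k * t) (x_deriv psi).
have lv : L2per L v by apply: (subspaceB sL); [exact: subspaceB|exact: subspaceZ].
have -> : L2dot L u (translate (k * (t + h)) psi) - L2dot L u (translate (k * t) psi) -
   h * (k * L2dot L u (translate (k * t) (x_deriv psi))) = L2dot L u v.
  by rewrite /v (bilinBr sL bL) ?(bilinBr sL bL) ?(bilinZr sL bL) ?mulrA//; [exact: subspaceB|exact: subspaceZ].
have hk0 : 0 <= C * (k * h) ^+ 2 by rewrite mulr_ge0 ?sqr_ge0.
have vv : L2dot L v v <= 2 * L * (C * (k * h) ^+ 2) ^+ 2.
  apply: L2dot_pointwise => // i x.
  have := HC i (x + k * t) (k * h); rewrite -[x + _ + _]addrA -mulrDr /component /v !mxE (mulrC h k).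
  by apply.
have KE : 0 <= K * k ^+ 2 * h ^+ 2.
  by apply: mulr_ge0 (sqr_ge0 h); exact: mulr_ge0 (sqrtr_ge0 _) (sqr_ge0 k).
apply: ler_of_sqr => //; rewrite real_normK ?num_real//.
apply: (le_trans (psd_CS sL bL (fun u => @L2dot_psd R L u) lu lv)).
apply: (le_trans (ler_wpM2l u0 vv)).
rewrite -[K * _ * _]mulrA [leRHS]exprMn /K sqr_sqrtr// le_eqVlt; apply/orP; left; apply/eqP.
by move: (L2dot L u u) => z; ring.
Qed.

Lemma L2dot_x_deriv_cst (a : 'cV[R]_2) psi y : smooth_periodic L psi ->
  L2dot L (fun=> a) (translate y (x_deriv psi)) = 0.
Proof.
move=> sp; have lp := smooth_L2per L0 sp.
have D := translate_derivative 1 y (L2per_cst (L := L) a) sp.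
have E : (fun t => L2dot L (fun=> a) (translate (1 * t) psi)) = cst (L2dot L (fun=> a) psi).
  by apply: funext => t; exact: (L2dot_translate L0 _ (L2per_cst (L := L) a) lp).
move: D; rewrite E !mul1r => D.
have := @derive_val _ _ _ _ _ _ _ D; by rewrite derive_cst => <-.
Qed.

End SmoothCalculus.

Section Solutions.
Context {R : realType} {L s c c1 c2 : R} {m : R -> 'M[R]_2} {G : 'cV[R]_2 -> R}.
Context (L0 : 0 < L) (s0 : 0 < s) (c10 : 0 < c1) (c20 : 0 < c2).
Context (adm : admissible_symbol s c1 c2 m) (GC2 : class_C2 G).
Notation mu := (@lebesgue_measure R).
Local Notation I L f := (\int[mu]_(x in `[0, L]) f x).
Local Notation X := (Xspace L s).
Local Notation xd := (xdot (L := L) (s := s)).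
Implicit Types (u v w h psi : R -> 'cV[R]_2) (U V : R -> R -> 'cV[R]_2).
Let sX : subspace X := X_subspace L0 s0.

Lemma translate_X y u : X u -> X (translate y u).
Proof. exact: Hper_translate. Qed.

Lemma translateB y u v : translate y u - translate y v = translate y (u - v).
Proof. by []. Qed.

Lemma Xnorm_translate y u : X u -> Xnorm L s (translate y u) = Xnorm L s u.
Proof. by move=> Xu; exact: (Hnorm_translate L0 _ _ (X_L2 Xu)). Qed.

Lemma xdot_translate y u : X u -> xd (translate y u) (translate y u) = xd u u.
Proof.
move=> Xu; rewrite -(Xnorm_sqr L0 s0 (translate_X y Xu)) (Xnorm_translate y Xu).
exact: (Xnorm_sqr L0 s0 Xu).
Qed.

Lemma CI_ae (f g : R -> R) : measurable_fun [set: R] f -> CI L g -> {ae mu, forall x, f x = g x} -> CI L f.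
Proof.
move=> mf [mg /integrableP[_ ig]] fg; split=> //; apply/integrableP; split.
  by apply/measurable_EFinP; exact: measurable_funS mf.
suff -> : (\int[mu]_(x in `[0%R, L]) `|(EFin \o f) x| = \int[mu]_(x in `[0%R, L]) `|(EFin \o g) x|)%E by [].
apply: ae_eq_integral => //.
- by apply: measurableT_comp => //; apply/measurable_EFinP; exact: measurable_funS mf.
- by apply: measurableT_comp => //; apply/measurable_EFinP; exact: measurable_funS mg.
by apply: aeS fg => x /= -> _.
Qed.

Lemma Xnorm_ae u v : L2per L u -> L2per L v -> ae_equal u v -> Xnorm L s u = Xnorm L s v.
Proof.
move=> lu lv E; rewrite /Xnorm /Hnorm (sobolev_sqE L0 _ lu) (sobolev_sqE L0 _ lv).
suff -> : hcoef L u = hcoef L v by [].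
by apply: funext => n; apply: hcoef_ae.
Qed.

Let cGi i : continuous (partial i G). Proof. by case: GC2 => _ _ h _ _; exact: h. Qed.

(** Solutions exist from every datum, so the integrability of the flux along
solutions is integrability over the whole energy space. *)
Lemma flux_integrable : globally_well_posed L s m G -> forall i u, X u ->
  mu.-integrable `[0, L] (fun x => (partial i G (u x))%:E).
Proof.
move=> [ex _ _] i u Xu; have [U [XU _ gU _] E] := ex u Xu.
have mf v : X v -> measurable_fun [set: R] (fun x => partial i G (v x)).
  by move=> Xv; apply: measurable_superposition => // j; exact: ((X_L2 Xv).2 j).1.
have cU : CI L (fun x => partial i G (U 0 x)).
  split; first exact: mf.
  have gE : (fun x => (grad G (U 0 x) i 0)%:E) = EFin \o (fun x => partial i G (U 0 x)).
    by apply: funext => x; rewrite mxE.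
  by rewrite -gE; exact: gU.
by have [] := CI_ae (mf _ Xu) cU (aeS (fun x (h : U 0 x = u x) => congr1 (partial i G) (esym h)) E).
Qed.

Context (g_int : forall i u, X u -> mu.-integrable `[0, L] (fun x => (partial i G (u x))%:E)).

Let flux_component_CI i u : X u -> CI L (fun x => partial i G (u x)).
Proof. by have [_ _ cG _ _] := GC2; apply: superposition_CI => //; exact: g_int. Qed.

Lemma flux_CI u v (M : R) : X u -> measurable_fun [set: R] (component v 0) ->
  measurable_fun [set: R] (component v 1) -> (forall i x, `|component v i x| <= M) ->
  CI L (fun x => dot (grad G (u x)) (v x)).
Proof.
move=> Xu m0 m1 H; rewrite /dot.
have -> : (fun x => \sum_(i < 2) grad G (u x) i 0 * v x i 0) =
  (fun x => partial 0 G (u x) * component v 0 x + partial 1 G (u x) * component v 1 x).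
  by apply: funext => x; rewrite sum2 !mxE.
apply: CID.
  by apply: CI_mul_bounded m0 (H 0); exact: flux_component_CI.
by apply: CI_mul_bounded m1 (H 1); exact: flux_component_CI.
Qed.

Lemma flux_smooth_CI u psi : X u -> smooth_periodic L psi -> CI L (fun x => dot (grad G (u x)) (psi x)).
Proof.
move=> Xu sp; have [M0 M00 H0] := smooth_component_bounded L0 0 sp.
have [M1 M10 H1] := smooth_component_bounded L0 1 sp.
have mp i : measurable_fun [set: R] (component psi i) by exact: ((smooth_L2per L0 sp).2 i).1.
apply: (@flux_CI u psi (M0 + M1)) => // i x.
case: i => [[|[|//]]] hi; [rewrite (_ : Ordinal hi = 0)|rewrite (_ : Ordinal hi = 1)]; try exact/val_inj.
  by apply: (le_trans (H0 _)); rewrite lerDl.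
by apply: (le_trans (H1 _)); rewrite lerDr.
Qed.

Lemma flux_translate u psi y : X u -> smooth_periodic L psi ->
  I L (fun x => dot (grad G (translate y u x)) (translate y psi x)) = I L (fun x => dot (grad G (u x)) (psi x)).
Proof.
move=> Xu sp; apply: (int_shift y L0 _ (flux_smooth_CI Xu sp).1) => x.
by have [pu _] := X_L2 Xu; have [pp _] := sp; rewrite /= pu pp.
Qed.

Lemma solution_translate y U : solution L s m G U -> solution L s m G (fun t => translate y (U t)).
Proof.
move=> [XU cU gU wU]; split=> [t|t|t i|psi sp t].
- exact: translate_X.
- have E : (fun t' => Xnorm L s (translate y (U t') - translate y (U t))) = (fun t' => Xnorm L s (U t' - U t)).
    by apply: funext => t'; exact: (Xnorm_translate y (subspaceB sX (XU t') (XU t))).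
  by rewrite E; exact: cU.
- have := g_int i (translate_X y (XU t)); suff -> : (fun x => (grad G (translate y (U t) x) i 0)%:E) =
    (fun x => (partial i G (translate y (U t) x))%:E) by [].
  by apply: funext => x; rewrite mxE.
have sp' := smooth_translate (- y) sp; have sd := smooth_x_deriv sp.
have tt (v : R -> 'cV[R]_2) : v = translate y (translate (- y) v) by rewrite translate_translate subrr translate0.
have := wU _ sp' t; rewrite x_deriv_translate.
rewrite -(@Mform_translate R L L0 m _ _ y (X_L2 (XU t)) (L2per_translate L0 _ (smooth_L2per L0 sd))) -tt.
rewrite -(flux_translate y (XU t) (smooth_translate (- y) sd)) -tt.
suff -> : (fun t' => L2dot L (U t') (translate (- y) psi)) = (fun t' => L2dot L (translate y (U t')) psi) by [].
apply: funext => t'; rewrite [in RHS](tt psi) (L2dot_translate L0)//; first exact: X_L2.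
exact: smooth_L2per sp'.
Qed.

Lemma Mform0r u : X u -> Mform L m u 0 = 0.
Proof.
move=> Xu; have bM := Mform_bilin L0 s0 c10 c20 adm.
rewrite (bilinC bM Xu sX.1); exact: (bilin0l sX bM Xu).
Qed.

(** Constants are test functions with vanishing derivative. *)
Lemma solution_component_mass (a : 'cV[R]_2) U t : solution L s m G U ->
  L2dot L (U t) (fun=> a) = L2dot L (U 0) (fun=> a).
Proof.
move=> [XU _ _ wU]; apply: (@is_derive_0_is_cst R (fun t => L2dot L (U t) (fun=> a))) => r.
have := wU _ (smooth_cst (L := L) a) r; rewrite x_deriv_cst Mform0r//.
rewrite (@int_ext _ L _ (fun=> 0)) ?int_cst// ?mul0r ?subr0// => x.
by rewrite dotC dot0l.
Qed.

Lemma solution_Xnorm_continuous U t (e : R) : solution L s m G U -> 0 < e ->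
  exists2 d : R, 0 < d & forall r, `|r - t| < d -> xd (U r - U t) (U r - U t) < e ^+ 2.
Proof.
move=> [XU cU _ _] e0; have /cvgr0Pnorm_lt/(_ e e0) := cU t.
move=> /nbhs_ballP[d /= d0 H]; exists d => // r hr.
have := H r; rewrite /ball/= distrC => /(_ hr).
by rewrite ger0_norm ?Xnorm_ge0// (Xnorm_lt L0 s0)//; exact: subspaceB.
Qed.

End Solutions.

Section TravelingWave.
Context {R : realType} {L s c c1 c2 : R} {m : R -> 'M[R]_2} {G : 'cV[R]_2 -> R}.
Context {phi : R -> 'cV[R]_2} {A : 'cV[R]_2}.
Context (L0 : 0 < L) (s0 : 0 < s) (c10 : 0 < c1) (c20 : 0 < c2).
Context (adm : admissible_symbol s c1 c2 m) (GC2 : class_C2 G) (sphi : smooth_periodic L phi).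
Context (phi_eq : profile_equation L c A m G phi).
Notation mu := (@lebesgue_measure R).
Local Notation I L f := (\int[mu]_(x in `[0, L]) f x).
Local Notation X := (Xspace L s).
Local Notation xd := (xdot (L := L) (s := s)).
Implicit Types (u v w h psi : R -> 'cV[R]_2) (U V : R -> R -> 'cV[R]_2).
Let sX : subspace X := X_subspace L0 s0.
Let Xphi : X phi := profile_X L0 s0 c10 adm phi_eq.
Let gphi y := translate y phi - phi.

Let gphi_X y : X (gphi y).
Proof. exact: (subspaceB sX (translate_X L0 y Xphi) Xphi). Qed.

(** The wave has s derivatives in L2, so translating it by a distance that is
small in L2 is small in the energy norm as well. *)
Lemma orbit_interpolation : exists2 C : R, 0 < C & forall y (B : R), 0 < B ->
  L2dot L (gphi y) (gphi y) <= B ^+ 2 -> xd (gphi y) (gphi y) <= C * B.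
Proof.
have [lphi [K HK]] : L2per L phi /\ exists B, strong_energy (L := L) (s := s) phi B.
  by apply/HperP => //; exact: (profile_Hper L0 s0 c10 adm phi_eq).
pose C2 := 4 * K; have K0 : 0 <= K by have := HK 0%N; rewrite big_ord0 mulr0.
exists (Num.sqrt (4 * K + 1)); first by rewrite sqrtr_gt0 ltr_wpDl// mulr_ge0.
move=> y B B0 hB; apply: (xdot_le_prod L0 s0 _ B0 (gphi_X y) (gphi_X y) _ hB).
  by rewrite sqrtr_gt0 ltr_wpDl// mulr_ge0.
move=> N; rewrite sqr_sqrtr; last by rewrite addr_ge0// mulr_ge0.
have HT := strong_energy_translate L0 y lphi HK.
have P n : sweight s n ^+ 2 * dot (hcoef L (gphi y) n) (hcoef L (gphi y) n) <=
   2 * (sweight s n ^+ 2 * dot (hcoef L (translate y phi) n) (hcoef L (translate y phi) n)) +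
   2 * (sweight s n ^+ 2 * dot (hcoef L phi n) (hcoef L phi n)).
  have -> : hcoef L (gphi y) n = hcoef L (translate y phi) n - hcoef L phi n.
    apply/matrixP => i j; have -> : j = 0 by exact: ord1.
    have := linfB (hcoef_linf L0 n i) (L2per_translate L0 y lphi) lphi; rewrite -/(gphi y) => ->.
    by move: (hcoef L (translate y phi) n) (hcoef L phi n) => a b; rewrite !mxE.
  rewrite !(mulrCA 2) -mulrDr; apply: ler_wpM2l; first exact: sqr_ge0.
  exact: (psd_sqB_le trueS dot_bilin (fun a _ => dot_ge0 a)).
apply: (@le_trans _ _ (2 * K + 2 * K)); last by rewrite -mulrDl; apply: ler_wpDr => //; rewrite -natrD.
apply: (@le_trans _ _ (L * \sum_(n < N)
   (2 * (sweight s n ^+ 2 * dot (hcoef L (translate y phi) n) (hcoef L (translate y phi) n)) +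
    2 * (sweight s n ^+ 2 * dot (hcoef L phi n) (hcoef L phi n))))).
  by apply: ler_wpM2l; [exact: ltW|apply: ler_sum => n _; exact: P].
rewrite big_split/= -!mulr_sumr mulrDr !(mulrCA L); apply: lerD; apply: ler_wpM2l => //.
- exact: HT.
- exact: HK.
Qed.

Lemma orbit_continuous (e : R) : 0 < e -> exists2 d : R, 0 < d & forall y, `|y| < d ->
  xd (gphi y) (gphi y) < e.
Proof.
move=> e0; have [C C0 HC] := orbit_interpolation.
have [K K0 HK] := translate_lipschitz L0 sphi.
pose B := e / (2 * C); have B0 : 0 < B by rewrite divr_gt0// mulr_gt0.
exists (B / (K + 1)); first by rewrite divr_gt0// ltr_wpDl.
move=> y hy; apply: (@le_lt_trans _ _ (C * B)); last first.
  have -> : C * B = e / 2 by rewrite /B; field; rewrite gt_eqF.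
  by rewrite gtr_pMr// invf_lt1// ltr1n.
apply: HC => //; apply: (le_trans (HK y)); rewrite -[y ^+ 2]real_normK ?num_real//.
have K1 : 0 < K + 1 by rewrite ltr_wpDl.
move: hy; rewrite ltr_pdivlMr// => hy.
apply: (@le_trans _ _ ((`|y| * (K + 1)) ^+ 2)); last first.
  by rewrite ler_pXn2r ?nnegrE ?(ltW hy) ?(ltW B0)//; exact: mulr_ge0 (normr_ge0 _) (ltW K1).
rewrite exprMn mulrC; apply: ler_wpM2l; first exact: sqr_ge0.
by rewrite sqrrD expr1n mulr1 -addrA; apply: ler_wpDl; [exact: sqr_ge0|rewrite mulr2n -addrA lerDl addr_ge0].
Qed.

Context (g_int : forall i u, X u -> mu.-integrable `[0, L] (fun x => (partial i G (u x))%:E)).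

(** The weak form is the profile equation tested with the derivative of a translated
test function; the constant A disappears because derivatives have mean zero. *)
Lemma traveling_wave_solution : solution L s m G (fun t => translate (- (c * t)) phi).
Proof.
have Xt t : X (translate (- (c * t)) phi) by exact: translate_X.
split=> [//|t|t i|psi sp t].
- apply/cvgr0Pnorm_lt => e e0; have [d d0 Hd] := orbit_continuous (exprn_gt0 2 e0).
  have c1p : 0 < `|c| + 1 by rewrite ltr_wpDl.
  near=> r; rewrite ger0_norm ?Xnorm_ge0//.
  have E : translate (- (c * r)) phi - translate (- (c * t)) phi = translate (- (c * t)) (gphi (c * (t - r))).
    apply: funext => x; rewrite /gphi /translate.
    rewrite -[LHS]/(phi (x + - (c * r)) - phi (x + - (c * t))).
    rewrite -[RHS]/(phi (x + - (c * t) + c * (t - r)) - phi (x + - (c * t))).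
    by congr (phi _ - _); ring.
  rewrite E (Xnorm_translate L0 _ (gphi_X _)) (Xnorm_lt L0 s0 e0 (gphi_X _)); apply: Hd.
  have : `|t - r| < d / (`|c| + 1) by near: r; apply: cvgr_dist_lt; [exact: cvg_id|rewrite divr_gt0].
  rewrite ltr_pdivlMr// mulrC => h; apply: le_lt_trans h; rewrite normrM; apply: ler_wpM2r => //.
  by rewrite lerDl.
- have := g_int i (Xt t); suff -> : (fun x => (grad G (translate (- (c * t)) phi x) i 0)%:E) =
    (fun x => (partial i G (translate (- (c * t)) phi x))%:E) by [].
  by apply: funext => x; rewrite mxE.
have sd := smooth_x_deriv sp; have lphi := X_L2 Xphi.
have lp := smooth_L2per L0 sp; have ld := smooth_L2per L0 sd.
pose v := translate (c * t) (x_deriv psi); have lv : L2per L v by exact: L2per_translate.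
have tt (w : R -> 'cV[R]_2) y : w = translate (- y) (translate y w) by rewrite translate_translate addNr translate0.
have -> : (fun t' => L2dot L (translate (- (c * t')) phi) psi) = (fun t' => L2dot L phi (translate (c * t') psi)).
  apply: funext => t'; rewrite [in LHS](tt psi (c * t')) (L2dot_translate L0)//.
  exact: L2per_translate.
have D := translate_derivative L0 c t lphi sp.
suff -> : I L (fun x => dot (grad G (translate (- (c * t)) phi x)) (x_deriv psi x)) -
  Mform L m (translate (- (c * t)) phi) (x_deriv psi) = c * L2dot L phi v by [].
have sv : smooth_periodic L v by exact: smooth_translate.
rewrite (tt (x_deriv psi) (c * t)) (Mform_translate L0)// (flux_translate L0 GC2 g_int _ Xphi sv).
have := profile_weak L0 adm GC2 sphi phi_eq lv.
rewrite -/v (L2dot_x_deriv_cst L0 _ _ sp) addr0.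
rewrite -[I L (fun x => _)]/(L2dot L (grad_profile (G := G) (phi := phi)) v).
move: (Mform _ _ _ _) (L2dot _ _ _) (c * _) => a b d E.
by rewrite -(subr0_eq E) addrAC subrr add0r.
Unshelve. all: by end_near. Qed.

End TravelingWave.

(** * Modulation and the stability argument *)

Section StabilityArithmetic.
Context {R : realType}.
Implicit Types (k D e eta x q De : R).

Lemma stability_combine k D x q al De eta e :
  k * x ^+ 2 <= q + D * al ^+ 2 -> `|De - 2^-1 * q| <= k / 8 * x ^+ 2 ->
  `|al| <= eta + e * x -> 0 <= eta -> 0 <= e -> 0 <= x -> 0 <= D -> 8 * D * e ^+ 2 <= k ->
  k / 4 * x ^+ 2 <= 2 * `|De| + 2 * (D * eta ^+ 2).
Proof.
move=> h1 /ler_normlP[h2 _] h3 eta0 e0 x0 D0 h4.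
have ex0 : 0 <= e * x by exact: mulr_ge0.
have sq : al ^+ 2 <= 2 * eta ^+ 2 + 2 * (e * x) ^+ 2.
  rewrite -real_normK ?num_real//; apply: (@le_trans _ _ ((eta + e * x) ^+ 2)).
    by rewrite ler_pXn2r ?nnegrE// addr_ge0.
  have := sqr_ge0 (eta - e * x); move: (e * x) => z; rewrite !expr2; lra.
have s1 : D * al ^+ 2 <= 2 * (D * eta ^+ 2) + 2 * (D * (e * x) ^+ 2).
  by rewrite -!(mulrCA D) -mulrDr; exact: ler_wpM2l.
have s2 : 8 * (D * (e * x) ^+ 2) <= k * x ^+ 2.
  have -> : 8 * (D * (e * x) ^+ 2) = 8 * D * e ^+ 2 * x ^+ 2 by ring.
  by apply: ler_wpM2r h4; exact: sqr_ge0.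
have s3 : 0 <= D * (e * x) ^+ 2 by rewrite mulr_ge0 ?sqr_ge0.
have := ler_norm De; move: h1 h2 s1 s2 s3; move: (x ^+ 2) (D * _) (D * _) (D * _) `|De| => X a b d y.
by move=> *; lra.
Qed.

Lemma small_square (k D eta e : R) : 0 < k -> 0 <= D -> 0 < e -> exists2 eta : R, 0 < eta &
  2 * eta + 2 * (D * eta ^+ 2) < k / 4 * e ^+ 2.
Proof.
move=> k0 D0 e0; pose T := k / 4 * e ^+ 2.
have T0 : 0 < T by rewrite mulr_gt0 ?exprn_gt0// divr_gt0.
pose z := T / (4 + 4 * D) / (1 + T).
have d1 : 0 < 4 + 4 * D by rewrite ltr_pwDl// mulr_ge0.
have d2 : 0 < 1 + T by rewrite ltr_wpDl// ltW.
have z0 : 0 < z by rewrite !divr_gt0.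
have z1 : z * (4 + 4 * D) <= T.
  have -> : z * (4 + 4 * D) = T / (1 + T) by rewrite /z; field; rewrite !gt_eqF.
  by rewrite ler_pdivrMr// ler_peMr ?(ltW T0)// lerDl ltW.
have z2 : z <= 1.
  rewrite /z ler_pdivrMr// mul1r; apply: (@le_trans _ _ T); last by rewrite lerDr.
  by rewrite ler_pdivrMr// ler_peMr ?(ltW T0)//; have := D0; lra.
exists z => //; rewrite -/T.
have : D * z ^+ 2 <= D * z by apply: ler_wpM2l => //; rewrite expr2 ler_piMl// ltW.
have Dz : 0 <= D * z by rewrite mulr_ge0// ltW.
by move: z1; rewrite mulrDr; lra.
Qed.

End StabilityArithmetic.

Section Stability.
Context {R : realType} {L s c c1 c2 : R} {m : R -> 'M[R]_2} {G : 'cV[R]_2 -> R}.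
Context {phi : R -> 'cV[R]_2} {A : 'cV[R]_2}.
Context (L0 : 0 < L) (s0 : 0 < s) (c10 : 0 < c1) (c20 : 0 < c2).
Context (adm : admissible_symbol s c1 c2 m) (GC2 : class_C2 G) (sphi : smooth_periodic L phi).
Context (phi_eq : profile_equation L c A m G phi).
Notation mu := (@lebesgue_measure R).
Local Notation I L f := (\int[mu]_(x in `[0, L]) f x).
Local Notation X := (Xspace L s).
Local Notation N := (Xnorm L s).
Local Notation xd := (xdot (L := L) (s := s)).
Local Notation l := (Lform L c m G phi).
Local Notation phi' := (x_deriv phi).
Local Notation act := (action (L := L) (c := c) (m := m) (G := G) (A := A)).
Implicit Types (u v w h psi : R -> 'cV[R]_2) (U V : R -> R -> 'cV[R]_2).
Let sX : subspace X := X_subspace L0 s0.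
Let sL : subspace (L2per L) := L2per_subspace (L := L).
Let bL := L2dot_bilin (L := L).
Let pL : psd (L2per L) (L2dot L) := fun u => @L2dot_psd R L u.
Let bX : bilin X xd := xdot_bilin L0 s0.
Let pX : psd X xd := xdot_psd L0 s0.
Let Xphi : X phi := profile_X L0 s0 c10 adm phi_eq.
Let lphi : L2per L phi := X_L2 Xphi.
Let N0 u : 0 <= N u := Xnorm_ge0 u.

Lemma critical_translate u y : L2per L u ->
  (forall z, L2dot L u (translate z phi) <= L2dot L u (translate y phi)) ->
  L2dot L u (translate y phi') = 0.
Proof.
move=> lu H; have D t := translate_derivative L0 1 t lu sphi.
have yab : y \in `]y - 1, y + 1[ by rewrite in_itv/= gtrDl ltrN10 ltrDl ltr01.
have ab : y - 1 <= y + 1 by rewrite lerD2l (@le_trans _ _ 0)// oppr_le0.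
have := @derive1_at_max _ (fun t => L2dot L u (translate (1 * t) phi)) _ _ y ab _ yab _.
have {ab yab} d1 (t : R) : t \in `]y - 1, y + 1[ -> derivable (fun t : R => L2dot L u (translate (1 * t) phi)) t 1.
  by move=> _; exact: (@ex_derive _ _ _ _ _ _ _ (D t)).
move=> /(_ d1) E; have {}E := E (fun t _ => _).
have {}E : is_derive y 1 (fun t => L2dot L u (translate (1 * t) phi)) 0.
  by apply: E => z; rewrite !mul1r; exact: H.
have := @derive_val _ _ _ _ _ _ _ E; rewrite (@derive_val _ _ _ _ _ _ _ (D y)).
by rewrite !mul1r.
Qed.

Lemma profile_perp : L2dot L phi phi' = 0.
Proof.
rewrite -(translate0 phi'); apply: critical_translate => // z; rewrite translate0.
have lz := L2per_translate L0 z lphi.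
have := pL (subspaceB sL lz lphi); rewrite (bilin_sqB sL bL lz lphi) (L2dot_translate L0 _ lphi lphi).
by rewrite (bilinC bL lz lphi); move: (L2dot L phi phi) (L2dot L phi _) => a b; lra.
Qed.

(** The first-order condition at a minimum of the distance in L2, which exists by
periodicity. *)
Lemma best_translate u : L2per L u -> exists y, L2dot L (translate y u - phi) phi' = 0 /\
  forall z, L2dot L (translate y u - phi) (translate y u - phi) <=
            L2dot L (translate z u - phi) (translate z u - phi).
Proof.
move=> lu; pose g t := L2dot L u (translate (1 * t) phi).
have cg : {within `[0, L], continuous g}.
  apply: continuous_subspaceT; apply: derivable_continuous_fun => t.
  exact: (@ex_derive _ _ _ _ _ _ _ (translate_derivative L0 1 t lu sphi)).
have [y _ Hy] := EVT_max (ltW L0) cg.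
have pg x : g (x + L) = g x.
  rewrite /g !mul1r; congr (L2dot L u _); apply: funext => z; rewrite /translate addrA.
  by have [pp _] := sphi; rewrite pp.
have H z : L2dot L u (translate z phi) <= L2dot L u (translate y phi).
  have [r rL E] := periodic_reduce L0 z pg; have := Hy r; rewrite in_itv/= => /(_ rL).
  by rewrite -E /g !mul1r.
have sw z v : L2per L v -> L2dot L (translate (- z) u) v = L2dot L u (translate z v).
  move=> lv; rewrite -(L2dot_translate L0 z _ lv); first by rewrite translate_translate subrr translate0.
  exact: L2per_translate.
have ld : L2per L phi' := smooth_L2per L0 (smooth_x_deriv sphi).
exists (- y); split.
  rewrite (bilinBl bL) ?profile_perp ?subr0//; last exact: L2per_translate.
  by rewrite sw//; exact: critical_translate.
move=> z; have lt x := L2per_translate L0 x lu.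
rewrite !(bilin_sqB sL bL) ?(L2dot_translate L0)//.
have := H (- z); rewrite -!sw// opprK.
by move: (L2dot L u u) (L2dot L _ _) (L2dot L _ _) (L2dot L _ _) => p q r t; lra.
Qed.

(** The best translate in L2 is also close in X: it differs from a translate that is
close in X by a small motion along the orbit, and such a motion is small in X by
interpolation. *)
Lemma modulation (e : R) : 0 < e -> exists2 d : R, 0 < d & forall u z, X u ->
  N (translate z u - phi) < d ->
  exists2 y, L2dot L (translate y u - phi) phi' = 0 & N (translate y u - phi) < e.
Proof.
move=> e0; have [C C0 HC] := orbit_interpolation L0 s0 c10 adm phi_eq.
pose T := 2 + 4 * C; have T0 : 0 < T by rewrite ltr_pwDl// mulr_ge0// ltW.
pose d := e ^+ 2 / T / (1 + e ^+ 2 / T).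
have eT : 0 < e ^+ 2 / T by rewrite divr_gt0// exprn_gt0.
have d0 : 0 < d by rewrite divr_gt0// ltr_wpDl// ltW.
have d1 : d < 1 by rewrite /d ltr_pdivrMr ?mul1r ?ltrDr// ltr_wpDl// ltW.
have dT : d * T <= e ^+ 2.
  rewrite -ler_pdivlMr// /d ler_pdivrMr; last by rewrite ltr_wpDl// ltW.
  by rewrite ler_peMr ?(ltW eT)// lerDl ltW.
exists d => // u z Xu hz; have Xt y := translate_X L0 y Xu.
have Xv y : X (translate y u - phi) := subspaceB sX (Xt y) Xphi.
have [y [py Hy]] := best_translate (X_L2 Xu); exists y => //.
pose w := translate z u - phi; have Xw : X w := Xv z.
pose g := translate (y - z) phi - phi.
have Xg : X g := subspaceB sX (translate_X L0 (y - z) Xphi) Xphi.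
pose w' := translate (y - z) w; have Xw' : X w' := translate_X L0 (y - z) Xw.
have vE : translate y u - phi = w' + g.
  have -> : w' = translate y u - translate (y - z) phi.
    by rewrite /w' /w -translateB translate_translate subrK.
  by rewrite /g addrA subrK.
have hw : xd w w < d ^+ 2 by rewrite -(Xnorm_lt L0 s0).
have hLw : L2dot L w w <= d ^+ 2 := le_trans (L2dot_le_xdot L0 s0 Xw) (ltW hw).
have hg : L2dot L g g <= (2 * d) ^+ 2.
  have gE : g = (translate y u - phi) - w' by rewrite vE addrC addKr.
  rewrite gE; apply: (le_trans (psd_sqB_le sL bL pL (X_L2 (Xv y)) (X_L2 Xw'))).
  rewrite /w' (L2dot_translate L0 _ (X_L2 Xw) (X_L2 Xw)).
  have := Hy z; rewrite -/w exprMn; move: hLw; move: (L2dot L w w) (L2dot L _ _) (d ^+ 2) => p q r.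
  by rewrite -natrX; lra.
have xg : xd g g <= C * (2 * d) by apply: HC => //; rewrite mulr_gt0.
rewrite (Xnorm_lt L0 s0 e0 (Xv y)) vE.
apply: (le_lt_trans (psd_sqD_le sX bX pX Xw' Xg)); apply: lt_le_trans dT.
rewrite /w' (xdot_translate L0 s0 _ Xw).
have : d ^+ 2 <= d by rewrite expr2 ler_piMl ?ltW.
move: hw xg; rewrite /T mulrDr; move: (xd w w) (xd g g) (d ^+ 2) => p q r.
have -> : C * (2 * d) = C * d * 2 by ring.
have -> : d * (4 * C) = C * d * 4 by ring.
by move: (C * d) => Cd; lra.
Qed.

Context (E_def : energy_defined L s G).

Lemma action_translate y u : X u -> act (translate y u) = act u.
Proof.
move=> Xu; have lu := X_L2 Xu; have lA := L2per_cst (L := L) A.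
rewrite /action /energy /momentum (Mform_translate L0 m y lu lu) (L2dot_translate L0 y lu lu).
rewrite -[X in _ + L2dot L X _ = _]/(translate y (fun=> A)) (L2dot_translate L0 y lA lu).
congr (_ - _ + _ + _).
have [mG _] := energy_CI GC2 E_def Xu.
rewrite -[RHS](int_shift y L0 _ mG)// => x; by have [pu _] := lu; rewrite pu.
Qed.

Context (E_cons : conserved L s m G (energy L m G)) (F_cons : conserved L s m G (momentum L)).

Lemma action_conserved U t : solution L s m G U ->
  act (U t) = act (U 0).
Proof.
move=> sU; have [XU _ _ _] := sU; rewrite /action (E_cons sU) (F_cons sU).
have lA := L2per_cst (L := L) A; congr (_ + _).
rewrite !(bilinC bL lA (X_L2 (XU _))).
exact: (solution_component_mass L0 s0 c10 c20 adm _ _ sU).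
Qed.

Lemma Lform_quadratic_bound : exists2 C : R, 0 <= C & forall v, X v -> `|l v v| <= C * xd v v.
Proof.
have [C C0 HC] := Lform_le (c := c) L0 s0 c10 c20 adm GC2 sphi.
have [k [K [k0 K0 HK]]] := Lform_garding (c := c) L0 s0 c10 c20 adm GC2 sphi.
exists (C + K); first exact: addr_ge0.
move=> v Xv; have x0 := pX Xv; have := HC v Xv; have := HK v Xv.
have : K * L2dot L v v <= K * xd v v by apply: ler_wpM2l => //; exact: (L2dot_le_xdot L0 s0).
have : 0 <= k * xd v v by rewrite mulr_ge0// ltW.
have : 0 <= C * xd v v by rewrite mulr_ge0.
have : 0 <= K * xd v v by rewrite mulr_ge0.
rewrite mulrDl; move: (l v v) (C * xd v v) (K * xd v v) (k * xd v v) (K * _) => q a b d e.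
by move=> *; rewrite ler_norml; apply/andP; split; lra.
Qed.

Lemma action_increment_le : exists2 d : R, 0 < d & exists2 C : R, 0 < C & forall v, X v -> N v < d ->
  `|act (phi + v) - act phi| <= C * N v ^+ 2.
Proof.
have [C C0 HC] := Lform_quadratic_bound.
have [d d0 Hd] := action_expansion L0 s0 c10 c20 adm GC2 sphi phi_eq E_def ltr01.
have ds0 : 0 < Num.sqrt d by rewrite sqrtr_gt0.
exists (Num.sqrt d) => //.
exists (1 + C); first by rewrite ltr_wpDr.
move=> v Xv; rewrite (Xnorm_lt L0 s0 ds0 Xv) (sqr_sqrtr (ltW d0)) => hv.
rewrite (Xnorm_sqr L0 s0 Xv); have := Hd v Xv hv; have := HC v Xv.
move: (action _ - action _) (l v v) (xd v v) (pX Xv) => a q x x0 h1 h2.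
rewrite -[a](subrK (2^-1 * q)); apply: (le_trans (ler_normD _ _)); rewrite mulrDl.
apply: lerD => //; rewrite normrM (@ger0_norm _ 2^-1) ?invr_ge0//.
by apply: le_trans h1; rewrite ler_piMl// invf_le1// ler1n.
Qed.

Context (H1 : hypothesis_H1 L s c m G phi) (Phi : R -> 'cV[R]_2) (XPhi : X Phi) (negPhi : l Phi Phi < 0).

(** What a third conserved functional contributes, for [f = l Phi]: smallness along
the solutions that start near the wave, up to an error that is small relative to
the distance to the orbit. *)
Definition controlled (f : (R -> 'cV[R]_2) -> R) := forall e : R, 0 < e -> exists2 r : R, 0 < r &
  forall eta : R, 0 < eta -> exists2 d : R, 0 < d & forall U, solution L s m G U -> N (U 0 - phi) < d ->
  forall t y, N (translate y (U t) - phi) < r ->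
  `|f (translate y (U t) - phi)| <= eta + e * N (translate y (U t) - phi).

Context (ctrl : controlled (l Phi)).

(** Either the solution is at distance at least [r0] from the orbit or it is much
closer; continuity in time will exclude the jump. *)
Lemma stability_gap : exists2 r0 : R, 0 < r0 & forall e : R, 0 < e -> exists2 d : R, 0 < d &
  forall U, solution L s m G U -> N (U 0 - phi) < d -> forall t z, N (translate z (U t) - phi) < r0 ->
  exists y, N (translate y (U t) - phi) < e.
Proof.
have [k [D [k0 D0 HkD]]] := coercive_direction L0 s0 c10 c20 adm GC2 sphi H1 XPhi negPhi.
have k8 : 0 < k / 8 by rewrite divr_gt0.
have [d1 d10 Hd1] := action_expansion L0 s0 c10 c20 adm GC2 sphi phi_eq E_def k8.
have [d2 d20 [C C0 HC]] := action_increment_le.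
pose e1 := Num.sqrt (k / (8 * D + 1)).
have D1 : 0 < 8 * D + 1 by rewrite ltr_wpDl// mulr_ge0.
have e10 : 0 < e1 by rewrite sqrtr_gt0 divr_gt0.
have De1 : 8 * D * e1 ^+ 2 <= k.
  rewrite sqr_sqrtr; last by rewrite ltW// divr_gt0.
  by rewrite mulrA ler_pdivrMr// mulrDr mulr1 (mulrC k) lerDl ltW.
have [r r_gt0 Hr] := ctrl e10.
pose r1 := Num.min r (Num.sqrt d1).
have r10 : 0 < r1 by rewrite lt_min r_gt0 sqrtr_gt0.
have [r0 r00 Hr0] := modulation r10.
exists r0 => // e e0; have [eta eta0 Heta] := small_square 0 k0 D0 e0.
have [d3 d30 Hd3] := Hr eta eta0.
pose d4 := Num.sqrt (eta / C); have d40 : 0 < d4 by rewrite sqrtr_gt0 divr_gt0.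
exists (Num.min d2 (Num.min d3 d4)); first by rewrite !lt_min d20 d30 d40.
move=> U sU hU t z hz; have [h2 h3 h4] : [/\ N (U 0 - phi) < d2, N (U 0 - phi) < d3 & N (U 0 - phi) < d4].
  by move: hU; move: (N (U 0 - phi)) => n; rewrite !lt_min => /and3P.
have [XU _ _ _] := sU; have [y py hy] := Hr0 _ _ (XU t) hz.
exists y; set v := translate y (U t) - phi in py hy *.
have Xv : X v := subspaceB sX (translate_X L0 y (XU t)) Xphi.
move: hy; rewrite lt_min => /andP[hvr hvd].
have c1' : `|l Phi v| <= eta + e1 * N v := Hd3 U sU h3 t y hvr.
have hvd' : xd v v < d1 by move: hvd; rewrite (Xnorm_lt L0 s0) ?sqrtr_gt0// sqr_sqrtr ?ltW.
have X0 : X (U 0 - phi) := subspaceB sX (XU 0) Xphi.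
have E0 := HC _ X0 h2; rewrite [phi + _]addrC subrK in E0.
have Ev := Hd1 v Xv hvd'; rewrite /v [phi + _]addrC subrK (action_translate _ (XU t)) (action_conserved t sU) -/v in Ev.
have Q := HkD v Xv py; rewrite -(Xnorm_sqr L0 s0 Xv) in Q Ev.
have S := stability_combine Q Ev c1' (ltW eta0) (ltW e10) (N0 v) D0 De1.
have E1 : C * N (U 0 - phi) ^+ 2 <= eta.
  rewrite mulrC -ler_pdivlMr// -[_ / _]sqr_sqrtr; last by rewrite ltW// divr_gt0.
  by rewrite ler_pXn2r ?nnegrE ?(ltW h4)// ltW.
have fin : k / 4 * N v ^+ 2 < k / 4 * e ^+ 2.
  apply: le_lt_trans S _; apply: le_lt_trans Heta; apply: lerD => //.
  by apply: ler_wpM2l => //; exact: le_trans E0 E1.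
move: fin; rewrite ltr_pM2l ?divr_gt0// ltr_pXn2r ?nnegrE ?N0//.
exact: ltW.
Qed.

Lemma locally_constant (P : R -> Prop) : (forall t, exists2 d : R, 0 < d & forall r, `|r - t| < d -> P r <-> P t) ->
  forall t r, P t -> P r.
Proof.
move=> H t r Pt; pose f x : R := (`[< P x >])%:R.
have fE : f r = f t.
  apply: (@is_derive_0_is_cst R f) => x; have [d d0 Hd] := H x.
  apply: (@is_derive_quadratic _ _ _ _ (d ^- 2)) => h; rewrite mulr0 subr0.
  have [hd|hd] := ltP `|h| d.
    have -> : f (x + h) = f x.
      by rewrite /f; have -> : P (x + h) = P x by apply/propext; apply: Hd; rewrite addrAC subrr add0r.
    by rewrite subrr normr0 mulr_ge0 ?sqr_ge0 ?invr_ge0 ?exprn_ge0 ?ltW.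
  apply: (@le_trans _ _ 1).
    by rewrite /f; do 2!case: asbool; rewrite ?subrr ?subr0 ?sub0r ?normrN ?normr0 ?normr1.
  rewrite mulrC ler_pdivlMr ?exprn_gt0// mul1r -[h ^+ 2]real_normK ?num_real//.
  by rewrite ler_pXn2r ?nnegrE// ltW.
move: fE; rewrite /f (asboolT Pt); case: asboolP => // _ /eqP.
by rewrite eq_sym oner_eq0.
Qed.

Lemma stability_of_controlled : globally_well_posed L s m G -> orbitally_stable L s m G phi.
Proof.
move=> [ex _ _] e e0; have [r0 r00 Hr0] := stability_gap.
pose e1 := Num.min e (r0 / 2); have e10 : 0 < e1 by rewrite lt_min e0 divr_gt0.
have [d d0 Hd] := Hr0 e1 e10.
exists (Num.min d e1); first by rewrite lt_min d0.
move=> u0 Xu0 h0; split; first exact: ex.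
move=> U sU U0 t _; have [XU _ _ _] := sU.
have h0' : N (U 0 - phi) < Num.min d e1.
  rewrite (@Xnorm_ae _ _ s L0 _ (u0 - phi))//.
  - exact: X_L2 (subspaceB sX (XU 0) Xphi).
  - exact: X_L2 (subspaceB sX Xu0 Xphi).
  by apply: aeS U0 => x E; rewrite -[LHS]/(U 0 x - phi x) E.
move: h0'; rewrite lt_min => /andP[hd he].
pose P t := exists y, N (translate y (U t) - phi) < e1.
have P0 : P 0 by exists 0; rewrite translate0.
have near r r' : N (U r' - U r) < r0 / 2 -> P r -> P r'.
  move=> hr [y hy]; apply: (Hd U sU hd r' y).
  have Xr : X (translate y (U r' - U r)) := translate_X L0 y (subspaceB sX (XU r') (XU r)).
  have Xv : X (translate y (U r) - phi) := subspaceB sX (translate_X L0 y (XU r)) Xphi.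
  have -> : translate y (U r') - phi = translate y (U r' - U r) + (translate y (U r) - phi).
    by rewrite -translateB addrA subrK.
  apply: (le_lt_trans (Xnorm_triangle L0 s0 Xr Xv)).
  rewrite (Xnorm_translate L0 _ (subspaceB sX (XU r') (XU r))) [r0]splitr.
  by apply: ltrD hr _; apply: lt_le_trans hy _; rewrite ge_min lexx orbT.
have [y hy] : P t.
  apply: (@locally_constant P _ 0 t P0) => r.
  have [d' d'0 Hd'] := solution_Xnorm_continuous L0 s0 r sU (divr_gt0 r00 (ltr0Sn _ 1)).
  exists d'; first exact: d'0.
  move=> r' hr'; have := Hd' r' hr'; have XB : X (U r' - U r) := subspaceB sX (XU r') (XU r).
  rewrite -(Xnorm_lt L0 s0 (divr_gt0 r00 (ltr0Sn _ 1)) XB) => hN; split; last exact: near hN.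
  by apply: near; rewrite -opprB (XnormN L0 s0 XB).
apply: (@le_lt_trans _ _ (N (translate y (U t) - phi))); last by apply: lt_le_trans hy _; rewrite ge_min lexx.
have -> : N (translate y (U t) - phi) = N (U t - translate (- y) phi).
  rewrite -(Xnorm_translate L0 y (subspaceB sX (XU t) (translate_X L0 (- y) Xphi))).
  by rewrite -[translate y (U t - _)]translateB translate_translate subrr translate0.
apply: ge_inf; last by exists (- y).
by exists 0 => _ [z _ <-].
Qed.

End Stability.

(** * Trigonometric approximation of functionals *)

Section SmoothFunctions.
Context {R : realType} {L : R} (L0 : 0 < L).
Implicit Types (u v psi : R -> 'cV[R]_2).
Let bL := L2dot_bilin (L := L).

Lemma derive1n_lin (a : R) (f g : R -> R) n : (forall n x, derivable (derive1n n f) x 1) ->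
  (forall n x, derivable (derive1n n g) x 1) ->
  derive1n n (fun x => a * f x + g x) = (fun x => a * derive1n n f x + derive1n n g x).
Proof.
move=> df dg; elim: n => [//|n IH]; rewrite !derive1nS IH; apply: funext => x.
rewrite !derive1E.
have Df : is_derive x (1 : R) (derive1n n f) ('D_1 (derive1n n f) x) := DeriveDef (df n x) erefl.
have Dg : is_derive x (1 : R) (derive1n n g) ('D_1 (derive1n n g) x) := DeriveDef (dg n x) erefl.
have D : is_derive x (1 : R) (fun x => a * derive1n n f x + derive1n n g x)
  (a * 'D_1 (derive1n n f) x + 'D_1 (derive1n n g) x).
  by apply: is_deriveD; apply: is_deriveZ.
exact: (@derive_val _ _ _ _ _ _ _ D).
Qed.

Lemma smooth_lin (a : R) u v : smooth_periodic L u -> smooth_periodic L v ->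
  smooth_periodic L (a *: u + v).
Proof.
move=> [pu du] [pv dv]; split.
  by move=> x; rewrite -[LHS]/(a *: u (x + L) + v (x + L)) pu pv.
move=> i n x; rewrite componentE (derive1n_lin a n (du i) (dv i)).
by apply: derivableD; [apply: derivableZ; exact: du|exact: dv].
Qed.

Lemma x_deriv_lin (a : R) u v : smooth_periodic L u -> smooth_periodic L v ->
  x_deriv (a *: u + v) = a *: x_deriv u + x_deriv v.
Proof.
move=> [_ du] [_ dv]; apply: funext => x; apply/matrixP => i j; rewrite -[RHS]/((a *: x_deriv u x + x_deriv v x) i j) !mxE.
rewrite componentE; have := @derive1n_lin a (component u i) (component v i) 1 (du i) (dv i).
by rewrite !derive1n1 => ->.
Qed.

Lemma L2dot_by_parts u psi : smooth_periodic L u -> smooth_periodic L psi ->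
  L2dot L u (x_deriv psi) = - L2dot L (x_deriv u) psi.
Proof.
move=> su sp; have lu := smooth_L2per L0 su; have lp := smooth_L2per L0 sp.
have lu' := smooth_L2per L0 (smooth_x_deriv su).
have D1 := translate_derivative L0 1 0 lu sp; have D2 := translate_derivative L0 (-1) 0 lp su.
have E : (fun t => L2dot L u (translate (1 * t) psi)) = (fun t => L2dot L psi (translate (-1 * t) u)).
  apply: funext => t; rewrite mul1r mulN1r (bilinC bL lp (L2per_translate L0 _ lu)).
  rewrite -(L2dot_translate L0 (- t) lu (L2per_translate L0 t lp)).
  by rewrite translate_translate addNr translate0.
rewrite E in D1; have := @derive_val _ _ _ _ _ _ _ D1; rewrite (@derive_val _ _ _ _ _ _ _ D2).
by rewrite !mulr0 !translate0 mul1r mulN1r (bilinC bL lp lu') => <-.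
Qed.

Lemma cas_derive (k : int) (x : R) : is_derive x (1 : R) (cas L k) (2 * pi * k%:~R / L * cas L (- k) x).
Proof.
have pE : phase L k = (fun x => (2 * pi * k%:~R / L) * x).
  by apply: funext => y; rewrite /phase mulrAC.
have Dp : is_derive x (1 : R) (phase L k) (2 * pi * k%:~R / L).
  by rewrite pE; apply: is_derive_eq; rewrite /GRing.scale/= mulr1.
rewrite /cas phaseN cosN sinN.
have D1 : is_derive x (1 : R) (fun y => cos (phase L k y)) (2 * pi * k%:~R / L * - sin (phase L k x)).
  have := @is_derive1_comp R cos (phase L k) x _ _ (is_derive_cos (phase L k x)) Dp.
  by rewrite mulrC.
have D2 : is_derive x (1 : R) (fun y => sin (phase L k y)) (2 * pi * k%:~R / L * cos (phase L k x)).
  have := @is_derive1_comp R sin (phase L k) x _ _ (is_derive_sin (phase L k x)) Dp.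
  by rewrite mulrC.
rewrite [cos (phase L k x) - _]addrC mulrDr; exact: is_deriveD.
Qed.

Lemma cas_scaled_derive (k : int) (b : R) : derive1 (fun x => cas L k x * b) =
  (fun x => cas L (- k) x * (2 * pi * k%:~R / L * b)).
Proof.
apply: funext => x; rewrite derive1E.
have D := is_deriveZ b (cas_derive k x).
have -> : (fun x => cas L k x * b) = (fun x => b *: cas L k x) by apply: funext => y; rewrite mulrC.
rewrite (@derive_val _ _ _ _ _ _ _ D) /GRing.scale/=.
by move: (2 * pi * _ / _) (cas _ _ _) => p q; ring.
Qed.

Lemma component_wave n a i : component (wave L n a) i = (fun x => cas L (zint n) x * a i 0).
Proof. by apply: funext => x; rewrite /component /wave mxE. Qed.

Lemma smooth_wave n a : smooth_periodic L (wave L n a).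
Proof.
split; first by move=> x; rewrite /wave cas_periodic.
move=> i d x; rewrite component_wave.
have [k [b ->]] : exists k, exists b : R, derive1n d (fun x => cas L (zint n) x * a i 0) = (fun x => cas L k x * b).
  elim: d => [|d [k [b IH]]]; first by exists (zint n), (a i 0).
  by exists (- k), (2 * pi * k%:~R / L * b); rewrite derive1nS IH cas_scaled_derive.
have -> : (fun x => cas L k x * b) = (fun x => b *: cas L k x) by apply: funext => y; rewrite mulrC.
by apply: derivableZ; exact: (@ex_derive _ _ _ _ _ _ _ (cas_derive k x)).
Qed.

Lemma x_deriv_wave n k a : zint k = - zint n ->
  x_deriv (wave L n a) = wave L k ((2 * pi * (zint n)%:~R / L) *: a).
Proof.
move=> E; apply: funext => x; apply/matrixP => i j; rewrite mxE component_wave cas_scaled_derive -E.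
by rewrite /wave !mxE (ord1 j).
Qed.

Lemma x_deriv_wave_index n a : exists k b, x_deriv (wave L n a) = wave L k b.
Proof.
have [k E] := zint_surj (- zint n).
by exists k, ((2 * pi * (zint n)%:~R / L) *: a); exact: x_deriv_wave.
Qed.

End SmoothFunctions.

Section Approximation.
Context {R : realType} {L s : R} (L0 : 0 < L) (s0 : 0 < s).
Local Notation cf := (hcoef L).
Local Notation wt := (sweight s).
Local Notation X := (Xspace L s).
Local Notation xd := (xdot (L := L) (s := s)).
Implicit Types (u v w z psi : R -> 'cV[R]_2).
Let sX : subspace X := X_subspace L0 s0.
Let sL : subspace (L2per L) := L2per_subspace (L := L).
Let bL := L2dot_bilin (L := L).
Let bX : bilin X xd := xdot_bilin L0 s0.
Let pX : psd X xd := xdot_psd L0 s0.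

Definition test_function psi := [/\ smooth_periodic L psi, X psi & X (x_deriv psi)].

Lemma test_wave n a : test_function (wave L n a).
Proof.
split; [exact: smooth_wave|exact: wave_X|].
by have [k [b ->]] := x_deriv_wave_index (L := L) n a; exact: wave_X.
Qed.

Lemma test_lin (a : R) u v : test_function u -> test_function v -> test_function (a *: u + v).
Proof.
move=> [su Xu Du] [sv Xv Dv]; split; [exact: smooth_lin|exact: sX.2|].
by rewrite (x_deriv_lin _ su sv); exact: sX.2.
Qed.

Lemma test_zero : test_function 0.
Proof.
split; [exact: (smooth_cst (L := L) 0)|exact: sX.1|].
by rewrite (x_deriv_cst (0 : 'cV[R]_2)); exact: sX.1.
Qed.

Lemma test_wave_sum N (a : nat -> 'cV[R]_2) : test_function (\sum_(n < N) wave L n (a n)).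
Proof.
elim: N => [|N IH]; first by rewrite big_ord0; exact: test_zero.
rewrite big_ord_recr/= addrC -[wave L N (a N)]scale1r.
exact: (test_lin 1 (test_wave N (a N)) IH).
Qed.

Lemma low_X M u : X (low L M u).
Proof. by have [] := test_wave_sum M (cf u). Qed.

Lemma xdot_wave u n a : X u -> xd u (wave L n a) = wt n * L2dot L u (wave L n a).
Proof.
move=> Xu; rewrite (L2dot_wave L0 n a (X_L2 Xu)) mulrCA; congr (_ * _).
apply/cvg_lim => //; apply: cvg_near_cst.
exists n.+1 => // N /= nN; rewrite /qseries seriesEnat/= big_mkord (bigD1 (Ordinal nN))//= big1 => [|k].
  by rewrite (hcoef_wave L0) eqxx scale1r addr0 dot_scalar.
rewrite -val_eqE/= => kn; rewrite (hcoef_wave L0) (negPf kn) scale0r.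
by rewrite dotC dot0l.
Qed.

Lemma low_dense u (e : R) : X u -> 0 < e -> exists M, xd (u - low L M u) (u - low L M u) <= e.
Proof.
move=> Xu e0; have cv : cvgn (energy_series (L := L) (s := s) u) by apply: energy_cvg.
have nd : nondecreasing_seq (energy_series (L := L) (s := s) u) by apply: energy_series_nd.
set S := energy_series (L := L) (s := s) u in cv nd.
have eL : 0 < e / L by rewrite divr_gt0.
have /cvgrPdist_lt/(_ _ eL)[M _ HM] := cv.
exists M; have Xh : X (u - low L M u) := subspaceB sX Xu (low_X M u).
apply: (xdot_le L0 s0 Xh) => N.
rewrite -ler_pdivlMl// mulrC; apply: (@le_trans _ _ (limn S - S M)); last first.
  by apply: (le_trans (ler_norm _)); exact: ltW (HM M (leqnn M)).
have [NM|MN] := leqP N M.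
  apply: (@le_trans _ _ 0); last by rewrite subr_ge0; exact: nondecreasing_cvgn_le.
  rewrite le_eqVlt big1 ?eqxx// => n _.
  by rewrite (hcoef_high L0 _ _ (X_L2 Xu)) leqNgt (leq_trans (ltn_ord n) NM) scale0r dot0l mulr0.
apply: (@le_trans _ _ (S N - S M)); last by rewrite lerD2r; exact: nondecreasing_cvgn_le.
rewrite /S !energy_seriesE lerBrDr -(subnKC (ltnW MN)) !big_split_ord/= big1 => [|n _]; last first.
  by rewrite (hcoef_high L0 _ _ (X_L2 Xu)) leqNgt/= ltn_ord scale0r dot0l mulr0.
rewrite [leLHS]addrC add0r lerD2l; apply: ler_sum => n _.
by rewrite (hcoef_high L0 _ _ (X_L2 Xu)) leq_addr scale1r.
Qed.

(** The representing vector of a bounded functional on the energy space need not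
be smooth; cutting its high frequencies gives a test function whose L2 pairing
approximates the functional in operator norm. *)
Lemma functional_approx (f : (R -> 'cV[R]_2) -> R) (D : R) : linf X f -> 0 <= D ->
  (forall v, X v -> f v ^+ 2 <= D * xd v v) -> forall e : R, 0 < e ->
  exists2 psi, test_function psi & forall z, X z -> (f z - L2dot L z psi) ^+ 2 <= e * xd z z.
Proof.
move=> lf D0 fD e e0.
have D1 : 0 <= D + 1 by rewrite addr_ge0.
have [y Xy Hy] : exists2 y, X y & forall v, X v -> xd y v = f v.
  apply: (lax_milgram (C := D + 1) (kappa := 1) sX sX _ (X_complete L0 s0) _ bX pX bX lf) => //.
  - by move=> v Xv; rewrite mul1r.
  - by move=> v Xv; rewrite mulrDl mul1r lerDr; apply: mulr_ge0 => //; exact: pX.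
  by move=> v Xv; rewrite mulrDl mul1r; apply: ler_wpDr; [exact: pX|exact: fD].
have [M HM] := low_dense Xy e0.
pose a n := wt n *: cf y n.
exists (\sum_(n < M) wave L n (a n)); first exact: test_wave_sum.
move=> z Xz; have Xl := low_X M y; have Xd := subspaceB sX Xy Xl.
have E : L2dot L z (\sum_(n < M) wave L n (a n)) = xd z (low L M y).
  rewrite (linf_sum sL (bilin_linr sL bL (X_L2 Xz))) => [|n]; last by apply: wave_L2per.
  rewrite /low (linf_sum sX (bilin_linr sX bX Xz)) => [|n]; last by apply: wave_X.
  apply: eq_bigr => n _; rewrite (xdot_wave n (cf y n) Xz) (L2dot_wave L0 n (a n) (X_L2 Xz)).
  rewrite (L2dot_wave L0 n (cf y n) (X_L2 Xz)) [RHS]mulrCA; congr (_ * _); rewrite /a.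
  by rewrite dotC -[_ *: _]addr0 dot_lin dot0l addr0 dotC.
rewrite E -Hy// (bilinC bX Xy Xz) -(bilinBr sX bX Xy Xl Xz) (bilinC bX Xz Xd).
by apply: (le_trans (psd_CS sX bX pX Xd Xz)); apply: ler_wpM2r => //; exact: pX.
Qed.

End Approximation.

(** * The conserved functional near the orbit of a moving wave *)

Section Moving.
Context {R : realType} {L s c c1 c2 : R} {m : R -> 'M[R]_2} {G : 'cV[R]_2 -> R}.
Context {phi : R -> 'cV[R]_2} {A : 'cV[R]_2}.
Context (L0 : 0 < L) (s0 : 0 < s) (c10 : 0 < c1) (c20 : 0 < c2).
Context (adm : admissible_symbol s c1 c2 m) (GC2 : class_C2 G) (sphi : smooth_periodic L phi).
Context (phi_eq : profile_equation L c A m G phi) (wp : globally_well_posed L s m G).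
Local Notation X := (Xspace L s).
Local Notation N := (Xnorm L s).
Implicit Types (u v w h psi : R -> 'cV[R]_2) (U V : R -> R -> 'cV[R]_2).
Let sX : subspace X := X_subspace L0 s0.
Let Xphi : X phi := profile_X L0 s0 c10 adm phi_eq.
Let N0 u : 0 <= N u := Xnorm_ge0 u.
Let g_int := flux_integrable GC2 wp.

Context (Q f : (R -> 'cV[R]_2) -> R).
Context (Qc : conserved L s m G Q) (Qf : frechet_derivative L s Q phi f).

Lemma frechet_continuous (eta : R) : 0 < eta -> exists2 d : R, 0 < d & forall h, X h -> N h < d ->
  `|Q (phi + h) - Q phi| <= eta.
Proof.
move=> eta0; have [_ [C HC] HF] := Qf; have [d d0 Hd] := HF 1 ltr01.
pose K := `|C| + 1; have K0 : 0 < K by rewrite ltr_wpDl.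
exists (Num.min d (eta / K)); first by rewrite lt_min d0 divr_gt0.
move=> h Xh; move: (N h) (N0 h) (Hd h Xh) (HC h Xh) => n n0 H1 H2.
rewrite lt_min => /andP[h1]; rewrite ltr_pdivlMr// => h2.
rewrite -[X in `|X|](subrK (f h)); apply: (le_trans (ler_normD _ _)).
apply: (@le_trans _ _ (1 * n + `|C| * n)); last by rewrite -mulrDl addrC mulrC ltW.
apply: lerD; first exact: H1.
by apply: (le_trans H2); apply: ler_wpM2r => //; exact: ler_norm.
Qed.

Lemma controlled_of_orbit_values : (forall eta : R, 0 < eta -> exists2 d : R, 0 < d &
  forall U, solution L s m G U -> N (U 0 - phi) < d -> forall t y, `|Q (translate y (U t)) - Q phi| <= eta) ->
  controlled (L := L) (s := s) (m := m) (G := G) (phi := phi) f.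
Proof.
move=> H e e0; have [_ _ HF] := Qf; have [r r0 Hr] := HF e e0; exists r => // eta eta0.
have [d d0 Hd] := H eta eta0; exists d => // U sU hU t y hv.
have [XU _ _ _] := sU; have Xv := subspaceB sX (translate_X L0 y (XU t)) Xphi.
have := Hr _ Xv hv; rewrite [phi + _]addrC subrK => h1; have := Hd U sU hU t y.
rewrite -[X in _ <= _ -> `|X| <= _](subKr (Q (translate y (U t)) - Q phi)) => h2.
by apply: (le_trans (ler_normB _ _)); exact: lerD.
Qed.

(** While the wave moves through all its translates, so does every solution
starting near it; hence the values of Q at the translates of the initial datum
are close to its value at the wave, by conservation along translated
solutions. *)
Lemma controlled_moving : c != 0 -> controlled (L := L) (s := s) (m := m) (G := G) (phi := phi) f.
Proof.
move=> cn0; apply: controlled_of_orbit_values => eta eta0.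
have [d1 d10 Hd1] := frechet_continuous eta0.
have sP := traveling_wave_solution L0 s0 c10 adm GC2 sphi phi_eq g_int.
have [_ _ cd] := wp.
have T0 : 0 < L / `|c| by rewrite divr_gt0// normr_gt0.
have [d d0 Hd] := cd _ sP (L / `|c|) d1 T0 d10; exists d; first exact: d0.
move=> U sU hU t y; have [XU _ _ _] := sU.
have per : forall x, (fun r : R => translate (x + L) (U r)) = (fun r => translate x (U r)).
  move=> x; apply: funext => r; apply: funext => z; have [pU _] := X_L2 (XU r).
  by rewrite /translate addrA pU.
have [z /andP[z0 zL] E] := periodic_reduce L0 y per.
rewrite (congr1 (fun F => F t) E).
have -> : Q (translate z (U t)) = Q (translate z (U (z / c))).
  have sT := solution_translate L0 s0 GC2 g_int z sU.
  by rewrite (Qc sT t) (Qc sT (z / c)).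
have hz : `|z / c| <= L / `|c|.
  by rewrite normrM normfV (ger0_norm z0) ler_pM2r// invr_gt0 normr_gt0.
have hU' : N (U 0 - translate (- (c * 0)) phi) < d by rewrite mulr0 oppr0 translate0.
have := Hd U sU hU' _ hz.
have -> : c * (z / c) = z by rewrite mulrC divfK.
have Xw : X (U (z / c) - translate (- z) phi) := subspaceB sX (XU _) (translate_X L0 (- z) Xphi).
rewrite -(Xnorm_translate L0 z Xw) => hn.
have := Hd1 _ (translate_X L0 z Xw) hn.
rewrite -[translate z (_ - _)]translateB translate_translate subrr translate0.
by rewrite [phi + _]addrC subrK.
Qed.

End Moving.

(** * Response of a standing wave to small perturbations *)

Section ResponseArithmetic.
Context {R : realType}.
Implicit Types (a b d e k x y z mu B : R).

Lemma interval_clip (t r T : R) : `|Num.max 0 (Num.min r T) - Num.max 0 (Num.min t T)| <= `|r - t|.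
Proof.
have [rT|rT] := leP r T; have [tT|tT] := leP t T;
  repeat (case: (leP 0 _) => ?); rewrite ?subrr ?normr0 ?normr_ge0//;
  rewrite ler_norml; apply/andP; split; have := ler_norm (r - t); have := ler_norm (t - r);
  rewrite -(distrC r t); lra.
Qed.

(** Continuous induction: a bound that improves itself persists. *)
Lemma bootstrap (f : R -> R) (K q T : R) : q < K -> 0 <= T ->
  (forall t e, 0 < e -> exists2 d : R, 0 < d & forall r, `|r - t| < d -> `|f r - f t| < e) ->
  f 0 <= K -> (forall t, 0 <= t <= T -> (forall r, 0 <= r <= t -> f r <= K) -> f t <= q) ->
  forall t, 0 <= t <= T -> f t <= q.
Proof.
move=> qK T0 cf f0 H; pose cl t := Num.max 0 (Num.min t T).
have cl0 t : 0 <= cl t by rewrite /cl le_max lexx.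
have clT t : cl t <= T by rewrite /cl ge_max T0 ge_min lexx orbT.
have clE t : 0 <= t <= T -> cl t = t.
  by move=> /andP[t0 tT]; rewrite /cl (min_idPl tT) (max_idPr t0).
pose P t := forall r, 0 <= r <= cl t -> f r <= K.
have PP t r : P t -> P r.
  apply: (@locally_constant R P) => {}t.
  have m0 : 0 < (K - q) / 2 by rewrite divr_gt0// subr_gt0.
  have [d d0 Hd] := cf (cl t) _ m0; exists d => // {}r hr.
  have hc : `|cl r - cl t| < d by apply: le_lt_trans hr; exact: interval_clip.
  have fq x : P x -> f (cl x) <= q.
    by move=> Px; apply: H; [rewrite cl0 clT|exact: Px].
  have E x : `|f x - f (cl t)| < (K - q) / 2 -> `|f (cl r) - f (cl t)| < (K - q) / 2 ->
    (f (cl t) <= q \/ f (cl r) <= q) -> f x <= K.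
    move=> /ltr_normlP[h1 h2] /ltr_normlP[h3 h4]; move: (f x) (f (cl t)) (f (cl r)) h1 h2 h3 h4 => a b e h1 h2 h3 h4.
    by case=> h; lra.
  have between x : Num.min (cl r) (cl t) <= x <= Num.max (cl r) (cl t) -> `|x - cl t| < d.
    move=> /andP[h1 h2]; apply: le_lt_trans hc; move: h1 h2; rewrite ge_min le_max.
    move: (cl t) (cl r) => p q' h1 h2.
    have [pq|pq] := leP p q'; first by rewrite (ger0_norm (_ : 0 <= q' - p)) ?subr_ge0// ler_norml; case/orP: h1; case/orP: h2 => *; apply/andP; split; lra.
    by rewrite (ltr0_norm (_ : q' - p < 0)) ?subr_lt0// ler_norml; case/orP: h1; case/orP: h2 => *; apply/andP; split; lra.
  split=> Px x /andP[x0 xc].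
    have [h|h] := leP x (cl r); first by apply: Px; rewrite x0.
    apply: E; [apply: Hd|exact: Hd|by right; exact: fq].
    by apply: between; rewrite ge_min (ltW h) le_max xc orbT.
  have [h|h] := leP x (cl t); first by apply: Px; rewrite x0.
  apply: E; [apply: Hd|exact: Hd|by left; exact: fq].
  by apply: between; rewrite ge_min (ltW h) orbT le_max xc.
move=> t ht; have P0 : P 0.
  move=> r; rewrite clE ?lexx// => /andP[r0 r1]; suff -> : r = 0 by [].
  by apply/eqP; rewrite eq_le r1.
by apply: H => // r hr; apply: (PP _ _ P0 : P t); rewrite clE.
Qed.

Lemma defect_split (G : 'cV[R]_2 -> R) (a b p h : 'cV[R]_2) :
  dot (grad G (a + b)) p = dot (grad G a) p + dot h p +
    ((partial 0 G (a + b) - partial 0 G a - h 0 0) * p 0 0 +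
     (partial 1 G (a + b) - partial 1 G a - h 1 0) * p 1 0).
Proof.
have gE q i : grad G q i 0 = partial i G q by rewrite mxE.
rewrite /dot !sum2 (gE (a + b) 0) (gE (a + b) 1) (gE a 0) (gE a 1).
move: (partial 0 G (a + b)) (partial 1 G (a + b)) (partial 0 G a) (partial 1 G a) => q r t z.
by move: (h 0 0) (h 1 0) (p 0 0) (p 1 0) => *; ring.
Qed.

Lemma flux_cancel (g a v h q : R) : a - g = 0 -> g + h + q - (a + v) + (v - h) = q.
Proof. by move=> /subr0_eq ->; ring. Qed.

Lemma norm_le_of_sq x y : 0 <= y -> x ^+ 2 <= y ^+ 2 -> `|x| <= y.
Proof. by move=> y0 h; apply: ler_of_sqr => //; rewrite real_normK ?num_real. Qed.

Lemma le_add1_of_sq x y : 0 <= x -> x ^+ 2 <= y -> x <= y + 1.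
Proof. by move=> x0 h; have := sqr_ge0 (x - 1); rewrite sqrrB1 -mulr_natl; move: h; move: (x ^+ 2) => z; lra. Qed.

End ResponseArithmetic.

#[local] Opaque Xnorm.

Section Response.
Context {R : realType} {L s c c1 c2 : R} {m : R -> 'M[R]_2} {G : 'cV[R]_2 -> R}.
Context {phi : R -> 'cV[R]_2} {A : 'cV[R]_2}.
Context (L0 : 0 < L) (s0 : 0 < s) (c10 : 0 < c1) (c20 : 0 < c2).
Context (adm : admissible_symbol s c1 c2 m) (GC2 : class_C2 G) (sphi : smooth_periodic L phi).
Context (phi_eq : profile_equation L c A m G phi) (wp : globally_well_posed L s m G).
Context (E_def : energy_defined L s G) (c0 : c = 0).
Notation mu := (@lebesgue_measure R).
Local Notation I L f := (\int[mu]_(x in `[0, L]) f x).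
Local Notation X := (Xspace L s).
Local Notation N := (Xnorm L s).
Local Notation xd := (xdot (L := L) (s := s)).
Local Notation l := (Lform L c m G phi).
Local Notation test := (test_function (L := L) (s := s)).
Local Notation act := (action (L := L) (c := c) (m := m) (G := G) (A := A)).
Implicit Types (u v w h psi zeta eta : R -> 'cV[R]_2) (U V : R -> R -> 'cV[R]_2).
Let sX : subspace X := X_subspace L0 s0.
Let bX : bilin X xd := xdot_bilin L0 s0.
Let pX : psd X xd := xdot_psd L0 s0.
Let bl : bilin X l := Lform_bilin L0 s0 c10 c20 adm GC2 sphi.
Let bM := Mform_bilin L0 s0 c10 c20 adm.
Let Xphi : X phi := profile_X L0 s0 c10 adm phi_eq.
Let N0 u : 0 <= N u := Xnorm_ge0 u.
Let g_int := flux_integrable GC2 wp.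
Let defect v i := gradient_defect (G := G) (phi := phi) v i.

(** [l + C xd] is a nonnegative form, so that Cauchy-Schwarz applies to it. *)
Lemma Lform_continuous : exists2 C : R, 0 <= C & forall u v, X u -> X v -> `|l u v| <= C * (N u * N v).
Proof.
have [C C0 HC] := Lform_quadratic_bound (c := c) L0 s0 c10 c20 adm GC2 sphi.
pose b u v := l u v + C * xd u v.
have bb : bilin X b.
  split=> [u v Xu Xv|a u v w Xu Xv Xw]; first by rewrite /b (bilinC bl Xu Xv) (bilinC bX Xu Xv).
  rewrite /b (bl.2 a _ _ _ Xu Xv Xw) (bX.2 a _ _ _ Xu Xv Xw).
  by move: (l u w) (l v w) (xd u w) (xd v w) => p q r t; ring.
have bE u : X u -> 0 <= b u u <= 2 * C * xd u u.
  move=> Xu; have := HC u Xu; rewrite /b -(mulrA 2 C) ler_norml => /andP[]; move: (l u u) (C * xd u u) => p q h1 h2.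
  by apply/andP; split; lra.
have pb : psd X b by move=> u Xu; case/andP: (bE u Xu).
have xN u v : X u -> X v -> `|xd u v| <= N u * N v.
  move=> Xu Xv; apply: norm_le_of_sq; first exact: mulr_ge0.
  rewrite [(N u * N v) ^+ 2]exprMn (Xnorm_sqr L0 s0 Xu) (Xnorm_sqr L0 s0 Xv).
  exact: (psd_CS sX bX pX Xu Xv).
have bN u v : X u -> X v -> `|b u v| <= 2 * C * (N u * N v).
  move=> Xu Xv; have k0 : 0 <= 2 * C by rewrite mulr_ge0.
  apply: norm_le_of_sq; first by apply: (mulr_ge0 k0); exact: mulr_ge0.
  rewrite [(_ * _) ^+ 2]exprMn [(N u * N v) ^+ 2]exprMn (Xnorm_sqr L0 s0 Xu) (Xnorm_sqr L0 s0 Xv).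
  apply: (le_trans (psd_CS sX bb pb Xu Xv)).
  case/andP: (bE u Xu) => u0 u1; case/andP: (bE v Xv) => v0 v1.
  apply: (le_trans (ler_pM u0 v0 u1 v1)); rewrite le_eqVlt; apply/orP; left; apply/eqP.
  by move: (xd u u) (xd v v) => p q; ring.
exists (3 * C); first by rewrite mulr_ge0.
move=> u v Xu Xv; have -> : l u v = b u v - C * xd u v by rewrite /b addrK.
apply: (le_trans (ler_normB _ _)); have := bN u v Xu Xv; rewrite normrM (ger0_norm C0).
have := ler_wpM2l C0 (xN u v Xu Xv); move: `|b u v| (C * `|xd u v|) (N u * N v) => p q r h1 h2.
have -> : 3 * C * r = 2 * C * r + C * r by ring.
exact: lerD.
Qed.

Definition flux u psi := I L (fun x => dot (grad G (u x)) (x_deriv psi x)) - Mform L m u (x_deriv psi).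

(** At a standing wave the flux vanishes, and its linear part is minus the linearized
form against the derivative of the test function. *)
Lemma flux_defect v psi (B : R) : X v -> test psi -> (forall i x, `|component (x_deriv psi) i x| <= B) ->
  `|flux (phi + v) psi + l v (x_deriv psi)| <= B * (I L (fun x => `|defect v 0 x|) + I L (fun x => `|defect v 1 x|)).
Proof.
move=> Xv [sp Xp Xd] HB; have sd := smooth_x_deriv sp; have ld := smooth_L2per L0 sd.
set p := x_deriv psi in Xd HB sd ld *; have lv := X_L2 Xv.
have lH := Hop_L2per L0 GC2 sphi lv; have lg := grad_profile_L2per L0 GC2 sphi.
have B0 : 0 <= B := le_trans (normr_ge0 _) (HB 0 0).
have cd i : CI L (defect v i) := gradient_defect_CI L0 s0 c10 adm GC2 sphi phi_eq g_int i Xv.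
have mp i : measurable_fun [set: R] (component p i) := (ld.2 i).1.
have cdp i : CI L (fun x => defect v i x * component p i x) := CI_mul_bounded (cd i) (mp i) (HB i).
have E : flux (phi + v) psi + l v p = I L (fun x => defect v 0 x * component p 0 x + defect v 1 x * component p 1 x).
  have W := profile_weak L0 adm GC2 sphi phi_eq ld; move: W.
  have A0 : L2dot L (fun=> A) p = 0 by rewrite -(translate0 p); exact: L2dot_x_deriv_cst.
  rewrite A0 addr0 c0 mul0r addr0 => W.
  have F : I L (fun x => dot (grad G ((phi + v) x)) (p x)) = L2dot L (grad_profile (G := G) (phi := phi)) p +
     L2dot L (Hop (G := G) (phi := phi) v) p + I L (fun x => defect v 0 x * component p 0 x + defect v 1 x * component p 1 x).
    rewrite -(intD (CI_dot lg ld) (CI_dot lH ld)) -(intD (CID (CI_dot lg ld) (CI_dot lH ld)) (CID (cdp 0) (cdp 1))).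
    by apply: int_ext => x; exact: (defect_split G (phi x) (v x) (p x) (Hop (G := G) (phi := phi) v x)).
  rewrite /flux -/p F LformE (bilinDl bM Xphi Xv Xd) mul0r addr0.
  exact: flux_cancel W.
rewrite E; have cB i : CI L (fun x => B * `|defect v i x|) := CIZ B (CI_norm (cd i)).
rewrite mulrDr -!(intZ B (CI_norm (cd _))) -(intD (cB 0) (cB 1)).
apply: (int_norm_le (CID (cdp 0) (cdp 1)) (CID (cB 0) (cB 1))) => x.
apply: (le_trans (ler_normD _ _)); rewrite !normrM !(mulrC B).
by apply: lerD; apply: ler_wpM2l => //; exact: HB.
Qed.

Lemma xdot_scaled (e K : R) eta : X eta -> 0 < e -> e <= 1 -> xd eta eta <= K ->
  xd (e *: eta) (e *: eta) <= e * K.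
Proof.
move=> Xe e0 e1 hK; rewrite (bilin_sqZ sX bX e Xe); have x0 := pX Xe.
rewrite expr2 -mulrA; apply: ler_wpM2l; first exact: ltW.
by apply: le_trans hK; rewrite ler_piMl.
Qed.

Lemma scale_small (d K : R) : 0 < d -> 0 <= K -> exists2 e0 : R, 0 < e0 & forall e, 0 < e -> e < e0 -> e <= 1 /\ e * K < d.
Proof.
move=> d0 K0; have K1 : 0 < K + 1 by rewrite ltr_wpDl.
exists (Num.min 1 (d / (K + 1))); first by rewrite lt_min ltr01 divr_gt0.
move=> e e0; rewrite lt_min => /andP[e1]; rewrite ltr_pdivlMr// => h; split; first exact: ltW.
by apply: le_lt_trans h; rewrite ler_pM2l// lerDl.
Qed.

Lemma flux_linearization (B K nu : R) : 0 <= B -> 0 <= K -> 0 < nu -> exists2 e0 : R, 0 < e0 &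
  forall e eta psi, 0 < e -> e < e0 -> X eta -> xd eta eta <= K -> test psi ->
  (forall i x, `|component (x_deriv psi) i x| <= B) ->
  `|e^-1 * flux (phi + e *: eta) psi + l eta (x_deriv psi)| <= nu.
Proof.
move=> B0 K0 nu0; pose T := (B + 1) * (2 * (1 + 2 * K)).
have K1 : 0 < 1 + 2 * K by rewrite ltr_pwDl// mulr_ge0.
have B1 : 0 < B + 1 by rewrite ltr_wpDl.
have T0 : 0 < T by apply: mulr_gt0 B1 _; exact: mulr_gt0.
pose e1 := nu / T; have e10 : 0 < e1 by rewrite divr_gt0.
have [d1 d10 H1] := gradient_expansion L0 s0 c10 adm GC2 sphi phi_eq g_int 0 e10.
have [d2 d20 H2] := gradient_expansion L0 s0 c10 adm GC2 sphi phi_eq g_int 1 e10.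
have d12 : 0 < Num.min d1 d2 by rewrite lt_min d10.
have [e0 e00 He0] := scale_small d12 K0; exists e0; first exact: e00.
move=> e eta psi ep ee0 Xe hK tp HB; have [e1' hd] := He0 e ep ee0.
have Xv : X (e *: eta) := subspaceZ e sX Xe.
have hx := xdot_scaled Xe ep e1' hK; have x0 := pX Xv.
have hlt : xd (e *: eta) (e *: eta) < Num.min d1 d2 := le_lt_trans hx hd.
move: hlt; rewrite lt_min => /andP[h1 h2].
have D := flux_defect Xv tp HB.
have bnd (y : R) : y <= e1 * (e + xd (e *: eta) (e *: eta) / e + xd (e *: eta) (e *: eta)) -> y <= e1 * (e * (1 + 2 * K)).
  move=> h; apply: (le_trans h); rewrite ler_pM2l//; clear h.
  have a1 : xd (e *: eta) (e *: eta) / e <= e * K.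
    have -> : xd (e *: eta) (e *: eta) / e = e * xd eta eta.
      by rewrite (bilin_sqZ sX bX e Xe); move: (xd _ _) => q; field; rewrite gt_eqF.
    by rewrite ler_pM2l.
  move: a1 hx; move: (xd _ _ / e) => p; move: (xd (e *: eta) (e *: eta)) => q a1 a2; have -> : e * (1 + 2 * K) = e + e * K + e * K by ring.
  by apply: lerD => //; rewrite lerD2l.
have S : B * (I L (fun x => `|defect (e *: eta) 0 x|) + I L (fun x => `|defect (e *: eta) 1 x|)) <= e * nu.
  have hp : I L (fun x => `|defect (e *: eta) 0 x|) <= _ := bnd _ (H1 _ Xv h1 e ep).
  have hq : I L (fun x => `|defect (e *: eta) 1 x|) <= _ := bnd _ (H2 _ Xv h2 e ep).
  apply: (@le_trans _ _ (B * (e1 * (e * (1 + 2 * K)) + e1 * (e * (1 + 2 * K))))).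
    by apply: (ler_wpM2l B0); exact: (lerD hp hq).
  apply: (@le_trans _ _ ((B + 1) * (e1 * (e * (1 + 2 * K)) + e1 * (e * (1 + 2 * K))))).
    apply: ler_wpM2r; last by rewrite lerDl.
    by rewrite -mulrDr -mulr2n; apply: mulr_ge0; [exact: ltW|apply: mulrn_wge0; apply: mulr_ge0; [exact: ltW|apply: addr_ge0 => //; exact: mulr_ge0]].
  rewrite le_eqVlt; apply/orP; left; apply/eqP; rewrite /e1 /T; field.
  by rewrite !gt_eqF.
have -> : e^-1 * flux (phi + e *: eta) psi + l eta (x_deriv psi) =
   e^-1 * (flux (phi + e *: eta) psi + l (e *: eta) (x_deriv psi)).
  have [_ _ Xd] := tp; by rewrite (bilinZl sX bl e Xe Xd) [RHS]mulrDr (mulKf (lt0r_neq0 ep)).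
rewrite normrM gtr0_norm ?invr_gt0// ler_pdivrMl//.
exact: le_trans D S.
Qed.

Lemma action_linearization (K nu : R) : 0 <= K -> 0 < nu -> exists2 e0 : R, 0 < e0 &
  forall e eta, 0 < e -> e < e0 -> X eta -> xd eta eta <= K ->
  `|act (phi + e *: eta) - act phi - e ^+ 2 / 2 * l eta eta| <= nu * e ^+ 2.
Proof.
move=> K0 nu0; have K1 : 0 < K + 1 by rewrite ltr_wpDl.
have n1 : 0 < nu / (K + 1) by rewrite divr_gt0.
have [d d0 Hd] := action_expansion L0 s0 c10 c20 adm GC2 sphi phi_eq E_def n1.
have [e0 e00 He0] := scale_small d0 K0; exists e0; first exact: e00.
move=> e eta ep ee0 Xe hK; have [e1 hd] := He0 e ep ee0.
have Xv : X (e *: eta) := subspaceZ e sX Xe.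
have := Hd _ Xv (le_lt_trans (xdot_scaled Xe ep e1 hK) hd).
rewrite (bilin_sqZ sX bl e Xe) (bilin_sqZ sX bX e Xe) mulrA (mulrC 2^-1) => h; apply: (le_trans h).
rewrite mulrCA [leRHS]mulrC; apply: ler_wpM2l; first exact: sqr_ge0.
rewrite mulrAC ler_pdivrMr// ler_pM2l//; apply: (le_trans hK); by rewrite lerDl.
Qed.

Lemma frechet_linearization Q f (K nu : R) : frechet_derivative L s Q phi f -> 0 <= K -> 0 < nu ->
  exists2 e0 : R, 0 < e0 & forall e eta, 0 < e -> e < e0 -> X eta -> xd eta eta <= K ->
  `|Q (phi + e *: eta) - Q phi - e * f eta| <= nu * e.
Proof.
move=> [lf _ Hf] K0 nu0; have K1 : 0 < K + 1 by rewrite ltr_wpDl.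
have n1 : 0 < nu / (K + 1) by rewrite divr_gt0.
have [d d0 Hd] := Hf _ n1; have d2 : 0 < d ^+ 2 by rewrite exprn_gt0.
have [e0 e00 He0] := scale_small d2 K0; exists e0; first exact: e00.
move=> e eta ep ee0 Xe hK; have [e1 hd] := He0 e ep ee0.
have Xv : X (e *: eta) := subspaceZ e sX Xe.
have hN : N (e *: eta) < d.
  by rewrite (Xnorm_lt L0 s0 d0 Xv); exact: (le_lt_trans (xdot_scaled Xe ep e1 hK) hd).
have := Hd _ Xv hN; rewrite (linfZ sX lf e Xe) (XnormZ L0 s0 e Xe) (gtr0_norm ep) => h.
apply: (le_trans h); rewrite mulrCA [leRHS]mulrC; apply: ler_wpM2l; first exact: ltW.
rewrite mulrAC ler_pdivrMr// ler_pM2l//.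
have nK : N eta ^+ 2 <= K by rewrite (Xnorm_sqr L0 s0 Xe).
exact: le_add1_of_sq.
Qed.

End Response.

Section BootstrapArithmetic.
Context {R : realType}.
Implicit Types (kap C S x lz gz B D E M tau : R).

(** The quantities of the bootstrap: [x] is the size of the response at a time
up to [tau], [gz] its pairing with the forcing, [S] its low frequencies. *)
Lemma bootstrap_step kap C S x lz gz B Cl D M tau : 0 < kap -> 0 <= C -> 0 <= B -> 0 <= Cl ->
  0 < D -> 0 <= M -> 0 < tau -> tau <= 1 -> Cl * D * tau <= 1 -> 0 <= x ->
  3 + C * (M * (2 * B + 1) ^+ 2) + 2 * (Cl * B) * D <= kap / 4 * D ^+ 2 ->
  kap * x ^+ 2 <= lz + C * S -> `|lz + 2 * gz| <= tau ^+ 2 ->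
  `|gz| <= tau * (Cl * (D * tau) * B + tau ^+ 2) ->
  S <= M * (tau * (B + (Cl * (D * tau) * B + tau ^+ 2))) ^+ 2 -> x <= D * tau / 2.
Proof.
move=> k0 C0 B0 Cl0 D0 M0 t0 t1 ct x0 big gard en hg hS.
have T0 : 0 <= tau ^+ 2 by exact: sqr_ge0.
have tt : tau ^+ 2 <= 1 by rewrite expr_le1// ltW.
have t3 : tau * tau ^+ 2 <= tau ^+ 2 by rewrite ler_piMl.
have S1 : S <= M * (2 * B + 1) ^+ 2 * tau ^+ 2.
  apply: (le_trans hS); have -> : M * (2 * B + 1) ^+ 2 * tau ^+ 2 = M * (tau * (2 * B + 1)) ^+ 2 by ring.
  apply: ler_wpM2l => //.
  have a0 : 0 <= B + (Cl * (D * tau) * B + tau ^+ 2).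
    by rewrite addr_ge0// addr_ge0// !mulr_ge0// ltW.
  have p0 : 0 <= tau * (B + (Cl * (D * tau) * B + tau ^+ 2)) by apply: mulr_ge0 => //; exact: ltW.
  have q0 : 0 <= tau * (2 * B + 1).
    by apply: mulr_ge0; [exact: ltW|apply: addr_ge0 => //; exact: mulr_ge0].
  rewrite ler_pXn2r ?nnegrE// ler_pM2l//; have : Cl * (D * tau) * B <= B by rewrite mulrA ler_piMl.
  by move: tt; move: (Cl * _ * B) (tau ^+ 2) => p q; lra.
have CS : C * S <= C * (M * (2 * B + 1) ^+ 2) * tau ^+ 2.
  by rewrite -mulrA; apply: ler_wpM2l.
have g1 : tau * (Cl * (D * tau) * B + tau ^+ 2) <= (Cl * B) * D * tau ^+ 2 + tau ^+ 2.
  rewrite mulrDr; apply: lerD => //; rewrite le_eqVlt; apply/orP; left; apply/eqP; ring.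
have fin : kap * x ^+ 2 <= (3 + C * (M * (2 * B + 1) ^+ 2) + 2 * (Cl * B) * D) * tau ^+ 2.
  move: en; rewrite ler_norml => /andP[_ en].
  have := le_trans hg g1; rewrite ler_norml => /andP[hg' _].
  have -> : (3 + C * (M * (2 * B + 1) ^+ 2) + 2 * (Cl * B) * D) * tau ^+ 2 =
    3 * tau ^+ 2 + C * (M * (2 * B + 1) ^+ 2) * tau ^+ 2 + 2 * (Cl * B * D * tau ^+ 2) by ring.
  move: gard en CS hg'; clear.
  by move: (kap * _) (C * S) (tau ^+ 2) (C * _ * _) (Cl * B * D * _) => a b d e h; lra.
have {}fin : kap * x ^+ 2 <= kap * (D * tau / 2) ^+ 2.
  apply: (le_trans fin); apply: (le_trans (ler_wpM2r T0 big)).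
  by rewrite le_eqVlt; apply/orP; left; apply/eqP; field.
move: fin; rewrite ler_pM2l// => fin; apply: ler_of_sqr => //.
by rewrite divr_ge0// mulr_ge0// ltW.
Qed.

(** The right-hand side is quadratic in D, the left-hand side affine. *)
Lemma bootstrap_constant kap E F : 0 < kap -> 0 <= E -> 0 <= F -> exists2 D : R, 0 < D &
  E + 2 * F * D <= kap / 4 * D ^+ 2.
Proof.
move=> k0 E0 F0; pose D := (8 * F + 4 * E) / kap + 1.
have D1 : 1 <= D by rewrite lerDr divr_ge0 ?addr_ge0 ?mulr_ge0// ltW.
exists D; first exact: lt_le_trans ltr01 D1.
have kD : 8 * F + 4 * E <= kap * D.
  by rewrite /D mulrDr mulr1 mulrCA mulfV ?gt_eqF// mulr1 lerDl ltW.
have ED : E <= E * D by rewrite ler_peMr.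
have D0 : 0 <= D := le_trans ler01 D1.
have := ler_wpM2r D0 kD; rewrite mulrDl expr2.
have -> : kap / 4 * (D * D) = kap * D * D / 4 by ring.
have -> : 2 * F * D = 2 * (F * D) by ring.
have -> : 8 * F * D = 8 * (F * D) by ring.
have -> : 4 * E * D = 4 * (E * D) by ring.
by move: ED; move: (F * D) (E * D) (kap * D * D) => p q r *; lra.
Qed.

Lemma rate_combine (a b d q nu : R) : `|b| <= q -> `|a + (- d + b)| <= nu -> `|a - d| <= q + nu.
Proof.
move=> h1 h2; have -> : a - d = (a + (- d + b)) - b by ring.
by apply: (le_trans (ler_normB _ _)); rewrite addrC; exact: lerD.
Qed.

Lemma norm_recombine (y z p q t : R) : `|y| <= t * p -> `|z - y| <= t * q -> `|z| <= t * (p + q).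
Proof.
move=> h1 h2; rewrite mulrDr -[z](subrK y) addrC.
by apply: (le_trans (ler_normD _ _)); exact: lerD.
Qed.

Lemma energy_combine (a p q r d nu : R) : 0 < d -> `|a - d / 2 * p| <= nu / 4 * d ->
  `|a - d / 2 * (p + 2 * r + q)| <= nu / 4 * d -> `|q + 2 * r| <= nu.
Proof.
move=> d0 h1 h2; have h : `|d / 2 * (q + 2 * r)| <= d / 2 * nu.
  have -> : d / 2 * (q + 2 * r) = (a - d / 2 * p) - (a - d / 2 * (p + 2 * r + q)) by ring.
  apply: (le_trans (ler_normB _ _)); have -> : d / 2 * nu = nu / 4 * d + nu / 4 * d by field.
  exact: lerD.
by move: h; rewrite normrM gtr0_norm ?divr_gt0// ler_pM2l// divr_gt0.
Qed.

End BootstrapArithmetic.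

Section Perturbation.
Context {R : realType} {L s c c1 c2 : R} {m : R -> 'M[R]_2} {G : 'cV[R]_2 -> R}.
Context {phi : R -> 'cV[R]_2} {A : 'cV[R]_2}.
Context (L0 : 0 < L) (s0 : 0 < s) (c10 : 0 < c1) (c20 : 0 < c2).
Context (adm : admissible_symbol s c1 c2 m) (GC2 : class_C2 G) (sphi : smooth_periodic L phi).
Context (Xphi : Xspace L s phi).
Notation mu := (@lebesgue_measure R).
Local Notation I L f := (\int[mu]_(x in `[0, L]) f x).
Local Notation X := (Xspace L s).
Local Notation N := (Xnorm L s).
Local Notation xd := (xdot (L := L) (s := s)).
Local Notation l := (Lform L c m G phi).
Local Notation test := (test_function (L := L) (s := s)).
Local Notation act := (action (L := L) (c := c) (m := m) (G := G) (A := A)).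
Local Notation flow_flux := (flux (L := L) (m := m) (G := G)).
Implicit Types (u v w h psi eta : R -> 'cV[R]_2).
Let sX : subspace X := X_subspace L0 s0.
Let sL : subspace (L2per L) := L2per_subspace (L := L).
Let bL := L2dot_bilin (L := L).
Let bl : bilin X l := Lform_bilin L0 s0 c10 c20 adm GC2 sphi.
Context (g w0 : R -> 'cV[R]_2) (tg : test g) (Xw0 : X w0) (lw0 : forall v, X v -> l w0 v = L2dot L g v).
Context (e nu K B Cl : R) (e0 : 0 < e) (U : R -> R -> 'cV[R]_2) (sU : solution L s m G U).
Context (U0 : U 0 = phi + e *: w0).

(** The error terms depend on a test function through these sizes only. *)
Definition tame b psi := [/\ test psi, (forall i x, `|component (x_deriv psi) i x| <= b),
  N (x_deriv psi) <= b & `|L2dot L (x_deriv g) psi| <= b].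

Context (Cl0 : 0 <= Cl) (Hl : forall u v, X u -> X v -> `|l u v| <= Cl * (N u * N v)).
Context (flin : forall eta psi, X eta -> xd eta eta <= K -> tame B psi ->
  `|e^-1 * flow_flux (phi + e *: eta) psi + l eta (x_deriv psi)| <= nu).
Context (alin : forall eta, X eta -> xd eta eta <= K ->
  `|act (phi + e *: eta) - act phi - e ^+ 2 / 2 * l eta eta| <= nu / 4 * e ^+ 2).
Context (act_cons : forall t, act (U t) = act (U 0)).

Definition response t := e^-1 *: (U t - U 0).
Local Notation zeta := response.

Let XU t : X (U t). Proof. by case: sU. Qed.

Lemma response_X t : X (zeta t).
Proof. exact: (subspaceZ _ sX (subspaceB sX (XU t) (XU 0))). Qed.

Lemma response_state t : U t = phi + e *: (w0 + zeta t).
Proof.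
rewrite scalerDr addrA -U0 /zeta scalerA divff ?gt_eqF// scale1r.
by rewrite addrC subrK.
Qed.

(** Conservation of the action between time 0 and time t, at second order in e. *)
Lemma response_energy t : xd w0 w0 <= K -> xd (w0 + zeta t) (w0 + zeta t) <= K ->
  `|l (zeta t) (zeta t) + 2 * L2dot L g (zeta t)| <= nu.
Proof.
move=> h0 ht; have Xz := response_X t; have Xe := subspaceD sX Xw0 Xz.
have a0 := alin Xw0 h0; have a1 := alin Xe ht.
rewrite -U0 in a0; rewrite -response_state act_cons (bilin_sqD sX bl Xw0 Xz) (lw0 Xz) in a1.
have e2 : 0 < e ^+ 2 by rewrite exprn_gt0.
exact: energy_combine e2 a0 a1.
Qed.

Lemma response_derive psi t : test psi ->
  is_derive t (1 : R) (fun t => L2dot L (zeta t) psi) (e^-1 * flow_flux (U t) psi).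
Proof.
move=> [sp Xp _]; have lp := X_L2 Xp; have [_ _ _ wU] := sU; have D := wU psi sp t.
have -> : (fun t => L2dot L (zeta t) psi) = (fun t => e^-1 *: (L2dot L (U t) psi - cst (L2dot L (U 0) psi) t)).
  apply: funext => r; rewrite /zeta (bilinZl sL bL _ (subspaceB sL (X_L2 (XU r)) (X_L2 (XU 0))) lp).
  by rewrite (bilinBl bL (X_L2 (XU r)) (X_L2 (XU 0)) lp).
apply: is_derive_eq (is_deriveZ e^-1 (is_deriveB D (is_derive_cst _ _ _))) _.
by rewrite subr0.
Qed.

Lemma response_zero : zeta 0 = 0.
Proof. by rewrite /zeta subrr scaler0. Qed.

(** The equation tested with [psi]: the forcing contributes [<g', psi>], and the
response itself acts back through [l]. *)
Lemma response_rate psi t k : tame B psi -> 0 <= t ->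
  (forall r, 0 <= r <= t -> xd (w0 + zeta r) (w0 + zeta r) <= K /\ N (zeta r) <= k) ->
  `|L2dot L (zeta t) psi - t * L2dot L (x_deriv g) psi| <= t * (Cl * k * B + nu).
Proof.
move=> tp t0 H; have [tt _ hN _] := tp; have [sp Xp Xd] := tt; have [sg Xg _] := tg.
have cz : {within `[0, t], continuous (fun t => L2dot L (zeta t) psi)}.
  apply: continuous_subspaceT; apply: derivable_continuous_fun => r.
  exact: (@ex_derive _ _ _ _ _ _ _ (response_derive r tt)).
have [r rt] := MVT_segment t0 (fun r _ => response_derive r tt) cz.
have z0 : L2dot L (zeta 0) psi = 0 by rewrite response_zero (bilin0l sL bL (X_L2 Xp)).
rewrite z0 !subr0 => ->; rewrite in_itv/= in rt; have [h1 h2] := H r rt.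
rewrite mulrC -mulrBr normrM (ger0_norm t0); apply: ler_wpM2l => //.
have Xz := response_X r; have := flin (subspaceD sX Xw0 Xz) h1 tp; rewrite -response_state.
rewrite (bilinDl bl Xw0 Xz Xd) (lw0 Xd) (L2dot_by_parts L0 sg sp).
have lz : `|l (zeta r) (x_deriv psi)| <= Cl * k * B.
  apply: (le_trans (Hl Xz Xd)); rewrite -mulrA; apply: ler_wpM2l => //.
  by apply: ler_pM => //; exact: Xnorm_ge0.
exact: rate_combine lz.
Qed.

Lemma response_continuous t (eps : R) : 0 < eps ->
  exists2 d : R, 0 < d & forall r, `|r - t| < d -> `|N (zeta r) - N (zeta t)| < eps.
Proof.
move=> eps0; have ee : 0 < eps * e by rewrite mulr_gt0.
have [d d0 Hd] := solution_Xnorm_continuous L0 s0 t sU ee; exists d; first exact: d0.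
move=> r hr; have Xd := subspaceB sX (XU r) (XU t).
have := Hd r hr; rewrite -(Xnorm_lt L0 s0 ee Xd) => hN.
have zE : zeta r - zeta t = e^-1 *: (U r - U t).
  by rewrite /zeta -scalerBr; congr (_ *: _); rewrite opprB addrA subrK.
have dz : N (zeta r - zeta t) < eps.
  by rewrite zE (XnormZ L0 s0 _ Xd) gtr0_norm ?invr_gt0// mulrC ltr_pdivrMr.
have Xr := response_X r; have Xt := response_X t; have Xz := subspaceB sX Xr Xt.
have t1 := Xnorm_triangle L0 s0 Xz Xt; rewrite subrK in t1.
have Xz' : X (zeta t - zeta r) := subspaceB sX Xt Xr.
have t2 := Xnorm_triangle L0 s0 Xz' Xr; rewrite subrK -opprB (XnormN L0 s0 Xz) in t2.
move: dz t1 t2; move: (N (zeta r - zeta t)) (N (zeta r)) (N (zeta t)) => a b d' h1 h2 h3.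
by rewrite ltr_norml; apply/andP; split; lra.
Qed.

Lemma dot_delta (a : 'cV[R]_2) i : dot a (delta_mx i 0) = a i 0.
Proof.
rewrite /dot (bigD1 i)//= big1 => [|j ji]; first by rewrite mxE !eqxx mulr1 addr0.
by rewrite mxE (negPf ji) mulr0.
Qed.

Context (M : nat) (kap C D tau : R) (k0 : 0 < kap) (C0 : 0 <= C) (B0 : 0 <= B) (D0 : 0 < D).
Context (gard : forall u, X u -> kap * xd u u <= l u u + C * \sum_(n < M) dot (hcoef L u n) (hcoef L u n)).
Local Notation modes j := (wave L j./2 (delta_mx (inord (odd j)) 0)).
Context (tame_g : tame B g) (tame_modes : forall j, (j < M.*2)%N -> tame B (modes j)).
Context (tau0 : 0 < tau) (tau1 : tau <= 1) (Ctau : Cl * D * tau <= 1) (nuE : nu = tau ^+ 2).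
Context (big : 3 + C * (M.*2%:R * L ^- 2 * (2 * B + 1) ^+ 2) + 2 * (Cl * B) * D <= kap / 4 * D ^+ 2).
Context (KE : 2 * xd w0 w0 + 2 * D ^+ 2 <= K).

Lemma response_in_ball r : N (zeta r) <= D * tau -> xd (w0 + zeta r) (w0 + zeta r) <= K.
Proof.
have DT0 : 0 < D * tau by rewrite mulr_gt0.
move=> h; have Xz := response_X r; apply: le_trans KE.
apply: (le_trans (psd_sqD_le sX (xdot_bilin L0 s0) (xdot_psd L0 s0) Xw0 Xz)); rewrite lerD2l.
apply: ler_wpM2l => //; rewrite -(Xnorm_sqr L0 s0 Xz).
apply: (@le_trans _ _ ((D * tau) ^+ 2)); first by rewrite ler_pXn2r ?nnegrE ?Xnorm_ge0// ltW.
by rewrite exprMn ler_piMr ?sqr_ge0// expr_le1// ltW.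
Qed.

(** The action is conserved, so [l zeta zeta] is minus twice the pairing with g up to
a small error; that pairing and the low modes of zeta are driven by the equation
at rates proportional to the size of zeta and to one. By the inequality of Garding
the bound [D tau] on the norm improves itself for a suitable D. *)
Lemma response_bound t : 0 <= t <= tau -> N (zeta t) <= D * tau / 2.
Proof.
have DT0 : 0 < D * tau by rewrite mulr_gt0.
have w00 := xdot_psd L0 s0 Xw0; have inK := response_in_ball.
have w0K : xd w0 w0 <= K by apply: le_trans KE; have := sqr_ge0 D; move: w00; move: (xd w0 w0) (D ^+ 2) => p q; lra.
apply: (@bootstrap _ (fun t => N (zeta t)) (D * tau)); first by rewrite gtr_pMr// invf_lt1// ltr1n.
- exact: ltW.
- exact: response_continuous.
- by rewrite response_zero -(scale0r (0 : R -> 'cV[R]_2)) (XnormZ L0 s0 _ sX.1) normr0 mul0r ltW.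
move=> {}t /andP[t0 tt] H; have Xz := response_X t; have lz := X_L2 Xz.
have ht : N (zeta t) <= D * tau by apply: H; rewrite t0 lexx.
have H' r : 0 <= r <= t -> xd (w0 + zeta r) (w0 + zeta r) <= K /\ N (zeta r) <= D * tau.
  by move=> hr; split; [apply: inK|]; exact: H.
have b0 : 0 <= Cl * (D * tau) * B + nu.
  by rewrite nuE addr_ge0 ?sqr_ge0// mulr_ge0// mulr_ge0// ltW.
have rate psi : tame B psi -> `|L2dot L (zeta t) psi - t * L2dot L (x_deriv g) psi| <= tau * (Cl * (D * tau) * B + nu).
  by move=> tp; apply: (le_trans (response_rate tp t0 H')); apply: ler_wpM2r.
have en := response_energy w0K (inK t ht).
have gg : L2dot L (x_deriv g) g = 0.
  have [sg Xg Xdg] := tg; have := L2dot_by_parts L0 sg sg; rewrite (bilinC bL (X_L2 Xg) (X_L2 Xdg)).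
  by move: (L2dot L _ g) => p; lra.
have hg := rate g tame_g; rewrite gg mulr0 subr0 in hg.
have [_ Xg _] := tg; rewrite (bilinC bL lz (X_L2 Xg)) in hg.
have gz := gard Xz; rewrite -(Xnorm_sqr L0 s0 Xz) in gz.
rewrite nuE in en hg.
have S : \sum_(n < M) dot (hcoef L (zeta t) n) (hcoef L (zeta t) n) <=
   M.*2%:R * L ^- 2 * (tau * (B + (Cl * (D * tau) * B + tau ^+ 2))) ^+ 2.
  rewrite low_modes_sum -nuE; set b := tau * _.
  have bb : 0 <= b by rewrite /b; apply: mulr_ge0; [exact: ltW|exact: addr_ge0].
  apply: (@le_trans _ _ (\sum_(j < M.*2) L ^- 2 * b ^+ 2)); last first.
    by rewrite sumr_const card_ord -[leLHS]mulr_natl mulrA.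
  apply: ler_sum => j _; have tj := tame_modes (ltn_ord j).
  have E : hcoef L (zeta t) j./2 (inord (odd j)) 0 = L^-1 * L2dot L (zeta t) (modes j).
    by rewrite (L2dot_wave L0 _ _ lz) dot_delta mulKf// gt_eqF.
  rewrite E exprMn exprVn; apply: ler_wpM2l; first by rewrite invr_ge0 sqr_ge0.
  rewrite -[leLHS]real_normK ?num_real// ler_pXn2r ?nnegrE//.
  have h2 := rate _ tj; have [_ _ _ h] := tj.
  have h1 : `|t * L2dot L (x_deriv g) (modes j)| <= tau * B.
    by rewrite normrM (ger0_norm t0); apply: ler_pM.
  exact: norm_recombine h1 h2.
have M0 : 0 <= M.*2%:R * L ^- 2 by rewrite mulr_ge0 ?invr_ge0 ?sqr_ge0.
exact: (bootstrap_step k0 C0 B0 Cl0 D0 M0 tau0 tau1 Ctau (Xnorm_ge0 _) big gz en hg S).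
Qed.

End Perturbation.

Section StandingArithmetic.
Context {R : realType}.

Lemma frechet_combine (a e p q nu : R) : 0 < e -> `|a - e * p| <= nu / 2 * e ->
  `|a - e * (p + q)| <= nu / 2 * e -> `|q| <= nu.
Proof.
move=> e0 h1 h2; have h : `|e * q| <= e * nu.
  have -> : e * q = (a - e * p) - (a - e * (p + q)) by ring.
  apply: (le_trans (ler_normB _ _)); have -> : e * nu = nu / 2 * e + nu / 2 * e by field.
  exact: lerD.
by move: h; rewrite normrM gtr0_norm// ler_pM2l.
Qed.

Lemma rate_sq (C D B tau : R) : 0 < tau -> tau <= 1 ->
  tau * (C * (D * tau) * B + tau ^+ 2) <= (C * D * B + 1) * tau ^+ 2.
Proof.
move=> t0 t1; rewrite mulrDr [leRHS]mulrDl mul1r.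
have -> : tau * (C * (D * tau) * B) = C * D * B * tau ^+ 2 by ring.
by rewrite lerD2l ler_piMl ?sqr_ge0.
Qed.

Lemma derivative_le (y z fz C D e tau : R) : 0 < tau -> `|z - tau * y| <= C * tau ^+ 2 ->
  `|fz - z| <= e * (D * tau) -> `|fz| <= tau ^+ 2 -> `|y| <= (C + 1) * tau + e * D.
Proof.
move=> t0 h1 h2 h3; rewrite -(ler_pM2l t0) -[X in X * `|y|](gtr0_norm t0) -normrM.
have -> : tau * y = fz - (fz - z) - (z - tau * y) by ring.
apply: (le_trans (ler_normB _ _)); have -> : tau * ((C + 1) * tau + e * D) = tau ^+ 2 + e * (D * tau) + C * tau ^+ 2 by ring.
by apply: lerD h1; apply: (le_trans (ler_normB _ _)); exact: lerD.
Qed.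

Lemma sq3_le (a b d x p q r : R) : a ^+ 2 <= p * x -> b ^+ 2 <= q * x -> d ^+ 2 <= r * x ->
  (a - b - d) ^+ 2 <= 3 * (p + q + r) * x.
Proof.
move=> h1 h2 h3; have := sqr_ge0 (a + b); have := sqr_ge0 (a + d); have := sqr_ge0 (b - d).
have -> : (a - b - d) ^+ 2 = 3 * (a ^+ 2 + b ^+ 2 + d ^+ 2) - (a + b) ^+ 2 - (a + d) ^+ 2 - (b - d) ^+ 2 by ring.
rewrite -mulrA !mulrDl; move: h1 h2 h3; move: (_ ^+ 2) (_ ^+ 2) (_ ^+ 2) ((a + b) ^+ 2) ((a + d) ^+ 2) ((b - d) ^+ 2) (p * x) (q * x) (r * x) => *.
lra.
Qed.

Lemma sq_le_norm (x y : R) : `|x| <= y -> x ^+ 2 <= y ^+ 2.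
Proof.
move=> h; have y0 := le_trans (normr_ge0 x) h.
by rewrite -[leLHS]real_normK ?num_real// ler_pXn2r ?nnegrE.
Qed.

Lemma small_inv (a t : R) : 0 <= a -> 0 < t -> t < (a + 1)^-1 -> a * t <= 1.
Proof.
move=> a0 t0; have a1 : 0 < a + 1 by rewrite ltr_wpDl.
rewrite -(ltr_pM2r a1) mulVf ?gt_eqF// mulrDr mulr1 mulrC => h; apply: ltW; apply: lt_trans h.
by rewrite ltrDl.
Qed.

Lemma le_double_add (p q : R) : 0 <= p -> 0 <= q -> p <= 2 * p + 2 * q.
Proof. by move=> *; lra. Qed.

Lemma control_combine (a C e eta r d n0 n q0 q f0 fv : R) : 0 < d -> d <= 1 -> (C + `|a|) * d <= eta ->
  `|a| * r <= 2 * e -> 0 <= C -> 0 <= n0 -> n0 <= d -> 0 <= n -> n <= r -> `|f0| <= C * n0 ->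
  0 <= q0 -> q0 <= n0 ^+ 2 -> 0 <= q -> q <= n ^+ 2 ->
  fv = f0 + a / 2 * (q0 - q) -> `|fv| <= eta + e * n.
Proof.
move=> d0 d1 hd hr C0 n00 n0d nn0 nr hf q00 q0n qq0 qn ->.
have -> : f0 + a / 2 * (q0 - q) = f0 + 2^-1 * (a * q0) - 2^-1 * (a * q) by field.
apply: (le_trans (ler_normB _ _)); apply: lerD.
  apply: (le_trans _ hd); apply: (le_trans (ler_normD _ _)); rewrite mulrDl; apply: lerD.
    by apply: (le_trans hf); exact: ler_wpM2l.
  rewrite !normrM (ger0_norm q00) gtr0_norm ?invr_gt0//.
  apply: (@le_trans _ _ (`|a| * q0)); first by rewrite ler_piMl ?mulr_ge0// invf_le1// ler1n.
  apply: ler_wpM2l => //; apply: (le_trans q0n); apply: (le_trans _ n0d); rewrite expr2 ler_piMl//.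
  exact: le_trans n0d d1.
rewrite !normrM (ger0_norm qq0) gtr0_norm ?invr_gt0// ler_pdivrMl// mulrA.
apply: (@le_trans _ _ (`|a| * r * n)); last exact: ler_wpM2r.
rewrite -mulrA; apply: ler_wpM2l => //; apply: (le_trans qn); rewrite expr2; exact: ler_wpM2r.
Qed.

End StandingArithmetic.

Section StandingWave.
Context {R : realType} {L s c c1 c2 : R} {m : R -> 'M[R]_2} {G : 'cV[R]_2 -> R}.
Context {phi : R -> 'cV[R]_2} {A : 'cV[R]_2}.
Context (L0 : 0 < L) (s0 : 0 < s) (c10 : 0 < c1) (c20 : 0 < c2).
Context (adm : admissible_symbol s c1 c2 m) (GC2 : class_C2 G) (sphi : smooth_periodic L phi).
Context (phi_eq : profile_equation L c A m G phi) (wp : globally_well_posed L s m G).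
Context (E_def : energy_defined L s G) (c0 : c = 0).
Context (E_cons : conserved L s m G (energy L m G)) (F_cons : conserved L s m G (momentum L)).
Context (H1 : hypothesis_H1 L s c m G phi).
Local Notation X := (Xspace L s).
Local Notation N := (Xnorm L s).
Local Notation xd := (xdot (L := L) (s := s)).
Local Notation l := (Lform L c m G phi).
Local Notation test := (test_function (L := L) (s := s)).
Local Notation cst v := ((fun=> v) : R -> 'cV[R]_2).
Implicit Types (u v w h psi eta g : R -> 'cV[R]_2) (U V : R -> R -> 'cV[R]_2).
Let sX : subspace X := X_subspace L0 s0.
Let sL : subspace (L2per L) := L2per_subspace (L := L).
Let bL := L2dot_bilin (L := L).
Let pL : psd (L2per L) (L2dot L) := fun u => @L2dot_psd R L u.
Let pX : psd X xd := xdot_psd L0 s0.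
Let Xphi : X phi := profile_X L0 s0 c10 adm phi_eq.
Let lphi : L2per L phi := X_L2 Xphi.
Let N0 u : 0 <= N u := Xnorm_ge0 u.

Context (Q f : (R -> 'cV[R]_2) -> R).
Context (Qc : conserved L s m G Q) (Qf : frechet_derivative L s Q phi f).
Let lf : linf X f. Proof. by case: Qf. Qed.

Local Notation tame := (tame (L := L) (s := s)).

Lemma tame_mono g b b' psi : b <= b' -> tame g b psi -> tame g b' psi.
Proof.
move=> bb [tp h1 h2 h3]; split=> [//|i x||].
- exact: le_trans (h1 i x) bb.
- exact: le_trans h2 bb.
- exact: le_trans h3 bb.
Qed.

Lemma tame_exists g psi : test psi -> exists2 b : R, 0 <= b & tame g b psi.
Proof.
move=> tp; have [sp Xp Xd] := tp; have sd := smooth_x_deriv sp.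
have [M0 M00 H0] := smooth_component_bounded L0 0 sd.
have [M1 M10 H1'] := smooth_component_bounded L0 1 sd.
have n0 := N0 (x_deriv psi); have q0 := normr_ge0 (L2dot L (x_deriv g) psi).
exists (M0 + M1 + N (x_deriv psi) + `|L2dot L (x_deriv g) psi|); first by rewrite !addr_ge0.
have M01 : 0 <= M0 + M1 by rewrite addr_ge0.
split=> [//|i x||].
- apply: (@le_trans _ _ (M0 + M1)); last by rewrite -addrA lerDl addr_ge0.
  case: i => [[|[|//]]] hi; [rewrite (_ : Ordinal hi = 0)|rewrite (_ : Ordinal hi = 1)]; try exact/val_inj.
    by apply: (le_trans (H0 _)); rewrite lerDl.
  by apply: (le_trans (H1' _)); rewrite lerDr.
- by rewrite -addrA; apply: ler_wpDl M01 _; rewrite lerDl.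
- by rewrite lerDr addr_ge0.
Qed.

Lemma tame_family g (F : nat -> R -> 'cV[R]_2) M : (forall j, test (F j)) ->
  exists2 b : R, 0 <= b & forall j, (j < M)%N -> tame g b (F j).
Proof.
move=> tF; elim: M => [|M [b b0 Hb]]; first by exists 0.
have [b' b'0 Hb'] := tame_exists g (tF M).
exists (b + b'); first exact: addr_ge0.
move=> j; rewrite ltnS leq_eqVlt => /orP[/eqP ->|jM].
  by apply: tame_mono Hb'; rewrite lerDr.
by apply: (tame_mono _ (Hb j jM)); rewrite lerDl.
Qed.

Lemma functional_bound : exists2 D : R, 0 <= D & forall v, X v -> f v ^+ 2 <= D * xd v v.
Proof.
have [_ [C HC] _] := Qf; exists (C ^+ 2); first exact: sqr_ge0.
move=> v Xv; rewrite -(Xnorm_sqr L0 s0 Xv) -exprMn; exact: sq_le_norm (HC v Xv).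
Qed.

(** Perturbing the wave by [e w], where [l w] is the pairing with [g], makes the
solution drift by [e t g'] to first order in [t]: the flow linearised at a
standing wave is the x-derivative of the linearised operator. *)
Lemma standing_response g : test g -> L2dot L phi (x_deriv g) = 0 -> exists2 D : R, 0 < D &
  forall psi, test psi -> exists C tau0 : R, 0 < tau0 /\ forall tau, 0 < tau -> tau < tau0 ->
  exists z, [/\ X z, N z <= D * tau, `|f z| <= tau ^+ 2 &
    `|L2dot L z psi - tau * L2dot L (x_deriv g) psi| <= C * tau ^+ 2].
Proof.
move=> tg pg; have [sg Xg Xg'] := tg; have lg := X_L2 Xg.
have [Cl Cl0 Hl] := Lform_continuous (c := c) L0 s0 c10 c20 adm GC2 sphi.
have [kap [C [M [k0 C0 gard]]]] := Lform_garding_low (c := c) L0 s0 c10 c20 adm GC2 sphi.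
have [B1 B10 HB1] := tame_family g M.*2 (fun j => test_wave L0 s0 j./2 (delta_mx (inord (odd j)) 0)).
have [B2 B20 HB2] := tame_exists g tg.
pose B := B1 + B2; have B0 : 0 <= B := addr_ge0 B10 B20.
have tG : tame g B g by apply: tame_mono HB2; rewrite lerDr.
have tM j : (j < M.*2)%N -> tame g B (wave L j./2 (delta_mx (inord (odd j)) 0)).
  by move=> jM; apply: (tame_mono _ (HB1 j jM)); rewrite lerDl.
have E0 : 0 <= 3 + C * (M.*2%:R * L ^- 2 * (2 * B + 1) ^+ 2).
  apply: addr_ge0 => //; apply: (mulr_ge0 C0); apply: mulr_ge0; last exact: sqr_ge0.
  by apply: mulr_ge0 => //; rewrite invr_ge0 sqr_ge0.
have [D D0 big] := bootstrap_constant k0 E0 (mulr_ge0 Cl0 B0).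
exists D => // psi tp; have [B3 B30 HB3] := tame_exists g tp.
pose B' := B + B3; have B'0 : 0 <= B' := addr_ge0 B0 B30.
have tpsi : tame g B' psi by apply: tame_mono HB3; rewrite lerDr.
have BB' : B <= B' by rewrite lerDl.
have CD1 : 0 < Cl * D + 1 by rewrite ltr_wpDl// mulr_ge0// ltW.
exists (Cl * D * B' + 1), (Num.min 1 (Cl * D + 1)^-1).
split; first by rewrite lt_min ltr01 invr_gt0.
move=> tau tau0; rewrite lt_min => /andP[/ltW tau1 tauC].
have Ctau : Cl * D * tau <= 1 := small_inv (mulr_ge0 Cl0 (ltW D0)) tau0 tauC.
have glin : linf X (L2dot L g) := linfS (@X_L2 R L s) (bilin_linr sL bL lg).
have gb v : X v -> L2dot L g v ^+ 2 <= L2dot L g g * xd v v.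
  move=> Xv; apply: (le_trans (psd_CS sL bL pL lg (X_L2 Xv))).
  by apply: ler_wpM2l; [exact: pL|exact: (L2dot_le_xdot L0 s0 Xv)].
have gphi : L2dot L g (x_deriv phi) = 0.
  by rewrite (L2dot_by_parts L0 sg sphi) (bilinC bL (X_L2 Xg') lphi) pg oppr0.
have [w Xw Hw] := solve_linearized L0 s0 c10 c20 adm GC2 sphi H1 glin (pL lg) gb gphi.
pose K := 2 * xd w w + 2 * D ^+ 2.
have K0 : 0 <= K by rewrite /K addr_ge0// mulr_ge0 ?sqr_ge0//; exact: pX.
have nu0 : 0 < tau ^+ 2 by rewrite exprn_gt0.
have nu4 : 0 < tau ^+ 2 / 4 by rewrite divr_gt0.
have nu2 : 0 < tau ^+ 2 / 2 by rewrite divr_gt0.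
have [e1 e10 F1] := flux_linearization L0 s0 c10 c20 adm GC2 sphi phi_eq wp c0 B'0 K0 nu0.
have [e2 e20 F2] := action_linearization L0 s0 c10 c20 adm GC2 sphi phi_eq E_def K0 nu4.
have [e3 e30 F3] := frechet_linearization L0 s0 Qf K0 nu2.
pose e := Num.min e1 (Num.min e2 e3) / 2.
have em : 0 < Num.min e1 (Num.min e2 e3) by rewrite !lt_min e10 e20 e30.
have e0 : 0 < e by rewrite divr_gt0.
have [l1 l2 l3] : [/\ e < e1, e < e2 & e < e3].
  have : e < Num.min e1 (Num.min e2 e3) by rewrite /e gtr_pMr// invf_lt1// ltr1n.
  by rewrite !lt_min => /and3P.
have [ex _ _] := wp.
have [U sU EU] := ex _ (subspaceD sX Xphi (subspaceZ e sX Xw)).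
have [XU _ _ _] := sU.
pose w0 := e^-1 *: (U 0 - phi).
have Xw0 : X w0 := subspaceZ _ sX (subspaceB sX (XU 0) Xphi).
have U0 : U 0 = phi + e *: w0.
  by rewrite /w0 scalerA divff ?gt_eqF// scale1r addrC subrK.
have ae0 : ae_equal w0 w.
  apply: aeS EU => x Ex; rewrite -[w0 x]/(e^-1 *: (U 0 x - phi x)) Ex -[(phi + e *: w) x]/(phi x + e *: w x).
  by rewrite addrAC subrr add0r scalerA mulVf ?gt_eqF// scale1r.
have lw0 v : X v -> l w0 v = L2dot L g v.
  by move=> Xv; rewrite (Lform_ae L0 s0 c10 c20 adm GC2 sphi Xw0 Xw Xv ae0) Hw.
have xw0 : xd w0 w0 = xd w w.
  by rewrite -(Xnorm_sqr L0 s0 Xw0) (Xnorm_ae L0 (X_L2 Xw0) (X_L2 Xw) ae0) (Xnorm_sqr L0 s0 Xw).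
have KE : 2 * xd w0 w0 + 2 * D ^+ 2 <= K by rewrite xw0.
have ac t := action_conserved (c := c) (A := A) L0 s0 c10 c20 adm E_cons F_cons t sU.
have flin' eta psi' : X eta -> xd eta eta <= K -> tame g B' psi' ->
  `|e^-1 * flux (L := L) (m := m) (G := G) (phi + e *: eta) psi' + l eta (x_deriv psi')| <= tau ^+ 2.
  by move=> Xe he [tp' hp _ _]; exact: F1.
have flin eta psi' : X eta -> xd eta eta <= K -> tame g B psi' ->
  `|e^-1 * flux (L := L) (m := m) (G := G) (phi + e *: eta) psi' + l eta (x_deriv psi')| <= tau ^+ 2.
  by move=> Xe he tp'; exact: (flin' _ _ Xe he (tame_mono BB' tp')).
have alin eta : X eta -> xd eta eta <= K -> `|action (L := L) (c := c) (m := m) (G := G) (A := A) (phi + e *: eta) -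
   action (L := L) (c := c) (m := m) (G := G) (A := A) phi - e ^+ 2 / 2 * l eta eta| <= tau ^+ 2 / 4 * e ^+ 2.
  by move=> Xe he; exact: F2.
have bound r : 0 <= r <= tau -> N (response e U r) <= D * tau / 2.
  exact: (response_bound L0 s0 c10 c20 adm GC2 sphi tg Xw0 lw0 e0 sU U0 Cl0 Hl flin alin ac k0 C0 B0 D0 gard tG tM tau0 tau1 Ctau erefl big KE).
have DT : D * tau / 2 <= D * tau by apply: ler_piMr; [exact: mulr_ge0 (ltW D0) (ltW tau0)|rewrite invf_le1// ler1n].
have bound' r : 0 <= r <= tau -> N (response e U r) <= D * tau.
  by move=> hr; exact: le_trans (bound r hr) DT.
have inK r : 0 <= r <= tau -> xd (w0 + response e U r) (w0 + response e U r) <= K.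
  by move=> hr; apply: (response_in_ball L0 s0 Xw0 sU D0 tau0 tau1 KE); exact: bound'.
have tt : 0 <= tau <= tau by rewrite (ltW tau0) lexx.
have Xz := response_X L0 s0 e sU tau.
exists (response e U tau); split; [exact: Xz|exact: (bound' tau tt)| |].
  have w0K : xd w0 w0 <= K.
    rewrite xw0; exact: (le_double_add (pX Xw) (sqr_ge0 D)).
  have := F3 e _ e0 l3 Xw0 w0K; have := F3 e _ e0 l3 (subspaceD sX Xw0 Xz) (inK _ tt).
  rewrite -(response_state e0 U0) -U0 (Qc sU tau) (linfD lf Xw0 Xz) => h2 h1.
  exact: frechet_combine e0 h1 h2.
apply: (le_trans _ (rate_sq Cl D B' tau0 tau1)).
apply: (response_rate L0 s0 c10 c20 adm GC2 sphi tg Xw0 lw0 e0 sU U0 Cl0 Hl flin' tpsi (ltW tau0)).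
by move=> r hr; split; [exact: inK|exact: bound'].
Qed.

(** The response at time tau is tau g' up to tau^2 in every smooth direction, and f is
of size tau^2 on it; f is approximated by smooth directions. *)
Lemma standing_annihilates g : test g -> L2dot L phi (x_deriv g) = 0 -> f (x_deriv g) = 0.
Proof.
move=> tg pg; have [_ _ Xg'] := tg; have [D D0 HD] := standing_response tg pg.
have [Df Df0 Hf] := functional_bound.
apply/eqP; rewrite -normr_le0; apply/ler_addgt0Pl => eps eps0; rewrite addr0.
pose T := 1 + D + N (x_deriv g); have T0 : 0 < T by rewrite ltr_wpDr// ltr_wpDr// ltW.
pose e := eps / T; have ee : 0 < e by rewrite divr_gt0.
have [psi tp Hpsi] := functional_approx L0 s0 lf Df0 Hf (exprn_gt0 2 ee).
have ap z : X z -> `|f z - L2dot L z psi| <= e * N z.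
  move=> Xz; apply: norm_le_of_sq; first by rewrite mulr_ge0// ltW.
  by rewrite exprMn (Xnorm_sqr L0 s0 Xz); exact: Hpsi.
have [C [tau0 [t0 Htau]]] := HD psi tp.
have C1 : 0 < `|C + 1| + 1 by rewrite ltr_wpDl.
pose tau := Num.min tau0 (e / (`|C + 1| + 1)) / 2.
have m0 : 0 < Num.min tau0 (e / (`|C + 1| + 1)) by rewrite lt_min t0 divr_gt0.
have tp0 : 0 < tau by rewrite divr_gt0.
have : tau < Num.min tau0 (e / (`|C + 1| + 1)) by rewrite /tau gtr_pMr// invf_lt1// ltr1n.
rewrite lt_min => /andP[tt0]; rewrite ltr_pdivlMr// => tC.
have [z [Xz hz fz rz]] := Htau tau tp0 tt0.
have az : `|f z - L2dot L z psi| <= e * (D * tau).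
  by apply: (le_trans (ap z Xz)); apply: ler_wpM2l => //; exact: ltW.
have := derivative_le tp0 rz az fz.
have Ce : (C + 1) * tau <= e.
  apply: le_trans (ltW tC); rewrite mulrC; apply: ler_wpM2l; first exact: ltW.
  by apply: (le_trans (ler_norm _)); rewrite lerDl.
have := ap _ Xg'; have := N0 (x_deriv g); move: (f (x_deriv g)) (L2dot L (x_deriv g) psi) => p q n0 h1 h2.
have -> : eps = e + e * D + e * N (x_deriv g) by rewrite /e /T; field; rewrite gt_eqF.
rewrite -[p](subrK q) addrC; apply: (le_trans (ler_normD _ _)); apply: lerD h1.
by apply: (le_trans h2); rewrite lerD2r.
Qed.

Lemma wave_lin n (x : R) (a b : 'cV[R]_2) : wave L n (x *: a + b) = x *: wave L n a + wave L n b.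
Proof.
apply: funext => z; rewrite -[RHS]/(x *: (cas L (zint n) z *: a) + cas L (zint n) z *: b).
by rewrite /wave scalerDr !scalerA mulrC.
Qed.

Lemma functional_on_derivatives : exists a : R, forall n al,
  f (x_deriv (wave L n al)) = a * L2dot L phi (x_deriv (wave L n al)).
Proof.
have [[n0 [al0 h0]]|none] := pselect (exists n0 al0, L2dot L phi (x_deriv (wave L n0 al0)) != 0); last first.
  exists 0 => n al; rewrite mul0r; apply: standing_annihilates; first exact: test_wave.
  by apply/eqP; apply/negPn/negP => h; apply: none; exists n, al.
have t0 := test_wave L0 s0 n0 al0; have [sg0 Xg0 X0] := t0.
set p0 := L2dot L phi _ in h0; exists (f (x_deriv (wave L n0 al0)) / p0) => n al.
have t1 := test_wave L0 s0 n al; have [sg1 Xg1 X1] := t1.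
pose r := L2dot L phi (x_deriv (wave L n al)) / p0.
have tg := test_lin L0 s0 (- r) t0 t1.
have dE := x_deriv_lin (- r) sg0 sg1.
have pg : L2dot L phi (x_deriv (- r *: wave L n0 al0 + wave L n al)) = 0.
  have X0' := subspaceZ (- r) sX X0.
  rewrite dE (bilinDr sL bL (X_L2 X0') (X_L2 X1) lphi) (bilinZr sL bL _ (X_L2 X0) lphi) -/p0.
  by rewrite /r mulNr divfK// addNr.
have := standing_annihilates tg pg; rewrite dE (lf _ X0 X1) => /eqP.
rewrite mulNr addrC subr_eq0 => /eqP ->; rewrite /r.
by rewrite -mulrA [RHS]mulrC; congr (_ * _); rewrite mulrC.
Qed.

(** On the zero-mean part of the energy space the functional is a multiple of
the derivative of the momentum, hence altogether the derivative at the wave of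
a combination of the momentum and of the component masses. *)
Lemma functional_form : exists (a : R) (b : 'cV[R]_2), forall v, X v ->
  f v = a * L2dot L phi v + L2dot L (cst b) v.
Proof.
have [a Ha] := functional_on_derivatives.
have Hpos n al : (0 < n)%N -> f (wave L n al) = a * L2dot L phi (wave L n al).
  move=> n0; have [k Ek] := zint_surj (- zint n).
  have kn : (zint k)%:~R != 0 :> R.
    rewrite intr_eq0 Ek oppr_eq0; apply/eqP => E.
    have E' : n = 0%N by case: (n) E => [|[|j]]; rewrite /zint//=; case: ifP.
    by rewrite E' in n0.
  pose q : R := 2 * pi * (zint k)%:~R / L.
  have q0 : q != 0.
    apply: mulf_neq0; last by rewrite invr_eq0 gt_eqF.
    by apply: mulf_neq0 kn; apply: mulf_neq0; [rewrite pnatr_eq0|rewrite gt_eqF// pi_gt0].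
  have E : zint n = - zint k by rewrite Ek opprK.
  have := Ha k (q^-1 *: al); rewrite (x_deriv_wave _ E) -/q scalerA mulfV// scale1r.
  by [].
pose D0 al := f (wave L 0 al) - a * L2dot L phi (wave L 0 al).
pose b : 'cV[R]_2 := \col_i (L^-1 * D0 (delta_mx i 0)).
have lb := L2per_cst (L := L) b.
have Xw n al : X (wave L n al) := wave_X L0 s0 n al.
have lw n al := X_L2 (Xw n al).
have bE : cst b = wave L 0 b.
  by apply: funext => x; rewrite /wave /cas phase0 cos0 sin0 addr0 scale1r.
have bw n al : L2dot L (cst b) (wave L n al) = L * ((n == 0)%N%:R * dot b al).
  rewrite (L2dot_wave L0 n al lb) bE (hcoef_wave L0); congr (_ * _).
  by rewrite -[_ *: b]addr0 dot_lin dot0l addr0.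
have D0lin (x : R) p q : D0 (x *: p + q) = x * D0 p + D0 q.
  have Xxp := subspaceZ x sX (Xw 0%N p).
  rewrite /D0 wave_lin (lf _ (Xw _ p) (Xw _ q)) (bilinDr sL bL (X_L2 Xxp) (lw _ q) lphi).
  rewrite (bilinZr sL bL _ (lw _ p) lphi).
  by move: (f _) (f _) (L2dot _ _ _) (L2dot _ _ _) => *; ring.
pose h v := f v - a * L2dot L phi v - L2dot L (cst b) v.
have lh : linf X h.
  move=> x u v Xu Xv; have Xxu := subspaceZ x sX Xu; rewrite /h (lf _ Xu Xv).
  rewrite !(bilinDr sL bL (X_L2 Xxu) (X_L2 Xv))// !(bilinZr sL bL _ (X_L2 Xu))//.
  by move: (f _) (f _) (L2dot _ phi _) (L2dot _ phi _) (L2dot L (cst b) u) (L2dot L (cst b) v) => *; ring.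
have hw n al : h (wave L n al) = 0.
  rewrite /h bw; case: n => [|n]; last by rewrite mul0r mulr0 subr0 Hpos// subrr.
  rewrite eqxx mul1r -/(D0 al).
  have -> : D0 al = al 0 0 * D0 (delta_mx 0 0) + al 1 0 * D0 (delta_mx 1 0).
    have Z : D0 0 = 0 by have := D0lin 1 0 0; rewrite scaler0 addr0 mul1r => /esym/eqP; rewrite -subr_eq0 addrK => /eqP.
    rewrite [in LHS](vec2E al) D0lin -[al 1 0 *: _]addr0 D0lin Z addr0.
    by [].
  rewrite /dot sum2 !mxE; move: (D0 _) (D0 _) (al 0 0) (al 1 0) => p q x y.
  by apply/eqP; rewrite subr_eq0; apply/eqP; field; rewrite gt_eqF.
have [Df Df0 Hf] := functional_bound.
have hb v : X v -> h v ^+ 2 <= 3 * (Df + a ^+ 2 * L2dot L phi phi + L2dot L (cst b) (cst b)) * xd v v.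
  move=> Xv; have lv := X_L2 Xv; apply: sq3_le; first exact: Hf.
    rewrite exprMn -mulrA; apply: ler_wpM2l; first exact: sqr_ge0.
    apply: (le_trans (psd_CS sL bL pL lphi lv)); apply: ler_wpM2l; first exact: pL.
    exact: (L2dot_le_xdot L0 s0 Xv).
  apply: (le_trans (psd_CS sL bL pL lb lv)); apply: ler_wpM2l; first exact: pL.
  exact: (L2dot_le_xdot L0 s0 Xv).
exists a, b => v Xv; have -> : f v = h v + (a * L2dot L phi v + L2dot L (cst b) v).
  by rewrite /h -(addrA (f v)) -opprD subrK.
suff -> : h v = 0 by rewrite add0r.
apply: (@closed_sq_le _ _ (3 * (Df + a ^+ 2 * L2dot L phi phi + L2dot L (cst b) (cst b)))) => e e0.
have [M HM] := low_dense L0 s0 Xv e0; have Xl := low_X L0 s0 M v.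
have Xd := subspaceB sX Xv Xl.
have -> : h v = h (v - low L M v).
  rewrite (linfB lh Xv Xl) /low (linf_sum sX lh) => [|n]; last by apply: wave_X.
  by rewrite big1 ?subr0// => n _; exact: hw.
apply: (le_trans (hb _ Xd)); apply: ler_wpM2l => //.
by rewrite mulr_ge0// addr_ge0 ?pL// addr_ge0// mulr_ge0 ?sqr_ge0 ?pL.
Qed.

(** The combination of conserved quantities is quadratic, and its second-order part is
negligible near the wave. *)
Lemma controlled_standing : controlled (L := L) (s := s) (m := m) (G := G) (phi := phi) f.
Proof.
have [a [b Hab]] := functional_form.
have [_ [C HC] _] := Qf.
have lb := L2per_cst (L := L) b.
have idn u : X u -> f (u - phi) = a / 2 * L2dot L u u + L2dot L (cst b) u -
  (a / 2 * L2dot L phi phi + L2dot L (cst b) phi) - a / 2 * L2dot L (u - phi) (u - phi).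
  move=> Xu; have lu := X_L2 Xu; rewrite (Hab _ (subspaceB sX Xu Xphi)).
  rewrite (bilinBr sL bL lu lphi lphi) (bilinBr sL bL lu lphi lb) (bilin_sqB sL bL lu lphi) (bilinC bL lphi lu).
  by move: (L2dot L u u) (L2dot L u phi) (L2dot L phi phi) (L2dot L _ _) (L2dot L _ _) => *; field.
move=> e e0; have a1 : 0 < `|a| + 1 by rewrite ltr_wpDl.
exists (2 * e / (`|a| + 1)); first by rewrite divr_gt0// mulr_gt0.
move=> eta eta0; have C1 : 0 < `|C| + `|a| + 1 by rewrite ltr_wpDl// addr_ge0.
have d0 : 0 < Num.min 1 (eta / (`|C| + `|a| + 1)) by rewrite lt_min ltr01 divr_gt0.
exists (Num.min 1 (eta / (`|C| + `|a| + 1))); first exact: d0.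
move=> U sU h0 t y hv; have [XU _ _ _] := sU.
have XT := translate_X L0 y (XU t); have lT := X_L2 XT; have lU r := X_L2 (XU r).
have X0 := subspaceB sX (XU 0) Xphi; have Xv := subspaceB sX XT Xphi.
have q0 : L2dot L (U 0 - phi) (U 0 - phi) <= N (U 0 - phi) ^+ 2.
  by rewrite (Xnorm_sqr L0 s0 X0); exact: (L2dot_le_xdot L0 s0 X0).
have qv : L2dot L (translate y (U t) - phi) (translate y (U t) - phi) <= N (translate y (U t) - phi) ^+ 2.
  by rewrite (Xnorm_sqr L0 s0 Xv); exact: (L2dot_le_xdot L0 s0 Xv).
have E : f (translate y (U t) - phi) = f (U 0 - phi) +
   a / 2 * (L2dot L (U 0 - phi) (U 0 - phi) - L2dot L (translate y (U t) - phi) (translate y (U t) - phi)).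
  rewrite (idn _ XT) (idn _ (XU 0)) (L2dot_translate L0 y (lU t) (lU t)).
  have -> : L2dot L (U t) (U t) = L2dot L (U 0) (U 0).
    by have := F_cons sU t; rewrite /momentum => /mulfI; apply; rewrite invr_eq0 pnatr_eq0.
  have -> : L2dot L (cst b) (translate y (U t)) = L2dot L (cst b) (U 0).
    rewrite -[cst b]/(translate y (cst b)) (L2dot_translate L0 y lb (lU t)).
    by rewrite !(bilinC bL lb (lU _)); exact: (solution_component_mass L0 s0 c10 c20 adm b t sU).
  by move: (L2dot L (U 0) (U 0)) (L2dot L phi phi) (L2dot L (cst b) phi) (L2dot L (cst b) (U 0)) (L2dot L (U 0 - phi) _) (L2dot L (_ - phi) _) => *; ring.
have hf : `|f (U 0 - phi)| <= `|C| * N (U 0 - phi).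
  apply: (le_trans (HC _ X0)); apply: ler_wpM2r; [exact: N0|exact: ler_norm].
apply: (control_combine d0 _ _ _ (normr_ge0 C) (N0 _) (ltW h0) (N0 _) (ltW hv) hf (pL (X_L2 X0)) q0 (pL (X_L2 Xv)) qv E).
- by rewrite ge_min lexx.
- apply: (@le_trans _ _ ((`|C| + `|a|) * (eta / (`|C| + `|a| + 1)))).
    by apply: ler_wpM2l; [exact: addr_ge0|rewrite ge_min lexx orbT].
  by rewrite mulrA ler_pdivrMr// mulrDr mulr1 mulrC lerDl ltW.
- by rewrite mulrA ler_pdivrMr// mulrDr mulr1 mulrC lerDl mulr_ge0// ltW.
Qed.

End StandingWave.

(** * Orbital stability *)

Theorem theorem1p2 (R : realType) (L s c c1 c2 : R) (A : 'cV[R]_2)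
    (m : R -> 'M[R]_2) (G : 'cV[R]_2 -> R) (phi : R -> 'cV[R]_2)
    (L_gt0 : 0 < L) (s_gt0 : 0 < s) (c1_gt0 : 0 < c1) (c2_gt0 : 0 < c2)
    (m_adm : admissible_symbol s c1 c2 m)
    (G_C2 : class_C2 G)
    (E_def : energy_defined L s G)
    (E_cons : conserved L s m G (energy L m G))
    (F_cons : conserved L s m G (momentum L))
    (M_cons : conserved L s m G (mass L))
    (wp : globally_well_posed L s m G)
    (phi_eq : profile_equation L c A m G phi)
    (H1 : hypothesis_H1 L s c m G phi)
    (H2 : hypothesis_H2 L s c m G phi) :
  orbitally_stable L s m G phi.
Proof.
have [sphi _ _ _] := H1; have [Phi [XPhi neg _ [Q Qc Qf]]] := H2.
apply: (stability_of_controlled L_gt0 s_gt0 c1_gt0 c2_gt0 m_adm G_C2 sphi phi_eq E_def E_cons F_cons H1 XPhi neg _ wp).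
have [c_eq0|c_neq0] := eqVneq c 0; last first.
  exact: (controlled_moving L_gt0 s_gt0 c1_gt0 m_adm G_C2 sphi phi_eq wp Qc Qf c_neq0).
exact: (controlled_standing L_gt0 s_gt0 c1_gt0 c2_gt0 m_adm G_C2 sphi phi_eq wp E_def c_eq0 E_cons F_cons H1 Qc Qf).
Qed.
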